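(* Suppose that $\mathbf E Z=0$ and that $Z$ is multivariate regularly varying with index $\alpha>1$ and spectral probability measure $\mathbf S$ on $\mathfrak N_d$. Suppose there is $D\in[1,\infty)$ such that $\|\sigma(x)-\sigma(y)\|\vee\|a(x)-a(y)\|\le D\|x-y\|$ for all $x,y\in\mathbb R^m$. (i) Let $b\in(0,\infty)$, $k\in\mathbb N=\{0,1,2,\dots\}$, $x\in\mathbb R^m$, and let $B\subseteq\mathbb D[0,1]$ be measurable. Suppose that $B$ is bounded away from $\mathbb D^{(k-1)|b}_{\{x\}}(\epsilon)$ for some (and hence all) $\epsilon>0$ small enough, and $\mathbf C^{(k)|b}(B^\circ;x)=\mathbf C^{(k)|b}(B^-;x)>0$. Then, as $\eta\downarrow0$, the following weak convergence holds: $$\mathbf P\big(X^{\eta|b}_{[0,1]}(x)\in\cdot\,\big|\,X^{\eta|b}_{[0,1]}(x)\in B\big)\Rightarrow\frac{\mathbf C^{(k)|b}(\,\cdot\cap B;x)}{\mathbf C^{(k)|b}(B;x)}.$$ (ii) Suppose furthermore that there is $C\in[1,\infty)$ with $\|a(x)\|\vee\|\sigma(x)\|\le C$ for all $x\in\mathbb R^m$. Let $k\in\mathbb N$, $x\in\mathbb R^m$, and let $B\subseteq\mathbb D[0,1]$ be measurable. Suppose that $B$ is bounded away from $\mathbb D^{(k-1)|\infty}_{\{x\}}(\epsilon)$ for some (and hence all) $\epsilon>0$ small enough, and $\mathbf C^{(k)|\infty}(B^\circ;x)=\mathbf C^{(k)|\infty}(B^-;x)>0$. Then, as $\eta\downarrow0$,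 $$\mathbf P\big(X^{\eta|\infty}_{[0,1]}(x)\in\cdot\,\big|\,X^{\eta|\infty}_{[0,1]}(x)\in B\big)\Rightarrow\frac{\mathbf C^{(k)|\infty}(\,\cdot\cap B;x)}{\mathbf C^{(k)|\infty}(B;x)}.$$ Here $B^\circ$ and $B^-$ are the interior and closure of $B$.
   Context: $\|\cdot\|$ is the Euclidean norm (operator norm for matrices); $u\vee v=\max\{u,v\}$, $u\wedge v=\min\{u,v\}$. In a metric space, sets $E,F$ are bounded away from each other if the infimum of distances between their points is positive ($\inf\emptyset=\infty$). $\mathbb M$-convergence. For a metric space $(\mathbb S,\mathbf d)$ and Borel $\mathbb C\subseteq\mathbb S$, let $\mathbb C^r=\{y:\inf_{c\in\mathbb C}\mathbf d(c,y)\le r\}$; $\nu_n\to\nu$ in $\mathbb M(\mathbb S\setminus\mathbb C)$ (Borel measures on $\mathbb S\setminus\mathbb C$ finite on $\mathbb S\setminus\mathbb C^r$ for all $r>0$) means $\int f\,d\nu_n\to\int f\,d\nu$ for all non-negative bounded continuous $f$ on $\mathbb S\setminus\mathbb C$ vanishing on $\mathbb C^r$ for some $r>0$. Noise. $Z,Z_1,Z_2,\dots$ are iid random vectors in $\mathbb R^d$; $H(x)=\mathbf P(\|Z\|>x)$. $\mathfrak N_d$ is the unit sphere of $\mathbb R^d$; $\Phi(x)=(\|x\|,x/\|x\|)$ for $x\ne0$, $\Phi(0)=(0,(1,0,\dots,0))$; $\nu_\alpha$ is the Borel measure on $(0,\infty)$ with $\nu_\alpha[x,\infty)=x^{-\alpha}$.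 ''$Z$ is multivariate regularly varying with index $\alpha$ and spectral measure $\mathbf S$'' means: $\lim_{x\to\infty}H(tx)/H(x)=t^{-\alpha}$ for all $t>0$, and with $(R,\Theta)=\Phi(Z)$, $\mathbf P((x^{-1}R,\Theta)\in\cdot)/H(x)\to\nu_\alpha\times\mathbf S$ in $\mathbb M\big(([0,\infty)\times\mathfrak N_d)\setminus(\{0\}\times\mathfrak N_d)\big)$ as $x\to\infty$. Process. $a:\mathbb R^m\to\mathbb R^m$, $\sigma:\mathbb R^m\to\mathbb R^{m\times d}$. For $b\in(0,\infty)$, $\varphi_b(w)=(\frac b{\|w\|}\wedge1)w$ for $w\ne0$, $\varphi_b(0)=0$; $\varphi_\infty(w)=w$. For $\eta>0$, $b\in(0,\infty]$: $X^{\eta|b}_0(x)=x$, $X^{\eta|b}_t(x)=X^{\eta|b}_{t-1}(x)+\varphi_b\big(\eta a(X^{\eta|b}_{t-1}(x))+\eta\sigma(X^{\eta|b}_{t-1}(x))Z_t\big)$ for $t\ge1$, and $X^{\eta|b}_{[0,1]}(x)=\{X^{\eta|b}_{\lfloor t/\eta\rfloor}(x):t\in[0,1]\}$. Path space. $\mathbb D[0,1]$ is the space of càdlàg functions $[0,1]\to\mathbb R^m$ with the Skorokhod $J_1$ metric (and its Borel $\sigma$-algebra). For $E\subseteq\mathbb R$, $E^{k\uparrow}=\{(t_1,\dots,t_k)\in E^k:t_1<\dots<t_k\}$. Perturbed ODE. For $x\in\mathbb R^m$, $W=(w_1,\dots,w_k)\in\mathbb R^{d\times k}$, $V=(v_1,\dots,v_k)\in\mathbb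 R^{m\times k}$, $\mathbf t=(t_1,\dots,t_k)\in(0,1]^{k\uparrow}$, $b\in(0,\infty]$, let $\bar h^{(k)|b}(x,W,V,\mathbf t)=\xi\in\mathbb D[0,1]$ be the solution of $\xi_0=x$; $d\xi_s/ds=a(\xi_s)$ for $s\in[0,1]\setminus\{t_1,\dots,t_k\}$; $\xi_s=\xi_{s-}+v_j+\varphi_b(\sigma(\xi_{s-}+v_j)w_j)$ if $s=t_j$. Put $h^{(k)|b}(x,W,\mathbf t)=\bar h^{(k)|b}(x,W,(0,\dots,0),\mathbf t)$; for $k=0$ it is the ODE solution started at $x$. With $\bar B_\epsilon(0)$ the closed $\epsilon$-ball in $\mathbb R^m$, $\mathbb D^{(k)|b}_A(\epsilon)=\bar h^{(k)|b}\big(A\times\mathbb R^{d\times k}\times(\bar B_\epsilon(0))^k\times(0,1]^{k\uparrow}\big)$ and $\mathbb D^{(-1)|b}_A(\epsilon)=\emptyset$. Limit measure. $((\nu_\alpha\times\mathbf S)\circ\Phi)(E)=(\nu_\alpha\times\mathbf S)(\Phi(E))$ for Borel $E\subseteq\mathbb R^d\setminus\{0\}$; $\mathcal L^{k\uparrow}_1$ is Lebesgue measure restricted to $(0,1)^{k\uparrow}$; $$\mathbf C^{(k)|b}(\cdot;x)=\int\mathbb I\{h^{(k)|b}(x,W,\mathbf t)\in\cdot\}\,((\nu_\alpha\times\mathbf S)\circ\Phi)^k(dW)\times\mathcal L^{k\uparrow}_1(d\mathbf t),$$ where $((\nu_\alpha\times\mathbf S)\circ\Phi)^k$ is the $k$-fold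 product measure; for $k=0$ this is the Dirac mass at $h^{(0)|b}(x)$. *)

(* Defs.v *)
From HB Require Import structures.
From mathcomp Require Import all_boot all_order all_algebra.
From mathcomp Require Import all_classical all_reals all_analysis.
From mathcomp Require Import measurable_realfun.
From mathcomp Require Import ring lra.

Set Implicit Arguments.
Unset Strict Implicit.
Unset Printing Implicit Defensive.

Import Order.TTheory GRing.Theory Num.Theory.
Import numFieldNormedType.Exports.

Local Open Scope classical_set_scope.
Local Open Scope ring_scope.

(* Vectors of R^n are columns 'cV[R]_n.  The library norm `|x| on matrices is
   the sup norm; it induces the same topology as the Euclidean norm. *)
Section euclidean.
Context {R : realType}.

Definition enorm n (x : 'cV[R]_n) : R := Num.sqrt (\sum_i x i ord0 ^+ 2).

Definition opnorm m n (A : 'M[R]_(m, n)) : R :=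
  sup [set enorm (A *m w) | w in [set w | enorm w <= 1]].

Lemma enorm_ge0 n (x : 'cV[R]_n) : 0 <= enorm x.
Proof. exact: sqrtr_ge0. Qed.

Lemma enorm0 n : enorm (0 : 'cV[R]_n) = 0.
Proof.
by rewrite /enorm big1 ?sqrtr0// => i _; rewrite mxE expr0n.
Qed.

Lemma enormN n (x : 'cV[R]_n) : enorm (- x) = enorm x.
Proof.
by rewrite /enorm; congr Num.sqrt; apply: eq_bigr => i _; rewrite mxE sqrrN.
Qed.

Lemma enorm_eq0 n (x : 'cV[R]_n) : enorm x = 0 -> x = 0.
Proof.
move=> /eqP; rewrite sqrtr_eq0 => x0.
have x1 : 0 <= \sum_i x i ord0 ^+ 2 by apply: sumr_ge0 => i _; exact: sqr_ge0.
have /eqP : \sum_i x i ord0 ^+ 2 == 0 by rewrite eq_le x0.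
move=> /psumr_eq0P h; apply/colP => i; rewrite mxE.
by have /eqP := h (fun i _ => sqr_ge0 _) i isT; rewrite sqrf_eq0 => /eqP.
Qed.

Lemma sum_cauchy_schwarz n (x y : 'cV[R]_n) :
  (\sum_i x i ord0 * y i ord0) ^+ 2 <=
  (\sum_i x i ord0 ^+ 2) * (\sum_i y i ord0 ^+ 2).
Proof.
set A := \sum_i x i ord0 ^+ 2; set C := \sum_i y i ord0 ^+ 2.
set B := \sum_i _.
have C0 : 0 <= C by apply: sumr_ge0 => i _; exact: sqr_ge0.
have : 0 <= \sum_i (C * x i ord0 - B * y i ord0) ^+ 2.
  by apply: sumr_ge0 => i _; exact: sqr_ge0.
rewrite (_ : (\sum_(i < n) _) = C * (A * C - B ^+ 2)); last first.
  rewrite (_ : C * _ = C ^+ 2 * A + (- (2 * C * B) * B + B ^+ 2 * C)); last by ring.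
  transitivity (\sum_i (C ^+ 2 * x i ord0 ^+ 2 +
      (- (2 * C * B) * (x i ord0 * y i ord0) + B ^+ 2 * y i ord0 ^+ 2))).
    by apply: eq_bigr => i _; ring.
  by rewrite !big_split/= -!mulr_sumr.
have [C1|C1] := eqVneq C 0; last first.
  by rewrite pmulr_rge0 ?subr_ge0// lt_neqAle eq_sym C1.
move=> _; rewrite C1 mulr0.
have {}C1 i : y i ord0 = 0.
  move/psumr_eq0P : C1 => /(_ (fun i _ => sqr_ge0 _)) /(_ i isT)/eqP.
  by rewrite sqrf_eq0 => /eqP.
by rewrite /B big1 ?expr0n// => i _; rewrite C1 mulr0.
Qed.

Lemma enormD n (x y : 'cV[R]_n) : enorm (x + y) <= enorm x + enorm y.
Proof.
rewrite -(@ler_pXn2r _ 2)// ?nnegrE ?addr_ge0 ?enorm_ge0//.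
have S0 (z : 'cV[R]_n) : 0 <= \sum_i z i ord0 ^+ 2.
  by apply: sumr_ge0 => i _; exact: sqr_ge0.
have E (z : 'cV[R]_n) : enorm z ^+ 2 = \sum_i z i ord0 ^+ 2 by rewrite sqr_sqrtr.
rewrite sqrrD !E.
rewrite (_ : \sum_i _ = \sum_i x i ord0 ^+ 2 + (\sum_i x i ord0 * y i ord0) *+ 2
  + \sum_i y i ord0 ^+ 2); last first.
  rewrite -sumrMnl -!big_split/=; apply: eq_bigr => i _.
  by rewrite mxE sqrrD.
rewrite lerD2r lerD2l lerMn2r/= (le_trans (ler_norm _))//.
rewrite -sqrtr_sqr /enorm -sqrtrM// ler_sqrt ?mulr_ge0//.
exact: sum_cauchy_schwarz.
Qed.

Lemma enorm_le_norm n (x : 'cV[R]_n) : enorm x <= n%:R * `|x|.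
Proof.
have -> : n%:R * `|x| = Num.sqrt ((n%:R * `|x|) ^+ 2).
  by rewrite sqrtr_sqr ger0_norm// mulr_ge0.
apply: ler_wsqrtr.
apply: (@le_trans _ _ (\sum_(i < n) `|x| ^+ 2)).
  apply: ler_sum => i _; rewrite -real_normK ?num_real//.
  rewrite lerXn2r ?nnegrE//.
  rewrite [leRHS]/Num.Def.normr /= mx_normrE; apply/bigmax_geP; right => /=.
  by exists (i, ord0).
rewrite sumr_const card_ord -[_ *+ n]mulr_natl exprMn ler_wpM2r ?sqr_ge0//.
by rewrite -natrX ler_nat; case: n {x} => // n; rewrite expnS expn1 leq_pmulr.
Qed.

End euclidean.

(* Cadlag functions on [0, 1], represented by functions on R extended by 0
   outside [0, 1], so that equality of representatives is equality on [0, 1]. *)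
Section cadlag.
Context {R : realType} {m : nat}.
Implicit Types f : R -> 'cV[R]_m.

Definition cadlag01 f :=
  [/\ forall t : R, t \in `[0, 1[ -> f u @[u --> t^'+] --> f t,
      forall t : R, t \in `]0, 1] -> cvg (f u @[u --> t^'-])
    & forall t : R, t \notin `[0, 1] -> f t = 0].

Lemma cadlag01_bounded f : cadlag01 f ->
  exists2 M, 0 <= M & forall t : R, t \in `[0, 1] -> enorm (f t) <= M.
Proof.
move=> [fr fl _].
pose Q (M u : R) := u \in `[0, 1] -> enorm (f u) <= M.
have near_bnd (F : set_system R) (FF : Filter F) (l : 'cV[R]_m) :
    f u @[u --> F] --> l -> exists K, \forall u \near F, enorm (f u) <= K.
  move=> fFl; exists (m%:R * (`|l| + 1)).
  have l1 : `|l| < `|l| + 1 by rewrite ltrDl.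
  apply: filterS (cvgr_norm_lt l fFl _ l1) => u fu.
  by rewrite (le_trans (enorm_le_norm _))// ler_wpM2l// ltW.
have loc (x : R) : x \in `[0, 1] -> exists K, \forall u \near x, Q K u.
  rewrite in_itv/= => /andP[x0 x1].
  have [Kr Hr] : exists K, \forall u \near x^'+, Q K u.
    have [x1'|x1'] := ltP x 1.
      have xI : x \in `[0, 1[ by rewrite in_itv/= x0.
      have [K HK] := near_bnd x^'+ _ (f x) (fr _ xI).
      by exists K; apply: filterS HK => u ? _.
    exists 0; near=> u; rewrite /Q in_itv/= => /andP[_ u1].
    suff : x < u by rewrite ltNge (le_trans u1).
    by near: u; exact: nbhs_right_gt.
  have [Kl Hl] : exists K, \forall u \near x^'-, Q K u.
    have [x0'|x0'] := ltP 0 x.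
      have xI : x \in `]0, 1] by rewrite in_itv/= x0'.
      have [K HK] := near_bnd x^'- _ (lim (f u @[u --> x^'-])) (fl _ xI).
      by exists K; apply: filterS HK => u ? _.
    exists 0; near=> u; rewrite /Q in_itv/= => /andP[u0 _].
    suff : u < x by rewrite ltNge (le_trans x0').
    by near: u; exact: nbhs_left_lt.
  exists (Num.max Kr (Num.max Kl (enorm (f x)))).
  have {}Hr : \forall u \near x, x < u -> Q Kr u by [].
  have {}Hl : \forall u \near x, u < x -> Q Kl u by [].
  near=> u => u01; rewrite !le_max.
  have [ux|xu|->] := ltgtP u x; last by rewrite lexx !orbT.
  - suff -> : enorm (f u) <= Kl by rewrite orbT.
    by apply: (near Hl u).
  - suff -> : enorm (f u) <= Kr by [].
    by apply: (near Hr u).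
have /compact_near_coveringP cpt : compact (`[0, 1]%classic : set R) := @segment_compact R 0 1.
have : \forall M \near +oo, `[0, 1]%classic `<=` Q M.
  apply: cpt => x; rewrite /= => /loc[K HK].
  exists ([set u | Q K u], [set M | K <= M]) => /=.
    by split => //; by apply: nbhs_pinfty_ge; rewrite num_real.
  by move=> [u M]/= [QKu KM] /QKu /le_trans; exact.
move=> H; near (pinfty_nbhs R) => M; exists M.
  by near: M; apply: nbhs_pinfty_ge; rewrite num_real.
by move=> t t01; apply: (near H M _ t).
Unshelve. all: by end_near. Qed.

End cadlag.

Record skorokhod (R : realType) (m : nat) := Skorokhod {
  skorokhod_fun :> R -> 'cV[R]_m ;
  skorokhod_cadlag : cadlag01 skorokhod_fun }.

HB.instance Definition _ (R : realType) m := gen_eqMixin (skorokhod R m).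
HB.instance Definition _ (R : realType) m := gen_choiceMixin (skorokhod R m).

Lemma cadlag01_cst0 (R : realType) m : cadlag01 (fun _ : R => 0 : 'cV[R]_m).
Proof.
by split => // t _; [exact: cvg_cst|apply/cvg_ex; exists 0; exact: cvg_cst].
Qed.

HB.instance Definition _ (R : realType) m :=
  isPointed.Build (skorokhod R m) (Skorokhod (@cadlag01_cst0 R m)).

Section skorokhod_metric.
Context {R : realType} {m : nat}.
Local Notation D := (skorokhod R m).
Implicit Types x y z : D.

Lemma skorokhod_ext x y : (forall t, t \in `[0, 1] -> x t = y t) -> x = y.
Proof.
case: x y => [f [fr fl f0]] [g [gr gl g0]] /= fg.
have fgE : f = g.
  apply/funext => t; have [/fg//|t01] := boolP (t \in `[0, 1]).
  by rewrite f0// g0.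
by subst g; congr Skorokhod; exact: Prop_irrelevance.
Qed.

(* increasing homeomorphisms of [0, 1]; values outside [0, 1] are irrelevant *)
Definition time_change (l : R -> R) :=
  [/\ {in `[0, 1] &, {homo l : s t / s < t}},
      {within `[0, 1], continuous l}
    & l @` `[0, 1] = `[0, 1]%classic].

Definition J1_bounds x y : set R := [set e | exists2 l, time_change l &
  forall t, t \in `[0, 1] -> `|l t - t| <= e /\ enorm (x t - y (l t)) <= e].

Definition J1_dist x y : R := inf (J1_bounds x y).

Lemma time_change_itv l t : time_change l -> t \in `[0, 1] -> l t \in `[0, 1].
Proof.
move=> [_ _ ls] t01; suff : (`[0, 1]%classic : set R) (l t) by [].
by rewrite -ls; exists t.
Qed.

Lemma time_change_id : time_change id.
Proof.
split => //; last by rewrite image_id.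
by apply: continuous_subspaceT => ?; exact: cvg_id.
Qed.

Lemma time_change_le l : time_change l ->
  {in `[0, 1] &, {mono l : s t / s <= t}}.
Proof. by move=> [li _ _]; apply: (le_mono_in li). Qed.

Lemma time_change_of_surj l : {in `[0, 1] &, {homo l : s t / s < t}} ->
  l @` `[0, 1] = `[0, 1]%classic -> time_change l.
Proof.
move=> li ls; split => //; have lm := le_mono_in li.
have lI t : t \in `[0, 1] -> l t \in `[0, 1].
  move=> t01; suff : (`[0, 1]%classic : set R) (l t) by [].
  by rewrite -ls; exists t.
have I0 : 0 \in `[0, 1 : R] by rewrite in_itv/= lexx ler01.
have I1 : 1 \in `[0, 1 : R] by rewrite in_itv/= lexx ler01.
have l0 : l 0 = 0.
  have : (`[0, 1]%classic : set R) 0 by [].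
  rewrite -ls => -[s /= s01 ls0]; apply/eqP; rewrite eq_le.
  have /andP[-> _] : 0 <= l 0 <= 1 by have := lI _ I0; rewrite in_itv.
  rewrite -{2}ls0 lm// andbT.
  by move: s01; rewrite in_itv/= => /andP[].
have l1 : l 1 = 1.
  have : (`[0, 1]%classic : set R) 1 by [].
  rewrite -ls => -[s /= s01 ls0]; apply/eqP; rewrite eq_le.
  have /andP[_ ->] : 0 <= l 1 <= 1 by have := lI _ I1; rewrite in_itv.
  rewrite -{1}ls0 lm//=.
  by move: s01; rewrite in_itv/= => /andP[].
apply: segment_inc_surj_continuous => //.
by rewrite l0 l1 => t /= t01; move: ls => /seteqP[_ /(_ t t01)].
Qed.

Lemma time_change_comp l1 l2 : time_change l1 -> time_change l2 ->
  time_change (l2 \o l1).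
Proof.
move=> tl1 tl2; apply: time_change_of_surj; last first.
  by rewrite -image_comp; case: tl1 => _ _ ->; case: tl2.
move=> s t s01 t01 st /=; case: (tl2) => + _ _; apply; rewrite ?time_change_itv//.
by case: (tl1) => + _ _; exact.
Qed.

Lemma time_change_inv l : time_change l -> exists2 g, time_change g &
  forall t, t \in `[0, 1] -> l (g t) = t.
Proof.
move=> tl; have [li _ ls] := tl.
have /choice[g gP] t :
    exists s, t \in `[0, 1] -> s \in `[0, 1] /\ l s = t.
  have [t01|] := boolP (t \in `[0, 1]); last by exists 0.
  have : (`[0, 1]%classic : set R) t by [].
  by rewrite -ls => -[s s01 lst]; exists s.
exists g; last by move=> t /gP[].
have gl t : t \in `[0, 1] -> g (l t) = t.
  move=> t01; have [g01 lg] := gP _ (time_change_itv tl t01).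
  by apply: (inc_inj_in (time_change_le tl)) => //.
apply: time_change_of_surj.
  move=> s t s01 t01 st; have [gs lgs] := gP _ s01; have [gt lgt] := gP _ t01.
  by rewrite -(leW_mono_in (time_change_le tl))// lgs lgt.
apply/seteqP; split => [_ [t t01 <-]|t t01]; first by case: (gP _ t01).
by exists (l t); [exact: time_change_itv|exact: gl].
Qed.

Lemma J1_bounds_ge0 x y e : J1_bounds x y e -> 0 <= e.
Proof.
move=> [l _ /(_ 0)] []; first by rewrite in_itv/= lexx ler01.
by move=> + _; apply: le_trans.
Qed.

Lemma J1_bounds_neq0 x y : J1_bounds x y !=set0.
Proof.
have [M M0 xM] := cadlag01_bounded (skorokhod_cadlag x).
have [N N0 yN] := cadlag01_bounded (skorokhod_cadlag y).
exists (M + N); exists id; first exact: time_change_id.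
move=> t t01; rewrite subrr normr0 addr_ge0//; split => //.
by rewrite (le_trans (enormD _ _))// enormN lerD ?xM ?yN.
Qed.

Lemma J1_bounds_has_inf x y : has_inf (J1_bounds x y).
Proof. by split; [exact: J1_bounds_neq0|exists 0 => e /J1_bounds_ge0]. Qed.

Lemma J1_dist_ge0 x y : 0 <= J1_dist x y.
Proof.
by apply: lb_le_inf; [exact: J1_bounds_neq0|move=> e /J1_bounds_ge0].
Qed.

Lemma J1_distxx x : J1_dist x x = 0.
Proof.
apply/eqP; rewrite eq_le J1_dist_ge0 andbT; apply: ge_inf.
  by case: (J1_bounds_has_inf x x).
exists id; first exact: time_change_id.
by move=> t _; rewrite !subrr normr0 enorm0.
Qed.

Lemma J1_distP x y e : J1_dist x y < e -> exists2 e', J1_bounds x y e' & e' < e.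
Proof. by move=> /(inf_lt (J1_bounds_neq0 x y)). Qed.

Lemma J1_bounds_sym x y e : J1_bounds x y e -> J1_bounds y x e.
Proof.
move=> [l tl le]; have [g tg lg] := time_change_inv tl; exists g => // t t01.
have [] := le (g t) (time_change_itv tg t01).
by rewrite lg// distrC -[enorm (y t - _)]enormN opprB.
Qed.

Lemma J1_dist_sym x y : J1_dist x y = J1_dist y x.
Proof.
by rewrite /J1_dist; congr inf; apply/seteqP; split => e; exact: J1_bounds_sym.
Qed.

Lemma J1_dist_triangle y x z : J1_dist x z <= J1_dist x y + J1_dist y z.
Proof.
apply/ler_addgt0Pl => e e0.
have e20 : 0 < e / 2 by rewrite divr_gt0.
have /J1_distP[e1 [l1 tl1 H1] he1] : J1_dist x y < J1_dist x y + e / 2 by rewrite ltrDl.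
have /J1_distP[e2 [l2 tl2 H2] he2] : J1_dist y z < J1_dist y z + e / 2 by rewrite ltrDl.
apply: (@le_trans _ _ (e1 + e2)); last by lra.
apply: ge_inf; first by case: (J1_bounds_has_inf x z).
exists (l2 \o l1); first exact: time_change_comp.
move=> t t01; have [a1 b1] := H1 _ t01.
have [a2 b2] := H2 _ (time_change_itv tl1 t01); split => /=.
  rewrite (_ : _ - t = (l1 t - t) + (l2 (l1 t) - l1 t)); last by ring.
  by rewrite (le_trans (ler_normD _ _))// lerD.
rewrite -(subrKA (y (l1 t))).
by rewrite (le_trans (enormD _ _))// lerD.
Qed.

Lemma cadlag01_right_enorm x t e : 0 < e -> t \in `[0, 1[ ->
  \forall u \near t^'+, enorm (x u - x t) <= e.
Proof.
move=> e0 t01; case: (skorokhod_cadlag x) => xr _ _.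
have e1 : 0 < e / (m%:R + 1) by rewrite divr_gt0// ltr_wpDl.
move/cvgrPdist_lt : (xr _ t01) => /(_ _ e1); apply: filterS => u xu.
rewrite (le_trans (enorm_le_norm _))// distrC.
rewrite (le_trans (ler_wpM2l _ (ltW xu)))// mulrA ler_pdivrMr ?ltr_wpDl//.
by rewrite mulrC ler_pM2l// lerDl.
Qed.

Lemma J1_dist_eq0 x y : J1_dist x y = 0 -> x = y.
Proof.
move=> xy0; apply: skorokhod_ext => t t01.
apply/eqP; rewrite -subr_eq0; apply/eqP/enorm_eq0/eqP.
rewrite eq_le enorm_ge0 andbT; apply/ler_addgt0Pl => e e0; rewrite addr0.
have e30 : 0 < e / 3 by rewrite divr_gt0.
move: (t01); rewrite in_itv/= => /andP[t0]; rewrite le_eqVlt => /predU1P[t1|t1].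
  have /J1_distP[e1 [l tl H1] he1] : J1_dist x y < e by rewrite xy0.
  have [_] := H1 _ t01; rewrite t1 (_ : l 1 = 1).
    by move=> /le_trans; apply; exact: ltW.
  have I1 : 1 \in `[0, 1 : R] by rewrite in_itv/= lexx ler01.
  case: (tl) => _ _ ls.
  have : (`[0, 1]%classic : set R) 1 by rewrite /= -/(is_true _).
  rewrite -{1}ls => -[s /= s01 ls1]; apply/eqP; rewrite eq_le.
  have := time_change_itv tl I1; rewrite in_itv/= => /andP[_ ->]/=.
  rewrite -{1}ls1 (time_change_le tl)//.
  by move: s01; rewrite in_itv/= => /andP[].
have tI : t \in `[0, 1[ by rewrite in_itv/= t0.
have [d /= d0 Hd] : exists2 d, 0 < d & forall u, t < u -> u < t + d ->
    [/\ u < 1, enorm (x u - x t) <= e / 3 & enorm (y u - y t) <= e / 3].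
  have : \forall u \near t^'+, [/\ u < 1, enorm (x u - x t) <= e / 3 &
      enorm (y u - y t) <= e / 3].
    near=> u; split; near: u; first exact: nbhs_right_lt.
      exact: cadlag01_right_enorm.
    exact: cadlag01_right_enorm.
  move=> [d /= d0 H]; exists d => // u tu ud; apply: H => //=.
  by rewrite distrC ger0_norm ?subr_ge0 ?(ltW tu)// ltrBlDl.
pose s := t + d / 2.
have [s1 xs _] : [/\ s < 1, enorm (x s - x t) <= e / 3 & enorm (y s - y t) <= e / 3].
  by apply: Hd; rewrite /s; lra.
have /J1_distP[e1 [l tl H1]] : J1_dist x y < Num.min (d / 2) (e / 3).
  by rewrite xy0 lt_min divr_gt0// e30.
rewrite lt_min => /andP[ed ee].
have s01 : s \in `[0, 1] by rewrite in_itv/= (ltW s1) andbT /s; lra.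
have [ls xy] := H1 _ s01.
have [_ _ ys] : [/\ l s < 1, enorm (x (l s) - x t) <= e / 3
    & enorm (y (l s) - y t) <= e / 3].
  by move: ls; rewrite ler_norml /s => /andP[? ?]; apply: Hd; lra.
have -> : x t - y t = (x t - x s) + (x s - y (l s)) + (y (l s) - y t).
  by rewrite !subrKA.
rewrite (le_trans (enormD _ _))// (le_trans (lerD (enormD _ _) (lexx _)))//.
by rewrite -[x t - _]opprB enormN; lra.
Unshelve. all: by end_near. Qed.

HB.instance Definition _ := isMetric.Build R (skorokhod R m)
  J1_distxx J1_dist_eq0 J1_dist_sym J1_dist_triangle.

End skorokhod_metric.

Section borel_mx.
Context {R : realType} {m n : nat}.
HB.instance Definition _ :=
  Measurable.copy 'M[R]_(m, n) (g_sigma_algebraType (@open 'M[R]_(m, n))).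
End borel_mx.

Section borel_skorokhod.
Context {R : realType} {m : nat}.
HB.instance Definition _ :=
  Measurable.copy (skorokhod R m) (g_sigma_algebraType (@open (skorokhod R m))).
End borel_skorokhod.

Section skorokhod_sets.
Context {R : realType} {m : nat}.
Local Notation D := (skorokhod R m).

Definition bounded_away (E F : set D) :=
  (0 < ereal_inf [set (mdist x y)%:E | x in E & y in F])%E.

(* Laws are plain set functions: the integral of the library is defined for
   these, and agrees with the usual one when the set function is a measure. *)
Definition weak_cvg {I : Type} (F : set_system I)
    (mu_ : I -> set D -> \bar R) (mu : set D -> \bar R) :=
  forall f : D -> R, continuous f -> (exists M : R, forall xi, `|f xi| <= M) ->
  (\int[mu_ i]_xi (f xi)%:E @[i --> F] --> \int[mu]_xi (f xi)%:E)%E.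

Definition normalized_restriction (mu : set D -> \bar R) (B A : set D) :=
  (mu (A `&` B) / mu B)%E.

Definition cond_law {disp} {Omega : measurableType disp}
    (P : probability Omega R) (Y : Omega -> D) (B A : set D) : \bar R :=
  (P (Y @^-1` (A `&` B)) / P (Y @^-1` B))%E.

End skorokhod_sets.

Section noise.
Context {R : realType} {d : nat} {disp} {Omega : measurableType disp}.
Variable P : probability Omega R.
Local Notation V := 'cV[R]_d.+1.

(* Z 0 plays the role of the generic copy Z of the sequence Z 1, Z 2, ... *)
Definition iid (Z : nat -> Omega -> V) :=
  (forall n (A : set V), measurable A -> P (Z n @^-1` A) = P (Z 0%N @^-1` A)) /\
  (forall (J : seq nat) (A : nat -> set V), uniq J ->
    (forall n, measurable (A n)) ->
    P (\bigcap_(n in [set` J]) Z n @^-1` A n) =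
    (\prod_(n <- J) P (Z n @^-1` A n))%E).

Definition mean_zero (Z : Omega -> V) := forall i,
  P.-integrable [set: Omega] (fun w => (Z w i ord0)%:E) /\
  ('E_P[fun w => Z w i ord0] = 0)%E.

Definition tail (Z : Omega -> V) (x : R) : \bar R := P [set w | x < enorm (Z w)].

Definition sphere : set V := [set w | enorm w = 1].

Definition polar (w : V) : R * V :=
  if w == 0 then (0, delta_mx ord0 ord0) else (enorm w, (enorm w)^-1 *: w).

Definition power_law (alpha : R) (nu : set R -> \bar R) :=
  nu `]-oo, 0]%classic = 0%E /\
  forall x : R, 0 < x -> nu `[x, +oo[%classic = (x `^ (- alpha))%:E.

Definition polar_dist (p q : R * V) : R :=
  Num.max `|p.1 - q.1| (enorm (p.2 - q.2)).

Definition M_cvg (S C : set (R * V)) {I : Type} (F : set_system I)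
    (mu_ : I -> set (R * V) -> \bar R) (mu : set (R * V) -> \bar R) :=
  forall f : R * V -> R,
  {within S `\` C, continuous f} ->
  (exists M, forall p, (S `\` C) p -> 0 <= f p <= M) ->
  (exists2 r : R, 0 < r & forall p, (S `\` C) p ->
    (ereal_inf [set (polar_dist c p)%:E | c in C] <= r%:E)%E -> f p = 0) ->
  (\int[mu_ i]_(p in S `\` C) (f p)%:E @[i --> F] -->
   \int[mu]_(p in S `\` C) (f p)%:E)%E.

Definition polar_law (Z : Omega -> V) (x : R) (A : set (R * V)) : \bar R :=
  P [set w | A (x^-1 * (polar (Z w)).1, (polar (Z w)).2)].

Definition MRV (Z : Omega -> V) (alpha : R) (nu : set R -> \bar R)
    (S : set V -> \bar R) :=
  (forall t : R, 0 < t ->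
    (tail Z (t * x) / tail Z x)%E @[x --> +oo] --> (t `^ (- alpha))%:E) /\
  M_cvg (`[0, +oo[ `*` sphere) ([set 0] `*` sphere) +oo
    (fun x A => polar_law Z x A / tail Z x)%E (nu \x S)%E.

End noise.

(* image of Lebesgue measure on ]0, +oo[ under u |-> u `^ (- alpha^-1) *)
Lemma power_law_exists (R : realType) (alpha : R) : 0 < alpha ->
  exists nu : {measure set R -> \bar R}, power_law alpha nu.
Proof.
move=> a0; pose T := measurableTypeR R.
have mp : measurable (`]0, +oo[%classic : set T) by exact: measurable_itv.
pose lam : {measure set T -> \bar R} := mrestr (@lebesgue_measure R) mp.
pose f (u : T) : R := u `^ (- alpha^-1).
have mf (A : set R) : measurable A -> measurable (f @^-1` A).
  by move=> mA; rewrite -[X in measurable X]setTI; exact: (measurable_powR _ _).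
pose nu0 (A : set R) : \bar R := lam (f @^-1` A).
have nu00 : nu0 set0 = 0%E by rewrite /nu0 preimage_set0 measure0.
have nu0_ge0 A : (0 <= nu0 A)%E by exact: measure_ge0.
have nu0_sigma : semi_sigma_additive nu0.
  move=> F mF tF mUF; rewrite /nu0 preimage_bigcup.
  apply: measure_semi_sigma_additive; first by move=> n; exact: mf.
    apply/trivIsetP => i j _ _ ij; rewrite -preimage_setI.
    by move/trivIsetP : tF => /(_ _ _ _ _ ij) ->//; rewrite preimage_set0.
  by rewrite -preimage_bigcup; exact: mf.
pose nu : {measure set R -> \bar R} :=
  HB.pack nu0 (isMeasure.Build _ R R nu0 nu00 nu0_ge0 nu0_sigma).
exists nu; split.
  rewrite /= /nu0 /lam/= /mrestr.
  rewrite (_ : _ `&` _ = set0) ?measure0//; apply/seteqP; split => // u [] /=.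
  rewrite !in_itv/= andbT => + u0; rewrite leNgt => /negP; apply.
  exact: powR_gt0.
move=> x x0; rewrite /= /nu0 /lam/= /mrestr.
rewrite (_ : _ `&` _ = `]0, x `^ (- alpha)]%classic).
  by rewrite lebesgue_measure_itv/= lte_fin powR_gt0// sube0.
have aN0 : alpha != 0 by rewrite gt_eqF.
apply/seteqP; split => u /=; rewrite !in_itv/= !andbT.
  move=> [xu u0]; rewrite u0/=.
  have -> : u = (u `^ (- alpha^-1)) `^ (- alpha).
    by rewrite -powRrM mulrNN mulVf// powRr1// ltW.
  rewrite !(powRN _ alpha) lef_pV2 ?posrE ?powR_gt0//.
  by apply: ge0_ler_powR; rewrite ?nnegrE ?powR_ge0 ?(ltW x0) ?(ltW a0).
move=> /andP[u0 ux]; split => //.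
have -> : x = (x `^ (- alpha)) `^ (- alpha^-1).
  by rewrite -powRrM mulrNN mulfV// powRr1// ltW.
rewrite /f !(powRN _ alpha^-1) lef_pV2 ?posrE ?powR_gt0//.
by apply: ge0_ler_powR; rewrite ?nnegrE ?invr_ge0 ?powR_ge0 ?(ltW u0) ?(ltW a0).
Qed.

Definition increasing_tuples {R : realType} (E : set R) k : set (k.-tuple R) :=
  [set t | sorted <%R t /\ forall s : R, s \in t -> E s].
Arguments increasing_tuples {R} E k t : rename.

Section process.
Context {R : realType} {m d : nat}.
Variables (a : 'cV[R]_m -> 'cV[R]_m) (sigma : 'cV[R]_m -> 'M[R]_(m, d)).

(* b ranges over ]0, +oo]; for w = 0 the value is 0 whatever the coefficient *)
Definition clip (b : \bar R) (w : 'cV[R]_m) : 'cV[R]_m :=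
  if b is r%:E then Num.min (r / enorm w) 1 *: w else w.

Fixpoint X_iter (eta : R) (b : \bar R) (x : 'cV[R]_m) (z : nat -> 'cV[R]_d) (t : nat) :
    'cV[R]_m :=
  if t is s.+1 then
    let y := X_iter eta b x z s in y + clip b (eta *: a y + (eta *: sigma y) *m z t)
  else x.

Definition step_path (eta : R) (u : nat -> 'cV[R]_m) (t : R) : 'cV[R]_m :=
  if t \in `[0, 1] then u (Num.truncn (t / eta)) else 0.

Lemma step_path_cadlag eta u : cadlag01 (step_path eta u).
Proof.
have stepE t : t \in `[0, 1] -> step_path eta u t = u (Num.truncn (t / eta)).
  by rewrite /step_path => ->.
have neg t : eta <= 0 -> 0 <= t -> Num.truncn (t / eta) = 0%N.
  move=> e0 t0; apply/eqP; rewrite -leqn0 truncn_le_nat.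
  by rewrite (le_lt_trans _ (ltr01))// mulr_ge0_le0// invr_le0.
split => [t|t|t /negbTE]; last by rewrite /step_path => ->.
  rewrite in_itv/= => /andP[t0 t1].
  apply: cvg_near_cst.
  suff : \forall s \near t^'+, Num.truncn (s / eta) = Num.truncn (t / eta).
    apply: filter_app; near=> s => E.
    rewrite !stepE ?E// in_itv/= ?t0 ?(ltW t1)//.
    apply/andP; split; last by near: s; exact: nbhs_right_le.
    by rewrite (le_trans t0)//; near: s; exact: nbhs_right_ge.
  have [e0|e0] := leP eta 0.
    near=> s; rewrite !neg// (le_trans t0)//; near: s; exact: nbhs_right_ge.
  set n := Num.truncn (t / eta).
  have /andP[n0 n1] : n%:R <= t / eta < n.+1%:R by apply: truncn_itv; rewrite divr_ge0// ltW.
  near=> s; apply: truncn_def; apply/andP; split.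
    rewrite (le_trans n0)// ler_pM2r ?invr_gt0//; near: s; exact: nbhs_right_ge.
  by rewrite ltr_pdivrMr//; near: s; apply: nbhs_right_lt; rewrite -ltr_pdivrMr.
rewrite in_itv/= => /andP[t0 t1].
suff [n H] : exists n, \forall s \near t^'-, Num.truncn (s / eta) = n.
  apply/cvg_ex; exists (u n); apply: cvg_near_cst.
  move: H; apply: filter_app; near=> s => E; rewrite stepE ?E// in_itv/=.
  apply/andP; split; first by near: s; exact: nbhs_left_ge.
  by rewrite (le_trans _ t1)//; near: s; exact: nbhs_left_le.
have [e0|e0] := leP eta 0.
  by exists 0%N; near=> s; rewrite neg//; near: s; exact: nbhs_left_ge.
set n := Num.truncn (t / eta).
have /andP[n0 n1] : n%:R <= t / eta < n.+1%:R.
  by apply: truncn_itv; rewrite divr_ge0// ltW.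
move: n0; rewrite le_eqVlt => /predU1P[n0|n0]; last first.
  exists n; near=> s; apply: truncn_def; apply/andP; split.
    by rewrite ler_pdivlMr//; near: s; apply: nbhs_left_ge; rewrite -ltr_pdivlMr.
  rewrite (le_lt_trans _ n1)// ler_pM2r ?invr_gt0//; near: s; exact: nbhs_left_le.
have n_gt0 : (0 < n)%N by rewrite -(ltr_nat R) n0 divr_gt0.
exists n.-1; near=> s; apply: truncn_def; rewrite prednK//; apply/andP; split.
  rewrite ler_pdivlMr//; near: s; apply: nbhs_left_ge.
  by rewrite -ltr_pdivlMr// -n0 ltr_nat prednK.
rewrite n0 ltr_pM2r ?invr_gt0//; near: s; exact: nbhs_left_lt.
Unshelve. all: by end_near. Qed.

Definition X_path (eta : R) (b : \bar R) (x : 'cV[R]_m) (z : nat -> 'cV[R]_d) :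
    skorokhod R m := Skorokhod (step_path_cadlag eta (X_iter eta b x z)).

Definition left_limit (xi : skorokhod R m) (s : R) : 'cV[R]_m :=
  lim (xi u @[u --> s^'-]).

(* The derivative is taken within [0, 1], hence is one-sided at 0 and at 1. *)
Definition perturbed_ode (b : \bar R) k (x : 'cV[R]_m) (W : k.-tuple 'cV[R]_d)
    (V : k.-tuple 'cV[R]_m) (t : k.-tuple R) (xi : skorokhod R m) :=
  [/\ xi 0 = x,
      forall s : R, s \in `[0, 1] -> s \notin t ->
        (u - s)^-1 *: (xi u - xi s) @[u --> within `[0, 1] s^'] --> a (xi s)
    & forall j : 'I_k, let y := left_limit xi (tnth t j) + tnth V j in
        xi (tnth t j) = y + clip b (sigma y *m tnth W j)].

(* When a is Lipschitz and t is increasing in ]0, 1], the solution exists and is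
   unique; otherwise the value may be arbitrary. *)
Definition hbar (b : \bar R) k (x : 'cV[R]_m) (W : k.-tuple 'cV[R]_d)
    (V : k.-tuple 'cV[R]_m) (t : k.-tuple R) : skorokhod R m :=
  get (perturbed_ode b x W V t).

Definition h (b : \bar R) k (x : 'cV[R]_m) (W : k.-tuple 'cV[R]_d)
  (t : k.-tuple R) : skorokhod R m := hbar b x W [tuple of nseq k 0] t.

Definition perturbed_paths (b : \bar R) (A : set 'cV[R]_m) k (eps : R) :
    set (skorokhod R m) :=
  [set xi | exists x W V t, [/\ A x, forall j, enorm (tnth V j) <= eps,
    increasing_tuples `]0, 1] k t & xi = @hbar b k x W V t]].

(* index k - 1, with the empty set for k = 0 *)
Definition perturbed_paths_pred b A k eps : set (skorokhod R m) :=
  if k is j.+1 then perturbed_paths b A j eps else set0.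

End process.

Section limit_measure.
Context {R : realType}.

(* k-fold product measure, built by iterating the formula that defines \x *)
Fixpoint tuple_measure {disp} {T : measurableType disp} (mu : set T -> \bar R)
    (k : nat) : set (k.-tuple T) -> \bar R :=
  match k with
  | 0 => fun A => \d_[tuple] A
  | j.+1 => fun A =>
      (\int[mu]_x tuple_measure mu [set s : j.-tuple T | A [tuple of x :: s]])%E
  end.
Arguments tuple_measure {disp T} mu k A.

Definition lebesgue_increasing k (A : set (k.-tuple R)) : \bar R :=
  tuple_measure (T := R) (@lebesgue_measure R) k (A `&` increasing_tuples `]0, 1[ k).
Arguments lebesgue_increasing k A : clear implicits.

(* E `\ 0 makes this a measure on all of R^d that does not charge the origin *)
Definition polar_measure d (nu : set R -> \bar R) (S : set 'cV[R]_d.+1 -> \bar R)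
    (E : set 'cV[R]_d.+1) : \bar R :=
  (nu \x S)%E (polar @` (E `\ 0)).

Definition limit_measure m d (a : 'cV[R]_m -> 'cV[R]_m)
    (sigma : 'cV[R]_m -> 'M[R]_(m, d.+1)) (nu : set R -> \bar R)
    (S : set 'cV[R]_d.+1 -> \bar R) (b : \bar R) k (x : 'cV[R]_m)
    (E : set (skorokhod R m)) : \bar R :=
  (\int[tuple_measure (polar_measure nu S) k \x lebesgue_increasing k]_Wt (\1_E (h a sigma b x Wt.1 Wt.2))%:E)%E.

End limit_measure.

(* Main.v *)
From HB Require Import structures.
Require Import Defs.
From mathcomp Require Import all_boot all_order all_algebra.
From mathcomp Require Import all_classical all_reals all_analysis.
From mathcomp Require Import measurable_realfun.
From mathcomp Require Import ring lra.

Set Implicit Arguments.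
Unset Strict Implicit.
Unset Printing Implicit Defensive.

Import Order.TTheory GRing.Theory Num.Theory.
Import numFieldNormedType.Exports.

Local Open Scope classical_set_scope.
Local Open Scope ring_scope.

(* The idea.  With overwhelming probability the noises below a level [delta / eta]
   accumulate to at most [eps] (a Chernoff bound), so the path shadows the ODE
   perturbed at the few steps that carry a larger noise.  If [g] is continuous and
   vanishes near the paths with [k - 1] perturbed jumps, then [g (X)] is, up to
   terms of order [o (rate^-k)] in mean, a sum over increasing [k]-tuples of steps
   of [g (h x W t)], where [W] lists the scaled noises of these steps and [t] their
   times.  By regular variation the laws of the scaled noises converge vaguely, after
   normalization, to the polar measure, and the sum over the steps is a Riemann sum
   in [t]; hence [rate^k * E g(X)] tends to the integral of [g] against the limit
   measure.  When the jumps are clipped, the coefficients may be frozen outside a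
   large ball: leaving the ball is excluded in the limit by the same convergence,
   applied to a cutoff of the supremum norm.  Finally the indicator of [B] is squeezed
   between continuous cutoffs, and the conditional laws are quotients of such limits. *)

(** * Euclidean and operator norms, clipping *)

(** Two obstacles shape the argument. A continuous [g] on path space need not be uniformly
    continuous, and the error in replacing the discrete path by a jump path is amplified at every
    jump by a factor that grows with its noise. The error is therefore measured relative to a weight
    of the noises, and the noises for which such an error could change [g] by more than [tau] form
    [osc_set]; its contribution is negligible because it is again a sum over the grid, with limit 0.
    Moreover [polar_measure] may be infinite near the origin, so a jump with small noise must be
    invisible to [g]. Such a jump is traded for a small perturbation at the next jump, which is why
    the paths to be avoided carry the perturbations [V]; the same perturbations absorb the deviation
    of the discrete path just before each jump. In the conditional statement the normalization
    cancels, and a ratio of two limits remains. *)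

Section set_fun_integral.
Import HBNNSimple.

(** The integral is built from simple functions, so it sees a set function on measurable sets only.
    Laws and limit measures enter as plain set functions; this is how each is exchanged for a
    genuine measure. *)
Lemma eq_integral_set_fun d (T : measurableType d) (R : realType)
    (m1 m2 : set T -> \bar R) (D : set T) (f : T -> \bar R) :
  (forall A, measurable A -> m1 A = m2 A) ->
  (\int[m1]_(x in D) f x = \int[m2]_(x in D) f x)%E.
Proof.
move=> m12; rewrite /integral.
have E (g : {nnsfun T >-> R}) : sintegral m1 g = sintegral m2 g.
  by rewrite /sintegral; apply: eq_fsbigr => x _; rewrite m12.
by congr (ereal_sup _ - ereal_sup _)%E; apply/seteqP; split => _ [g gf <-];
  exists g.
Qed.

End set_fun_integral.

(** Being open relative to [D] for finitely many real functions, [A] is the trace on [D] of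
    countably many rational boxes. This avoids any comparison of the Borel sets of vectors, tuples
    and paths with product sigma-algebras. *)
Lemma measurable_rel_open d (T : measurableType d) (R : realType) (I : finType)
    (c : I -> T -> R) (D A : set T) :
  (forall i, measurable_fun setT (c i)) -> measurable D -> A `<=` D ->
  (forall p, A p -> exists2 e : R, 0 < e &
     forall p', D p' -> (forall i, `|c i p' - c i p| < e) -> A p') ->
  measurable A.
Proof.
move=> mc mD AD Ao.
pose Box (q : {ffun I -> rat} * nat) : set T :=
  [set p | forall i, `|c i p - ratr (q.1 i)| < q.2.+1%:R^-1].
have mBox q : measurable (Box q).
  rewrite (_ : Box q = \bigcap_(i in [set: I])
      ((fun p => `|c i p - ratr (q.1 i)|) @^-1` `]-oo, q.2.+1%:R^-1[)); last first.
    by apply/seteqP; split => p /= Hp i; have := Hp i; rewrite /= in_itv//=; apply.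
  have [[i0 _]|] := pselect ([set: I] !=set0); last first.
    by move/set0P/negP/negPn/eqP => ->; rewrite bigcap_set0.
  apply: fin_bigcap_measurable => //.
  move=> i _; rewrite -[X in measurable X]setTI.
  have : measurable_fun setT (fun p => `|c i p - ratr (q.1 i)|).
    by apply: measurableT_comp => //; apply: measurable_funB.
  by apply => //; exact: measurable_itv.
rewrite (_ : A = D `&` \bigcup_q (if `[< D `&` Box q `<=` A >] then Box q else set0)).
  apply: measurableI => //; apply: countable_bigcupT_measurable => [|q].
    exact: countableP.
  by case: ifP.
apply/seteqP; split => [p Ap|p [Dp [q _]]]; last first.
  by case: ifPn => // /asboolP H Bp; apply: H.
split; first exact: AD.
have [e e0 He] := Ao _ Ap.
(* A box of radius below [e / 2] that contains [p] stays within [e] of [p]. *)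
have [N HN] : exists N : nat, N.+1%:R^-1 < e / 2.
  have e20 : 0 < e / 2 by rewrite divr_gt0.
  exists (Num.truncn (e / 2)^-1); rewrite invf_plt ?posrE//.
  exact: truncnS_gt.
have /choice[q Hq] i : exists q : rat, `|c i p - ratr q| < N.+1%:R^-1.
  have /rat_in_itvoo[q] : c i p - N.+1%:R^-1 < c i p by rewrite ltrBlDr ltrDl.
  rewrite in_itv/= => /andP[q1 q2]; exists q.
  by rewrite ger0_norm ?subr_ge0 1?ltW// ltrBlDr -ltrBlDl.
exists ([ffun i => q i], N) => //.
rewrite ifT; first by move=> i; rewrite /= ffunE.
apply/asboolP => p' [Dp' Bp']; apply: He => // i.
have := Bp' i; rewrite /= ffunE => H.
rewrite (_ : _ - _ = (c i p' - ratr (q i)) - (c i p - ratr (q i))); last by ring.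
rewrite (le_lt_trans (ler_normB _ _))//; have := Hq i.
by move: HN H; move: N.+1%:R^-1 => r; lra.
Qed.

Section vectors.
Context {R : realType}.
Implicit Types n m : nat.

Lemma coord_le_enorm n (x : 'cV[R]_n) i : `|x i ord0| <= enorm x.
Proof.
rewrite /enorm -sqrtr_sqr; apply: ler_wsqrtr; rewrite (bigD1 i)//= lerDl.
by apply: sumr_ge0 => j _; exact: sqr_ge0.
Qed.

Lemma norm_le_enorm n (x : 'cV[R]_n) : `|x| <= enorm x.
Proof.
rewrite [leLHS]/Num.Def.normr /= mx_normrE.
apply/bigmax_leP; split => [|[i j] _]; first exact: enorm_ge0.
by rewrite (ord1 j)/= coord_le_enorm.
Qed.

Lemma enorm_le_sum n (x : 'cV[R]_n) : enorm x <= \sum_i `|x i ord0|.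
Proof.
have S0 : 0 <= \sum_i `|x i ord0| by apply: sumr_ge0.
rewrite -(@ler_pXn2r _ 2)// ?nnegrE ?enorm_ge0// /enorm sqr_sqrtr; last first.
  by apply: sumr_ge0 => i _; exact: sqr_ge0.
rewrite expr2 mulr_suml; apply: ler_sum => i _.
rewrite -real_normK ?num_real// expr2 ler_wpM2l//.
by rewrite (bigD1 i)//= lerDl; apply: sumr_ge0.
Qed.

Lemma enormZ n (a : R) (x : 'cV[R]_n) : enorm (a *: x) = `|a| * enorm x.
Proof.
rewrite /enorm -sqrtr_sqr -sqrtrM ?sqr_ge0// mulr_sumr; congr Num.sqrt.
by apply: eq_bigr => i _; rewrite mxE exprMn.
Qed.

Lemma enormB n (x y : 'cV[R]_n) : enorm (x - y) = enorm (y - x).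
Proof. by rewrite -enormN opprB. Qed.

Lemma enormBD n (y x z : 'cV[R]_n) : enorm (x - z) <= enorm (x - y) + enorm (y - z).
Proof. by rewrite -(subrKA y) enormD. Qed.

Lemma enorm_sub n (x y : 'cV[R]_n) : enorm x - enorm y <= enorm (x - y).
Proof. by rewrite lerBlDr -[X in enorm X <= _](subrK y) enormD. Qed.

Lemma enorm_dist n (x y : 'cV[R]_n) : `|enorm x - enorm y| <= enorm (x - y).
Proof. by rewrite ler_norml enorm_sub andbT lerNl opprB enormB enorm_sub. Qed.

Lemma enorm_sum n (I : Type) (r : seq I) (P : pred I) (F : I -> 'cV[R]_n) :
  enorm (\sum_(i <- r | P i) F i) <= \sum_(i <- r | P i) enorm (F i).
Proof.
elim/big_ind2 : _ => // [|x a y b xa yb]; first by rewrite enorm0.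
by rewrite (le_trans (enormD _ _))// lerD.
Qed.

Lemma enorm_cvg_ball n (x : 'cV[R]_n) (e : R) : 0 < e ->
  \forall y \near x, enorm (y - x) < e.
Proof.
move=> e0.
(* Balls are those of the sup norm, and [enorm] is at most [n] times larger; [n + 1] keeps the
   radius positive for [n = 0]. *)
have e1 : 0 < e / (n%:R + 1) by rewrite divr_gt0// ltr_wpDl.
have : \forall y \near x, ball x (e / (n%:R + 1)) y by exact: nbhsx_ballx.
apply: filterS => y; rewrite -ball_normE/= => xy.
rewrite enormB (le_lt_trans (enorm_le_norm _))//.
move: xy; rewrite ltr_pdivlMr ?ltr_wpDl// mulrC mulrDl mul1r => xy.
by apply: le_lt_trans xy; rewrite lerDl.
Qed.

Lemma nbhs_enormP n (x : 'cV[R]_n) (A : set 'cV[R]_n) :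
  nbhs x A <-> exists2 e : R, 0 < e & forall y, enorm (y - x) < e -> A y.
Proof.
split=> [/nbhs_ballP[e /= e0 xA]|[e e0 eA]].
  exists e => // y yx; apply: xA; rewrite -ball_normE/= -normrN opprB.
  exact: le_lt_trans (norm_le_enorm _) yx.
by have := enorm_cvg_ball x e0; apply: filterS.
Qed.

Lemma opnorm_has_sup m n (A : 'M[R]_(m, n)) :
  has_sup [set enorm (A *m w) | w in [set w : 'cV[R]_n | enorm w <= 1]].
Proof.
split; first by exists (enorm (A *m 0)); exists 0 => //=; rewrite enorm0.
exists (\sum_i \sum_j `|A i j|) => _ /= [w w1 <-].
rewrite (le_trans (enorm_le_sum _))//; apply: ler_sum => i _; rewrite mxE.
rewrite (le_trans (ler_norm_sum _ _ _))//; apply: ler_sum => j _.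
by rewrite normrM ler_piMr// (le_trans (coord_le_enorm _ _)).
Qed.

Lemma opnorm_ge0 m n (A : 'M[R]_(m, n)) : 0 <= opnorm A.
Proof.
apply: (@le_trans _ _ (enorm (A *m 0))); first exact: enorm_ge0.
apply: ub_le_sup; first by have [] := opnorm_has_sup A.
by exists 0 => //=; rewrite enorm0.
Qed.

Lemma enorm_mulmx m n (A : 'M[R]_(m, n)) (w : 'cV[R]_n) :
  enorm (A *m w) <= opnorm A * enorm w.
Proof.
have [w0|w0] := eqVneq (enorm w) 0.
  by rewrite w0 (enorm_eq0 w0) mulmx0 enorm0 mulr0.
have wp : 0 < enorm w by rewrite lt_neqAle eq_sym w0 enorm_ge0.
have -> : A *m w = enorm w *: (A *m ((enorm w)^-1 *: w)).
  by rewrite -scalemxAr scalerA mulfV// scale1r.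
rewrite enormZ ger0_norm ?enorm_ge0// mulrC ler_wpM2r ?enorm_ge0//.
apply: ub_le_sup; first by have [] := opnorm_has_sup A.
exists ((enorm w)^-1 *: w) => //=.
by rewrite enormZ ger0_norm ?invr_ge0 ?enorm_ge0// mulVf.
Qed.

Lemma opnorm_le m n (A : 'M[R]_(m, n)) (c : R) :
  (forall w, enorm w <= 1 -> enorm (A *m w) <= c) -> opnorm A <= c.
Proof.
move=> H; apply: ge_sup; first by have [] := opnorm_has_sup A.
by move=> _ [w w1 <-]; exact: H.
Qed.

Lemma measurable_fun_cV d (T : measurableType d) n (f : T -> 'cV[R]_n) :
  (forall i, measurable_fun setT (fun t => f t i ord0)) -> measurable_fun setT f.
Proof.
move=> mf; apply: (@measurability _ _ _ _ _ _ (@open 'cV[R]_n)) => //.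
move=> _ [U oU <-]; rewrite setTI.
apply: (@measurable_rel_open _ _ _ _ (fun i t => f t i ord0) setT) => // p Up.
have : nbhs (f p) U by exact: open_nbhs_nbhs.
move=> /nbhs_ballP[e /= e0 He]; exists e => // p' _ fp'.
apply: He; rewrite mx_norm_ball /ball_ /=.
rewrite [ltLHS]/Num.Def.normr /= mx_normrE.
apply/bigmax_ltP; split => // -[i j] _; rewrite (ord1 j)/= !mxE distrC.
exact: fp'.
Qed.

Lemma measurable_open_cV n (U : set 'cV[R]_n) : open U -> measurable U.
Proof. exact: sub_sigma_algebra. Qed.

Lemma continuous_measurable_cV n (f : 'cV[R]_n -> R) :
  continuous f -> measurable_fun setT f.
Proof.
move=> cf; apply: (@measurability _ _ _ _ _ _ (@RGenOInfty.G R)).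
  exact: RGenOInfty.measurableE.
move=> _ [_ [a ->] <-]; rewrite setTI; apply: measurable_open_cV.
by move/continuousP : cf; apply; exact: rray_open.
Qed.

Lemma measurable_coord n i : measurable_fun setT (fun x : 'cV[R]_n => x i ord0).
Proof. by apply: continuous_measurable_cV => x; exact: coord_continuous. Qed.

Lemma continuous_enorm n : continuous (@enorm R n).
Proof.
move=> x; apply/(@cvgrPdist_lt _ _ _ (nbhs x)) => e e0.
apply: filterS (enorm_cvg_ball x e0) => y yx; rewrite distrC.
exact: le_lt_trans (enorm_dist _ _) yx.
Qed.

Lemma measurable_enorm n : measurable_fun setT (@enorm R n).
Proof. by apply: continuous_measurable_cV; exact: continuous_enorm. Qed.

End vectors.

Section clipping.
Context {R : realType} {m : nat}.
Implicit Types (b : \bar R) (w v : 'cV[R]_m).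

Lemma clip_small b w : ((enorm w)%:E <= b)%E -> clip b w = w.
Proof.
case: b => [r| |]//=; rewrite lee_fin => wr.
have [w0|w0] := eqVneq (enorm w) 0; first by rewrite (enorm_eq0 w0) scaler0.
have wp : 0 < enorm w by rewrite lt_neqAle eq_sym w0 enorm_ge0.
by rewrite min_r ?scale1r// ler_pdivlMr// mul1r.
Qed.

Lemma enorm_clip_le b w : (0 <= b)%E -> enorm (clip b w) <= enorm w.
Proof.
case: b => [r| |]//= r0; rewrite lee_fin in r0.
rewrite enormZ ger0_norm; last by rewrite le_min ler01 andbT divr_ge0 ?enorm_ge0.
by rewrite ler_piMl ?enorm_ge0// ge_min lexx orbT.
Qed.

Lemma enorm_clip_bound (r : R) w : 0 <= r -> enorm (clip r%:E w) <= r.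
Proof.
move=> r0 /=; rewrite enormZ ger0_norm; last first.
  by rewrite le_min ler01 andbT divr_ge0 ?enorm_ge0.
have [w0|w0] := eqVneq (enorm w) 0; first by rewrite w0 mulr0.
have wp : 0 < enorm w by rewrite lt_neqAle eq_sym w0 enorm_ge0.
by rewrite -ler_pdivlMr// ge_min lexx.
Qed.

Definition dotp n (x y : 'cV[R]_n) : R := \sum_i x i ord0 * y i ord0.

Lemma dotp_le n (x y : 'cV[R]_n) : `|dotp x y| <= enorm x * enorm y.
Proof.
rewrite -sqrtr_sqr /enorm -sqrtrM; last by apply: sumr_ge0 => i _; exact: sqr_ge0.
exact: ler_wsqrtr (sum_cauchy_schwarz x y).
Qed.

Lemma enorm_sqr n (x : 'cV[R]_n) : enorm x ^+ 2 = dotp x x.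
Proof.
rewrite /enorm sqr_sqrtr; last by apply: sumr_ge0 => i _; exact: sqr_ge0.
by apply: eq_bigr => i _; rewrite expr2.
Qed.

Lemma enorm_scaleB_sqr n (s t : R) (x y : 'cV[R]_n) :
  enorm (s *: x - t *: y) ^+ 2 =
  s ^+ 2 * enorm x ^+ 2 - 2 * s * t * dotp x y + t ^+ 2 * enorm y ^+ 2.
Proof.
rewrite !enorm_sqr /dotp !mulr_sumr -sumrB -big_split/=.
by apply: eq_bigr => i _; rewrite !mxE; ring.
Qed.

(* [clip b] is the projection on a ball, hence nonexpansive. *)
Lemma clip_lip b w v : (0 < b)%E -> enorm (clip b w - clip b v) <= enorm (w - v).
Proof.
case: b => [r| |]//; rewrite lte_fin => r0.
wlog vw : w v / enorm v <= enorm w.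
  move=> H; have [/H//|/ltW/H] := leP (enorm v) (enorm w).
  by rewrite enormB [leRHS]enormB.
have [wr|rw] := leP (enorm w) r.
  by rewrite !clip_small ?lee_fin// (le_trans vw).
have w0 : 0 < enorm w by exact: lt_trans rw.
have D := dotp_le w v.
have D' : dotp w v <= enorm w * enorm v by exact: le_trans (ler_norm _) D.
(* After squaring, both sides are quadratic in the two norms and the scalar product, and
   Cauchy-Schwarz settles the remaining polynomial inequality. *)
rewrite -(@ler_pXn2r _ 2)// ?nnegrE ?enorm_ge0//.
rewrite [X in _ <= enorm X ^+ 2](_ : w - v = 1 *: w - 1 *: v); last by rewrite !scale1r.
have cw : clip r%:E w = (r / enorm w) *: w.
  by rewrite /clip min_l// ler_pdivrMr// mul1r ltW.
have [vr|rv] := leP (enorm v) r.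
  rewrite (@clip_small _ v) ?lee_fin// cw.
  rewrite -[X in _ - X]scale1r !enorm_scaleB_sqr.
  set p := r / enorm w.
  have pw : p * enorm w = r by rewrite /p divfK// gt_eqF.
  have p0 : 0 <= p by rewrite divr_ge0// ltW.
  have p1 : p <= 1 by rewrite /p ler_pdivrMr// mul1r ltW.
  move: D' vr pw p0 p1 (enorm_ge0 v) w0; move: (enorm w) (enorm v) (dotp w v) => W V d.
  move=> D' vr pw p0 p1 V0 W0; rewrite expr1n !mul1r !mulr1.
  have : (1 - p) * (2 * d) <= (1 - p) * ((1 + p) * W ^+ 2).
    apply: ler_wpM2l; first lra.
    have : W * V <= W * r by rewrite ler_wpM2l// ltW.
    rewrite -pw => ?; have : W * (p * W) <= W * W.
      by rewrite ler_wpM2l ?(ltW W0)// ler_piMl// ltW.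
    by rewrite expr2; nra.
  by rewrite expr2; nra.
have v0 : 0 < enorm v by exact: lt_trans rv.
have cv : clip r%:E v = (r / enorm v) *: v.
  by rewrite /clip min_l// ler_pdivrMr// mul1r ltW.
rewrite cw cv !enorm_scaleB_sqr.
set p := r / enorm w; set q := r / enorm v.
have pw : p * enorm w = r by rewrite /p divfK// gt_eqF.
have qv : q * enorm v = r by rewrite /q divfK// gt_eqF.
have p0 : 0 <= p by rewrite divr_ge0// ltW.
have q0 : 0 <= q by rewrite divr_ge0// ltW.
have p1 : p <= 1 by rewrite /p ler_pdivrMr// mul1r ltW.
have q1 : q <= 1 by rewrite /q ler_pdivrMr// mul1r ltW.
rewrite -!exprMn pw qv.
move: D' pw qv p0 q0 p1 q1 w0 v0; move: (enorm w) (enorm v) (dotp w v) => W V d.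
move=> D' pw qv p0 q0 p1 q1 W0 V0; rewrite !mul1r !mulr1.
have : (1 - p * q) * (2 * d) <= (1 - p * q) * (2 * (W * V)).
  by rewrite ler_wpM2l ?ler_wpM2l// subr_ge0 mulr_ile1.
have : p * q * (W * V) = r ^+ 2 by rewrite mulrACA pw qv.
by have := sqr_ge0 (W - V); rewrite !expr2; nra.
Qed.

End clipping.

(** * Flow of a bounded Lipschitz vector field *)

Section flow.
Context {R : realType} {m : nat}.
Variables (a : 'cV[R]_m -> 'cV[R]_m) (C D : R).
Hypothesis C0 : 0 <= C.
Hypothesis D0 : 0 <= D.
Hypothesis aC : forall x, enorm (a x) <= C.
Hypothesis aD : forall x y, enorm (a x - a y) <= D * enorm (x - y).
Implicit Types (x y : 'cV[R]_m) (h t s : R).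

(** The flow is obtained as the limit of Euler polygons over dyadic meshes, so that Lipschitz
    dependence, the semigroup law and growth bounds can be read off from finite iterations. *)
Definition euler h x := x + h *: a x.

Lemma euler_lip h x y : 0 <= h ->
  enorm (euler h x - euler h y) <= (1 + h * D) * enorm (x - y).
Proof.
move=> h0; rewrite /euler opprD addrACA -scalerBr (le_trans (enormD _ _))//.
by rewrite mulrDl mul1r lerD2l enormZ ger0_norm// -mulrA ler_wpM2l.
Qed.

Lemma euler_move h x : 0 <= h -> enorm (euler h x - x) <= C * h.
Proof.
by move=> h0; rewrite /euler addrC addKr enormZ ger0_norm// mulrC ler_wpM2r.
Qed.

Lemma euler_half h x : 0 <= h ->
  enorm (euler h (euler h x) - euler (h + h) x) <= D * C * h ^+ 2.
Proof.
move=> h0; rewrite {1 3}/euler {1}/euler.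
rewrite (_ : _ - _ = h *: (a (euler h x) - a x)); last first.
  by rewrite scalerBr scalerDl /euler !opprD !addrA; apply/matrixP => i j; rewrite !mxE; ring.
rewrite enormZ ger0_norm// (le_trans (ler_wpM2l h0 (aD _ _)))//.
have := ler_wpM2l h0 (ler_wpM2l D0 (euler_move x h0)).
by rewrite (_ : h * (D * (C * h)) = D * C * h ^+ 2)//; ring.
Qed.

Lemma iter_euler_lip h n x y : 0 <= h ->
  enorm (iter n (euler h) x - iter n (euler h) y) <=
  expR (h * n%:R * D) * enorm (x - y).
Proof.
move=> h0; elim: n => [|n IH]; first by rewrite mulr0 mul0r expR0 mul1r.
rewrite !iterS (le_trans (euler_lip _ _ h0))//.
rewrite (_ : h * n.+1%:R * D = h * D + h * n%:R * D); last by rewrite -natr1; ring.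
by rewrite expRD -mulrA ler_pM ?enorm_ge0 ?addr_ge0 ?mulr_ge0// expR_ge1Dx.
Qed.

Lemma iter_euler_move h n x : 0 <= h ->
  enorm (iter n (euler h) x - x) <= C * (h * n%:R).
Proof.
move=> h0; elim: n => [|n IH]; first by rewrite subrr enorm0 !mulr0.
rewrite iterS (le_trans (enormBD (iter n (euler h) x) _ _))//.
rewrite (_ : C * (h * n.+1%:R) = C * h + C * (h * n%:R)); last by rewrite -natr1; ring.
by rewrite lerD// euler_move.
Qed.

(** Discrete Gronwall argument: each double step adds a local error of order [h ^+ 2] and multiplies
    the accumulated one by at most [expR ((h + h) * D)]. *)
Lemma iter_euler_half h n x : 0 <= h ->
  enorm (iter n.*2 (euler h) x - iter n (euler (h + h)) x) <=
  expR ((h + h) * n%:R * D) * (D * C * h * (h * n%:R)).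
Proof.
move=> h0; elim: n => [|n IH]; first by rewrite subrr enorm0 !mulr0.
have hh0 : 0 <= h + h by rewrite addr_ge0.
rewrite doubleS !iterS.
set u := iter n.*2 _ x; set v := iter n _ x in IH *.
rewrite (le_trans (enormBD (euler (h + h) u) _ _))//.
rewrite (le_trans (lerD (euler_half _ h0) (euler_lip _ _ hh0)))//.
have E1 : 1 <= expR ((h + h) * n.+1%:R * D).
  by rewrite -expR0 ler_expR !mulr_ge0.
have P0 : 0 <= D * C * h ^+ 2 by rewrite !mulr_ge0 ?sqr_ge0.
have E2 : (1 + (h + h) * D) * enorm (u - v) <=
    expR ((h + h) * n.+1%:R * D) * (D * C * h * (h * n%:R)).
  apply: (le_trans (ler_wpM2l _ IH)); first by rewrite addr_ge0// mulr_ge0.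
  rewrite [leLHS]mulrA ler_wpM2r ?mulr_ge0//.
  rewrite -natr1 mulrDr mulr1 mulrDl expRD mulrC ler_wpM2l ?expR_ge0//.
  exact: expR_ge1Dx.
apply: (le_trans (lerD (_ : _ <= expR ((h + h) * n.+1%:R * D) * (D * C * h ^+ 2)) E2)).
  by rewrite ler_peMl.
rewrite -mulrDr ler_wpM2l ?expR_ge0// le_eqVlt; apply/orP; left; apply/eqP.
by rewrite -natr1; ring.
Qed.

Definition mesh n : R := (2 ^+ n)^-1.

Lemma mesh_gt0 n : 0 < mesh n. Proof. by rewrite invr_gt0 exprn_gt0. Qed.

Lemma meshS n : mesh n = mesh n.+1 + mesh n.+1.
Proof. by rewrite /mesh exprS invfM -mulrDl -{1}[(2 ^+ n)^-1]mul1r; congr (_ * _); lra. Qed.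

(** Constant between grid times: the incomplete last step is dropped, which later costs at most
    [C * mesh n]. *)
Definition polygon n t x := iter (Num.truncn (t / mesh n)) (euler (mesh n)) x.

Lemma polygon_steps n t : 0 <= t ->
  mesh n * (Num.truncn (t / mesh n))%:R <= t < mesh n * (Num.truncn (t / mesh n)).+1%:R.
Proof.
move=> t0; have /andP[H1 H2] : (Num.truncn (t / mesh n))%:R <= t / mesh n < (Num.truncn (t / mesh n)).+1%:R.
  by apply: truncn_itv; rewrite divr_ge0// ltW// mesh_gt0.
by rewrite mulrC -ler_pdivlMr ?mesh_gt0// H1 mulrC -ltr_pdivrMr ?mesh_gt0.
Qed.

Lemma polygon_lip n t x y : 0 <= t ->
  enorm (polygon n t x - polygon n t y) <= expR (t * D) * enorm (x - y).
Proof.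
move=> t0; rewrite (le_trans (iter_euler_lip _ _ _ (ltW (mesh_gt0 n))))//.
rewrite ler_wpM2r ?enorm_ge0// ler_expR ler_wpM2r//.
by have /andP[] := polygon_steps n t0.
Qed.

Lemma polygon_move n t x : 0 <= t -> enorm (polygon n t x - x) <= C * t.
Proof.
move=> t0; rewrite (le_trans (iter_euler_move _ _ (ltW (mesh_gt0 n))))//.
by rewrite ler_wpM2l//; have /andP[] := polygon_steps n t0.
Qed.

Lemma iter_euler_near n p q x : (p <= q.+1)%N -> (q <= p.+1)%N ->
  enorm (iter p (euler (mesh n)) x - iter q (euler (mesh n)) x) <= C * mesh n.
Proof.
move=> pq qp; have M := ltW (mesh_gt0 n).
case: (ltngtP p q) => [pq'|pq'|->]; last by rewrite subrr enorm0 mulr_ge0.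
  have -> : q = p.+1 by apply/eqP; rewrite eqn_leq qp.
  by rewrite iterS enormB euler_move.
have -> : p = q.+1 by apply/eqP; rewrite eqn_leq pq.
by rewrite iterS euler_move.
Qed.

(** Bounds the distance between consecutive polygons in units of the finer mesh: the first term is
    the halving error accumulated up to time [t], the second one leftover step. *)
Definition growth t := expR (t * D) * (D * C * t) + C.

Lemma growth_ge0 t : 0 <= t -> 0 <= growth t.
Proof. by move=> t0; rewrite /growth addr_ge0// !mulr_ge0// expR_ge0. Qed.

Lemma polygonS n t x : 0 <= t ->
  enorm (polygon n.+1 t x - polygon n t x) <= mesh n.+1 * growth t.
Proof.
move=> t0; rewrite {2}/polygon meshS.
set h := mesh n.+1; have h0 : 0 < h := mesh_gt0 _.
set p := Num.truncn (t / h); set q := Num.truncn (t / (h + h)).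
have hh0 : 0 < h + h by rewrite addr_gt0.
have /andP[p1 p2] : p%:R <= t / h < p.+1%:R.
  by apply: truncn_itv; rewrite divr_ge0// ltW.
have /andP[q1 q2] : q%:R <= t / (h + h) < q.+1%:R.
  by apply: truncn_itv; rewrite divr_ge0// ltW.
rewrite ler_pdivlMr// in q1; rewrite ltr_pdivrMr// in q2.
rewrite ler_pdivlMr// in p1; rewrite ltr_pdivrMr// in p2.
have e1 : (q.*2 <= p)%N.
  rewrite -ltnS -(ltr_nat R) -(ltr_pM2r h0) (le_lt_trans _ p2)//.
  by rewrite (le_trans _ q1)// -muln2 natrM -mulrA ler_wpM2l// -mulr2n mulr_natl.
have e2 : (p <= q.*2.+1)%N.
  rewrite -ltnS -doubleS -(ltr_nat R) -(ltr_pM2r h0) (le_lt_trans p1)//.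
  by rewrite (lt_le_trans q2)// -muln2 natrM -mulrA ler_wpM2l// -mulr2n mulr_natl.
rewrite (le_trans (enormBD (iter q.*2 (euler h) x) _ _))//.
have := @iter_euler_near n.+1 p q.*2 x e2 (leq_trans e1 (leqnSn _)).
rewrite -/h => H1; have H2 := iter_euler_half q x (ltW h0).
rewrite addrC /growth mulrDr lerD//; last by rewrite mulrC.
apply: (le_trans H2).
rewrite [leRHS](_ : _ = expR (t * D) * (D * C * h * t)); last by ring.
apply: ler_pM; rewrite ?expR_ge0//.
- by apply: mulr_ge0; apply: mulr_ge0; rewrite ?ler0n ?(ltW h0)// mulr_ge0.
- by rewrite ler_expR ler_wpM2r// mulrC.
rewrite ler_wpM2l//; first by rewrite !mulr_ge0// ltW.
by apply: le_trans q1; rewrite mulrC ler_wpM2l// lerDl ltW.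
Qed.

(** The meshes form a geometric series of ratio one half; this exact form of the partial sum is what
    the induction reproduces. *)
Lemma polygon_cauchy n p t x : 0 <= t ->
  enorm (polygon (n + p) t x - polygon n t x) <= mesh n * growth t - mesh (n + p) * growth t.
Proof.
move=> t0; elim: p => [|p IH]; first by rewrite addn0 !subrr enorm0.
rewrite (le_trans (enormBD (polygon (n + p) t x) _ _))//.
rewrite addnS (le_trans (lerD (polygonS _ _ t0) IH))//.
by rewrite (meshS (n + p)) mulrDl; lra.
Qed.

Lemma mesh_cvg0 : mesh n @[n --> \oo] --> 0.
Proof.
have : `|2^-1 : R| < 1 by rewrite ger0_norm ?invr_ge0// invf_lt1// ltr1n.
move/cvg_expr; have -> // : mesh = (fun n => 2^-1 ^+ n).
by apply/funext => n; rewrite /mesh exprVn.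
Qed.

Lemma polygon_is_cvg t x : 0 <= t -> cvgn (fun n => polygon n t x).
Proof.
move=> t0; apply/cauchy_cvgP/cauchy_ballP => e /= e0.
(* Both polygons of a pair beyond [N] are within [mesh N * growth t] of the [N]-th one, whence the
   factor 2; the added 1 makes the bound strict. *)
have H : mesh n * (growth t * 2 + 1) @[n --> \oo] --> 0.
  by rewrite -[X in _ --> X](mul0r (growth t * 2 + 1)); apply: cvgMr_tmp mesh_cvg0.
have gt0 := growth_ge0 t0.
move/cvgrPdist_lt : H => /(_ _ e0)[N _ HN].
exists ([set polygon n t x | n in [set n | (N <= n)%N]],
        [set polygon n t x | n in [set n | (N <= n)%N]]) => /=.
  by split; exists N => // n /= Nn; exists n.
move=> [_ _]/= [[n Nn <-] [p Np <-]].
rewrite -ball_normE/= (le_lt_trans (norm_le_enorm _))//.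
have B q : (N <= q)%N -> enorm (polygon q t x - polygon N t x) <= mesh N * growth t.
  move=> Nq; rewrite -(subnKC Nq) (le_trans (polygon_cauchy _ _ _ t0))//.
  by rewrite lerBlDr lerDl mulr_ge0// ltW// mesh_gt0.
rewrite (le_lt_trans (enormBD (polygon N t x) _ _))//.
have B1 := B _ Nn; have B2 := B _ Np; rewrite enormB in B2.
have := HN N (leqnn _); rewrite sub0r normrN ger0_norm; last first.
  by rewrite mulr_ge0 ?addr_ge0 ?mulr_ge0// ltW// mesh_gt0.
by have := mesh_gt0 N; lra.
Qed.

Definition flow t x : 'cV[R]_m := limn (fun n => polygon n t x).

Lemma enorm_limn_le (u : nat -> 'cV[R]_m) (l y : 'cV[R]_m) (c : R) :
  u n @[n --> \oo] --> l -> (\forall n \near \oo, enorm (u n - y) <= c) ->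
  enorm (l - y) <= c.
Proof.
move=> ul uc; apply/ler_addgt0Pl => e e0.
have [n [ne nc]] : exists n, enorm (u n - l) < e /\ enorm (u n - y) <= c.
  have H : \forall n \near \oo, enorm (u n - l) < e.
    by apply: (ul [set y | enorm (y - l) < e]); exact: enorm_cvg_ball.
  near \oo => n; exists n; split; by near: n.
by rewrite (le_trans (enormBD (u n) _ _))// lerD// enormB ltW.
Unshelve. all: by end_near. Qed.

Lemma flow_cvg t x : 0 <= t -> polygon n t x @[n --> \oo] --> flow t x.
Proof. exact: polygon_is_cvg. Qed.

Lemma flow_polygon n t x : 0 <= t ->
  enorm (flow t x - polygon n t x) <= mesh n * growth t.
Proof.
move=> t0; apply: (enorm_limn_le (flow_cvg t0)).
exists n => // p /= np; rewrite -(subnKC np) (le_trans (polygon_cauchy _ _ _ t0))//.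
by rewrite lerBlDr lerDl mulr_ge0 ?growth_ge0// ltW// mesh_gt0.
Qed.

Lemma le0_mesh (z c : R) : (forall n, z <= mesh n * c) -> z <= 0.
Proof.
move=> H; have : mesh n * c @[n --> \oo] --> 0 * c by apply: cvgMr_tmp mesh_cvg0.
rewrite mul0r => cv; apply: (@ler_cvg_to _ \oo _ _ (cst z) _ z 0 (cvg_cst _) cv).
by apply: nearW.
Qed.

Lemma flow_lip t x y : 0 <= t ->
  enorm (flow t x - flow t y) <= expR (t * D) * enorm (x - y).
Proof.
move=> t0; rewrite -subr_le0; apply: (@le0_mesh _ (growth t + growth t)) => n.
have H1 := flow_polygon n x t0; have H2 := flow_polygon n y t0.
have H3 := polygon_lip n x y t0.
have := enormBD (polygon n t x) (flow t x) (flow t y).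
have := enormBD (polygon n t y) (polygon n t x) (flow t y).
by rewrite [enorm (polygon n t y - flow t y)]enormB; lra.
Qed.

Lemma flow_move t x : 0 <= t -> enorm (flow t x - x) <= C * t.
Proof.
move=> t0; apply: (enorm_limn_le (flow_cvg t0)).
by apply: nearW => n; exact: polygon_move.
Qed.

Lemma flow0 x : flow 0 x = x.
Proof.
apply/eqP; rewrite -subr_eq0; apply/eqP/enorm_eq0/eqP.
by rewrite eq_le enorm_ge0 andbT (le_trans (flow_move _ _))// mulr0.
Qed.

Lemma flowD s t x : 0 <= s -> 0 <= t -> flow (s + t) x = flow t (flow s x).
Proof.
move=> s0 t0; have st0 : 0 <= s + t by rewrite addr_ge0.
apply/eqP; rewrite -subr_eq0; apply/eqP/enorm_eq0/eqP.
rewrite eq_le enorm_ge0 andbT.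
apply: (@le0_mesh _ (growth (s + t) + C + expR (t * D) * growth s + growth t)) => n.
have H1 := flow_polygon n x st0; have H2 := flow_polygon n (flow s x) t0.
have H3 := polygon_lip n (polygon n s x) (flow s x) t0.
have := ler_wpM2l (expR_ge0 (t * D)) (flow_polygon n x s0).
rewrite [enorm (flow s x - _)]enormB => H4; rewrite enormB in H2.
(* Counting the whole steps in [s] and in [t] separately loses at most one step against counting
   those in [s + t]. *)
suff H5 : enorm (polygon n (s + t) x - polygon n t (polygon n s x)) <= C * mesh n.
  have := enormBD (polygon n (s + t) x) (flow (s + t) x) (flow t (flow s x)).
  have := enormBD (polygon n t (polygon n s x)) (polygon n (s + t) x) (flow t (flow s x)).
  have := enormBD (polygon n t (flow s x)) (polygon n t (polygon n s x)) (flow t (flow s x)).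
  by lra.
rewrite /polygon -iterD.
have [/andP[h1 h2] /andP[h3 h4] /andP[h5 h6]] :=
  And3 (polygon_steps n s0) (polygon_steps n t0) (polygon_steps n st0).
have M := mesh_gt0 n.
apply: iter_euler_near.
  rewrite -ltnS -(ltr_nat R) -(ltr_pM2l M) (le_lt_trans h5)//.
  rewrite (lt_le_trans (ltrD h2 h4))//.
  by rewrite -mulrDr ler_pM2l// -natrD ler_nat addSn addnS addnC.
rewrite -ltnS -(ltr_nat R) -(ltr_pM2l M) natrD mulrDr.
rewrite (le_lt_trans (lerD h3 h1))// addrC (lt_le_trans h6)//.
by rewrite ler_pM2l// ler_nat.
Qed.

Lemma iter_euler_step h n x : 0 <= h ->
  enorm (iter n (euler h) x - (x + (h * n%:R) *: a x)) <= D * C * (h * n%:R) ^+ 2.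
Proof.
move=> h0; elim: n => [|n IH].
  by rewrite mulr0 scale0r addr0 subrr enorm0 expr0n mulr0.
rewrite iterS; set u := iter n _ x in IH *.
rewrite (_ : _ - _ = (u - (x + (h * n%:R) *: a x)) + h *: (a u - a x)); last first.
  by rewrite /euler -natr1; apply/matrixP => i j; rewrite !mxE; ring.
have H : enorm (h *: (a u - a x)) <= h * (D * (C * (h * n%:R))).
  rewrite enormZ ger0_norm// ler_wpM2l// (le_trans (aD _ _))// ler_wpM2l//.
  exact: iter_euler_move.
rewrite (le_trans (enormD _ _))// (le_trans (lerD IH H))//.
rewrite (_ : D * C * _ + _ = D * C * ((h * n%:R) ^+ 2 + h * (h * n%:R))); last by ring.
rewrite ler_wpM2l ?mulr_ge0// -[n.+1%:R]natr1 -subr_ge0.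
rewrite (_ : _ - _ = h ^+ 2 * (n%:R + 1)); last by ring.
by rewrite mulr_ge0 ?sqr_ge0// addr_ge0.
Qed.

(** The quadratic remainder serves twice: it gives the differential equation of the flow and the
    one-step error of the discrete path. *)
Lemma flow_step t x : 0 <= t ->
  enorm (flow t x - (x + t *: a x)) <= D * C * t ^+ 2.
Proof.
move=> t0; rewrite -subr_le0; apply: (@le0_mesh _ (growth t + C)) => n.
have /andP[h1 h2] := polygon_steps n t0; have M := mesh_gt0 n.
set q := Num.truncn _ in h1 h2.
have H1 := flow_polygon n x t0.
have H2 : enorm ((x + (mesh n * q%:R) *: a x) - (x + t *: a x)) <= C * mesh n.
  rewrite opprD addrACA subrr add0r -scalerBl enormZ.
  have -> : `|mesh n * q%:R - t| = t - mesh n * q%:R.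
    by rewrite distrC ger0_norm// subr_ge0.
  rewrite mulrC ler_pM ?enorm_ge0 ?subr_ge0//.
  by rewrite lerBlDr (le_trans (ltW h2))// -[q.+1%:R]natr1; lra.
have H3 : enorm (polygon n t x - (x + (mesh n * q%:R) *: a x)) <= D * C * t ^+ 2.
  apply: (le_trans (iter_euler_step _ _ (ltW M))); rewrite ler_wpM2l ?mulr_ge0//.
  by rewrite lerXn2r ?nnegrE// mulr_ge0// ltW.
have := enormBD (polygon n t x) (flow t x) (x + t *: a x).
have := enormBD (x + (mesh n * q%:R) *: a x) (polygon n t x) (x + t *: a x).
by lra.
Qed.

End flow.

(** * Jump paths and the perturbed equation *)

Section ode_uniqueness.
Context {R : realType} {m : nat}.
Implicit Types (f g : R -> 'cV[R]_m) (s t u z : R).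

Lemma cvg_enormP (T : Type) (F : set_system T) (FF : Filter F)
    (f : T -> 'cV[R]_m) (y : 'cV[R]_m) :
  f x @[x --> F] --> y <-> forall e, 0 < e -> \forall x \near F, enorm (f x - y) < e.
Proof.
split=> [fy e e0|H].
  by apply: (fy [set z | enorm (z - y) < e]); exact: enorm_cvg_ball.
by move=> A /nbhs_enormP[e e0 He]; apply: filterS (H _ e0) => x; exact: He.
Qed.

(** Increment form of the derivative within [A]. It allows [z = u] and involves no division, so it
    restricts to subsets and passes between functions that agree near [u]. *)
Definition deriv_in (A : set R) f u (v : 'cV[R]_m) := forall e, 0 < e ->
  exists2 r, 0 < r & forall z, A z -> `|z - u| < r ->
    enorm (f z - f u - (z - u) *: v) <= e * `|z - u|.

Lemma deriv_inP A f u v :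
  (z - u)^-1 *: (f z - f u) @[z --> within A u^'] --> v <-> deriv_in A f u v.
Proof.
split=> [fv e e0|H].
  have := fv [set y | enorm (y - v) < e] (enorm_cvg_ball v e0).
  move=> /nbhs_ballP[r /= r0 Hr].
  exists r => // z Az zr; have [->|zu] := eqVneq z u.
    by rewrite !subrr scale0r subrr enorm0 normr0 mulr0.
  have zu0 : z - u != 0 by rewrite subr_eq0.
  have /= := Hr z; rewrite -ball_normE/= distrC => /(_ zr zu Az) H.
  rewrite (_ : _ - _ = (z - u) *: ((z - u)^-1 *: (f z - f u) - v)).
    by rewrite enormZ mulrC ler_wpM2r// ltW.
  by rewrite scalerBr scalerA mulfV// scale1r.
apply/cvg_enormP => e e0; have e20 : 0 < e / 2 by rewrite divr_gt0.
have [r r0 Hr] := H _ e20.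
apply/nbhs_ballP; exists r => //= z; rewrite -ball_normE/= distrC => zr zu Az.
have zu0 : z - u != 0 by rewrite subr_eq0.
rewrite (_ : _ - v = (z - u)^-1 *: (f z - f u - (z - u) *: v)).
  rewrite enormZ normfV mulrC ltr_pdivrMr ?normr_gt0//.
  rewrite (le_lt_trans (Hr _ Az zr))// ltr_pM2r ?normr_gt0//; lra.
by rewrite (scalerBr (z - u)^-1 (f z - f u)) scalerA mulVf// scale1r.
Qed.

Lemma deriv_in_sub A B f u v : B `<=` A -> deriv_in A f u v -> deriv_in B f u v.
Proof.
by move=> BA H e e0; have [r r0 Hr] := H e e0; exists r => // z /BA; exact: Hr.
Qed.

Lemma deriv_in_cont A f u v e : deriv_in A f u v -> 0 < e ->
  exists2 r, 0 < r & forall z, A z -> `|z - u| < r -> enorm (f z - f u) < e.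
Proof.
move=> H e0; have [r r0 Hr] := H _ ltr01.
have v1 : 0 < enorm v + 1 by rewrite ltr_wpDl// enorm_ge0.
exists (Num.min r (e / (enorm v + 1))); first by rewrite lt_min r0 divr_gt0.
move=> z Az; rewrite lt_min ltr_pdivlMr// => /andP[zr ze].
rewrite -[_ - f u](subrK ((z - u) *: v)) (le_lt_trans (enormD _ _))//.
rewrite (le_lt_trans (lerD (Hr _ Az zr) (lexx _)))// enormZ.
by apply: le_lt_trans ze; rewrite mulrDr addrC mulr1 mul1r.
Qed.

Definition rcont f u := forall e, 0 < e ->
  exists2 r, 0 < r & forall z, u <= z < u + r -> enorm (f z - f u) < e.

Lemma rcontP f u : f z @[z --> u^'+] --> f u <-> rcont f u.
Proof.
split=> [/cvg_enormP H e e0|H].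
  have /nbhs_ballP[r /= r0 Hr] := H _ e0.
  exists r => // z /andP[]; rewrite le_eqVlt => /predU1P[<- _|uz zr].
    by rewrite subrr enorm0.
  by apply: Hr => //; rewrite -ball_normE/= distrC gtr0_norm ?subr_gt0// ltrBlDl.
apply/cvg_enormP => e e0; have [r r0 Hr] := H _ e0.
apply/nbhs_ballP; exists r => //= z; rewrite -ball_normE/= distrC => zr uz.
by apply: Hr; move: zr; rewrite gtr0_norm ?subr_gt0// ltrBlDl (ltW uz).
Qed.

Definition llim f u (L : 'cV[R]_m) := forall e, 0 < e ->
  exists2 r, 0 < r & forall z, u - r < z < u -> enorm (f z - L) < e.

Lemma llimP f u L : f z @[z --> u^'-] --> L <-> llim f u L.
Proof.
split=> [/cvg_enormP H e e0|H].
  have /nbhs_ballP[r /= r0 Hr] := H _ e0.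
  exists r => // z /andP[uz zu].
  by apply: Hr => //; rewrite -ball_normE/= gtr0_norm ?subr_gt0// ltrBlDl -ltrBlDr.
apply/cvg_enormP => e e0; have [r r0 Hr] := H _ e0.
apply/nbhs_ballP; exists r => //= z; rewrite -ball_normE/= => zr uz.
by apply: Hr; move: zr; rewrite gtr0_norm ?subr_gt0// ltrBlDl -ltrBlDr uz => ->.
Qed.

Lemma llim_uniq f u (L L' : 'cV[R]_m) : llim f u L -> llim f u L' -> L = L'.
Proof.
move=> /llimP H /llimP H'.
by apply: (@cvg_unique _ _ (f z @[z --> u^'-])) => //; exact: norm_hausdorff.
Qed.

(* [f] is within [eps * exp ((D + 1) (t - s))] of [g] for every [eps > 0] *)
Lemma ode_unique (a : 'cV[R]_m -> 'cV[R]_m) (D : R) f g s r :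
  0 <= D -> (forall x y, enorm (a x - a y) <= D * enorm (x - y)) ->
  f s = g s -> rcont f s -> rcont g s ->
  (forall u, s < u < r -> deriv_in `]s, r[ f u (a (f u)) /\
                          deriv_in `]s, r[ g u (a (g u))) ->
  forall t, s <= t < r -> f t = g t.
Proof.
move=> D0 aD fgs rf rg dfg t0 /andP[st0 t0r].
apply/eqP; rewrite -subr_eq0; apply/eqP/enorm_eq0/eqP.
rewrite eq_le enorm_ge0 andbT.
suff H (eps : R) : 0 < eps -> enorm (f t0 - g t0) <= eps * expR ((D + 1) * (t0 - s)).
  apply/ler_addgt0Pl => e e0; rewrite addr0.
  have E := expR_gt0 ((D + 1) * (t0 - s)).
  by have := H (e / expR ((D + 1) * (t0 - s))); rewrite divfK ?gt_eqF// divr_gt0//; apply.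
move=> eps0; pose N u := enorm (f u - g u).
(* The exponent uses [D + 1] rather than the Lipschitz constant [D]: the extra unit absorbs the two
   first-order remainders, each at most [eps / 2] times the increment of time. *)
pose M u := eps * expR ((D + 1) * (u - s)).
have Mmono u z : u <= z -> M u <= M z.
  by move=> uz; rewrite ler_pM2l// ler_expR ler_wpM2l ?lerD2r// addr_ge0.
have Mge u : s <= u -> eps <= M u.
  move=> su; apply: ler_peMr; first exact: ltW.
  by rewrite -[X in X <= _]expR0 ler_expR; apply: mulr_ge0; [rewrite addr_ge0|rewrite subr_ge0].
pose E := [set t | s <= t <= t0 /\ forall u, s <= u <= t -> N u <= M u].
have Es : E s.
  split; first by rewrite lexx.
  move=> u /andP[su us]; have -> : u = s by apply/eqP; rewrite eq_le us.
  by rewrite /N fgs subrr enorm0 mulr_ge0 ?expR_ge0// ltW.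
have hsE : has_sup E by split; [exists s|exists t0 => t [/andP[]]].
set T := sup E.
have sT : s <= T by apply: ub_le_sup Es; case: hsE.
have Tt0 : T <= t0 by apply: ge_sup; [exists s|move=> t [/andP[]]].
have below u : s <= u < T -> N u <= M u.
  move=> /andP[su uT]; have [t [_ Ht] ut] := sup_gt (ex_intro _ s Es) uT.
  by apply: Ht; rewrite su ltW.
have NTM : N T <= M T.
  have [sT'|Ts] := ltP s T; last first.
    have -> : T = s by apply/eqP; rewrite eq_le Ts.
    by case: Es => _; apply; rewrite lexx.
  apply/ler_addgt0Pl => e e0; have e20 : 0 < e / 2 by rewrite divr_gt0.
  have sTr : s < T < r by rewrite sT' (le_lt_trans Tt0).
  have [df dg] := dfg T sTr.
  have [r1 r10 H1] := deriv_in_cont df e20; have [r2 r20 H2] := deriv_in_cont dg e20.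
  pose d := Num.min (Num.min r1 r2) (T - s).
  have d0 : 0 < d by rewrite !lt_min r10 r20 subr_gt0.
  have [d1 d2 d3] : [/\ d <= r1, d <= r2 & d <= T - s].
    by split; rewrite /d !ge_min lexx ?orbT.
  pose z := T - d / 2.
  have zT : z < T by rewrite /z; lra.
  have sz : s < z by rewrite /z; lra.
  have Az : `]s, r[%classic z by rewrite /= in_itv/= sz (lt_trans zT)// (le_lt_trans Tt0).
  have zTd : `|z - T| = d / 2 by rewrite distrC gtr0_norm ?subr_gt0// /z; lra.
  have := H1 z Az; rewrite zTd => /(_ ltac:(lra)) {}H1.
  have := H2 z Az; rewrite zTd => /(_ ltac:(lra)) {}H2.
  have := below z; rewrite ltW// zT => /(_ isT) Bz.
  have := Mmono z T (ltW zT).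
  have : N T <= N z + enorm (f z - f T) + enorm (g z - g T).
    rewrite /N; have := enormBD (f z) (f T) (g T); have := enormBD (g z) (f z) (g T).
    by rewrite [enorm (f T - f z)]enormB; lra.
  by lra.
have [T0|T0] := eqVneq T t0.
  by rewrite -T0.
have {}T0 : T < t0 by rewrite lt_neqAle T0.
(* Continuation: if [T] were before [t0], the bound would extend beyond it, by the derivatives when
   [s < T], and by right continuity when [T = s], where no derivative is assumed. *)
exfalso.
suff [z zT Ez] : exists2 z, T < z & E z.
  by have := ub_le_sup (proj2 hsE) Ez; rewrite leNgt zT.
have ext z : T < z -> z <= t0 -> (forall u, T < u <= z -> N u <= M u) -> E z.
  move=> Tz zt0 Hz; split; first by rewrite zt0 (le_trans sT)// ltW.
  move=> u /andP[su uz]; have [uT|Tu|->//] := ltgtP u T.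
    by apply: below; rewrite su.
  by apply: Hz; rewrite Tu.
have [sT'|Ts] := ltP s T.
  have sTr : s < T < r by rewrite sT' (le_lt_trans Tt0).
  have [df dg] := dfg T sTr; have e20 : 0 < eps / 2 by rewrite divr_gt0.
  have [r1 r10 H1] := df _ e20; have [r2 r20 H2] := dg _ e20.
  pose d := Num.min (Num.min r1 r2) (t0 - T).
  have d0 : 0 < d by rewrite !lt_min r10 r20 subr_gt0.
  have [d1 d2 d3] : [/\ d <= r1, d <= r2 & d <= t0 - T].
    by split; rewrite /d !ge_min lexx ?orbT.
  exists (T + d / 2); first lra.
  apply: ext; [lra|lra|move=> u /andP[Tu ud]].
  have Au : `]s, r[%classic u by rewrite /= in_itv/= (lt_trans sT')//=; lra.
  have uTd : `|u - T| = u - T by rewrite gtr0_norm// subr_gt0.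
  have := H1 u Au; rewrite uTd => /(_ ltac:(lra)) {}H1.
  have := H2 u Au; rewrite uTd => /(_ ltac:(lra)) {}H2.
  set h := u - T in H1 H2 uTd; have h0 : 0 < h by rewrite subr_gt0.
  have HN : N u <= N T + h * (D * N T) + eps * h.
    have E1 : f u - g u = (f u - f T - h *: a (f T)) - (g u - g T - h *: a (g T)) +
        (f T - g T) + h *: (a (f T) - a (g T)).
      by apply/matrixP => i j; rewrite !mxE; ring.
    rewrite [N u]/N E1 /N; have K1 := enormD (f u - f T - h *: a (f T)) (- (g u - g T - h *: a (g T))).
    rewrite enormN in K1.
    have K2 := enormD (f u - f T - h *: a (f T) - (g u - g T - h *: a (g T))) (f T - g T).
    have K3 := enormD (f u - f T - h *: a (f T) - (g u - g T - h *: a (g T)) + (f T - g T))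
      (h *: (a (f T) - a (g T))).
    have K4 : enorm (h *: (a (f T) - a (g T))) <= h * (D * enorm (f T - g T)).
      by rewrite enormZ gtr0_norm// ler_wpM2l// ltW.
    by lra.
  have HM : M T * (1 + (D + 1) * h) <= M u.
    rewrite /M -mulrA ler_pM2l// (_ : (D + 1) * (u - s) = (D + 1) * (T - s) + (D + 1) * h); last first.
      by rewrite /h; ring.
    by rewrite expRD ler_pM2l ?expR_gt0// expR_ge1Dx.
  have MT := Mge T sT.
  have Dh : 0 <= D * h by rewrite mulr_ge0// ltW.
  have : N T * (1 + D * h) <= M T * (1 + D * h) by rewrite ler_wpM2r// addr_ge0.
  have : eps * h <= M T * h by rewrite ler_wpM2r// ltW.
  by lra.
have TE : T = s by apply/eqP; rewrite eq_le Ts.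
have e20 : 0 < eps / 2 by rewrite divr_gt0.
have [r1 r10 H1] := rf _ e20; have [r2 r20 H2] := rg _ e20.
pose d := Num.min (Num.min r1 r2) (t0 - T).
have d0 : 0 < d by rewrite !lt_min r10 r20 subr_gt0.
have [d1 d2 d3] : [/\ d <= r1, d <= r2 & d <= t0 - T].
  by split; rewrite /d !ge_min lexx ?orbT.
exists (T + d / 2); first lra.
apply: ext; [lra|lra|move=> u /andP[Tu ud]].
have {}H1 := H1 u ltac:(lra); have {}H2 := H2 u ltac:(lra).
have := Mge u ltac:(lra).
suff : N u <= enorm (f u - f s) + enorm (g u - g s) by lra.
by rewrite /N; have := enormBD (f s) (f u) (g u); rewrite {2}fgs [enorm (g s - g u)]enormB.
Qed.

End ode_uniqueness.

Section jump_flow.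
Context {R : realType} {m d : nat}.
Variables (a : 'cV[R]_m -> 'cV[R]_m) (sigma : 'cV[R]_m -> 'M[R]_(m, d)).
Variable b : \bar R.
Variables (C D : R).
Hypothesis C0 : 0 <= C.
Hypothesis D0 : 0 <= D.
Hypothesis aC : forall x, enorm (a x) <= C.
Hypothesis aD : forall x y, enorm (a x - a y) <= D * enorm (x - y).
Implicit Types (s t u z : R) (y v : 'cV[R]_m) (w : 'cV[R]_d).
Local Notation jump_data := (R * ('cV[R]_d * 'cV[R]_m))%type.

Definition jump y w v := y + v + clip b (sigma (y + v) *m w).

(* A jump [(t, (w, v))] occurs at time [t], with noise [w] after the perturbation
   [v]; the path is started at time [s] from [y]. *)
Fixpoint jpath s y (l : seq jump_data) t : 'cV[R]_m :=
  if l is (t1, (w, v)) :: l' then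
    if t < t1 then flow a (t - s) y
    else jpath t1 (jump (flow a (t1 - s) y) w v) l' t
  else flow a (t - s) y.

Local Notation times l := [seq p.1 | p <- l : seq jump_data].

Lemma flow_cont t u y : 0 <= t -> 0 <= u ->
  enorm (flow a t y - flow a u y) <= C * `|t - u|.
Proof.
wlog tu : t u / u <= t.
  move=> H t0 u0; have [ut|/ltW tu] := leP u t; first exact: H.
  by rewrite enormB distrC; exact: H.
move=> t0 u0; rewrite ger0_norm ?subr_ge0//.
rewrite -{1}(subrKC u t) (flowD C0 D0 aC aD) ?subr_ge0//.
by apply: (flow_move C0 D0 aC aD); rewrite subr_ge0.
Qed.

(** For [t < u] the expansion is made at time [t] and the drift is then moved to time [u]; this
    second error has the same size and gives the factor 2. *)
Lemma flow_diff t u y : 0 <= t -> 0 <= u ->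
  enorm (flow a t y - flow a u y - (t - u) *: a (flow a u y)) <=
  2 * D * C * `|t - u| ^+ 2.
Proof.
move=> t0 u0; have DC : 0 <= D * C by rewrite mulr_ge0.
have [ut|/ltW tu] := leP u t.
  rewrite ger0_norm ?subr_ge0// -{1}(subrKC u t) (flowD C0 D0 aC aD) ?subr_ge0//.
  rewrite -addrA -opprD; have tu0 : 0 <= t - u by rewrite subr_ge0.
  apply: (le_trans (flow_step C0 D0 aC aD _ tu0)).
  by rewrite -!mulrA ler_peMl ?ler1n// !mulr_ge0// sqr_ge0.
rewrite distrC ger0_norm ?subr_ge0//.
rewrite -{1}(subrKC t u) (flowD C0 D0 aC aD) ?subr_ge0//.
have ut0 : 0 <= u - t by rewrite subr_ge0.
set x := flow a t y.
have H1 := flow_step C0 D0 aC aD x ut0.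
have H2 : enorm (a (flow a u y) - a x) <= D * (C * (u - t)).
  rewrite (le_trans (aD _ _))// ler_wpM2l//.
  by have := flow_cont y u0 t0; rewrite ger0_norm.
rewrite (_ : _ - _ = - (flow a (u - t) x - (x + (u - t) *: a x)) +
    (u - t) *: (a (flow a u y) - a x)); last first.
  by apply/matrixP => i j; rewrite !mxE; ring.
apply: (le_trans (enormD _ _)); rewrite enormN enormZ (ger0_norm ut0).
have := ler_wpM2l ut0 H2; rewrite expr2 in H1 *.
by rewrite (_ : (u - t) * (D * (C * (u - t))) = D * C * ((u - t) * (u - t))); [lra|ring].
Qed.

Lemma flow_deriv s y u A : s <= u -> A `<=` `[s, +oo[%classic ->
  deriv_in A (fun t => flow a (t - s) y) u (a (flow a (u - s) y)).
Proof.
move=> su As e e0; pose K := 2 * D * C + 1.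
have K0 : 0 < K by rewrite ltr_wpDl// !mulr_ge0.
exists (e / K) => [|z /As]; first by rewrite divr_gt0.
rewrite /= in_itv/= andbT => sz; rewrite ltr_pdivlMr// => zu.
have -> : z - u = (z - s) - (u - s) by ring.
apply: (le_trans (flow_diff _ _ _)); rewrite ?subr_ge0//.
rewrite (_ : z - s - (u - s) = z - u); last by ring.
rewrite expr2 mulrA ler_wpM2r// (le_trans _ (ltW zu))// mulrC ler_wpM2l//.
by rewrite /K lerDl.
Qed.

(** The start is left out of the differential equation because, after a restart at a jump time, the
    perturbed equation asserts no derivative there. Right continuity takes its place. *)
Definition jsolution s y (l : seq jump_data) (r : R) (f : R -> 'cV[R]_m) :=
  [/\ f s = y,
      forall t, s <= t < r -> rcont f t,
      forall t, s < t <= r -> t \notin times l -> deriv_in `[s, r] f t (a (f t))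
    & forall p, p \in l -> exists2 L, llim f p.1 L & f p.1 = jump L p.2.1 p.2.2].

Lemma deriv_in_eq (A : set R) f g u v r : 0 < r -> f u = g u ->
  (forall z, A z -> `|z - u| < r -> f z = g z) ->
  deriv_in A f u v -> deriv_in A g u v.
Proof.
move=> r0 fgu fg H e e0; have [r' r'0 Hr] := H e e0.
exists (Num.min r r'); first by rewrite lt_min r0.
move=> z Az; rewrite lt_min => /andP[zr zr'].
by rewrite -fgu -fg//; exact: Hr.
Qed.

Lemma jsolution_flow s y r : jsolution s y [::] r (fun t => flow a (t - s) y).
Proof.
split => //; first by rewrite subrr (flow0 C0 D0 aC aD).
- move=> t /andP[st tr] e e0; exists (e / (C + 1)); first by rewrite divr_gt0// ltr_wpDl.
  move=> z /andP[tz ztr].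
  apply: (le_lt_trans (flow_cont _ _ _)); rewrite ?subr_ge0 ?(le_trans st)//.
  rewrite (_ : z - s - (t - s) = z - t); last by ring.
  rewrite ger0_norm ?subr_ge0//; move: ztr; rewrite -ltrBlDl ltr_pdivlMr ?ltr_wpDl//.
  by apply: le_lt_trans; rewrite mulrC mulrDr lerDl mulr1 subr_ge0.
- move=> t /andP[/ltW st _] _; apply: flow_deriv => // z /=.
  by rewrite !in_itv/= andbT => /andP[].
Qed.

Lemma jpath_start s y l : path <%R s (times l) -> jpath s y l s = y.
Proof.
case: l => [|[t1 [w v]] l]/=; first by rewrite subrr (flow0 C0 D0 aC aD).
by move=> /andP[-> _]; rewrite subrr (flow0 C0 D0 aC aD).
Qed.

Lemma jpath_jsolution s y l r : path <%R s (times l) ->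
  jsolution s y l r (jpath s y l).
Proof.
elim: l s y => [|[t1 [w v]] l IH] s y; first by move=> _; exact: jsolution_flow.
move=> /= /andP[st1 pl].
have [IH1 IH2 IH3 IH4] := IH t1 (jump (flow a (t1 - s) y) w v) pl.
have [F1 F2 F3 _] := @jsolution_flow s y r.
split; rewrite /jpath -/jpath.
- by rewrite st1 subrr (flow0 C0 D0 aC aD).
- move=> t /andP[st tr]; have [tt1|t1t] := ltP t t1.
    move=> e e0; have [r1 r10 Hr1] := F2 t ltac:(lra) e e0.
    exists (Num.min r1 (t1 - t)); first by rewrite lt_min r10 subr_gt0.
    move=> z; rewrite -ltrBlDl lt_min => /and3P[tz zr1 zt1].
    by rewrite tt1 ifT; [apply: Hr1; lra|lra].
  move=> e e0; have [r1 r10 Hr1] := IH2 t ltac:(lra) e e0.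
  exists r1 => // z /andP[tz ztr]; rewrite !ifF; first by apply: Hr1; rewrite tz.
    by apply/negbTE; rewrite -leNgt.
  by apply/negbTE; rewrite -leNgt (le_trans t1t).
- move=> t /andP[st tr]; rewrite inE negb_or => /andP[tt1 tl].
  have [{}tt1|t1t|] := ltgtP t t1; last by move/eqP; rewrite (negbTE tt1).
    apply: (@deriv_in_eq _ (fun t => flow a (t - s) y) _ _ _ (t1 - t)).
    - by rewrite subr_gt0.
    - by rewrite tt1.
    - by move=> z _; rewrite ltr_norml => /andP[_ zt]; rewrite ifT//; lra.
    - by apply: F3 => //; rewrite st.
  apply: (@deriv_in_eq _ (jpath t1 (jump (flow a (t1 - s) y) w v) l) _ _ _ (t - t1)).
  - by rewrite subr_gt0.
  - by rewrite ifF//; apply/negbTE; rewrite -leNgt ltW.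
  - by move=> z _; rewrite ltr_norml => /andP[zt _]; rewrite ifF//; apply/negbTE; rewrite -leNgt; lra.
  move=> e e0; have [r1 r10 Hr1] := IH3 t ltac:(lra) tl e e0.
  exists (Num.min r1 (t - t1)); first by rewrite lt_min r10 subr_gt0.
  move=> z; rewrite /= in_itv/= lt_min => /andP[sz zr] /andP[zt zt1].
  by apply: Hr1 => //=; rewrite in_itv/= zr andbT; move: zt1; rewrite ltr_norml; lra.
move=> p; rewrite inE => /predU1P[->|pl'] /=; last first.
  have t1p : t1 < p.1.
    have := order_path_min lt_trans pl => /allP; apply.
    by apply/mapP; exists p.
  have [L HL EL] := IH4 p pl'; exists L; last first.
    by rewrite ifF//; apply/negbTE; rewrite -leNgt ltW.
  move=> e e0; have [r1 r10 Hr1] := HL e e0.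
  exists (Num.min r1 (p.1 - t1)); first by rewrite lt_min r10 subr_gt0.
  move=> z; have := le_refl r1; set q := Num.min _ _.
  have : q <= r1 by rewrite /q ge_min lexx.
  have : q <= p.1 - t1 by rewrite /q ge_min lexx orbT.
  move=> q1 q2 _ /andP[z1 z2]; rewrite ifF; first by apply: Hr1; lra.
  by apply/negbTE; rewrite -leNgt; lra.
exists (flow a (t1 - s) y); last first.
  by rewrite ltxx jpath_start.
move=> e e0; exists (Num.min (t1 - s) (e / (C + 1))).
  by rewrite lt_min subr_gt0 st1 divr_gt0// ltr_wpDl.
move=> z; set q := Num.min _ _.
have q1 : q <= t1 - s by rewrite /q ge_min lexx.
have q2 : q <= e / (C + 1) by rewrite /q ge_min lexx orbT.
move=> /andP[z1 z2]; rewrite z2.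
apply: (le_lt_trans (flow_cont _ _ _)); [lra|lra|].
rewrite (_ : z - s - (t1 - s) = z - t1); last by ring.
rewrite distrC ger0_norm; last lra.
have : t1 - z < e / (C + 1) by lra.
rewrite ltr_pdivlMr ?ltr_wpDl//; apply: le_lt_trans.
by rewrite mulrC mulrDr lerDl mulr1; lra.
Qed.

(** Before the next jump [ode_unique] applies. Two solutions that agree there have the same left
    limit at the jump, the jump rule then fixes the value, and the induction restarts from it. *)
Lemma jsolution_unique s y l r f g :
  path <%R s (times l) -> all (fun t => t <= r) (times l) -> s <= r ->
  jsolution s y l r f -> jsolution s y l r g ->
  forall t, s <= t <= r -> f t = g t.
Proof.
elim: l s y => [|[t1 [w v]] l IH] s y /=.
  move=> _ _ sr [f1 f2 f3 _] [g1 g2 g3 _].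
  have [sr'|rs] := ltP s r; last first.
    by move=> t ?; have -> : t = s by [lra]; rewrite f1.
  have fg t : s <= t < r -> f t = g t.
    apply: (@ode_unique _ _ a D) => //; first by rewrite f1.
    - by apply: f2; rewrite lexx.
    - by apply: g2; rewrite lexx.
    - move=> u /andP[su ur].
      have I : `]s, r[%classic `<=` (`[s, r]%classic : set R).
        by move=> z /=; rewrite !in_itv/= => /andP[/ltW -> /ltW ->].
      by split; apply: (deriv_in_sub I); [apply: f3|apply: g3]; rewrite // su ltW.
  move=> t /andP[st]; rewrite le_eqVlt => /predU1P[->|tr]; last by rewrite fg// st.
  (* At the end [r] the equation makes both solutions left continuous, so equality before [r]
     extends to it. *)
  have L A : deriv_in `[s, r] A r (a (A r)) -> llim A r (A r).
    move=> dA e e0; have [q q0 Hq] := deriv_in_cont dA e0.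
    exists (Num.min q (r - s)); first by rewrite lt_min q0 subr_gt0.
    move=> z; set p := Num.min _ _.
    have p1 : p <= q by rewrite /p ge_min lexx.
    have p2 : p <= r - s by rewrite /p ge_min lexx orbT.
    move=> ?; apply: Hq; first by rewrite /= in_itv/=; lra.
    by rewrite ltr_norml; lra.
  have Lf : llim f r (f r) by apply/L/f3 => //; lra.
  have Lg : llim g r (g r) by apply/L/g3 => //; lra.
  apply: llim_uniq Lf _ => e e0; have [q q0 Hq] := Lg _ e0.
  exists (Num.min q (r - s)); first by rewrite lt_min q0 subr_gt0.
  move=> z; set p := Num.min _ _.
  have p1 : p <= q by rewrite /p ge_min lexx.
  have p2 : p <= r - s by rewrite /p ge_min lexx orbT.
  by move=> ?; rewrite fg; [apply: Hq; lra|lra].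
move=> /andP[st1 pl] /andP[t1r lr] sr [f1 f2 f3 f4] [g1 g2 g3 g4].
have tl u : u < t1 -> u \notin t1 :: times l.
  move=> ut1; rewrite inE negb_or lt_eqF//=; apply/negP => ul.
  have := order_path_min lt_trans pl => /allP/(_ _ ul).
  by rewrite ltNge ltW.
have fg t : s <= t < t1 -> f t = g t.
  apply: (@ode_unique _ _ a D) => //; first by rewrite f1.
  - by apply: f2; rewrite lexx (lt_le_trans st1).
  - by apply: g2; rewrite lexx (lt_le_trans st1).
  - move=> u /andP[su ut1].
    have I : `]s, t1[%classic `<=` (`[s, r]%classic : set R).
      by move=> z /=; rewrite !in_itv/=; lra.
    by split; apply: (deriv_in_sub I); [apply: f3|apply: g3]; rewrite ?tl//; lra.
have [L fL fE] := f4 (t1, (w, v)) (mem_head _ _).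
have [L' gL gE] := g4 (t1, (w, v)) (mem_head _ _).
have LL' : L = L'.
  apply: llim_uniq fL _ => e e0; have [q q0 Hq] := gL _ e0.
  exists (Num.min q (t1 - s)); first by rewrite lt_min q0 subr_gt0.
  move=> z /=; set p := Num.min _ _.
  have p1 : p <= q by rewrite /p ge_min lexx.
  have p2 : p <= t1 - s by rewrite /p ge_min lexx orbT.
  by move=> ?; rewrite fg; [apply: Hq => /=; lra|lra].
subst L'; rewrite /= in fE gE.
have {}fE : f t1 = jump L w v by [].
have IHp f' : (forall t, s <= t < r -> rcont f' t) ->
    (forall t, s < t <= r -> t \notin t1 :: times l -> deriv_in `[s, r] f' t (a (f' t))) ->
    (forall p, p \in (t1, (w, v)) :: l -> exists2 L, llim f' p.1 L & f' p.1 = jump L p.2.1 p.2.2) ->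
    f' t1 = jump L w v -> jsolution t1 (jump L w v) l r f'.
  move=> h2 h3 h4 h1; split => //.
  - by move=> t ?; apply: h2; lra.
  - move=> t /andP[t1t tr] tl'; apply: (@deriv_in_sub _ _ `[s, r]).
      by move=> z /=; rewrite !in_itv/=; lra.
    by apply: h3; rewrite ?inE ?negb_or ?tl' ?gt_eqF//; lra.
  - by move=> p pl'; apply: h4; rewrite inE pl' orbT.
move=> t /andP[st tr]; have [tt1|t1t] := ltP t t1; first by apply: fg; rewrite st.
apply: (IH t1 (jump L w v)) => //; [exact: IHp|exact: IHp|by rewrite t1t].
Qed.

(** [jsolution] omits the starting time, whereas the perturbed equation has to hold at time 0 as
    well. *)
Lemma jpath_deriv_start s y l r : s < r -> path <%R s (times l) ->
  deriv_in `[s, r] (jpath s y l) s (a y).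
Proof.
move=> sr pl; have F : deriv_in `[s, r] (fun t => flow a (t - s) y) s (a y).
  have := @flow_deriv s y s `[s, r] (lexx s); rewrite subrr (flow0 C0 D0 aC aD).
  by apply => z /=; rewrite !in_itv/= andbT => /andP[].
case: l pl => [|[t1 [w v]] l]//= /andP[st1 _].
apply: (@deriv_in_eq _ (fun t => flow a (t - s) y) _ _ _ (t1 - s)) => //.
- by rewrite subr_gt0.
- by rewrite st1.
- by move=> z _; rewrite ltr_norml => /andP[_ zt]; rewrite ifT//; lra.
Qed.

End jump_flow.

(** * Existence and uniqueness for the perturbed equation *)

Section perturbed_solutions.
Context {R : realType} {m d : nat}.
Variables (a : 'cV[R]_m -> 'cV[R]_m) (sigma : 'cV[R]_m -> 'M[R]_(m, d)).
Variable b : \bar R.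
Variable D : R.
Hypothesis D0 : 0 <= D.
Hypothesis aD : forall x y, enorm (a x - a y) <= D * enorm (x - y).

Definition jdata k (W : k.-tuple 'cV[R]_d) (V : k.-tuple 'cV[R]_m)
  (t : k.-tuple R) : seq (R * ('cV[R]_d * 'cV[R]_m)) := zip t (zip W V).

Lemma times_jdata k (W : k.-tuple 'cV[R]_d) V t :
  [seq p.1 | p <- jdata W V t] = t.
Proof. by rewrite -/unzip1 unzip1_zip// size_zip !size_tuple minnn. Qed.

Lemma mem_jdata k (W : k.-tuple 'cV[R]_d) V t p : p \in jdata W V t ->
  exists j, p = (tnth t j, (tnth W j, tnth V j)).
Proof.
have szV : size (zip W V) = k by rewrite size_zip !size_tuple minnn.
move=> pW; have ip := pW; rewrite -index_mem in ip.
have sz : size (jdata W V t) = k by rewrite /jdata size_zip szV size_tuple minnn.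
rewrite sz in ip; exists (Ordinal ip).
rewrite -[LHS](nth_index (0, (0, 0)) pW) nth_zip; last by rewrite szV size_tuple.
by rewrite nth_zip ?size_tuple// !(tnth_nth 0).
Qed.

Lemma jdata_mem k (W : k.-tuple 'cV[R]_d) V t j :
  (tnth t j, (tnth W j, tnth V j)) \in jdata W V t.
Proof.
have szV : size (zip W V) = k by rewrite size_zip !size_tuple minnn.
have sz : size (jdata W V t) = k by rewrite /jdata size_zip szV size_tuple minnn.
rewrite !(tnth_nth 0) -nth_zip ?size_tuple// -nth_zip ?szV ?size_tuple//.
by rewrite mem_nth// sz.
Qed.

Lemma increasing_path k (t : k.-tuple R) :
  increasing_tuples `]0, 1]%classic k t -> path <%R 0 t /\ all (fun s => s <= 1) t.
Proof.
move=> [st Ht]; have ht s : s \in t -> 0 < s <= 1 by move=> /Ht; rewrite /= in_itv.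
split; last by apply/allP => s /ht /andP[].
have {}ht s : s \in tval t -> 0 < s <= 1 := ht s.
case: (tval t) st ht => //= s l -> ht; rewrite andbT.
by have /andP[] := ht s (mem_head _ _).
Qed.

Lemma perturbed_ode_jsolution k x (W : k.-tuple 'cV[R]_d) V t xi :
  increasing_tuples `]0, 1]%classic k t ->
  perturbed_ode a sigma b x W V t xi -> jsolution a sigma b 0 x (jdata W V t) 1 xi.
Proof.
move=> ti [x0 dxi jxi]; have [xr xl _] := skorokhod_cadlag xi.
split=> //.
- by move=> s s01; apply/rcontP/xr; rewrite in_itv.
- move=> s /andP[s0 s1]; rewrite times_jdata => st.
  by apply/deriv_inP/dxi => //; rewrite in_itv/= s1 ltW.
- move=> p /mem_jdata[j ->] /=; exists (left_limit xi (tnth t j)); last exact: jxi.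
  by apply/llimP/xl; case: ti => _; apply; exact: mem_tnth.
Qed.

Lemma perturbed_ode_unique k x (W : k.-tuple 'cV[R]_d) V t xi xi' :
  increasing_tuples `]0, 1]%classic k t ->
  perturbed_ode a sigma b x W V t xi -> perturbed_ode a sigma b x W V t xi' ->
  xi = xi'.
Proof.
move=> ti h1 h2; apply: skorokhod_ext => u; rewrite in_itv/= => u01.
have [pt at1] := increasing_path ti.
by apply: (jsolution_unique D0 aD _ _ ler01 (perturbed_ode_jsolution ti h1)
  (perturbed_ode_jsolution ti h2)) => //; rewrite times_jdata.
Qed.

(** [hbar] is chosen by [get]; uniqueness identifies the choice with any solution at hand, and
    [jpath01] will supply one. *)
Lemma hbar_eq k x (W : k.-tuple 'cV[R]_d) V t xi :
  increasing_tuples `]0, 1]%classic k t ->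
  perturbed_ode a sigma b x W V t xi -> hbar a sigma b x W V t = xi.
Proof.
move=> ti h1; apply: (perturbed_ode_unique ti _ h1).
exact: (getPex (ex_intro _ xi h1)).
Qed.

Variable C : R.
Hypothesis C0 : 0 <= C.
Hypothesis aC : forall x, enorm (a x) <= C.

Definition jpath01 x l (t : R) : 'cV[R]_m :=
  if t \in `[0, 1] then jpath a sigma b 0 x l t else 0.

Lemma jpath01E x l t : t \in `[0, 1] -> jpath01 x l t = jpath a sigma b 0 x l t.
Proof. by rewrite /jpath01 => ->. Qed.

Lemma jpath01_left x l t : path <%R 0 [seq p.1 | p <- l] -> t \in `]0, 1] ->
  exists L, llim (jpath01 x l) t L /\ llim (jpath a sigma b 0 x l) t L.
Proof.
move=> pl; rewrite in_itv/= => /andP[t0 t1].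
have [_ _ P3 P4] := jpath_jsolution sigma b C0 D0 aC aD x 1 pl.
suff [L HL] : exists L, llim (jpath a sigma b 0 x l) t L.
  exists L; split => // e e0; have [r r0 Hr] := HL e e0.
  exists (Num.min r t); first by rewrite lt_min r0.
  move=> z; set q := Num.min _ _.
  have q1 : q <= r by rewrite /q ge_min lexx.
  have q2 : q <= t by rewrite /q ge_min lexx orbT.
  move=> ?; rewrite jpath01E; first by apply: Hr; lra.
  by rewrite in_itv/=; lra.
have [|tl] := boolP (t \in [seq p.1 | p <- l]).
  by move=> /mapP[p /P4[L HL _] ->]; exists L.
exists (jpath a sigma b 0 x l t) => e e0.
have := P3 t; rewrite t0 t1 => /(_ isT tl) dt.
have [r r0 Hr] := deriv_in_cont dt e0.
exists (Num.min r t); first by rewrite lt_min r0.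
move=> z; set q := Num.min _ _.
have q1 : q <= r by rewrite /q ge_min lexx.
have q2 : q <= t by rewrite /q ge_min lexx orbT.
move=> ?; apply: Hr; first by rewrite /= in_itv/=; lra.
by rewrite ltr_norml; lra.
Qed.

Lemma jpath01_cadlag x l : path <%R 0 [seq p.1 | p <- l] -> cadlag01 (jpath01 x l).
Proof.
move=> pl; have [_ P2 P3 P4] := jpath_jsolution sigma b C0 D0 aC aD x 1 pl.
split=> [t|t t01|t /negbTE]; last by rewrite /jpath01 => ->.
  rewrite in_itv/= => /andP[t0 t1]; apply/rcontP => e e0.
  have [r r0 Hr] := P2 t ltac:(lra) e e0.
  exists (Num.min r (1 - t)); first by rewrite lt_min r0 subr_gt0.
  move=> z; set q := Num.min _ _.
  have q1 : q <= r by rewrite /q ge_min lexx.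
  have q2 : q <= 1 - t by rewrite /q ge_min lexx orbT.
  move=> ?; rewrite !jpath01E; [|rewrite in_itv/=; lra|rewrite in_itv/=; lra].
  by apply: Hr; lra.
have [L [HL _]] := jpath01_left x pl t01.
by apply/cvg_ex; exists L; apply/llimP.
Qed.

Lemma jpath01_perturbed_ode k x (W : k.-tuple 'cV[R]_d) V t
    (pl : path <%R 0 [seq p.1 | p <- jdata W V t]) :
  increasing_tuples `]0, 1]%classic k t ->
  perturbed_ode a sigma b x W V t (Skorokhod (jpath01_cadlag x pl)).
Proof.
move=> ti; have [P1 P2 P3 P4] := jpath_jsolution sigma b C0 D0 aC aD x 1 pl.
have dE s : deriv_in `[0, 1] (jpath a sigma b 0 x (jdata W V t)) s
      (a (jpath a sigma b 0 x (jdata W V t) s)) -> s \in `[0, 1] ->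
    deriv_in `[0, 1] (jpath01 x (jdata W V t)) s (a (jpath01 x (jdata W V t) s)).
  move=> H s01; rewrite jpath01E//; apply: deriv_in_eq ltr01 _ _ H.
    by rewrite jpath01E.
  by move=> z z01 _; rewrite jpath01E.
split=> /=.
- by rewrite jpath01E// in_itv/= lexx ler01.
- move=> s s01 st; apply/deriv_inP; apply: (dE _ _ s01).
  move: (s01); rewrite in_itv/= => /andP[]; rewrite le_eqVlt => /predU1P[<- _|s0 s1].
    by rewrite P1; apply: (jpath_deriv_start sigma b C0 D0 aC aD).
  by apply: P3; rewrite ?s0// times_jdata.
move=> j; have tj : tnth t j \in `]0, 1].
  by case: ti => _ /(_ (tnth t j)); rewrite mem_tnth => /(_ isT).
have [L [L1 L2]] := jpath01_left x pl tj.
have -> : left_limit (Skorokhod (jpath01_cadlag x pl)) (tnth t j) = L.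
  by apply/cvg_lim => //; apply/llimP.
rewrite jpath01E; last by move: tj; rewrite !in_itv/= => /andP[/ltW -> ->].
have [L' L'1 ->] := P4 _ (jdata_mem W V t j).
by rewrite (llim_uniq L'1 L2).
Qed.

Lemma hbarE k x (W : k.-tuple 'cV[R]_d) V t u :
  increasing_tuples `]0, 1]%classic k t -> u \in `[0, 1] ->
  hbar a sigma b x W V t u = jpath a sigma b 0 x (jdata W V t) u.
Proof.
move=> ti u01; have [pt _] := increasing_path ti.
have pl : path <%R 0 [seq p.1 | p <- jdata W V t] by rewrite times_jdata.
by rewrite (hbar_eq ti (jpath01_perturbed_ode x pl ti)) /= jpath01E.
Qed.

Lemma hbar_perturbed_ode k x (W : k.-tuple 'cV[R]_d) V t :
  increasing_tuples `]0, 1]%classic k t ->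
  perturbed_ode a sigma b x W V t (hbar a sigma b x W V t).
Proof.
move=> ti; have [pt _] := increasing_path ti.
have pl : path <%R 0 [seq p.1 | p <- jdata W V t] by rewrite times_jdata.
rewrite (hbar_eq ti (jpath01_perturbed_ode x pl ti)).
exact: jpath01_perturbed_ode.
Qed.

End perturbed_solutions.

(** Only [a'] has to be bounded: existence is taken from the primed coefficients and uniqueness from
    the Lipschitz property of [a]. A solution that never meets a point where the coefficients were
    modified solves both equations. *)
Lemma hbar_agree {R : realType} {m d : nat}
    (a a' : 'cV[R]_m -> 'cV[R]_m) (sigma sigma' : 'cV[R]_m -> 'M[R]_(m, d))
    (b : \bar R) (D C : R) k x (W : k.-tuple 'cV[R]_d) V t :
  0 <= D -> 0 <= C ->
  (forall x y, enorm (a x - a y) <= D * enorm (x - y)) ->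
  (forall x y, enorm (a' x - a' y) <= D * enorm (x - y)) ->
  (forall x, enorm (a' x) <= C) ->
  increasing_tuples `]0, 1]%classic k t ->
  (forall u, u \in `[0, 1] -> a (hbar a' sigma' b x W V t u) =
                             a' (hbar a' sigma' b x W V t u)) ->
  (forall j, let y := left_limit (hbar a' sigma' b x W V t) (tnth t j) + tnth V j in
      sigma y = sigma' y) ->
  hbar a sigma b x W V t = hbar a' sigma' b x W V t.
Proof.
move=> D0 C0 aD aD' aC ti Ha Hs; apply: (hbar_eq D0 aD ti).
have [h1 h2 h3] := hbar_perturbed_ode sigma' b D0 aD' C0 aC x W V ti.
split => //; first by move=> s s01 st; rewrite Ha//; exact: h2.
by move=> j; have := h3 j; rewrite /= Hs.
Qed.

(** * Stability of jump paths *)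

Section path_estimates.
Context {R : realType} {m d : nat}.
Variables (a : 'cV[R]_m -> 'cV[R]_m) (sigma : 'cV[R]_m -> 'M[R]_(m, d)).
Variable b : \bar R.
Variables (C D : R).
Hypothesis b0 : (0 < b)%E.
Hypothesis C0 : 0 <= C.
Hypothesis D0 : 0 <= D.
Hypothesis aC : forall x, enorm (a x) <= C.
Hypothesis aD : forall x y, enorm (a x - a y) <= D * enorm (x - y).
Hypothesis sC : forall x, opnorm (sigma x) <= C.
Hypothesis sD : forall x y, opnorm (sigma x - sigma y) <= D * enorm (x - y).
Implicit Types (s t u : R) (x y v : 'cV[R]_m) (w : 'cV[R]_d).
Local Notation jump_data := (R * ('cV[R]_d * 'cV[R]_m))%type.
Local Notation times l := [seq p.1 | p <- l : seq jump_data].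
Local Notation jump := (jump sigma b).
Local Notation jpath := (jpath a sigma b).

Lemma enorm_sigma x w : enorm (sigma x *m w) <= C * enorm w.
Proof. by rewrite (le_trans (enorm_mulmx _ _))// ler_wpM2r ?enorm_ge0. Qed.

Lemma enorm_sigmaB x y w w' :
  enorm (sigma x *m w - sigma y *m w') <=
  D * enorm w * enorm (x - y) + C * enorm (w - w').
Proof.
rewrite (_ : _ - _ = (sigma x - sigma y) *m w + sigma y *m (w - w')); last first.
  by rewrite mulmxBl mulmxBr addrA subrK.
rewrite (le_trans (enormD _ _))// lerD ?enorm_sigma//.
rewrite (le_trans (enorm_mulmx _ _))// mulrAC ler_wpM2r ?enorm_ge0//.
Qed.

Lemma jump_lip y y' w w' v v' :
  enorm (jump y w v - jump y' w' v') <=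
  (1 + D * enorm w) * (enorm (y - y') + enorm (v - v')) + C * enorm (w - w').
Proof.
set q := y + v; set q' := y' + v'.
have Hq : enorm (q - q') <= enorm (y - y') + enorm (v - v').
  by rewrite /q /q' opprD addrACA enormD.
have H1 := clip_lip (sigma q *m w) (sigma q' *m w') b0.
have H2 := enorm_sigmaB q q' w w'.
have H3 : enorm (jump y w v - jump y' w' v') <= enorm (q - q') +
    enorm (clip b (sigma q *m w) - clip b (sigma q' *m w')).
  by rewrite /jump -/q -/q' opprD addrACA enormD.
have : (1 + D * enorm w) * enorm (q - q') <=
    (1 + D * enorm w) * (enorm (y - y') + enorm (v - v')).
  by rewrite ler_wpM2l// addr_ge0// mulr_ge0// enorm_ge0.
by lra.
Qed.

(** Growth of a discrepancy over one flow segment and one jump, apart from the factor of the noise: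
    [expR D] comes from the flow, and [3 * C + 3] leaves room for the shifts in time, noise and
    perturbation. *)
Definition amp_const : R := (3 * C + 3) * expR D.

Lemma amp_const_ge1 : 1 <= amp_const.
Proof.
have := expR_ge1Dx D; rewrite /amp_const.
by have := C0; have := D0; move: (expR D) => e; nra.
Qed.

Definition amp (l : seq jump_data) : R :=
  \prod_(p <- l) (amp_const * (1 + D * enorm p.2.1)).

Lemma amp_ge1 l : 1 <= amp l.
Proof.
rewrite /amp; elim/big_ind : _ => // [x y x1 y1|p _].
  by rewrite (le_trans x1)// ler_peMr// (le_trans ler01).
have := amp_const_ge1; have : 0 <= D * enorm p.2.1 by rewrite mulr_ge0 ?enorm_ge0.
by move: (D * _) amp_const => e q e0 q1; nra.
Qed.

(** The evaluation times enter so that, at [t] and at [t'], both paths have performed the same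
    jumps. *)
Fixpoint jclose (om t t' : R) (l l' : seq jump_data) : Prop :=
  match l, l' with
  | [::], [::] => True
  | p :: l1, p' :: l1' =>
    [/\ `|p.1 - p'.1| <= om, enorm (p.2.1 - p'.2.1) <= om,
        enorm (p.2.2 - p'.2.2) <= om, (t < p.1) = (t' < p'.1) & jclose om t t' l1 l1']
  | _, _ => False
  end.

Lemma flow_close t t' y y' om : 0 <= t <= 1 -> 0 <= t' -> `|t - t'| <= 2 * om ->
  enorm (flow a t y - flow a t' y') <= expR D * enorm (y - y') + 2 * C * om.
Proof.
move=> /andP[t0 t1] t'0 tt'.
have H1 := flow_lip C0 D0 aC aD y y' t0.
have H2 := flow_cont C0 D0 aC aD y' t0 t'0.
have H3 := ler_wpM2l C0 tt'.
have H4 : expR (t * D) * enorm (y - y') <= expR D * enorm (y - y').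
  by rewrite ler_wpM2r ?enorm_ge0// ler_expR ler_piMl.
by have := enormBD (flow a t y') (flow a t y) (flow a t' y'); lra.
Qed.

Lemma jpath_close om t t' s s' y y' l l' :
  path <%R s (times l) -> path <%R s' (times l') ->
  all (fun u => u <= 1) (times l) -> 0 <= s <= t -> t <= 1 -> 0 <= s' <= t' ->
  0 <= om -> `|s - s'| <= om -> `|t - t'| <= om -> jclose om t t' l l' ->
  enorm (jpath s y l t - jpath s' y' l' t') <=
  amp_const * amp l * (enorm (y - y') + om).
Proof.
move=> + + + + t1 + om0 + tt'.
have E1 : 1 <= expR D by rewrite -[X in X <= _]expR0 ler_expR.
have base s0 s0' y0 y0' u u' c : 0 <= s0 <= u -> u <= 1 -> 0 <= s0' <= u' ->
    `|s0 - s0'| <= om -> `|u - u'| <= om -> 1 <= c ->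
    enorm (flow a (u - s0) y0 - flow a (u' - s0') y0') <=
    amp_const * c * (enorm (y0 - y0') + om).
  move=> su u1 su' ss' uu' c1.
  apply: le_trans (flow_close _ _ (om := om) _ _ _) _; [lra|lra| |].
    rewrite (_ : _ - _ = (u - u') - (s0 - s0')); last by ring.
    by rewrite (le_trans (ler_normB _ _))//; lra.
  have K1 : expR D * enorm (y0 - y0') + 2 * C * om <= amp_const * (enorm (y0 - y0') + om).
    have := enorm_ge0 (y0 - y0'); rewrite /amp_const.
    move: (expR D) (enorm _) E1 => e q e1 q0.
    have Cq : 0 <= C * e * q by rewrite !mulr_ge0// (le_trans ler01).
    have eq : 0 <= e * q by rewrite mulr_ge0// (le_trans ler01).
    have Co : C * om <= C * om * e by rewrite ler_peMr// mulr_ge0.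
    have eo : 0 <= e * om by rewrite mulr_ge0// (le_trans ler01).
    have Co' : 0 <= C * om by rewrite mulr_ge0.
    by lra.
  apply: (le_trans K1); rewrite ler_wpM2r ?addr_ge0 ?enorm_ge0// ler_peMr//.
  by rewrite (le_trans ler01)// amp_const_ge1.
elim: l l' s s' y y' => [|[u [w v]] l IH] [|[u' [w' v']] l'] s s' y y' //=.
  move=> _ _ _ st st' ss' _; apply: base => //; exact: amp_ge1.
move=> /andP[su pl] /andP[su' pl'] /andP[u1 l1] st st' ss' [uu' ww' vv' tE tl].
rewrite -tE; have [tu|ut] := ltP t u.
  by apply: base => //; exact: amp_ge1.
have ut' : u' <= t' by rewrite leNgt -tE -leNgt.
apply: (le_trans (IH _ u u' _ _ pl pl' l1 _ _ uu' tl)); [lra|lra|].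
have key : enorm (jump (flow a (u - s) y) w v - jump (flow a (u' - s') y') w' v') + om
    <= amp_const * (1 + D * enorm w) * (enorm (y - y') + om).
  have H1 := jump_lip (flow a (u - s) y) (flow a (u' - s') y') w w' v v'.
  have H2 : enorm (flow a (u - s) y - flow a (u' - s') y') <=
      expR D * enorm (y - y') + 2 * C * om.
    apply: flow_close; [lra|lra|].
    rewrite (_ : _ - _ = (u - u') - (s - s')); last by ring.
    by rewrite (le_trans (ler_normB _ _))//; lra.
  have Q1 : 1 <= 1 + D * enorm w by rewrite lerDl mulr_ge0 ?enorm_ge0.
  have H3 : (1 + D * enorm w) * (enorm (flow a (u - s) y - flow a (u' - s') y')
      + enorm (v - v')) <= (1 + D * enorm w) * (expR D * enorm (y - y') + (2 * C + 1) * om).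
    by rewrite ler_wpM2l ?(le_trans ler01)//; lra.
  have H4 := ler_wpM2l C0 ww'.
  have q0 := enorm_ge0 (y - y').
  have : (1 + D * enorm w) * (expR D * enorm (y - y') + (2 * C + 1) * om) + C * om + om
     <= amp_const * (1 + D * enorm w) * (enorm (y - y') + om).
    rewrite /amp_const; move: (enorm (y - y')) (1 + _) (expR D) q0 Q1 E1 => q p e q0 p1 e1.
    have e0 : 0 <= e by lra.
    have p0 : 0 <= p by lra.
    have A1 : 0 <= C * (e * p * q) by rewrite !mulr_ge0.
    have A2 : 0 <= e * p * q by rewrite !mulr_ge0.
    have A3 : om <= e * p * om.
      by rewrite ler_peMl// mulr_ege1.
    have A4 : p * om <= e * p * om by rewrite -mulrA ler_peMl// mulr_ge0.
    have A5 : C * om <= C * (e * p * om) by rewrite ler_wpM2l.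
    have A6 : C * (p * om) <= C * (e * p * om) by rewrite ler_wpM2l.
    by lra.
  by lra.
have AK : 0 <= amp_const * amp l.
  by rewrite mulr_ge0// (le_trans ler01) ?amp_const_ge1 ?amp_ge1.
apply: (le_trans (ler_wpM2l AK key)).
rewrite [amp (_ :: _)]/amp big_cons -/(amp l) /=.
by move: amp_const (amp l) => K A; rewrite le_eqVlt; apply/orP; left; apply/eqP; ring.
Qed.

End path_estimates.

Section euler_flow.
Context {R : realType} {m : nat}.
Variables (a : 'cV[R]_m -> 'cV[R]_m) (C D : R).
Hypothesis C0 : 0 <= C.
Hypothesis D0 : 0 <= D.
Hypothesis aC : forall x, enorm (a x) <= C.
Hypothesis aD : forall x y, enorm (a x - a y) <= D * enorm (x - y).

(* Comparing [X - S] rather than [X] with the flow makes the error depend on the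
   partial sums of the noise only, not on the sum of their norms. *)
Lemma noisy_euler_flow (eta eps : R) (X S : nat -> 'cV[R]_m) (n : nat) y :
  0 <= eta -> eta * n%:R <= 1 -> S 0%N = 0 ->
  (forall i, (i < n)%N -> X i.+1 = X i + eta *: a (X i) + (S i.+1 - S i)) ->
  (forall i, (i <= n)%N -> enorm (S i) <= eps) ->
  enorm (X n - flow a (eta * n%:R) y) <=
  expR D * (enorm (X 0%N - y) + D * eps + D * C * eta) + eps.
Proof.
move=> eta0 etan S0 XS Seps.
have eps0 : 0 <= eps by have := Seps 0%N (leq0n _); rewrite S0 enorm0.
pose U i := X i - S i.
have DC : 0 <= D * C by rewrite mulr_ge0.
suff H i : (i <= n)%N -> enorm (U i - flow a (eta * i%:R) y) <=
    expR (eta * i%:R * D) *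
    (enorm (X 0%N - y) + eta * i%:R * (D * eps + D * C * eta)).
  have := H n (leqnn n) => {}H.
  have : expR (eta * n%:R * D) * (enorm (X 0%N - y) + eta * n%:R * (D * eps + D * C * eta))
      <= expR D * (enorm (X 0%N - y) + D * eps + D * C * eta).
    apply: ler_pM; rewrite ?expR_ge0//.
    - by rewrite addr_ge0 ?enorm_ge0// mulr_ge0 ?addr_ge0 ?mulr_ge0.
    - by rewrite ler_expR ler_piMl.
    by rewrite -addrA lerD2l ler_piMl// addr_ge0 ?mulr_ge0.
  have := Seps n (leqnn n); have := enormD (U n - flow a (eta * n%:R) y) (S n).
  by rewrite /U addrAC subrK; lra.
elim: i => [_|i IH iltn].
  by rewrite !mulr0 !mul0r expR0 mul1r addr0 (flow0 C0 D0 aC aD) /U S0 subr0.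
have {}IH := IH (ltnW iltn).
have step : enorm (U i.+1 - flow a eta (U i)) <= eta * (D * eps + D * C * eta).
  have -> : U i.+1 - flow a eta (U i) =
      eta *: (a (X i) - a (U i)) - (flow a eta (U i) - (U i + eta *: a (U i))).
    by rewrite /U XS//; apply/matrixP => p q; rewrite !mxE; ring.
  have H1 : enorm (eta *: (a (X i) - a (U i))) <= eta * (D * eps).
    rewrite enormZ ger0_norm// ler_wpM2l// (le_trans (aD _ _))// ler_wpM2l//.
    by rewrite /U opprB addrCA subrr addr0 Seps// ltnW.
  have H2 := flow_step C0 D0 aC aD (U i) eta0.
  have := enormD (eta *: (a (X i) - a (U i))) (- (flow a eta (U i) - (U i + eta *: a (U i)))).
  by rewrite enormN expr2 in H2 *; lra.
have ein : 0 <= eta * i%:R by rewrite mulr_ge0.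
have E : eta * i.+1%:R = eta * i%:R + eta by rewrite -natr1; ring.
have H3 := flow_lip C0 D0 aC aD (U i) (flow a (eta * i%:R) y) eta0.
rewrite -(flowD C0 D0 aC aD)// -E in H3.
have H4 := ler_wpM2l (expR_ge0 (eta * D)) IH.
rewrite mulrA -expRD -mulrDl [eta + _]addrC -E in H4.
have H5 : eta * (D * eps + D * C * eta) <=
    expR (eta * i.+1%:R * D) * (eta * (D * eps + D * C * eta)).
  rewrite ler_peMl//; first by rewrite mulr_ge0// addr_ge0 ?mulr_ge0.
  by rewrite -[X in X <= _]expR0 ler_expR !mulr_ge0.
have := enormBD (flow a eta (U i)) (U i.+1) (flow a (eta * i.+1%:R) y).
rewrite [in X in _ -> _ <= _ * (_ + X * _)]E.
by move: (expR (eta * i.+1%:R * D)) H4 H5 => q H4 H5; lra.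
Qed.

End euler_flow.

Section path_estimates2.
Context {R : realType} {m d : nat}.
Variables (a : 'cV[R]_m -> 'cV[R]_m) (sigma : 'cV[R]_m -> 'M[R]_(m, d)).
Variable b : \bar R.
Variables (C D : R).
Hypothesis b0 : (0 < b)%E.
Hypothesis C0 : 0 <= C.
Hypothesis D0 : 0 <= D.
Hypothesis aC : forall x, enorm (a x) <= C.
Hypothesis aD : forall x y, enorm (a x - a y) <= D * enorm (x - y).
Hypothesis sC : forall x, opnorm (sigma x) <= C.
Hypothesis sD : forall x y, opnorm (sigma x - sigma y) <= D * enorm (x - y).
Implicit Types (s t u : R) (x y v : 'cV[R]_m) (w : 'cV[R]_d).
Local Notation jump_data := (R * ('cV[R]_d * 'cV[R]_m))%type.
Local Notation times l := [seq p.1 | p <- l : seq jump_data].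
Local Notation jump := (jump sigma b).
Local Notation jpath := (jpath a sigma b).

Lemma J1_dist_sup (xi zeta : skorokhod R m) e :
  (forall u, u \in `[0, 1] -> enorm (xi u - zeta u) <= e) -> J1_dist xi zeta <= e.
Proof.
move=> H; apply: ge_inf; first by case: (J1_bounds_has_inf xi zeta).
exists id; first exact: time_change_id.
move=> t t01; split; last exact: H.
rewrite subrr normr0 (le_trans _ (H 0 _)) ?enorm_ge0//.
by rewrite in_itv/= lexx ler01.
Qed.

Lemma jdata_of_seq k (l : seq jump_data) : size l = k ->
  exists (W : k.-tuple 'cV[R]_d) (V : k.-tuple 'cV[R]_m) (t : k.-tuple R), jdata W V t = l.
Proof.
move=> lk.
have sW : size [seq p.2.1 | p <- l] == k by rewrite size_map lk.
have sV : size [seq p.2.2 | p <- l] == k by rewrite size_map lk.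
have st : size [seq p.1 | p <- l] == k by rewrite size_map lk.
exists (Tuple sW), (Tuple sV), (Tuple st); rewrite /jdata /=.
by elim: l {lk sW sV st} => //= -[t [w v]] l ->.
Qed.

Lemma perturbed_paths_jpath k l x eps : size l = k -> sorted <%R (times l) ->
  (forall u, u \in times l -> 0 < u <= 1) ->
  (forall p, p \in l -> enorm p.2.2 <= eps) ->
  exists2 xi, perturbed_paths a sigma b [set x] k eps xi &
    forall u, u \in `[0, 1] -> xi u = jpath 0 x l u.
Proof.
move=> lk sl tl vl; have [W [V [t tE]]] := jdata_of_seq lk.
have tE' : tval t = times l by rewrite -tE times_jdata.
have ti : increasing_tuples `]0, 1]%classic k t.
  split=> [|s st]; first by rewrite tE'.
  by rewrite /= in_itv/=; apply: tl; rewrite -tE'.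
exists (hbar a sigma b x W V t); last first.
  by move=> u u01; rewrite (hbarE sigma b D0 aD C0 aC x W V ti u01) tE.
exists x, W, V, t; split=> // j.
by have := vl _; rewrite -tE => /(_ _ (jdata_mem W V t j)).
Qed.

(** The displacement caused by a small noise is transported by the flow to the next jump and put
    into the perturbation there. The argument of that jump is unchanged, so the two paths coincide
    afterwards. *)
Lemma jpath_drop1 s y t1 w l e : 0 <= s -> enorm w <= e ->
  path <%R s (t1 :: times l) -> all (fun u => u <= 1) (t1 :: times l) ->
  exists l', [/\ size l' = size l, times l' = times l,
    (forall v, (forall p, p \in l -> p.2.2 = v) -> v = 0 ->
      forall p, p \in l' -> enorm p.2.2 <= expR D * (C * e)) &
    forall t, s <= t <= 1 ->
    enorm (jpath s y ((t1, (w, 0)) :: l) t - jpath s y l' t) <= expR D * (C * e)].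
Proof.
move=> s0 we /= /andP[st1 pl] /andP[t11 l1].
have e0 : 0 <= e by rewrite (le_trans _ we) ?enorm_ge0.
have E1 : 1 <= expR D by rewrite -[X in X <= _]expR0 ler_expR.
have B0 : 0 <= expR D * (C * e) by rewrite !mulr_ge0 ?expR_ge0.
pose z := flow a (t1 - s) y; pose z' := jump z w 0.
have zz' : enorm (z' - z) <= C * e.
  rewrite /z' /jump addr0 addrAC subrr add0r (le_trans (enorm_clip_le _ (ltW b0)))//.
  by rewrite (le_trans (enorm_sigma sC _ _))// ler_wpM2l.
have zfl t : t1 <= t <= 1 ->
    enorm (flow a (t - t1) z' - flow a (t - s) y) <= expR D * (C * e).
  move=> tt; have -> : flow a (t - s) y = flow a (t - t1) z.
    by rewrite -(flowD C0 D0 aC aD) ?subr_ge0 ?(ltW st1)//; [congr flow; ring|lra].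
  have t0 : 0 <= t - t1 by lra.
  rewrite (le_trans (flow_lip C0 D0 aC aD _ _ t0))//.
  by apply: ler_pM; rewrite ?expR_ge0 ?enorm_ge0// ler_expR ler_piMl//; lra.
case: l pl l1 => [_ _|[t2 [w2 v2]] l /= /andP[t12 pl] /andP[t21 l1]].
  exists [::]; split => //= t st; have [tt1|t1t] := ltP t t1.
    by rewrite subrr enorm0.
  by apply: zfl; lra.
exists ((t2, (w2, v2 + (flow a (t2 - t1) z' - flow a (t2 - s) y))) :: l).
split; [by []|by []| |].
  move=> v vl v0 p; rewrite inE => /predU1P[->|pl'] /=; last first.
    by rewrite (vl p) ?v0 ?enorm0// inE pl' orbT.
  by have := vl _ (mem_head _ _); rewrite /= v0 => ->; rewrite add0r; apply: zfl; lra.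
move=> t st /=; have [tt1|t1t] := ltP t t1.
  by rewrite ifT ?subrr ?enorm0// (lt_trans tt1).
have [tt2|t2t] := ltP t t2; first by apply: zfl; lra.
rewrite -/z -/z'; set q := jump _ w2 v2; set q' := jump _ w2 _.
have -> : q' = q.
  by rewrite /q /q' /jump; have -> : forall f g v : 'cV[R]_m, g + (v + (f - g)) = f + v
    by move=> f g v; apply/matrixP => i j; rewrite !mxE; ring.
by rewrite subrr enorm0.
Qed.

(** Consequently a path one of whose jumps has a small noise lies near a perturbed path with one
    jump fewer, that is, in the region where test functions vanish. *)
Lemma jpath_drop x l1 t1 w l2 e : enorm w <= e ->
  path <%R 0 (times (l1 ++ (t1, (w, 0)) :: l2)) ->
  all (fun u => u <= 1) (times (l1 ++ (t1, (w, 0)) :: l2)) ->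
  (forall p, p \in l1 ++ l2 -> p.2.2 = 0) ->
  exists l', [/\ size l' = size (l1 ++ l2), path <%R 0 (times l'),
    (forall u, u \in times l' -> 0 < u <= 1),
    (forall p, p \in l' -> enorm p.2.2 <= expR D * (C * e)) &
    forall t, 0 <= t <= 1 ->
    enorm (jpath 0 x (l1 ++ (t1, (w, 0)) :: l2) t - jpath 0 x l' t)
      <= expR D * (C * e)].
Proof.
move=> we; have e0 : 0 <= e by rewrite (le_trans _ we) ?enorm_ge0.
have B0 : 0 <= expR D * (C * e) by rewrite !mulr_ge0 ?expR_ge0.
have gen : forall s y, 0 <= s ->
  path <%R s (times (l1 ++ (t1, (w, 0)) :: l2)) ->
  all (fun u => u <= 1) (times (l1 ++ (t1, (w, 0)) :: l2)) ->
  (forall p, p \in l1 ++ l2 -> p.2.2 = 0) ->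
  exists l', [/\ size l' = size (l1 ++ l2), times l' = times (l1 ++ l2),
    (forall p, p \in l' -> enorm p.2.2 <= expR D * (C * e)) &
    forall t, s <= t <= 1 ->
    enorm (jpath s y (l1 ++ (t1, (w, 0)) :: l2) t - jpath s y l' t)
      <= expR D * (C * e)].
  elim: l1 => [|[u [wu vu]] l1 IH] s y s0 pl al vl.
    have [l' [h1 h2 h3 h4]] := @jpath_drop1 s y t1 w l2 e s0 we pl al.
    by exists l'; split => //; exact: (h3 0 vl).
  move: pl al => /= /andP[su pl] /andP[u1 al].
  have [||l' [h1 h2 h3 h4]] := IH u (jump (flow a (u - s) y) wu vu) _ pl al.
  - by rewrite (le_trans s0)// ltW.
  - by move=> p pl'; apply: vl; rewrite inE pl' orbT.
  exists ((u, (wu, vu)) :: l'); split => //=; [by rewrite h1|by rewrite h2| |].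
    move=> p; rewrite inE => /predU1P[->/=|/h3//].
    by have := vl _ (mem_head _ _); rewrite /= => ->; rewrite enorm0.
  move=> t st; have [tu|ut] := ltP t u; first by rewrite subrr enorm0.
  by apply: h4; lra.
move=> pl al vl; have [l' [h1 h2 h3 h4]] := gen 0 x (lexx _) pl al vl.
have sub : subseq (times (l1 ++ l2)) (times (l1 ++ (t1, (w, 0)) :: l2)).
  by rewrite !map_cat/= cat_subseq// subseq_cons.
have pl' : path <%R 0 (times l') by rewrite h2; exact: subseq_path lt_trans _ _ _ sub pl.
exists l'; split => // u ul.
have := order_path_min lt_trans pl' => /allP/(_ _ ul) -> /=.
by move/allP : al; apply; apply: (mem_subseq sub); rewrite -h2.
Qed.

End path_estimates2.

(** * Shadowing of the discrete path by a jump path *)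

Section discrete_shadow.
Context {R : realType} {m d : nat}.
Variables (a : 'cV[R]_m -> 'cV[R]_m) (sigma : 'cV[R]_m -> 'M[R]_(m, d)).
Variable b : \bar R.
Variables (C D : R).
Hypothesis b0 : (0 < b)%E.
Hypothesis C0 : 0 <= C.
Hypothesis D0 : 0 <= D.
Hypothesis aC : forall x, enorm (a x) <= C.
Hypothesis aD : forall x y, enorm (a x - a y) <= D * enorm (x - y).
Hypothesis sC : forall x, opnorm (sigma x) <= C.
Hypothesis sD : forall x y, opnorm (sigma x - sigma y) <= D * enorm (x - y).
Local Notation jump_data := (R * ('cV[R]_d * 'cV[R]_m))%type.
Local Notation times l := [seq p.1 | p <- l : seq jump_data].
Variables (eta eps : R) (x0 : 'cV[R]_m) (z : nat -> 'cV[R]_d).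
Hypothesis eta0 : 0 < eta.
Local Notation X := (X_iter a sigma eta b x0 z).
Local Notation n := (Num.truncn eta^-1).

Definition step_noise j := (eta *: sigma (X j)) *m z j.+1.

(** Steps are numbered from 1: the increment that leads from [X j] to [X j.+1] uses [z j.+1], whence
    the successor in the condition. *)
Definition off_noise (J : seq nat) i := \sum_(0 <= j < i | j.+1 \notin J) step_noise j.

Variable J0 : seq nat.
Hypothesis noise_le : forall i, (i <= n)%N -> enorm (off_noise J0 i) <= eps.
Hypothesis noclip : forall i, (i < n)%N -> i.+1 \notin J0 ->
  clip b (eta *: a (X i) + step_noise i) = eta *: a (X i) + step_noise i.

Lemma eta_steps i : (i <= n)%N -> eta * i%:R <= 1.
Proof.
move=> ni; rewrite mulrC -ler_pdivlMr// mul1r (le_trans (_ : _ <= n%:R))//.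
  by rewrite ler_nat.
by rewrite truncn_le// invr_ge0 ltW.
Qed.

(** Restarting at step [p] replaces the partial sums of the noise by differences of two of them,
    whence [2 * eps]. *)
Lemma segment_close p i y : (p <= i <= n)%N ->
  (forall j, (p < j <= i)%N -> j \notin J0) ->
  enorm (X i - flow a (eta * (i - p)%:R) y) <=
  expR D * (enorm (X p - y) + D * (2 * eps) + D * C * eta) + 2 * eps.
Proof.
move=> /andP[pi ni] pJ.
pose S r := off_noise J0 (p + r)%N - off_noise J0 p.
have := @noisy_euler_flow R m a C D C0 D0 aC aD eta (2 * eps)
  (fun r => X (p + r)%N) S (i - p)%N y (ltW eta0).
rewrite /= subnKC// addn0; apply.
- by apply: eta_steps; rewrite (leq_trans (leq_subr _ _)).
- by rewrite /S addn0 subrr.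
- move=> r rip; rewrite addnS /= -/(step_noise (p + r)).
  have prn : (p + r < n)%N by rewrite (leq_trans _ ni)// -ltn_subRL.
  have prJ : (p + r).+1 \notin J0.
    by apply: pJ; rewrite ltnS leq_addr/= -ltn_subRL.
  rewrite noclip// -addrA; congr (_ + (_ + _)); rewrite /S addnS.
  rewrite /off_noise [in RHS]big_mkcond/= big_nat_recr//= -big_mkcond/= prJ.
  by rewrite opprB addrA subrK addrAC subrr add0r.
- move=> r rip; rewrite /S (le_trans (enormD _ _))// enormN mulr2n mulrDl mul1r.
  by rewrite lerD// noise_le// -?(subnKC pi) ?leq_add2l// (leq_trans _ ni)// -leq_subRL.
Qed.

(** Inside the exponential factor stand the initial mismatch [C * eta], the effect of the noise on
    the drift and the Euler error. Outside stand the noise itself and the drift over an incomplete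
    step. *)
Definition shadow_err : R :=
  expR D * (C * eta + D * (2 * eps) + D * C * eta) + 2 * eps + C * eta.

Lemma shadow_err_ge0 : 0 <= shadow_err.
Proof.
have e0 : 0 <= eps by rewrite (le_trans _ (noise_le (leq0n _))) ?enorm_ge0.
have n0 := ltW eta0; rewrite /shadow_err !addr_ge0// ?mulr_ge0 ?expR_ge0//.
by rewrite !addr_ge0// !mulr_ge0.
Qed.

Lemma segment_close_time p y t : (p <= n)%N -> eta * p%:R <= t <= 1 ->
  (forall j, (p < j)%N -> eta * j%:R <= t -> j \notin J0) ->
  enorm (X p - y) <= C * eta ->
  enorm (X (Num.truncn (t / eta)) - flow a (t - eta * p%:R) y) <= shadow_err.
Proof.
move=> pn /andP[pt t1] pJ Xp; set i := Num.truncn (t / eta).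
have t0 : 0 <= t by rewrite (le_trans _ pt)// mulr_ge0// ltW.
have /andP[i1 i2] : i%:R <= t / eta < i.+1%:R by apply: truncn_itv; rewrite divr_ge0// ltW.
rewrite ler_pdivlMr// mulrC in i1; rewrite ltr_pdivrMr// mulrC in i2.
have pi : (p <= i)%N.
  by rewrite -ltnS -(ltr_nat R) -(ltr_pM2l eta0) (le_lt_trans pt).
have ni : (i <= n)%N.
  have i3 : i%:R <= eta^-1.
    by rewrite -[leRHS]mul1r ler_pdivlMr// mulrC (le_trans i1).
  have e0 : 0 <= eta^-1 by rewrite invr_ge0 ltW.
  by rewrite truncn_ge_nat.
have H1 : enorm (X i - flow a (eta * (i - p)%:R) y) <=
    expR D * (enorm (X p - y) + D * (2 * eps) + D * C * eta) + 2 * eps.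
  apply: segment_close; rewrite ?pi// => j /andP[pj ji]; apply: pJ => //.
  by rewrite (le_trans _ i1)// ler_pM2l// ler_nat.
have E : eta * (i - p)%:R = eta * i%:R - eta * p%:R by rewrite natrB// mulrBr.
have H2 : enorm (flow a (eta * (i - p)%:R) y - flow a (t - eta * p%:R) y) <= C * eta.
  apply: (le_trans (flow_cont C0 D0 aC aD _ _ _)); rewrite ?subr_ge0//.
    by rewrite mulr_ge0// ltW.
  rewrite ler_wpM2l// E distrC ger0_norm; last by rewrite opprB addrA subrK subr_ge0.
  by move: i2; rewrite -natr1 mulrDr mulr1; lra.
have := enormBD (flow a (eta * (i - p)%:R) y) (X i) (flow a (t - eta * p%:R) y).
have : expR D * (enorm (X p - y) + D * (2 * eps) + D * C * eta) <=
  expR D * (C * eta + D * (2 * eps) + D * C * eta).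
  by rewrite ler_pM2l ?expR_gt0// -!addrA lerD2r.
by rewrite /shadow_err; lra.
Qed.

Definition step_data (J : seq nat) (V : seq 'cV[R]_m) : seq jump_data :=
  zip [seq eta * i%:R | i <- J] (zip [seq eta *: z i | i <- J] V).

(* The perturbation at a jump is chosen so as to restart exactly from the discrete
   path, so that no Lipschitz bound on the jump is needed. *)
Lemma shadow (J : seq nat) p y : path ltn p J -> all (fun i => i <= n)%N J ->
  (p <= n)%N -> (forall j, (p < j)%N -> (j \in J0) = (j \in J)) ->
  enorm (X p - y) <= C * eta ->
  exists V, [/\ size V = size J, (forall v, v \in V -> enorm v <= shadow_err) &
    forall t, eta * p%:R <= t <= 1 ->
      enorm (X (Num.truncn (t / eta)) -
             jpath a sigma b (eta * p%:R) y (step_data J V) t) <= shadow_err].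
Proof.
elim: J p y => [|q J IH] p y.
  move=> _ _ pn pJ Xp; exists [::]; split => // t pt.
  by apply: segment_close_time => // j pj _; rewrite pJ.
move=> /= /andP[pq pJ] /andP[qn nJ] pn pJ0 Xp.
have q0 : (0 < q)%N by exact: leq_ltn_trans pq.
pose y1 := flow a (eta * q%:R - eta * p%:R) y.
(* The flow is taken up to the jump time [eta * q], but the discrete jump starts from step [q.-1];
   the drift over this last step is part of [shadow_err]. *)
pose v := X q.-1 - y1.
have pq' : (p <= q.-1)%N by rewrite -ltnS prednK.
have qn' : (q.-1 <= n)%N by rewrite (leq_trans _ qn)// leq_pred.
have notJ j : (p < j < q)%N -> j \notin J0.
  move=> /andP[pj jq]; rewrite pJ0// inE negb_or ltn_eqF//=.
  apply/negP => jJ; have := order_path_min ltn_trans pJ => /allP/(_ _ jJ).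
  by rewrite ltnNge ltnW.
have vle : enorm v <= shadow_err.
  have H1 : enorm (X q.-1 - flow a (eta * (q.-1 - p)%:R) y) <=
      expR D * (enorm (X p - y) + D * (2 * eps) + D * C * eta) + 2 * eps.
    apply: segment_close; rewrite ?pq'// => j /andP[pj jq]; apply: notJ.
    by rewrite pj/= (leq_ltn_trans jq)// ltn_predL.
  have E : eta * q%:R - eta * p%:R = eta * (q.-1 - p)%:R + eta.
    by rewrite natrB// -[in LHS](prednK q0) -natr1; ring.
  have H2 : enorm (flow a (eta * (q.-1 - p)%:R) y - y1) <= C * eta.
    have e1 : 0 <= eta * (q.-1 - p)%:R by rewrite mulr_ge0// ltW.
    rewrite /y1 E (le_trans (flow_cont C0 D0 aC aD _ e1 _))//.
      by rewrite addr_ge0// ltW.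
    by rewrite distrC addrAC subrr add0r gtr0_norm.
  have := enormBD (flow a (eta * (q.-1 - p)%:R) y) (X q.-1) y1.
  have : expR D * (enorm (X p - y) + D * (2 * eps) + D * C * eta) <=
    expR D * (C * eta + D * (2 * eps) + D * C * eta).
    by rewrite ler_pM2l ?expR_gt0// -!addrA lerD2r.
  by rewrite /shadow_err /v; lra.
(* The discrete step has its drift inside [clip] and the jump has none; since [clip] is nonexpansive
   the difference is at most [C * eta], the mismatch allowed at a restart. *)
have Xq : enorm (X q - jump sigma b y1 (eta *: z q) v) <= C * eta.
  have Xq' : forall r, (0 < r)%N -> X r = X r.-1 +
    clip b (eta *: a (X r.-1) + (eta *: sigma (X r.-1)) *m z r) by case.
  have yv : y1 + v = X q.-1 by rewrite /v addrC subrK.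
  rewrite /jump yv (Xq' q q0).
  rewrite opprD addrACA subrr add0r (le_trans (clip_lip _ _ b0))//.
  by rewrite -scalemxAl scalemxAr addrK enormZ gtr0_norm// mulrC ler_wpM2r// ltW.
have [|V [V1 V2 V3]] := IH q (jump sigma b y1 (eta *: z q) v) pJ nJ qn _ Xq.
  move=> j qj; rewrite pJ0 ?(ltn_trans pq)// inE gtn_eqF//.
exists (v :: V); split => /=; first by rewrite V1.
  by move=> v'; rewrite inE => /predU1P[->//|]; exact: V2.
move=> t /andP[pt t1]; have [tq|qt] := ltP t (eta * q%:R).
  apply: segment_close_time; rewrite ?pt// => j pj jt; apply: notJ; rewrite pj/=.
  by rewrite -(ltr_nat R) -(ltr_pM2l eta0) (le_lt_trans jt).
by apply: V3; rewrite qt.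
Qed.

End discrete_shadow.

(** * Time changes and continuity in the J1 metric *)

Section tent_time_change.
Context {R : realType} {k : nat}.
Implicit Types (t : k.-tuple R) (u : R).

Definition tent u : R := Num.max 0 (1 - `|u|).

Lemma tent_lip u v : `|tent u - tent v| <= `|u - v|.
Proof.
wlog uv : u v / `|u| <= `|v|.
  move=> H; have [/H//|/ltW/H] := leP `|u| `|v|.
  by rewrite distrC [leRHS]distrC.
have H : `|v| - `|u| <= `|u - v|.
  by rewrite distrC (le_trans (ler_norm _))// ler_dist_dist.
rewrite /tent; have [h1|h1] := ltP 0 (1 - `|u|); have [h2|h2] := ltP 0 (1 - `|v|);
  rewrite ?subr0 ?subrr ?normr0//.
- by rewrite ger0_norm; lra.
- by rewrite ger0_norm; lra.
- by lra.
Qed.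

(** Identity plus a hat of half-width [kappa] at each [tnth t j]. If the times are at distance at
    least [kappa] from each other and from 0 and 1, only one hat is nonzero at each of them and none
    at the two ends. *)
Definition tshift (kappa : R) t t' u : R :=
  u + \sum_(j < k) (tnth t' j - tnth t j) * tent ((u - tnth t j) / kappa).

Lemma tent_gap t : increasing_tuples `]0, 1[%classic k t ->
  exists2 kappa : R, 0 < kappa & forall i, kappa <= tnth t i <= 1 - kappa /\
    forall j, i != j -> kappa <= `|tnth t i - tnth t j|.
Proof.
move=> [st Ht]; have t01 i : 0 < tnth t i < 1.
  by have := Ht _ (mem_tnth i t); rewrite /= in_itv.
have tu : uniq t by apply: lt_sorted_uniq.
(* Diagonal entries measure the distance to the ends of [[0, 1]], the others the mutual distances;
   the default 1 covers [k = 0]. *)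
pose F (p : 'I_k * 'I_k) : R := if p.1 == p.2
  then Num.min (tnth t p.1) (1 - tnth t p.1) else `|tnth t p.1 - tnth t p.2|.
exists (\big[Num.min/1]_p F p).
  apply: contraPT (ltr01 : 0 < 1 :> R); rewrite -leNgt => /bigmin_leP[|[[i j] _]].
    by rewrite leNgt ltr01.
  rewrite /F /=; have := t01 i; case: eqP => [_ ti|/eqP ij ti].
    by rewrite ge_min; lra.
  rewrite normr_le0 subr_eq0 => /eqP/(tuple_uniqP _ tu) ijE.
  by rewrite ijE eqxx in ij.
move=> i; split.
  have : \big[Num.min/1]_p F p <= F (i, i) by exact: bigmin_le.
  by rewrite {2}/F eqxx /= le_min; lra.
move=> j ij; have : \big[Num.min/1]_p F p <= F (i, j) by exact: bigmin_le.
by rewrite {2}/F (negbTE ij).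
Qed.

Lemma tshift_time_change kappa t t' de :
  0 < kappa -> (forall i, kappa <= tnth t i <= 1 - kappa /\
    forall j, i != j -> kappa <= `|tnth t i - tnth t j|) ->
  (forall j, `|tnth t' j - tnth t j| <= de) -> k%:R * de < kappa ->
  [/\ time_change (tshift kappa t t'),
      forall u, `|tshift kappa t t' u - u| <= k%:R * de,
      {homo tshift kappa t t' : u v / u < v} &
      forall j, tshift kappa t t' (tnth t j) = tnth t' j].
Proof.
move=> kap0 gap tt' kde.
have tent0 u : 1 <= `|u| -> tent u = 0.
  by move=> u1; rewrite /tent max_l// subr_le0.
have tent01 u : 0 <= tent u <= 1.
  by rewrite /tent le_max lexx/= ge_max ler01 lerBlDr lerDl normr_ge0.
have clo u : `|tshift kappa t t' u - u| <= k%:R * de.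
  rewrite /tshift addrC addKr (le_trans (ler_norm_sum _ _ _))//.
  rewrite mulr_natl -[X in _ *+ X]card_ord -sumr_const ler_sum// => j _.
  rewrite normrM; have /andP[e0 e1] := tent01 ((u - tnth t j) / kappa).
  by rewrite (ger0_norm e0) (le_trans _ (tt' j))// ler_piMr.
(* The sum of hats has Lipschitz constant at most [k * de / kappa], which is below 1; hence the
   shifted identity is strictly increasing. *)
have lip u v : u < v ->
    `|tshift kappa t t' v - tshift kappa t t' u - (v - u)| < v - u.
  move=> uv; rewrite /tshift opprD addrACA -sumrB [v - u + _ - _]addrAC subrr add0r.
  apply: (@le_lt_trans _ _ (\sum_(j < k) de * ((v - u) / kappa))).
    rewrite (le_trans (ler_norm_sum _ _ _))// ler_sum// => j _.
    rewrite -mulrBr normrM ler_pM// (le_trans (tent_lip _ _))//.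
    rewrite -mulrBl opprB addrA subrK normrM [X in X * _]gtr0_norm ?subr_gt0//.
    by rewrite normfV gtr0_norm.
  rewrite sumr_const card_ord -[_ *+ _]mulr_natl mulrA mulrA.
  by rewrite ltr_pdivrMr// [ltRHS]mulrC ltr_pM2r// subr_gt0//.
have hom : {homo tshift kappa t t' : u v / u < v}.
  by move=> u v /lip; rewrite ltr_norml; lra.
have tj j : tshift kappa t t' (tnth t j) = tnth t' j.
  rewrite /tshift (bigD1 j)//= subrr mul0r {1}/tent normr0 subr0 max_r//.
  rewrite mulr1 big1 ?addr0 ?subrKC// => i ij.
  rewrite tent0 ?mulr0// normrM normfV (gtr0_norm kap0) ler_pdivlMr// mul1r.
  by have [_ ->] := gap j; rewrite // eq_sym.
have l0 : tshift kappa t t' 0 = 0.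
  rewrite /tshift big1 ?addr0// => i _; rewrite tent0 ?mulr0//.
  rewrite sub0r normrM normrN normfV (gtr0_norm kap0) ler_pdivlMr// mul1r.
  by have [+ _] := gap i; have := ler_norm (tnth t i); lra.
have l1 : tshift kappa t t' 1 = 1.
  rewrite /tshift big1 ?addr0// => i _; rewrite tent0 ?mulr0//.
  rewrite normrM normfV (gtr0_norm kap0) ler_pdivlMr// mul1r.
  by have [+ _] := gap i; have := ler_norm (1 - tnth t i); lra.
have lip2 u v : `|tshift kappa t t' u - tshift kappa t t' v| <= 2 * `|u - v|.
  wlog uv : u v / u < v.
    move=> H; have [/H//|/H H'|->] := ltgtP u v; last by rewrite !subrr normr0 mulr0.
    by rewrite distrC (distrC u).
  rewrite distrC (distrC u) (gtr0_norm (_ : 0 < v - u)) ?subr_gt0//.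
  by rewrite gtr0_norm ?subr_gt0 ?hom//; have := lip _ _ uv; rewrite ltr_norml; lra.
have cont : continuous (tshift kappa t t').
  move=> u; apply/(@cvgrPdist_lt _ _ _ (nbhs u)) => e e0.
  apply/nbhs_ballP; exists (e / 2) => /=; first by rewrite divr_gt0.
  by move=> v; rewrite -ball_normE/=; have := lip2 u v; lra.
have hom' : {mono tshift kappa t t' : u v / u <= v} by exact: le_mono.
split => //; apply: time_change_of_surj; first by move=> u v _ _; exact: hom.
apply/seteqP; split => [_ [u /= u01 <-]|u /= u01].
  by move: u01; rewrite !in_itv/= -(hom' 0 u) -(hom' u 1) l0 l1.
have [] := @IVT R (tshift kappa t t') 0 1 u ler01.
- by apply: continuous_subspaceT.
- by rewrite l0 l1 min_l// max_r//; move: u01; rewrite in_itv.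
by move=> c c01 <-; exists c.
Qed.

End tent_time_change.

Section hbar_continuity.
Context {R : realType} {m d : nat}.
Variables (a : 'cV[R]_m -> 'cV[R]_m) (sigma : 'cV[R]_m -> 'M[R]_(m, d)).
Variable b : \bar R.
Variables (C D : R).
Hypothesis b0 : (0 < b)%E.
Hypothesis C0 : 0 <= C.
Hypothesis D0 : 0 <= D.
Hypothesis aC : forall x, enorm (a x) <= C.
Hypothesis aD : forall x y, enorm (a x - a y) <= D * enorm (x - y).
Hypothesis sC : forall x, opnorm (sigma x) <= C.
Hypothesis sD : forall x y, opnorm (sigma x - sigma y) <= D * enorm (x - y).

Lemma increasing_tuples_oc k (t : k.-tuple R) :
  increasing_tuples `]0, 1[%classic k t -> increasing_tuples `]0, 1]%classic k t.
Proof.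
move=> [st Ht]; split => // s /Ht; rewrite /= !in_itv/= => /andP[-> /ltW ->] //.
Qed.

Lemma jclose_jdata k om u u' (W W' : k.-tuple 'cV[R]_d) (V V' : k.-tuple 'cV[R]_m)
    (t t' : k.-tuple R) :
  (forall j, [/\ `|tnth t j - tnth t' j| <= om,
     enorm (tnth W j - tnth W' j) <= om, enorm (tnth V j - tnth V' j) <= om &
     (u < tnth t j) = (u' < tnth t' j)]) ->
  jclose om u u' (jdata W V t) (jdata W' V' t').
Proof.
elim: k W W' V V' t t' => [|k IH] W W' V V' t t' H.
  by rewrite (tuple0 W) (tuple0 W') (tuple0 V) (tuple0 V') (tuple0 t) (tuple0 t').
have H0 := H ord0.
rewrite (tuple_eta W) (tuple_eta W') (tuple_eta V) (tuple_eta V') (tuple_eta t) (tuple_eta t').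
rewrite /jdata /=; case: H0 => h1 h2 h3 h4; split => //.
apply: (IH [tuple of behead W] [tuple of behead W'] [tuple of behead V]
  [tuple of behead V'] [tuple of behead t] [tuple of behead t']) => j.
by have := H (lift ord0 j); rewrite !(tnth_nth 0) /= !nth_behead.
Qed.

(** The time change carries the jump times of one path to those of the other, so both have performed
    the same jumps at [u] and [la u], and [jpath_close] applies. The factor [k.+1] dominates both
    the displacement [k * om] of the time and [om] itself. *)
Lemma h_J1_close k x (W W' : k.-tuple 'cV[R]_d) (t t' : k.-tuple R) kappa om :
  increasing_tuples `]0, 1[%classic k t -> increasing_tuples `]0, 1[%classic k t' ->
  0 < kappa -> (forall i, kappa <= tnth t i <= 1 - kappa /\
    forall j, i != j -> kappa <= `|tnth t i - tnth t j|) ->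
  k.+1%:R * om < kappa ->
  (forall j, `|tnth t' j - tnth t j| <= om) ->
  (forall j, enorm (tnth W j - tnth W' j) <= om) -> 0 <= om ->
  J1_dist (h a sigma b x W t) (h a sigma b x W' t') <=
  amp_const C D * amp C D (jdata W [tuple of nseq k (0 : 'cV[R]_m)] t) * (k.+1%:R * om).
Proof.
move=> ti ti' kap0 gap kom tt' ww' om0.
have kom0 : k%:R * om < kappa.
  by apply: le_lt_trans kom; rewrite ler_wpM2r// ler_nat.
have kom1 : om <= k.+1%:R * om by rewrite ler_peMl// ler1n.
have kom2 : k%:R * om <= k.+1%:R * om by rewrite ler_wpM2r// ler_nat.
have [tc clo hom tj] := tshift_time_change kap0 gap tt' kom0.
set la := tshift kappa t t' in tc clo hom tj.
have A1 : 1 <= amp_const C D * amp C D (jdata W [tuple of nseq k (0 : 'cV[R]_m)] t).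
  by rewrite mulr_ege1// ?amp_const_ge1// amp_ge1.
apply: ge_inf; first by case: (J1_bounds_has_inf (h a sigma b x W t) (h a sigma b x W' t')).
exists la => // u u01; split.
  by rewrite (le_trans (clo u))// (le_trans kom2)// ler_peMl// (le_trans om0).
have lu01 := time_change_itv tc u01.
have oc := increasing_tuples_oc ti; have oc' := increasing_tuples_oc ti'.
rewrite /h (hbarE sigma b D0 aD C0 aC x W _ oc u01) (hbarE sigma b D0 aD C0 aC x W' _ oc' lu01).
have [p1 p2] := increasing_path oc; have [p1' p2'] := increasing_path oc'.
move: (u01) (lu01); rewrite !in_itv/= => /andP[u0 u1] /andP[lu0 lu1].
have := @jpath_close R m d a sigma b C D b0 C0 D0 aC aD sC sD (k.+1%:R * om) u (la u) 0 0
  x x (jdata W [tuple of nseq k 0] t) (jdata W' [tuple of nseq k 0] t').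
rewrite !times_jdata (subrr x) enorm0 [0 + _ * om]add0r; apply => //.
- by rewrite lexx.
- by rewrite lexx.
- by rewrite (le_trans om0).
- by rewrite subrr normr0 (le_trans om0).
- by rewrite distrC (le_trans (clo u)).
apply: jclose_jdata => j; split.
- by rewrite distrC (le_trans (tt' j)).
- by rewrite (le_trans (ww' j)).
- by rewrite subrr enorm0 (le_trans om0).
- by rewrite -tj (leW_mono (le_mono hom)).
Qed.

(** Jump times stay below 1: time changes fix the end of [[0, 1]], so a jump at time 1 is in general
    not a J1 limit of earlier jumps. *)
Lemma h_continuous k x (W : k.-tuple 'cV[R]_d) (t : k.-tuple R) e :
  increasing_tuples `]0, 1[%classic k t -> 0 < e ->
  exists2 de, 0 < de & forall (W' : k.-tuple 'cV[R]_d) (t' : k.-tuple R),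
    increasing_tuples `]0, 1[%classic k t' ->
    (forall j, `|tnth t' j - tnth t j| < de) ->
    (forall j, enorm (tnth W' j - tnth W j) < de) ->
    J1_dist (h a sigma b x W t) (h a sigma b x W' t') < e.
Proof.
move=> ti e0; have [kappa kap0 gap] := tent_gap ti.
set A := amp_const C D * amp C D (jdata W [tuple of nseq k (0 : 'cV[R]_m)] t).
have A1 : 1 <= A by rewrite mulr_ege1// ?amp_const_ge1// amp_ge1.
have A0 : 0 < A by exact: lt_le_trans ltr01 A1.
pose de := Num.min (kappa / 2) (e / A / 2) / k.+1%:R.
have m0 : 0 < Num.min (kappa / 2) (e / A / 2) by rewrite lt_min !divr_gt0.
have de0 : 0 < de by rewrite divr_gt0.
have kde : k.+1%:R * de = Num.min (kappa / 2) (e / A / 2).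
  by rewrite /de mulrC divfK// pnatr_eq0.
have kde1 : k.+1%:R * de <= kappa / 2 by rewrite kde ge_min lexx.
have kde2 : k.+1%:R * de <= e / A / 2 by rewrite kde ge_min lexx orbT.
exists de => // W' t' ti' tt' ww'.
apply: le_lt_trans (h_J1_close x (W := W) (W' := W') ti ti' kap0 gap (om := de) _ _ _ _) _.
- by rewrite (le_lt_trans kde1)//; lra.
- by move=> j; rewrite ltW.
- by move=> j; rewrite enormB ltW.
- exact: ltW.
rewrite -/A (le_lt_trans (ler_wpM2l (ltW A0) kde2))// mulrA mulrCA divff ?gt_eqF// mulr1.
by lra.
Qed.

End hbar_continuity.

(** * Product measures and vague convergence *)

Section tuple_measures.
Local Open Scope ereal_scope.
Context {disp} {T : measurableType disp} {R : realType}.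
Variable mu : {sigma_finite_measure set T -> \bar R}.

Definition tcons k (p : T * k.-tuple T) : k.+1.-tuple T := [tuple of p.1 :: p.2].

Lemma measurable_tcons k : measurable_fun setT (@tcons k).
Proof. exact: measurable_cons. Qed.

Lemma measurable_tuncons k :
  measurable_fun setT (fun t : k.+1.-tuple T => (tnth t ord0, [tuple of behead t])).
Proof.
apply: measurable_fun_pair; first exact: measurable_tnth.
exact: measurable_behead.
Qed.

Lemma tuncons_tcons k (p : T * k.-tuple T) :
  (tnth (tcons p) ord0, [tuple of behead (tcons p)]) = p.
Proof.
case: p => x s; rewrite /tcons /=; congr (_, _).
by apply: val_inj.
Qed.

(** The iterated integral is recognized as the image of [mu \x M] under consing, which is a measure.
    The two agree on measurable sets, the only ones seen by integrals. *)
Lemma tuple_measure_exists k :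
  exists M : {sigma_finite_measure set (k.-tuple T) -> \bar R},
  forall A, measurable A -> @tuple_measure R disp T mu k A = M A.
Proof.
elim: k => [|k [M IH]].
  by exists [the {sigma_finite_measure set _ -> \bar R} of \d_([tuple] : 0.-tuple T)].
pose N0 : set (k.+1.-tuple T) -> \bar R := pushforward (mu \x M) (@tcons k).
have N00 : N0 set0 = 0 by rewrite /N0 /pushforward preimage_set0 measure0.
have N0_ge0 A : 0 <= N0 A by apply: integral_ge0 => x _; exact: measure_ge0.
have mpre (A : set (k.+1.-tuple T)) : measurable A -> measurable (@tcons k @^-1` A).
  by move=> mA; rewrite -[X in measurable X]setTI; exact: (@measurable_tcons k).
have N0_sigma : semi_sigma_additive N0.
  move=> F mF tF mUF; rewrite /N0 /pushforward preimage_bigcup.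
  apply: measure_semi_sigma_additive; first by move=> n; exact: mpre.
    apply/trivIsetP => i j _ _ ij; rewrite -preimage_setI.
    by move/trivIsetP : tF => /(_ _ _ _ _ ij) ->//; rewrite preimage_set0.
  by rewrite -preimage_bigcup; exact: mpre.
have N0_sf : sigma_finite setT N0.
  have /sigma_finiteP[F [TF ndF Foo]] := sigma_finiteT mu.
  have /sigma_finiteP[G [TG ndG Goo]] := sigma_finiteT M.
  pose unc (t : k.+1.-tuple T) := (tnth t ord0, [tuple of behead t]).
  exists (fun n => unc @^-1` (F n `*` G n)).
    apply/esym/seteqP; split=> // t _.
    have [n1 _ Hn1] : (\bigcup_i F i) (tnth t ord0) by rewrite -TF.
    have [n2 _ Hn2] : (\bigcup_i G i) [tuple of behead t] by rewrite -TG.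
    exists (maxn n1 n2) => //; split => /=.
      by have /subsetPset := ndF _ _ (leq_maxl n1 n2); exact.
    by have /subsetPset := ndG _ _ (leq_maxr n1 n2); exact.
  move=> n; have [mF F1] := Foo n; have [mG G1] := Goo n; split.
    rewrite -[X in measurable X]setTI; apply: measurable_tuncons => //.
    exact: measurableX.
  rewrite /N0 /pushforward (_ : _ @^-1` _ = F n `*` G n).
    by rewrite product_measure1E// lte_mul_pinfty// ge0_fin_numE.
  rewrite -comp_preimage (_ : unc \o _ = id) ?preimage_id//.
  by apply/funext => p; exact: tuncons_tcons.
pose N1 : {measure set (k.+1.-tuple T) -> \bar R} :=
  HB.pack N0 (isMeasure.Build _ _ R N0 N00 N0_ge0 N0_sigma).
pose N : {sigma_finite_measure set (k.+1.-tuple T) -> \bar R} :=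
  HB.pack N0 N1 (Measure_isSigmaFinite.Build _ _ R N1 N0_sf).
exists N => A mA; rewrite /N /= /N0 /pushforward /product_measure1 /=.
apply: eq_integral => x _; rewrite /= IH; last first.
  have mx : measurable_fun setT (fun s : k.-tuple T => tcons (x, s)).
    by apply: measurableT_comp; [exact: measurable_tcons|exact: measurable_pair1].
  by rewrite -[X in measurable X]setTI; exact: mx.
congr (M _); apply/seteqP; split => s /=; rewrite /xsection /= inE//.
Qed.

Definition tmeas k : {sigma_finite_measure set (k.-tuple T) -> \bar R} :=
  sval (cid (tuple_measure_exists k)).

Lemma tmeasE k A : measurable A -> @tuple_measure R disp T mu k A = tmeas k A.
Proof. exact: (svalP (cid (tuple_measure_exists k))). Qed.

Lemma tmeas_int0 (f : 0.-tuple T -> \bar R) : (forall t, 0 <= f t) ->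
  measurable_fun setT f -> \int[tmeas 0]_t f t = f [tuple].
Proof.
move=> f0 mf; rewrite (eq_integral_set_fun (m2 := \d_([tuple] : 0.-tuple T))).
  by rewrite integral_dirac// diracT mul1e.
by move=> A mA; rewrite -tmeasE.
Qed.

Lemma tmeasS k (A : set (k.+1.-tuple T)) : measurable A ->
  tmeas k.+1 A = (mu \x tmeas k) (@tcons k @^-1` A).
Proof.
move=> mA; rewrite -tmeasE// /product_measure1 /=.
apply: eq_integral => x _; rewrite /= tmeasE; last first.
  have mx : measurable_fun setT (fun s : k.-tuple T => tcons (x, s)).
    by apply: measurableT_comp; [exact: measurable_tcons|exact: measurable_pair1].
  by rewrite -[X in measurable X]setTI; exact: mx.
by congr (tmeas k _); apply/seteqP; split => s /=; rewrite /xsection /= inE.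
Qed.

Lemma tmeas_int_cons k (f : k.+1.-tuple T -> \bar R) : (forall t, 0 <= f t) ->
  measurable_fun setT f ->
  \int[tmeas k.+1]_t f t = \int[mu]_x \int[tmeas k]_s f (tcons (x, s)).
Proof.
move=> f0 mf.
rewrite (eq_integral_set_fun (m2 := pushforward (mu \x tmeas k) (@tcons k))); last first.
  by move=> A mA; rewrite tmeasS.
rewrite (ge0_integral_pushforward (@measurable_tcons k))//.
rewrite preimage_setT (@fubini_tonelli1 _ _ T (k.-tuple T) R mu (tmeas k) (f \o @tcons k))//.
  by apply: measurableT_comp => //; exact: measurable_tcons.
by move=> p; exact: f0.
Qed.

Lemma measurable_tmeas_int_cons k (f : k.+1.-tuple T -> \bar R) :
  (forall t, 0 <= f t) -> measurable_fun setT f ->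
  measurable_fun setT (fun x => \int[tmeas k]_s f (tcons (x, s))).
Proof.
move=> f0 mf.
have := @measurable_fun_fubini_tonelli_F _ _ T (k.-tuple T) R (tmeas k)
  (f \o @tcons k); apply.
  by apply: measurableT_comp => //; exact: measurable_tcons.
by move=> p; exact: f0.
Qed.

Definition box k (A : 'I_k -> set T) : set (k.-tuple T) :=
  [set t | forall i, A i (tnth t i)].

Lemma measurable_box k (A : 'I_k -> set T) : (forall i, measurable (A i)) ->
  measurable (box A).
Proof.
move=> mA; rewrite (_ : box A = \big[setI/setT]_(i < k) ((@tnth _ _ ^~ i) @^-1` A i)).
  apply: bigsetI_measurable => i _; rewrite -[X in measurable X]setTI.
  exact: measurable_tnth.
rewrite -(bigcap_seq (index_enum _) (fun i : 'I_k => (@tnth _ _ ^~ i) @^-1` A i)).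
apply/seteqP; split => t Ht i; first by move=> _; exact: Ht.
by apply: Ht; rewrite /= mem_index_enum.
Qed.

Lemma tmeas_box k (A : 'I_k -> set T) : (forall i, measurable (A i)) ->
  tmeas k (box A) = \prod_(i < k) mu (A i).
Proof.
elim: k A => [|k IH] A mA.
  rewrite big_ord0 -tmeasE /=; last exact: measurable_box.
  by rewrite diracE mem_set//; case.
rewrite tmeasS ?big_ord_recl; last exact: measurable_box.
rewrite (_ : _ @^-1` _ = A ord0 `*` box (fun i => A (lift ord0 i))).
  rewrite product_measure1E//; last by apply: measurable_box.
  by rewrite IH.
apply/seteqP; split => -[x s] /=.
  move=> H; split; first exact: (H ord0).
  by move=> i; have := H (lift ord0 i); rewrite /= tnthS.
move=> [Ax Hs] i; have [->//|i0] := eqVneq i ord0.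
have [j ->] : exists j, i = lift ord0 j.
  by case: (unliftP ord0 i) => [j ->|/eqP]; [exists j|rewrite (negbTE i0)].
by rewrite /= tnthS.
Qed.

(** Boxes are stable under intersection and generate the product sigma-algebra, so a finite measure
    is determined by them. This turns independence of the noises into a product law. *)
Lemma tmeas_unique k (N : {measure set (k.-tuple T) -> \bar R}) : N setT < +oo ->
  (forall A : 'I_k -> set T, (forall i, measurable (A i)) ->
     N (box A) = \prod_(i < k) mu (A i)) ->
  forall A, measurable A -> N A = tmeas k A.
Proof.
move=> Nfin NE A mA.
pose G := [set B | exists2 A : 'I_k -> set T, forall i, measurable (A i) & B = box A].
apply: (measure_unique G (fun=> setT)) => //.
- apply/seteqP; split.
    apply: smallest_sub; first exact: smallest_sigma_algebra.
    rewrite -(bigcup_seq (index_enum _) (fun i : 'I_k =>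
      preimage_set_system [set: k.-tuple T] (@tnth _ _ ^~ i) measurable)).
    move=> B [i _ [C mC <-]]; apply: sub_sigma_algebra.
    exists (fun j => if j == i then C else setT); first by move=> j; case: ifP.
    apply/seteqP; split => t /=; first by move=> [_ Ct] j; case: eqP => // ->.
    by move=> /(_ i); rewrite eqxx.
  apply: smallest_sub; first exact: sigma_algebra_measurable.
  by move=> B [A' mA' ->]; exact: measurable_box.
- move=> _ _ [A1 m1 ->] [A2 m2 ->]; exists (fun i => A1 i `&` A2 i).
    by move=> i; exact: measurableI.
  apply/seteqP; split => t /=; first by move=> [H1 H2] i; split; [exact: H1|exact: H2].
  by move=> H; split => i; have [] := H i.
- by move=> _; exists (fun=> setT) => //; apply/seteqP; split.
- by apply/seteqP; split => // t _; exists 0%N.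
- by move=> _ [A' mA' ->]; rewrite NE//; exact/esym/tmeas_box.
Qed.

End tuple_measures.

Section real_integral.
Context d (T : measurableType d) (R : realType).
Implicit Types (m : {measure set T -> \bar R}) (f g : T -> R).

(** [fine] sends an infinite integral to 0, so the algebraic rules below ask for finiteness. *)
Definition rint (m : set T -> \bar R) (f : T -> R) : R := fine (\int[m]_x (f x)%:E).

Lemma rint_bound m f (A : set T) (M : R) : measurable A -> measurable_fun setT f ->
  (forall x, 0 <= f x <= M) -> (forall x, ~ A x -> f x = 0) ->
  (\int[m]_x (f x)%:E <= M%:E * m A)%E.
Proof.
move=> mA mf fM fA.
have [x0|/set0P/negP/negPn/eqP T0] := pselect ([set: T] !=set0); last first.
  rewrite T0 integral_set0 (_ : A = set0) ?measure0 ?mule0//.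
  by rewrite -subset0 -T0.
have M0 : 0 <= M by case: x0 => x _; have /andP[] := fM x; exact: le_trans.
apply: (@le_trans _ _ (\int[m]_x (M%:E * (\1_A x)%:E))%E).
  apply: ge0_le_integral => //.
  - by move=> x _; rewrite lee_fin; have /andP[] := fM x.
  - exact/measurable_EFinP.
  - apply: emeasurable_funM => //; exact/measurable_EFinP.
  - move=> x _; rewrite -EFinM lee_fin indicE.
    case: (boolP (x \in A)) => [_|/negP xA].
      by rewrite mulr1; have /andP[] := fM x.
    by rewrite fA ?mulr0// => Ax; apply: xA; rewrite inE.
rewrite ge0_integralZl//; last exact/measurable_EFinP.
by rewrite integral_indic// setIT.
Qed.

Lemma rintE m f : (forall x, 0 <= f x) -> (\int[m]_x (f x)%:E < +oo)%E ->
  (rint m f)%:E = (\int[m]_x (f x)%:E)%E.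
Proof.
move=> f0 foo; rewrite /rint fineK// ge0_fin_numE//.
by apply: integral_ge0 => x _; rewrite lee_fin.
Qed.

Lemma rint_ge0 m f : (forall x, 0 <= f x) -> 0 <= rint m f.
Proof. by move=> f0; apply/fine_ge0/integral_ge0 => x _; rewrite lee_fin. Qed.

Lemma rint_le m f g : (forall x, 0 <= f x <= g x) -> measurable_fun setT f ->
  measurable_fun setT g -> (\int[m]_x (g x)%:E < +oo)%E -> rint m f <= rint m g.
Proof.
move=> fg mf mg goo.
have f0 x : 0 <= f x by have /andP[] := fg x.
have le : (\int[m]_x (f x)%:E <= \int[m]_x (g x)%:E)%E.
  apply: ge0_le_integral => //.
  - by move=> x _; rewrite lee_fin.
  - exact/measurable_EFinP.
  - exact/measurable_EFinP.
  - by move=> x _; rewrite lee_fin; have /andP[] := fg x.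
rewrite -lee_fin !rintE//; first by move=> x; have /andP[/le_trans] := fg x; apply.
exact: le_lt_trans goo.
Qed.

Lemma rintD m f g : (forall x, 0 <= f x) -> (forall x, 0 <= g x) ->
  measurable_fun setT f -> measurable_fun setT g ->
  (\int[m]_x (f x)%:E < +oo)%E -> (\int[m]_x (g x)%:E < +oo)%E ->
  (\int[m]_x (f x + g x)%:E < +oo)%E /\
  rint m (fun x => f x + g x) = rint m f + rint m g.
Proof.
move=> f0 g0 mf mg foo goo.
have E : (\int[m]_x (f x + g x)%:E = \int[m]_x (f x)%:E + \int[m]_x (g x)%:E)%E.
  rewrite -ge0_integralD//; try exact/measurable_EFinP.
  - by move=> x _; rewrite lee_fin.
  - by move=> x _; rewrite lee_fin.
have foo' : (\int[m]_x (f x + g x)%:E < +oo)%E by rewrite E lte_add_pinfty.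
split=> //; apply: EFin_inj; rewrite EFinD !rintE//.
by move=> x; rewrite addr_ge0.
Qed.

Lemma rintZ m f c : 0 <= c -> (forall x, 0 <= f x) -> measurable_fun setT f ->
  (\int[m]_x (f x)%:E < +oo)%E ->
  (\int[m]_x (c * f x)%:E < +oo)%E /\ rint m (fun x => c * f x) = c * rint m f.
Proof.
move=> c0 f0 mf foo.
have E : (\int[m]_x (c * f x)%:E = c%:E * \int[m]_x (f x)%:E)%E.
  apply: (@ge0_integralZl d T R m setT measurableT (fun x => (f x)%:E) _ c%:E) => //.
  - exact/measurable_EFinP.
  - by move=> x _; rewrite lee_fin.
have foo' : (\int[m]_x (c * f x)%:E < +oo)%E by rewrite E lte_mul_pinfty.
split=> //; apply: EFin_inj; rewrite EFinM !rintE//.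
by move=> x; rewrite mulr_ge0.
Qed.

End real_integral.

(** * Vague convergence and continuously convergent integrands *)

Section ramp_functions.
Context {R : realType} {d : nat}.
Local Notation V := 'cV[R]_d.

(** Continuous substitute for the indicator of [r <= enorm w]: 0 up to [r / 2], affine in the norm,
    1 from [r] on. *)
Definition ramp (r : R) (w : V) : R := Num.min 1 (Num.max 0 (2 / r * enorm w - 1)).

Lemma ramp01 r w : 0 <= ramp r w <= 1.
Proof. by rewrite /ramp ge_min lexx andbT le_min ler01 le_max lexx. Qed.

Lemma ramp1 r w : 0 < r -> r <= enorm w -> ramp r w = 1.
Proof.
move=> r0 rw; rewrite /ramp min_l// le_max lerBrDr; apply/orP; right.
by rewrite mulrAC ler_pdivlMr//; lra.
Qed.

Lemma ramp0 r w : 0 < r -> enorm w <= r / 2 -> ramp r w = 0.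
Proof.
move=> r0 wr; rewrite /ramp max_l ?min_r//.
by rewrite subr_le0 mulrAC ler_pdivrMr//; lra.
Qed.

Lemma ramp_continuous r : continuous (ramp r).
Proof.
move=> w; apply: (@continuous_comp _ _ _ (@enorm R d)
  (fun u => Num.min 1 (Num.max 0 (2 / r * u - 1)))); first exact: continuous_enorm.
apply: continuous_min; first exact: cvg_cst.
apply: continuous_max; first exact: cvg_cst.
by apply: cvgB; [apply: cvgMl_tmp; exact: cvg_id|exact: cvg_cst].
Qed.

Lemma measurable_ramp r : measurable_fun setT (ramp r).
Proof. by apply: continuous_measurable_cV; exact: ramp_continuous. Qed.

(** Transposition preserves the sup norm and carries the statement to row vectors, where closed
    bounded sets are compact. *)
Lemma compact_norm_ball (L : R) : compact [set w : V | `|w| <= L].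
Proof.
have -> : [set w : V | `|w| <= L] = trmx @` [set v : 'rV[R]_d | `|v| <= L].
  have tr p q (u : 'M[R]_(p, q)) : `|u^T| <= `|u|.
    rewrite [leLHS]/Num.Def.normr /= mx_normrE.
    apply/bigmax_leP; split => [|[i j] _ /=]; first exact: normr_ge0.
    rewrite mxE [leRHS]/Num.Def.normr /= mx_normrE.
    by apply/bigmax_geP; right; exists (j, i).
  apply/seteqP; split => [w /= wL|_ [v /= vL <-]].
    by exists w^T; rewrite ?trmxK//= (le_trans (tr _ _ _)).
  by rewrite /= (le_trans (tr _ _ _)).
apply: continuous_compact; last first.
  apply: bounded_closed_compact.
    by exists L; split; rewrite ?num_real// => M LM v /= /le_trans; apply; exact: ltW.
  apply: (@closed_comp _ _ (fun v : 'rV[R]_d => `|v|) [set u | u <= L]).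
    by move=> v _; exact: norm_continuous.
  exact: closed_le.
apply: continuous_subspaceT => v; apply/(@cvgrPdist_lt _ _ _ (nbhs v)) => e e0.
apply/nbhs_ballP; exists e => //= u; rewrite -ball_normE/=.
have tr p q (w : 'M[R]_(p, q)) : `|w^T| <= `|w|.
  rewrite [leLHS]/Num.Def.normr /= mx_normrE.
  apply/bigmax_leP; split => [|[i j] _ /=]; first exact: normr_ge0.
  rewrite mxE [leRHS]/Num.Def.normr /= mx_normrE.
  by apply/bigmax_geP; right; exists (j, i).
by apply: le_lt_trans; have := tr _ _ (v - u); rewrite linearB.
Qed.

End ramp_functions.

Section vague_convergence.
Context {R : realType} {d : nat}.
Local Notation V := 'cV[R]_d.

(** M-convergence of [rho i], multiplied by [c i], on the space without the origin: test functions
    are bounded and vanish near 0, but need not have compact support. The third clause is the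
    tightness at infinity of the limit, needed to pass from uniform convergence on compact sets to
    integrals. *)
Definition vague_cvg (I : Type) (F : set_system I) (c : I -> R)
    (rho : I -> probability V R) (mu : {sigma_finite_measure set V -> \bar R}) :=
  [/\ forall i, 0 <= c i,
      forall r : R, 0 < r -> (mu [set w | (r < enorm w)%R] < +oo)%E,
      forall tau : R, 0 < tau -> exists2 L : R, 0 < L & rint mu (ramp L) <= tau &
      forall (phi : V -> R) (M r : R), 0 < r -> continuous phi ->
        (forall w, 0 <= phi w <= M) -> (forall w, enorm w <= r -> phi w = 0) ->
        c i * rint (rho i) phi @[i --> F] --> rint mu phi].

Lemma measurable_enorm_gt (r : R) : measurable [set w : V | (r < enorm w)%R].
Proof.
rewrite (_ : mkset _ = @enorm R d @^-1` `]r, +oo[); last first.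
  by apply/seteqP; split => w /=; rewrite in_itv/= andbT.
by rewrite -[X in measurable X]setTI; exact: measurable_enorm.
Qed.

Lemma mu_int_fin (mu : {sigma_finite_measure set V -> \bar R}) (phi : V -> R) (M r : R) :
  (mu [set w | (r < enorm w)%R] < +oo)%E -> measurable_fun setT phi ->
  (forall w, 0 <= phi w <= M) -> (forall w, enorm w <= r -> phi w = 0) ->
  (\int[mu]_x (phi x)%:E < +oo)%E.
Proof.
move=> muoo mphi phiM phi0.
apply: (@le_lt_trans _ _ (M%:E * mu [set w | (r < enorm w)%R])%E).
  apply: rint_bound => //; first exact: measurable_enorm_gt.
  by move=> w /= /negP; rewrite -leNgt; exact: phi0.
rewrite lte_mul_pinfty// lee_fin.
by have /andP[] := phiM 0; exact: le_trans.
Qed.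

Lemma prob_int_fin d' (T : measurableType d') (m : {measure set T -> \bar R})
    (phi : T -> R) (M : R) : (m setT < +oo)%E -> measurable_fun setT phi ->
  (forall w, 0 <= phi w <= M) -> (\int[m]_x (phi x)%:E < +oo)%E.
Proof.
move=> mT mphi phiM.
have := @rint_bound _ _ _ m phi setT `|M| measurableT mphi; move=> H.
apply: (le_lt_trans (H _ _)).
- by move=> x; have /andP[-> /le_trans] := phiM x; apply; exact: ler_norm.
- by move=> x /(_ I).
by rewrite lte_mul_pinfty// lee_fin.
Qed.

Section one_factor.
Variables (I : Type) (F : set_system I) (FF : ProperFilter F).
Variables (c : I -> R) (rho : I -> probability V R).
Variable mu : {sigma_finite_measure set V -> \bar R}.
Hypothesis vag : vague_cvg F c rho mu.
Variables (Psi_ : I -> V -> R) (Psi : V -> R) (M r : R).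
Hypothesis r0 : 0 < r.
Hypothesis mPsi_ : forall i, measurable_fun setT (Psi_ i).
Hypothesis Psi_M : \forall i \near F, forall w, 0 <= Psi_ i w <= M.
Hypothesis Psi_0 : forall i w, enorm w <= r -> Psi_ i w = 0.
Hypothesis ccPsi : forall w, Psi_ p.2 p.1 @[p --> filter_prod (nbhs w) F] --> Psi w.

Lemma cc_pointwise w : Psi_ i w @[i --> F] --> Psi w.
Proof.
move=> A /ccPsi -[[B1 B2] /= [B1w FB2] BA].
change (F [set i | A (Psi_ i w)]); apply: filterS FB2 => i B2i.
exact: (BA (w, i) (conj (nbhs_singleton B1w) B2i)).
Qed.

Lemma cc_bound w : 0 <= Psi w <= M.
Proof.
apply/andP; split.
  apply: (cvgr_to_ge (@cc_pointwise w)); apply: filterS Psi_M => i /(_ w).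
  by case/andP.
apply: (cvgr_to_le (@cc_pointwise w)); apply: filterS Psi_M => i /(_ w).
by case/andP.
Qed.

Lemma cc_near w e : 0 < e -> \forall p \near filter_prod (nbhs w) F,
  `|Psi_ p.2 p.1 - Psi w| < e /\ `|Psi p.1 - Psi w| < e.
Proof.
move=> e0; have e20 : 0 < e / 2 by rewrite divr_gt0.
have [[B1 B2] /= [B1w FB2] BA] := @ccPsi w _ (nbhsx_ballx (Psi w) _ e20).
exists (B1, B2) => //= -[w' i] [/= B1w' B2i]; split.
  have : ball (Psi w) (e / 2) (Psi_ i w') := BA (w', i) (conj B1w' B2i).
  by rewrite -ball_normE/= distrC; lra.
suff : `|Psi w' - Psi w| <= e / 2 by lra.
have H : `|Psi_ j w' - Psi w| @[j --> F] --> `|Psi w' - Psi w|.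
  by apply: cvg_norm; apply: cvgB; [exact: cc_pointwise|exact: cvg_cst].
apply: (cvgr_to_le H); apply: filterS FB2 => j B2j.
have : ball (Psi w) (e / 2) (Psi_ j w') := BA (w', j) (conj B1w' B2j).
by rewrite -ball_normE/= distrC => /ltW.
Qed.

(** Continuous convergence makes the limit continuous although the [Psi_ i] are only assumed
    measurable, so [Psi] is an admissible test function. *)
Lemma cc_continuous : continuous Psi.
Proof.
move=> w; apply/(@cvgrPdist_lt _ _ _ (nbhs w)) => e e0.
have [[B1 B2] /= [B1w FB2] BA] := cc_near w e0.
have [i B2i] := filter_ex FB2.
apply: filterS B1w => w' B1w'; rewrite distrC.
by have [] := BA (w', i) (conj B1w' B2i).
Qed.

(** Continuous convergence is uniform near each point, and compactness makes it uniform on balls. *)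
Lemma cc_uniform L e : 0 < e ->
  \forall i \near F, forall w : V, `|w| <= L -> `|Psi_ i w - Psi w| < e.
Proof.
move=> e0; have := @compact_norm_ball R d L => /compact_near_coveringP.
move=> /(_ I F (fun i w => `|Psi_ i w - Psi w| < e) _); apply => w _.
have e20 : 0 < e / 2 by rewrite divr_gt0.
apply: filterS (cc_near w e20) => -[w' i] /= [h1 h2].
rewrite (_ : _ - _ = (Psi_ i w' - Psi w) - (Psi w' - Psi w)); last by ring.
by rewrite (le_lt_trans (ler_normB _ _))//; lra.
Qed.

(** The difference of the integrands is at most [e1] times [ramp r] on a ball, by uniform
    convergence, and at most [M] times [ramp L] outside it. Both ramps are test functions, and the
    second has a limit of size [tau], so each error takes a share of [e]. *)
Lemma one_factor : c i * rint (rho i) (Psi_ i) @[i --> F] --> rint mu Psi.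
Proof.
have [c0 muoo tight conv] := vag.
have Psi0 w : enorm w <= r -> Psi w = 0.
  move=> wr; apply: (cvg_unique (@Rhausdorff R) (@cc_pointwise w)).
  rewrite /= (_ : (fun i => _) = cst 0); first exact: cvg_cst.
  by apply/funext => i; rewrite Psi_0.
have mPsi : measurable_fun setT Psi := continuous_measurable_cV cc_continuous.
have M0 : 0 <= M by have /andP[/le_trans] := cc_bound 0; apply.
have ramp_meas q : measurable_fun setT (@ramp R d q).
  by apply: continuous_measurable_cV; exact: ramp_continuous.
have rhoT i : (rho i setT < +oo)%E by rewrite probability_setT ltry.
apply/cvgrPdist_le => e e0.
set K := rint mu (ramp r).
have K0 : 0 <= K by apply: rint_ge0 => w; have /andP[] := @ramp01 R d r w.
pose e1 := e / (4 * (K + 1)).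
have e10 : 0 < e1 by rewrite divr_gt0// mulr_gt0// ltr_wpDl.
pose tau := e / (8 * (M + 1)).
have tau0 : 0 < tau by rewrite divr_gt0// mulr_gt0// ltr_wpDl.
have [L L0 HL] := tight _ tau0.
have H1 : c i * rint (rho i) Psi @[i --> F] --> rint mu Psi.
  by apply: (conv _ M r) => //; [exact: cc_continuous|exact: cc_bound].
have H2 : c i * rint (rho i) (ramp r) @[i --> F] --> K.
  apply: (conv _ 1 (r / 2)) => //; first by rewrite divr_gt0.
  - exact: ramp_continuous.
  - exact: ramp01.
  - by move=> w; exact: ramp0.
have H3 : c i * rint (rho i) (ramp L) @[i --> F] --> rint mu (ramp L).
  apply: (conv _ 1 (L / 2)) => //; first by rewrite divr_gt0.
  - exact: ramp_continuous.
  - exact: ramp01.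
  - by move=> w; exact: ramp0.
have e40 : 0 < e / 4 by rewrite divr_gt0.
near=> i.
have A1 : `|rint mu Psi - c i * rint (rho i) Psi| < e / 4.
  by near: i; move/cvgrPdist_lt : H1; exact.
have A2 : c i * rint (rho i) (ramp r) <= K + 1.
  by near: i; apply: (cvgr_le K) => //; lra.
have A3 : c i * rint (rho i) (ramp L) <= 2 * tau.
  by near: i; apply: (cvgr_le _ H3); lra.
have A4 : forall w, `|w| <= L -> `|Psi_ i w - Psi w| < e1.
  by near: i; exact: cc_uniform.
have A5 : forall w, 0 <= Psi_ i w <= M by near: i.
have pt w : `|Psi_ i w - Psi w| <= e1 * ramp r w + M * ramp L w.
  have R1 : 0 <= M * ramp L w by rewrite mulr_ge0//; have /andP[] := ramp01 L w.
  have R2 : 0 <= e1 * ramp r w by apply: mulr_ge0; [exact: ltW|have /andP[] := ramp01 r w].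
  have [wr|wr] := leP (enorm w) r; first by rewrite Psi_0// Psi0// subrr normr0 addr_ge0.
  have [wL|wL] := leP `|w| L.
    by rewrite (ramp1 r0 (ltW wr)) mulr1; have := A4 _ wL; lra.
  rewrite (@ramp1 _ _ L)// ?mulr1; last by rewrite (le_trans (ltW wL))// norm_le_enorm.
  by have /andP[] := A5 w; have /andP[] := cc_bound w; rewrite ler_norml; lra.
have fin (f : V -> R) (B : R) : measurable_fun setT f -> (forall w : V, 0 <= f w <= B) ->
    (\int[rho i]_x (f x)%:E < +oo)%E by move=> mf fB; exact: (prob_int_fin (rhoT i) mf fB).
have F1 := fin _ _ mPsi cc_bound; have F2 := fin _ _ (mPsi_ i) A5.
have F3 := fin _ _ (ramp_meas r) (ramp01 r); have F4 := fin _ _ (ramp_meas L) (ramp01 L).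
have r0' q w : 0 <= @ramp R d q w by have /andP[] := ramp01 q w.
have [G1 E1] := rintZ (ltW e10) (r0' r) (ramp_meas r) F3.
have [G2 E2] := rintZ M0 (r0' L) (ramp_meas L) F4.
have m1 : measurable_fun [set: V] (fun w : V => e1 * ramp r w).
  by apply: measurable_funM; [exact: measurable_cst|exact: ramp_meas].
have m2 : measurable_fun [set: V] (fun w : V => M * ramp L w).
  by apply: measurable_funM; [exact: measurable_cst|exact: ramp_meas].
have p1 (w : V) : 0 <= e1 * ramp r w by apply: mulr_ge0; [exact: ltW|exact: r0'].
have p2 (w : V) : 0 <= M * ramp L w by apply: mulr_ge0; [|exact: r0'].
have [G3 E3] := rintD p1 p2 m1 m2 G1 G2.
have m3 : measurable_fun [set: V] (fun w : V => e1 * ramp r w + M * ramp L w).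
  exact: measurable_funD.
have p3 (w : V) : 0 <= e1 * ramp r w + M * ramp L w by rewrite addr_ge0.
have Pp (w : V) : 0 <= Psi w by have /andP[] := cc_bound w.
have Pp' (w : V) : 0 <= Psi_ i w by have /andP[] := A5 w.
have [G4 E4] := rintD Pp p3 mPsi m3 F1 G3.
have [G5 E5] := rintD Pp' p3 (mPsi_ i) m3 F2 G3.
have I1 : rint (rho i) (Psi_ i) <= rint (rho i) (fun w => Psi w + (e1 * ramp r w + M * ramp L w)).
  apply: rint_le => //; last by apply: measurable_funD.
  by move=> w; rewrite Pp'/= -lerBlDl (le_trans (ler_norm _)).
have I2 : rint (rho i) Psi <= rint (rho i) (fun w => Psi_ i w + (e1 * ramp r w + M * ramp L w)).
  apply: rint_le => //; last by apply: measurable_funD.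
  by move=> w; rewrite Pp/= -lerBlDl (le_trans (ler_norm _))// distrC.
rewrite E4 E3 E1 E2 in I1; rewrite E5 E3 E1 E2 in I2.
have J1 := ler_wpM2l (c0 i) I1; have J2 := ler_wpM2l (c0 i) I2.
have B1 : e1 * (c i * rint (rho i) (ramp r)) <= e / 4.
  apply: (le_trans (ler_wpM2l (ltW e10) A2)).
  have K1 : K + 1 != 0 by rewrite gt_eqF// ltr_wpDl.
  by rewrite /e1 invfM mulrA mulfVK.
have B2 : M * (c i * rint (rho i) (ramp L)) <= e / 4.
  apply: (le_trans (ler_wpM2l M0 A3)).
  have M1 : 0 < M + 1 by rewrite ltr_wpDl.
  rewrite (_ : M * (2 * tau) = (M / (M + 1)) * (e / 4)); last first.
    by rewrite /tau; field; rewrite gt_eqF.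
  apply: ler_piMl; first exact: ltW.
  by rewrite ler_pdivrMr// mul1r lerDl.
by move: A1; rewrite ltr_norml ler_norml; lra.
Unshelve. all: by end_near. Qed.

End one_factor.

(* Continuous convergence, in the shape of an induction on the factors: freezing the
   first one adds it to the index of the filter. *)
Fixpoint ccv k : forall (I : Type) (F : set_system I)
    (Psi_ : I -> k.-tuple V -> R) (Psi : k.-tuple V -> R), Prop :=
  match k with
  | 0 => fun I F Psi_ Psi => Psi_ i [tuple] @[i --> F] --> Psi [tuple]
  | j.+1 => fun I F Psi_ Psi => forall w : V,
      @ccv j (V * I)%type (filter_prod (nbhs w) F)
        (fun p s => Psi_ p.2 (tcons (p.1, s))) (fun s => Psi (tcons (w, s)))
  end.

Lemma ccv_near k (I : Type) (F : set_system I) (FF : Filter F)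
    (Psi_ : I -> k.-tuple V -> R) (Psi : k.-tuple V -> R) :
  (forall W e, 0 < e -> exists2 de : R, 0 < de & \forall i \near F,
     forall W' : k.-tuple V, (forall j, enorm (tnth W' j - tnth W j) < de) ->
       `|Psi_ i W' - Psi W| < e) ->
  ccv F Psi_ Psi.
Proof.
elim: k I F FF Psi_ Psi => [|k IH] I F FF Psi_ Psi H /=.
  apply/cvgrPdist_lt => e e0; have [de de0] := H [tuple] e e0.
  by apply: filterS => i Hi; rewrite distrC; apply: Hi; case.
move=> w; apply: IH => W e e0; have [de de0 Hde] := H (tcons (w, W)) e e0.
exists de => //; exists ([set w' | enorm (w' - w) < de], [set i | forall W' : k.+1.-tuple V,
    (forall j, enorm (tnth W' j - tnth (tcons (w, W)) j) < de) ->
    `|Psi_ i W' - Psi (tcons (w, W))| < e]) => /=.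
  by split => //; exact: enorm_cvg_ball.
move=> [w' i] [/= ww' Hi] W' WW'; apply: Hi => j.
case: (unliftP ord0 j) => [j' ->|->]; last exact: ww'.
by rewrite !tnthS; exact: WW'.
Qed.

Lemma vague_cvg_prod (I : Type) (F : set_system I) (FF : Filter F) c rho mu (w : V) :
  vague_cvg F c rho mu ->
  vague_cvg (filter_prod (nbhs w) F) (fun p : V * I => c p.2) (fun p => rho p.2) mu.
Proof.
move=> [h1 h2 h3 h4]; split => // phi M r r0 cphi phiM phi0.
by apply: (cvg_comp _ _ cvg_snd (h4 _ _ _ r0 cphi phiM phi0)).
Qed.

(** Integrating over all factors but the first gives functions of the first noise. By the induction
    hypothesis, used along the filter enlarged by the neighbourhoods of a point [w], they converge
    continuously at [w], and [one_factor] concludes. The induction therefore has to range over all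
    index types and filters. *)
Lemma multi_factor k (I : Type) (F : set_system I) (FF : ProperFilter F)
    (c : I -> R) (rho : I -> probability V R)
    (mu : {sigma_finite_measure set V -> \bar R})
    (Psi_ : I -> k.-tuple V -> R) (Psi : k.-tuple V -> R) (M r : R) :
  vague_cvg F c rho mu -> 0 < r ->
  (forall i, measurable_fun setT (Psi_ i)) -> measurable_fun setT Psi ->
  (forall i W, 0 <= Psi_ i W <= M) -> (forall W, 0 <= Psi W <= M) ->
  (forall i W, (exists j, enorm (tnth W j) <= r) -> Psi_ i W = 0) ->
  (forall W, (exists j, enorm (tnth W j) <= r) -> Psi W = 0) ->
  ccv F Psi_ Psi ->
  c i ^+ k * rint (tmeas (rho i) k) (Psi_ i) @[i --> F] --> rint (tmeas mu k) Psi.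
Proof.
elim: k I F FF c rho Psi_ Psi => [|k IH] I F FF c rho Psi_ Psi vag r0 mPsi_ mPsi PM PM' P0 P0' cc.
  have E (m : {sigma_finite_measure set V -> \bar R}) (f : 0.-tuple V -> R) :
      measurable_fun setT f -> (forall t, 0 <= f t) -> rint (tmeas m 0) f = f [tuple].
    move=> mf f0.
    have mf' : measurable_fun setT (fun t => (f t)%:E) by exact/measurable_EFinP.
    by rewrite /rint (tmeas_int0 m _ mf').
  rewrite E//; last by move=> t; have /andP[] := PM' t.
  rewrite (_ : (fun i => _) = Psi_ ^~ [tuple]); first exact: cc.
  apply/funext => i; rewrite expr0 mul1r E//.
  by move=> t; have /andP[] := PM i t.
have [c0 muoo tight conv] := vag.
have M0 : 0 <= M by have /andP[/le_trans] := PM' [tuple of nseq k.+1 0]; apply.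
have tfin (m : {sigma_finite_measure set V -> \bar R}) j (f : j.-tuple V -> R) :
    (m [set w | (r < enorm w)%R] < +oo)%E -> measurable_fun setT f ->
    (forall W, 0 <= f W <= M) -> (forall W, (exists i, enorm (tnth W i) <= r) -> f W = 0) ->
    (\int[tmeas m j]_W (f W)%:E <= M%:E * (m [set w | (r < enorm w)%R]) ^+ j)%E.
  move=> moo mf fM f0.
  apply: (@le_trans _ _ (M%:E * tmeas m j (box (fun=> [set w | (r < enorm w)%R])))%E).
    apply: rint_bound => //; first by apply: measurable_box => i; exact: measurable_enorm_gt.
    move=> W /= /existsNP[i /negP]; rewrite -leNgt => Wi.
    by apply: f0; exists i.
  rewrite tmeas_box; last by move=> i; exact: measurable_enorm_gt.
  by rewrite big_const_ord iter_mule mule1.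
have tfin_oo (m : {sigma_finite_measure set V -> \bar R}) j (f : j.-tuple V -> R) :
    (m [set w | (r < enorm w)%R] < +oo)%E -> measurable_fun setT f ->
    (forall W, 0 <= f W <= M) -> (forall W, (exists i, enorm (tnth W i) <= r) -> f W = 0) ->
    (\int[tmeas m j]_W (f W)%:E < +oo)%E.
  move=> moo mf fM f0; apply: (le_lt_trans (tfin m j f moo mf fM f0)).
  rewrite lte_mul_pinfty// -(@fineK _ (m _)) ?ge0_fin_numE//.
  by rewrite -EFin_expe ltry.
have mcons (f : k.+1.-tuple V -> R) w : measurable_fun setT f ->
    measurable_fun setT (fun s => f (tcons (w, s))).
  move=> mf; apply: (measurableT_comp mf).
  by apply: measurableT_comp; [exact: measurable_tcons|exact: measurable_pair1].
have fcons0 (f : k.+1.-tuple V -> R) w s :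
    (forall W, (exists i, enorm (tnth W i) <= r) -> f W = 0) ->
    (exists i, enorm (tnth s i) <= r) -> f (tcons (w, s)) = 0.
  by move=> f0 [i si]; apply: f0; exists (lift ord0 i); rewrite /tcons /= tnthS.
have consE (m : {sigma_finite_measure set V -> \bar R}) (f : k.+1.-tuple V -> R) :
    (m [set w | (r < enorm w)%R] < +oo)%E -> measurable_fun setT f ->
    (forall W, 0 <= f W <= M) -> (forall W, (exists i, enorm (tnth W i) <= r) -> f W = 0) ->
    rint (tmeas m k.+1) f = rint m (fun w => rint (tmeas m k) (fun s => f (tcons (w, s)))).
  move=> moo mf fM f0; rewrite /rint tmeas_int_cons; last 2 first.
  - by move=> t; rewrite lee_fin; have /andP[] := fM t.
  - exact/measurable_EFinP.
  congr fine; apply: eq_integral => w _; rewrite -/(rint _ _) rintE//.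
    by move=> s; have /andP[] := fM (tcons (w, s)).
  by apply: tfin_oo => //; [exact: mcons|move=> s; exact: fcons0].
pose K := rint mu (ramp r).
have rhooo i : (rho i [set w | (r < enorm w)%R] < +oo)%E.
  by rewrite (le_lt_trans (probability_le1 _ _)) ?ltry//; exact: measurable_enorm_gt.
have inner_fin (m : {sigma_finite_measure set V -> \bar R}) (f : k.+1.-tuple V -> R) w :
    (m [set w | (r < enorm w)%R] < +oo)%E -> measurable_fun setT f ->
    (forall W, 0 <= f W <= M) -> (forall W, (exists i, enorm (tnth W i) <= r) -> f W = 0) ->
    (\int[tmeas m k]_s (f (tcons (w, s)))%:E < +oo)%E.
  move=> moo mf fM f0; apply: tfin_oo => //; first exact: mcons.
  by move=> s; exact: fcons0.
have inner_bnd (m : {sigma_finite_measure set V -> \bar R}) (f : k.+1.-tuple V -> R) w :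
    (m [set w | (r < enorm w)%R] < +oo)%E -> measurable_fun setT f ->
    (forall W, 0 <= f W <= M) -> (forall W, (exists i, enorm (tnth W i) <= r) -> f W = 0) ->
    rint (tmeas m k) (fun s => f (tcons (w, s))) <= M * fine (m [set w | (r < enorm w)%R]) ^+ k.
  move=> moo mf fM f0; rewrite -lee_fin rintE; last 2 first.
  - by move=> s; have /andP[] := fM (tcons (w, s)).
  - exact: inner_fin.
  rewrite EFinM EFin_expe fineK ?ge0_fin_numE//; apply: tfin => //; first exact: mcons.
  by move=> s; exact: fcons0.
have inner_meas (m : {sigma_finite_measure set V -> \bar R}) (f : k.+1.-tuple V -> R) :
    measurable_fun setT f -> (forall W, 0 <= f W <= M) ->
    measurable_fun setT (fun w => rint (tmeas m k) (fun s => f (tcons (w, s)))).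
  move=> mf fM; apply: (@measurableT_comp _ _ _ _ _ _ fine) => //.
  apply: (@measurable_tmeas_int_cons _ _ _ m k (fun W => (f W)%:E)).
    by move=> t; rewrite lee_fin; have /andP[] := fM t.
  exact/measurable_EFinP.
have inner_ge0 (m : {sigma_finite_measure set V -> \bar R}) (f : k.+1.-tuple V -> R) w :
    (forall W, 0 <= f W <= M) -> 0 <= rint (tmeas m k) (fun s => f (tcons (w, s))).
  by move=> fM; apply: rint_ge0 => s; have /andP[] := fM (tcons (w, s)).
rewrite consE//; last exact: muoo.
rewrite (_ : (fun i => _) = (fun i => c i * rint (rho i)
    (fun w => c i ^+ k * rint (tmeas (rho i) k) (fun s => Psi_ i (tcons (w, s)))))); last first.
  apply/funext => i; rewrite (consE (rho i) (Psi_ i) (rhooo i) (mPsi_ i) (PM i) (P0 i)) exprS -mulrA.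
  set g := fun w => rint (tmeas (rho i) k) (fun s => Psi_ i (tcons (w, s))).
  have mg : measurable_fun setT g by exact: inner_meas.
  have g0 w : 0 <= g w by exact: inner_ge0.
  have gfin : (\int[rho i]_w (g w)%:E < +oo)%E.
    apply: (@prob_int_fin _ _ (rho i) g (M * fine (rho i [set w | (r < enorm w)%R]) ^+ k)).
    - by rewrite (le_lt_trans (probability_le1 (rho i) measurableT))// ltry.
    - exact: mg.
    - by move=> w; rewrite g0; exact: (inner_bnd (rho i) (Psi_ i) w (rhooo i) (mPsi_ i) (PM i) (P0 i)).
  by have [_ ->] := rintZ (exprn_ge0 k (c0 i)) g0 mg gfin.
(* The normalized mass beyond [r] is eventually at most [K + 1], since it is dominated by the
   integral of [ramp r] with limit [K]; this bounds the inner integrals by [M * (K + 1) ^+ k]. *)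
apply: (@one_factor I F FF c rho mu vag _ _ (M * (K + 1) ^+ k) r r0).
- by move=> i; apply: measurable_funM => //; exact: inner_meas.
- have H2 : c i * rint (rho i) (ramp r) @[i --> F] --> K.
    apply: (conv _ 1 (r / 2)) => //; first by rewrite divr_gt0.
    + exact: ramp_continuous.
    + exact: ramp01.
    + by move=> w; exact: ramp0.
  have : \forall i \near F, c i * rint (rho i) (ramp r) <= K + 1.
    by apply: (cvgr_le K) => //; lra.
  apply: filterS => i Hi w; rewrite mulr_ge0 ?exprn_ge0 ?inner_ge0//=.
  have ci : c i * fine (rho i [set w | (r < enorm w)%R]) <= K + 1.
    apply: le_trans Hi; rewrite ler_wpM2l// -lee_fin fineK ?ge0_fin_numE// rintE.
    - rewrite -[leLHS]mul1e -[X in (X * _)%E]/(1%:E).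
      rewrite -(setIT [set w | (r < enorm w)%R]) -integral_indic//; last exact: measurable_enorm_gt.
      rewrite mul1e; apply: ge0_le_integral => //.
      + by apply/measurable_EFinP/measurable_indic; exact: measurable_enorm_gt.
      + by apply/measurable_EFinP; exact: measurable_ramp.
      + move=> v _; rewrite lee_fin indicE; case: (boolP (v \in _)) => [|_].
          by rewrite inE /= => /ltW rv; rewrite ramp1.
        by have /andP[] := ramp01 r v.
    - by move=> v; have /andP[] := ramp01 r v.
    - apply: (@prob_int_fin _ _ (rho i) (ramp r) 1); last exact: ramp01.
        by rewrite (le_lt_trans (probability_le1 (rho i) measurableT))// ltry.
      exact: measurable_ramp.
  apply: (le_trans (ler_wpM2l (exprn_ge0 k (c0 i)) (inner_bnd (rho i) (Psi_ i) w (rhooo i) (mPsi_ i) (PM i) (P0 i)))).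
  rewrite mulrCA -exprMn ler_wpM2l// lerXn2r ?nnegrE//.
    by rewrite mulr_ge0// fine_ge0.
  by rewrite addr_ge0// rint_ge0// => v; have /andP[] := ramp01 r v.
- move=> i w wr; rewrite (_ : (fun s => _) = cst 0).
    by rewrite /rint integral0 mulr0.
  by apply/funext => s; rewrite P0//; exists ord0.
- move=> w; have := IH (V * I)%type (filter_prod (nbhs w) F) _ (fun p => c p.2)
    (fun p => rho p.2) (fun p s => Psi_ p.2 (tcons (p.1, s))) (fun s => Psi (tcons (w, s))).
  apply => //.
  + exact: vague_cvg_prod.
  + by move=> p; exact: mcons.
  + exact: mcons.
  + by move=> p s; exact: (fcons0 _ _ _ (P0 p.2)).
  + by move=> s; exact: (fcons0 _ _ _ P0').
Qed.

End vague_convergence.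

(** * Tails and laws of the noise *)

Lemma gt1_ltr_powR {R : realType} (a x y : R) : 1 < a -> x < y -> a `^ x < a `^ y.
Proof.
move=> a1 xy; have a0 : a != 0 by rewrite gt_eqF// (lt_trans ltr01).
by rewrite /powR (negbTE a0) ltr_expR ltr_pM2r// ln_gt0.
Qed.

Section tail_estimates.
Context {R : realType} {d : nat} {disp : measure_display} {Omega : measurableType disp}.
Variable P : probability Omega R.
Local Notation V := 'cV[R]_d.+1.
Variable Z0 : Omega -> V.
Hypothesis mZ0 : measurable_fun setT Z0.
Variable alpha : R.
Hypothesis alpha1 : 1 < alpha.
Hypothesis RV : forall t : R, 0 < t ->
  (tail P Z0 (t * x) / tail P Z0 x)%E @[x --> +oo] --> (t `^ (- alpha))%:E.

Definition rtail (x : R) : R := fine (tail P Z0 x).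

Lemma measurable_tail_set x : measurable [set w | x < enorm (Z0 w)].
Proof.
have := mZ0 measurableT (measurable_enorm_gt (d := d.+1) x).
by rewrite setTI.
Qed.

Lemma tailE x : tail P Z0 x = (rtail x)%:E.
Proof.
rewrite /rtail fineK// ge0_fin_numE// (le_lt_trans (probability_le1 _ _)) ?ltry//.
exact: measurable_tail_set.
Qed.

Lemma rtail_ge0 x : 0 <= rtail x.
Proof. exact: fine_ge0. Qed.

Lemma rtail_le x y : x <= y -> rtail y <= rtail x.
Proof.
move=> xy; rewrite -lee_fin -!tailE; apply: le_measure; rewrite ?inE.
- exact: measurable_tail_set.
- exact: measurable_tail_set.
- by move=> w /=; exact: le_lt_trans.
Qed.

Lemma rtail_le1 x : rtail x <= 1.
Proof.
by rewrite -lee_fin -tailE; apply: probability_le1; exact: measurable_tail_set.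
Qed.

Lemma rtail_ratio_near t : 0 < t -> forall c c', c < t `^ (- alpha) < c' ->
  \forall x \near +oo, 0 < rtail x /\ c * rtail x < rtail (t * x) < c' * rtail x.
Proof.
move=> t0 c c' /andP[ct tc'].
pose c1 := Num.max 0 c.
have c1t : c1 < t `^ (- alpha) by rewrite /c1 gt_max powR_gt0.
have tp0 := powR_gt0 (- alpha) t0.
pose e := Num.min (t `^ (- alpha) - c1) (c' - t `^ (- alpha)).
have e0 : 0 < e by rewrite lt_min !subr_gt0 c1t.
have e1 : e <= t `^ (- alpha) - c1 by rewrite /e ge_min lexx.
have e2 : e <= c' - t `^ (- alpha) by rewrite /e ge_min lexx orbT.
have /fine_cvgP[fin /cvgrPdist_lt/(_ _ e0) H] := RV t0.
near=> x.
have fx : (tail P Z0 (t * x) / tail P Z0 x)%E \is a fin_num by near: x; exact: fin.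
have : `|t `^ (- alpha) - fine (tail P Z0 (t * x) / tail P Z0 x)%E| < e by near: x; exact: H.
(* A vanishing tail at [x] would make the ratio infinite or, if both tails vanish, equal to 0.
   Thanks to the maximum with 0 in [c1], [e] is so small that 0 is too far from the limit. *)
have [x0|x0] := eqVneq (rtail x) 0.
  exfalso; move: fx; rewrite !tailE x0 inve0 => fx.
  have r0 : rtail (t * x) = 0.
    apply/eqP; rewrite eq_le rtail_ge0 andbT leNgt; apply/negP => r0.
    by move: fx; rewrite gt0_muley ?lte_fin.
  have := near H x; rewrite /= !tailE x0 r0 mul0e subr0 => H'.
  have {}H' : `|t `^ (- alpha)| < e by apply: H'.
  have := ler_norm (t `^ (- alpha)).
  have : 0 <= c1 by rewrite /c1 le_max lexx.
  by lra.
rewrite !tailE.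
have xp : 0 < rtail x by rewrite lt_neqAle eq_sym x0 rtail_ge0.
rewrite inver (negbTE x0) -EFinM /= ltr_norml => /andP[h1 h2]; split=> //.
have cc1 : c <= c1 by rewrite /c1 le_max lexx orbT.
have q1 : c < rtail (t * x) / rtail x by lra.
have q2 : rtail (t * x) / rtail x < c' by lra.
by rewrite ltr_pdivlMr// in q1; rewrite ltr_pdivrMr// in q2; rewrite q1.
Unshelve. all: by end_near. Qed.

Lemma pinfty_nearP (Q : R -> Prop) : (\forall x \near +oo, Q x) ->
  exists2 x0, 0 < x0 & forall x, x0 <= x -> Q x.
Proof.
move=> [M [_ HM]]; exists (Num.max M 0 + 1).
  by rewrite ltr_wpDl// le_max lexx orbT.
move=> x Mx; apply: HM; have : M <= Num.max M 0 by rewrite le_max lexx.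
by lra.
Qed.

(** Potter-type bound along powers of 2: a ratio [rho] strictly between the powers of 2 with
    exponents [- alpha] and [- p] is iterated. Its position below the latter makes the moment series
    of order [p] converge. *)
Lemma rtail_pow_upper p : 0 < p < alpha -> exists x0 rho : R,
  [/\ 0 < x0, 0 <= rho, rho * 2 `^ p < 1 & forall j, rtail (2 ^+ j * x0) <= rho ^+ j].
Proof.
move=> /andP[p0 pa].
have h2 : (1 : R) < 2 by lra.
have pa2 : (2 : R) `^ (- alpha) < 2 `^ (- p).
  by apply: gt1_ltr_powR; rewrite ?ltrN2.
pose rho : R := (2 `^ (- alpha) + 2 `^ (- p)) / 2.
have rho1 : 2 `^ (- alpha) < rho by rewrite /rho; lra.
have rho2 : rho < 2 `^ (- p) by rewrite /rho; lra.
have rho0 : 0 < rho by rewrite (lt_trans _ rho1)// powR_gt0.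
have c12 : (-1 : R) < 2 `^ (- alpha) < rho.
  by rewrite rho1 andbT (lt_trans _ (powR_gt0 _ _))//; lra.
have [x0 x00 H] := pinfty_nearP (rtail_ratio_near (ltr0Sn R 1) c12).
exists x0, rho; split => //; first exact: ltW.
  by rewrite -ltr_pdivlMr ?powR_gt0// mul1r -powRN.
elim=> [|j IH]; first by rewrite expr0 rtail_le1.
have := H (2 ^+ j * x0) _; rewrite ler_peMl ?(ltW x00)// ?exprn_ege1 ?(ltW h2)//.
move=> /(_ isT)[_ /andP[_]]; rewrite mulrA -exprS => /ltW/le_trans; apply.
by rewrite exprS ler_wpM2l// ltW.
Qed.

(** Dyadic layers: where the norm exceeds [x0], it lies between consecutive [2 ^+ j * x0], and the
    sum of the layers is dominated by a geometric series of ratio [g < 1]. *)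
Lemma tail_moment p : 0 < p < alpha -> exists2 K : R, 0 <= K &
  (\int[P]_w (enorm (Z0 w) `^ p)%:E <= K%:E)%E.
Proof.
move=> pa; have [p0 _] := andP pa.
have [x0 [rho [x00 rho0 rho1 H]]] := rtail_pow_upper pa.
set g := rho * 2 `^ p in rho1; have g0 : 0 <= g by rewrite mulr_ge0 ?powR_ge0.
pose A j := [set w | 2 ^+ j * x0 < enorm (Z0 w)].
have mA j : measurable (A j) by exact: measurable_tail_set.
pose c j : R := (2 ^+ j.+1 * x0) `^ p.
have c0 j : 0 <= c j by exact: powR_ge0.
have mf j : measurable_fun setT (fun w => (c j * \1_(A j) w)%:E).
  apply/measurable_EFinP; apply: measurable_funM; first exact: measurable_cst.
  exact: measurable_indic.
have f0 j w : (0 <= (c j * \1_(A j) w)%:E)%E by rewrite lee_fin mulr_ge0.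
have mS : measurable_fun setT (fun w => \sum_(0 <= j <oo) (c j * \1_(A j) w)%:E)%E.
  by apply: ge0_emeasurable_sum.
have mE : measurable_fun setT (fun w => enorm (Z0 w)).
  by apply: measurableT_comp => //; exact: measurable_enorm.
have mN : measurable_fun setT (fun w => (enorm (Z0 w) `^ p)%:E).
  apply/measurable_EFinP.
  by apply: (@measurableT_comp _ _ _ _ _ _ (fun u : R => u `^ p)) => //; exact: measurable_powR.
have pt w : ((enorm (Z0 w) `^ p)%:E <= (x0 `^ p)%:E + \sum_(0 <= j <oo) (c j * \1_(A j) w)%:E)%E.
  have [wx|xw] := leP (enorm (Z0 w)) x0.
    rewrite -[leLHS]adde0 leeD ?nneseries_ge0// lee_fin.
    by apply: ge0_ler_powR; rewrite ?nnegrE ?enorm_ge0// ltW.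
  have ex : exists n, enorm (Z0 w) <= 2 ^+ n * x0.
    exists (Num.truncn (enorm (Z0 w) / x0)).+1; rewrite -ler_pdivrMr//.
    have /andP[_ /ltW/le_trans] : (Num.truncn (enorm (Z0 w) / x0))%:R <= enorm (Z0 w) / x0 <
      (Num.truncn (enorm (Z0 w) / x0)).+1%:R by apply: truncn_itv; rewrite divr_ge0 ?enorm_ge0// ltW.
    by apply; rewrite -natrX ler_nat ltnW// ltn_expl.
  case: (ex_minnP ex) => -[|n]; first by rewrite expr0 mul1r leNgt xw.
  move=> wn /(_ n) Hn.
  have nw : 2 ^+ n * x0 < enorm (Z0 w).
    by rewrite ltNge; apply/negP => /Hn; rewrite ltnn.
  rewrite -[leLHS]add0e leeD ?lee_fin ?powR_ge0//.
  apply: (@le_trans _ _ (\sum_(0 <= j < n.+1) (c j * \1_(A j) w)%:E)%E); last first.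
    by apply: nneseries_lim_ge.
  rewrite big_nat_recr//= -[leLHS]add0e leeD ?sume_ge0// lee_fin.
  rewrite indicE mem_set// mulr1.
  by apply: ge0_ler_powR; rewrite ?nnegrE ?enorm_ge0 ?mulr_ge0 ?exprn_ge0// ltW.
exists (x0 `^ p + (2 * x0) `^ p / (1 - g)).
  by rewrite addr_ge0 ?divr_ge0 ?powR_ge0// subr_ge0 ltW.
apply: (@le_trans _ _ (\int[P]_w ((x0 `^ p)%:E + \sum_(0 <= j <oo) (c j * \1_(A j) w)%:E))%E).
  apply: ge0_le_integral => //.
  - by move=> w _; rewrite lee_fin powR_ge0.
  - exact: emeasurable_funD.
rewrite ge0_integralD//; last 2 first.
- by move=> w _; rewrite lee_fin powR_ge0.
- by move=> w _; exact: nneseries_ge0.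
rewrite (integral_cst P measurableT) [X in (_ * X)%E]probability_setT mule1 EFinD leeD//.
rewrite integral_nneseries//.
apply: lime_le; first by apply: is_cvg_nneseries => j _ _; exact: integral_ge0.
apply: nearW => N.
apply: (@le_trans _ _ (\sum_(0 <= j < N) ((2 * x0) `^ p * g ^+ j)%:E)%E).
  apply: lee_sum => j _.
  under eq_integral do rewrite EFinM.
  rewrite ge0_integralZl//; [|exact/measurable_EFinP/measurable_indic|by rewrite lee_fin].
  have -> : (\int[P]_w (\1_(A j) w)%:E = (rtail (2 ^+ j * x0))%:E)%E.
    by rewrite integral_indic// setIT -tailE.
  rewrite -EFinM lee_fin; apply: (@le_trans _ _ (c j * rho ^+ j)); first exact: ler_wpM2l.
  have -> : c j = (2 * x0) `^ p * (2 `^ p) ^+ j.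
    rewrite /c exprS -mulrA [2 ^+ j * x0]mulrC mulrA powRM ?mulr_ge0 ?exprn_ge0 ?(ltW x00)//.
    by rewrite -(powR_mulrn j (powR_ge0 2 p)) -powRrM [p * _]mulrC powRrM powR_mulrn.
  by rewrite -mulrA -exprMn [2 `^ p * rho]mulrC.
rewrite sumEFin lee_fin -mulr_sumr ler_wpM2l ?powR_ge0//.
have E : (\sum_(0 <= j < N) g ^+ j) * (1 - g) = 1 - g ^+ N.
  elim: N => [|N IH]; first by rewrite big_nil mul0r expr0 subrr.
  by rewrite big_nat_recr//= mulrDl IH exprSr; ring.
rewrite -[leRHS]mul1r ler_pdivlMr ?subr_gt0// E.
by rewrite lerBlDr lerDl exprn_ge0.
Qed.

(** Any integer [s] above [alpha] works: the tail loses at most a factor [2^-1 ^+ s] per doubling.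
    This is what lets powers of [eta] beat the normalization. *)
Lemma rtail_pow_lower : exists s : nat, exists x0 c : R,
  [/\ 0 < x0, 0 < c & forall x, x0 <= x -> c <= x ^+ s * rtail x].
Proof.
pose s := (Num.truncn alpha).+1.
have als : alpha < s%:R.
  have /andP[_] : (Num.truncn alpha)%:R <= alpha < (Num.truncn alpha).+1%:R.
    by apply: truncn_itv; rewrite (le_trans ler01)// ltW.
  by [].
have h2 : (1 : R) < 2 by lra.
have s2 : (2^-1) ^+ s < (2 : R) `^ (- alpha).
  rewrite exprVn -powR_mulrn// -powRN; apply: gt1_ltr_powR; rewrite ?ltrN2//.
have c12 : (2^-1) ^+ s < (2 : R) `^ (- alpha) < 2 `^ (- alpha) + 1.
  by rewrite s2 ltrDl ltr01.
have [x0 x00 H] := pinfty_nearP (rtail_ratio_near (ltr0Sn R 1) c12).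
have [H0 _] := H x0 (lexx _).
have low j : (2^-1) ^+ (s * j) * rtail x0 <= rtail (2 ^+ j * x0).
  elim: j => [|j IH]; first by rewrite muln0 !expr0 !mul1r.
  have := H (2 ^+ j * x0) _; rewrite ler_peMl ?(ltW x00)// ?exprn_ege1 ?(ltW h2)//.
  move=> /(_ isT)[_ /andP[+ _]]; rewrite mulrA -exprS => /ltW; apply: le_trans.
  by rewrite mulnS exprD -mulrA ler_wpM2l// exprn_ge0// invr_ge0.
have c0 : 0 < (x0 / 2) ^+ s * rtail x0 by rewrite mulr_gt0// exprn_gt0// divr_gt0.
exists s, x0, ((x0 / 2) ^+ s * rtail x0); split => // x x0x.
have ex : exists n, x <= 2 ^+ n * x0.
  exists (Num.truncn (x / x0)).+1; rewrite -ler_pdivrMr//.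
  have /andP[_ /ltW/le_trans] : (Num.truncn (x / x0))%:R <= x / x0 <
    (Num.truncn (x / x0)).+1%:R by apply: truncn_itv; rewrite divr_ge0// ltW// (lt_le_trans x00).
  by apply; rewrite -natrX ler_nat ltnW// ltn_expl.
have x_gt0 : 0 < x by exact: lt_le_trans x0x.
case: (ex_minnP ex) => n wn Hn.
have key : x0 / 2 * 2 ^+ n <= x.
  case: n wn Hn => [|n] _ Hn; first by rewrite expr0 mulr1; lra.
  have nw : 2 ^+ n * x0 < x by rewrite ltNge; apply/negP => /Hn; rewrite ltnn.
  by rewrite exprS mulrA divfK// mulrC ltW.
have := le_trans (low n) (rtail_le wn).
move=> /(ler_wpM2l (exprn_ge0 s (ltW x_gt0))); apply: le_trans.
rewrite mulrA ler_wpM2r ?rtail_ge0//.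
have key2 : x0 / 2 <= x * 2^-1 ^+ n by rewrite exprVn ler_pdivlMr ?exprn_gt0.
rewrite mulnC exprM -exprMn; apply: lerXn2r => //; rewrite nnegrE.
  by rewrite divr_ge0// ltW.
by rewrite mulr_ge0 ?exprn_ge0 ?invr_ge0// ltW.
Qed.

Lemma rtail_gt0 x : 0 < rtail x.
Proof.
have [s [x0 [c [x00 c0 H]]]] := rtail_pow_lower.
have := H (Num.max x0 x) _; rewrite le_max lexx => /(_ isT) h.
have : 0 < Num.max x0 x ^+ s * rtail (Num.max x0 x) by exact: lt_le_trans h.
rewrite pmulr_rgt0; last by rewrite exprn_gt0// lt_max x00.
by move=> /lt_le_trans; apply; apply: rtail_le; rewrite le_max lexx orbT.
Qed.

Lemma rtail_markov p : 0 < p < alpha -> exists2 K : R, 0 <= K &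
  forall x, 0 < x -> x `^ p * rtail x <= K.
Proof.
move=> pa; have [p0 _] := andP pa; have [K K0 HK] := tail_moment pa.
exists K => // x x0; rewrite -lee_fin; apply: le_trans HK.
have -> : (x `^ p * rtail x)%:E =
    ((x `^ p)%:E * \int[P]_w (\1_[set w | x < enorm (Z0 w)] w)%:E)%E.
  by rewrite integral_indic// ?setIT ?EFinM -?tailE//; exact: measurable_tail_set.
rewrite -ge0_integralZl//; last 2 first.
- exact/measurable_EFinP/measurable_indic/measurable_tail_set.
- by rewrite lee_fin powR_ge0.
apply: ge0_le_integral => //.
- by move=> w _; rewrite mule_ge0// lee_fin powR_ge0.
- apply: emeasurable_funM; first exact: measurable_cst.
  exact/measurable_EFinP/measurable_indic/measurable_tail_set.
- apply/measurable_EFinP.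
  apply: (@measurableT_comp _ _ _ _ _ _ (fun u : R => u `^ p)); first exact: measurable_powR.
  by apply: measurableT_comp => //; exact: measurable_enorm.
- move=> w _; rewrite -EFinM lee_fin indicE.
  case: (boolP (w \in _)) => [|_]; last by rewrite mulr0 powR_ge0.
  rewrite inE mulr1 => /= /ltW xw.
  by apply: ge0_ler_powR; rewrite ?nnegrE ?enorm_ge0 ?(ltW x0)// ltW.
Qed.

End tail_estimates.

Section laws.
Context {disp} {Omega : measurableType disp} {R : realType} (P : probability Omega R).

Definition law {disp'} {T : measurableType disp'} (Y : Omega -> T)
    (mY : measurable_fun setT Y) : probability T R :=
  [the probability _ _ of distribution P (mfun_Sub (mem_set mY))].

Lemma lawE {disp'} {T : measurableType disp'} (Y : Omega -> T)
  (mY : measurable_fun setT Y) A : law mY A = P (Y @^-1` A).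
Proof. by []. Qed.

Lemma law_int {disp'} {T : measurableType disp'} (Y : Omega -> T)
    (mY : measurable_fun setT Y) (f : T -> \bar R) : measurable_fun setT f ->
  (forall y, (0 <= f y)%E) ->
  (\int[law mY]_y f y = \int[P]_w f (Y w))%E.
Proof.
move=> mf f0; rewrite (eq_integral_set_fun (m2 := pushforward P Y)) //.
by rewrite (ge0_integral_pushforward mY)// preimage_setT.
Qed.

Lemma law_rint {disp'} {T : measurableType disp'} (Y : Omega -> T)
    (mY : measurable_fun setT Y) (f : T -> R) : measurable_fun setT f ->
  (forall y, 0 <= f y) -> rint (law mY) f = rint P (f \o Y).
Proof.
move=> mf f0; rewrite /rint law_int//; exact/measurable_EFinP.
Qed.

End laws.

Section noise_tuples.
Context {R : realType} {d : nat} {disp} {Omega : measurableType disp}.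
Variable P : probability Omega R.
Local Notation V := 'cV[R]_d.+1.
Variable Z : nat -> Omega -> V.
Hypothesis mZ : forall n, measurable_fun setT (Z n).
Hypothesis iidZ : iid P Z.

Lemma measurable_scaled eta n : measurable_fun setT (fun w => eta *: Z n w).
Proof.
apply: measurable_fun_cV => i.
rewrite (_ : (fun _ => _) = fun w => eta * (Z n w i ord0)); last first.
  by apply/funext => w; rewrite mxE.
apply: measurable_funM; first exact: measurable_cst.
by apply: (measurableT_comp (measurable_coord i)); exact: mZ.
Qed.

Definition nlaw eta : probability V R := law P (measurable_scaled eta 0).

Definition ntuple eta k (J : k.-tuple nat) (w : Omega) : k.-tuple V :=
  map_tuple (fun i => eta *: Z i w) J.

Lemma measurable_ntuple eta k (J : k.-tuple nat) : measurable_fun setT (ntuple eta J).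
Proof.
apply/measurable_fun_tnthP => i.
rewrite (_ : _ \o _ = fun w => eta *: Z (tnth J i) w); last first.
  by apply/funext => w /=; rewrite tnth_map.
exact: measurable_scaled.
Qed.

Lemma ntuple_law eta k (J : k.-tuple nat) A : uniq J -> measurable A ->
  law P (measurable_ntuple eta J) A = tmeas (nlaw eta) k A.
Proof.
move=> uJ mA; apply: tmeas_unique => //.
  by rewrite [X in (X < _)%E]probability_setT ltry.
move=> B mB; transitivity (P (ntuple eta J @^-1` box B)) => //.
(* [iid] asks for sets indexed by all steps: a step in [J] receives the set of its position, any
   other step receives [setT]. *)
pose C i := if insub (index i J) is Some j then (fun z => eta *: z) @^-1` B j else setT.
have mC i : measurable (C i).
  rewrite /C; case: insubP => // j _ _.
  rewrite -[X in measurable X]setTI.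
  apply: (_ : measurable_fun setT (fun z : V => eta *: z)) => //.
  apply: measurable_fun_cV => l.
  rewrite (_ : (fun _ => _) = fun w : V => eta * (w l ord0)); last first.
    by apply/funext => w; rewrite mxE.
  by apply: measurable_funM; [exact: measurable_cst|exact: measurable_coord].
have CE j : C (tnth J j) = (fun z => eta *: z) @^-1` B j.
  rewrite /C insubT; first by rewrite (tnth_nth 0%N) index_uniq ?size_tuple.
  move=> lt; congr (_ @^-1` B _); apply: val_inj => /=.
  by rewrite (tnth_nth 0%N) index_uniq ?size_tuple.
have -> : ntuple eta J @^-1` box B = \bigcap_(n in [set` (J : seq nat)]) Z n @^-1` C n.
  apply/seteqP; split => w /= H.
    move=> n /= /tnthP[j ->]; rewrite CE /=.
    by have := H j; rewrite tnth_map.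
  by move=> j; have := H (tnth J j) (mem_tnth j J); rewrite CE /= tnth_map.
have [i1 i2] := iidZ; rewrite i2// big_tuple; apply: eq_bigr => j _.
by rewrite i1// CE.
Qed.

Lemma ntuple_int eta k (J : k.-tuple nat) (f : k.-tuple V -> \bar R) : uniq J ->
  measurable_fun setT f -> (forall W, (0 <= f W)%E) ->
  (\int[P]_w f (ntuple eta J w) = \int[tmeas (nlaw eta) k]_W f W)%E.
Proof.
move=> uJ mf f0; rewrite -(law_int P (measurable_ntuple eta J))//.
by apply: eq_integral_set_fun => A mA; exact: ntuple_law.
Qed.

Lemma ntuple_rint eta k (J : k.-tuple nat) (f : k.-tuple V -> R) : uniq J ->
  measurable_fun setT f -> (forall W, 0 <= f W) ->
  rint P (fun w => f (ntuple eta J w)) = rint (tmeas (nlaw eta) k) f.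
Proof.
move=> uJ mf f0; rewrite /rint (@ntuple_int eta k J (fun W => (f W)%:E))//.
exact/measurable_EFinP.
Qed.

Lemma nlaw_tail eta r : 0 < eta -> nlaw eta [set z | (r < enorm z)%R] = tail P (Z 0%N) (r / eta).
Proof.
move=> eta0; rewrite lawE /tail; congr (P _); apply/seteqP; split => w /=.
  by rewrite enormZ gtr0_norm// ltr_pdivrMr// mulrC.
by rewrite enormZ gtr0_norm// ltr_pdivrMr// mulrC.
Qed.

Lemma big_noise_prob eta r k (J : k.-tuple nat) : 0 < eta -> uniq J ->
  P [set w | forall j : 'I_k, r < enorm (eta *: Z (tnth J j) w)] =
  (rtail P (Z 0%N) (r / eta) ^+ k)%:E.
Proof.
move=> eta0 uJ.
have mB : measurable [set z : V | (r < enorm z)%R] := measurable_enorm_gt r.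
transitivity (law P (measurable_ntuple eta J) (box (fun=> [set z | (r < enorm z)%R]))).
  rewrite lawE; congr (P _); apply/seteqP; split => w /= H j.
    by have := H j; rewrite tnth_map.
  by have := H j; rewrite tnth_map.
rewrite ntuple_law//; last exact: measurable_box.
rewrite tmeas_box// (eq_bigr (fun=> tail P (Z 0%N) (r / eta))); last first.
  by move=> j _; exact: nlaw_tail.
rewrite big_const_ord iter_mule mule1.
by rewrite (tailE P (mZ 0)) EFin_expe.
Qed.

End noise_tuples.

(** * Measurability of the discrete dynamics *)

Section measurable_dynamics.
Context {R : realType}.

Lemma measurable_jointly_continuous {disp} {T : measurableType disp} m d p
    (f : 'cV[R]_m -> 'cV[R]_d -> 'cV[R]_p) (Y : T -> 'cV[R]_m) (W : T -> 'cV[R]_d) :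
  (forall y w e, 0 < e -> exists2 de, 0 < de & forall y' w',
     enorm (y' - y) < de -> enorm (w' - w) < de -> enorm (f y' w' - f y w) < e) ->
  measurable_fun setT Y -> measurable_fun setT W ->
  measurable_fun setT (fun t => f (Y t) (W t)).
Proof.
move=> cf mY mW; apply: (@measurability _ _ _ _ _ _ (@open 'cV[R]_p)) => //.
move=> _ [U oU <-]; rewrite setTI.
pose c (i : 'I_m + 'I_d) t := match i with inl i => Y t i ord0 | inr i => W t i ord0 end.
apply: (@measurable_rel_open _ _ _ _ c setT) => //.
  case=> i; first by apply: (measurableT_comp (measurable_coord i)).
  by apply: (measurableT_comp (measurable_coord i)).
move=> t Ut; have : nbhs (f (Y t) (W t)) U by exact: open_nbhs_nbhs.
move=> /nbhs_enormP[e e0 eU]; have [de de0 H] := cf (Y t) (W t) e e0.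
pose e' := de / (m + d)%N.+1%:R.
have e'0 : 0 < e' by rewrite divr_gt0.
have E n (v : 'cV[R]_n) : (n <= m + d)%N -> (forall i, `|v i ord0| < e') -> enorm v < de.
  move=> nmd ve; apply: le_lt_trans (enorm_le_sum _) _.
  apply: (@le_lt_trans _ _ (\sum_(i < n) e')); first by apply: ler_sum => i _; exact: ltW.
  rewrite sumr_const card_ord -[_ *+ _]mulr_natl /e' mulrA ltr_pdivrMr// mulrC.
  by rewrite ltr_pM2l// ltr_nat ltnS.
exists e' => // t' _ ct; apply: eU; apply: H; apply: E.
- exact: leq_addr.
- by move=> i; rewrite !mxE; have := ct (inl i).
- exact: leq_addl.
- by move=> i; rewrite !mxE; have := ct (inr i).
Qed.

Lemma measurable_addv {disp} {T : measurableType disp} n (f g : T -> 'cV[R]_n) :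
  measurable_fun setT f -> measurable_fun setT g ->
  measurable_fun setT (fun t => f t + g t).
Proof.
move=> mf mg; apply: measurable_fun_cV => i.
rewrite (_ : (fun _ => _) = fun t => f t i ord0 + g t i ord0); last first.
  by apply/funext => t; rewrite mxE.
apply: measurable_funD.
  by apply: (measurableT_comp (measurable_coord i)).
by apply: (measurableT_comp (measurable_coord i)).
Qed.

Context {m d : nat}.
Variables (a : 'cV[R]_m -> 'cV[R]_m) (sigma : 'cV[R]_m -> 'M[R]_(m, d)).
Variables (b : \bar R) (D : R).
Hypothesis b0 : (0 < b)%E.
Hypothesis D0 : 0 <= D.
Hypothesis aD : forall x y, enorm (a x - a y) <= D * enorm (x - y).
Hypothesis sD : forall x y, opnorm (sigma x - sigma y) <= D * enorm (x - y).

Lemma sigma_mul_continuous (y : 'cV[R]_m) (w : 'cV[R]_d) (e : R) : 0 < e ->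
  exists2 de, 0 < de & forall y' w',
    enorm (y' - y) < de -> enorm (w' - w) < de -> enorm (sigma y' *m w' - sigma y *m w) < e.
Proof.
move=> e0; pose K := D * (enorm w + 1) + opnorm (sigma y) + 1.
have K0 : 0 < K.
  by rewrite ltr_wpDl// addr_ge0 ?opnorm_ge0// mulr_ge0// addr_ge0 ?enorm_ge0.
exists (Num.min 1 (e / K)); first by rewrite lt_min ltr01 divr_gt0.
move=> y' w'; rewrite !lt_min => /andP[_ y1] /andP[w1 w2].
have -> : sigma y' *m w' - sigma y *m w = (sigma y' - sigma y) *m w' + sigma y *m (w' - w).
  by rewrite mulmxBl mulmxBr addrA subrK.
have w'n : enorm w' <= enorm w + 1.
  by have := enorm_sub w' w; lra.
have H1 : enorm ((sigma y' - sigma y) *m w') <= D * (e / K) * (enorm w + 1).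
  apply: (le_trans (enorm_mulmx _ _)); apply: ler_pM; rewrite ?opnorm_ge0 ?enorm_ge0//.
  by apply: (le_trans (sD _ _)); rewrite ler_wpM2l// ltW.
have H2 : enorm (sigma y *m (w' - w)) <= opnorm (sigma y) * (e / K).
  by apply: (le_trans (enorm_mulmx _ _)); rewrite ler_wpM2l ?opnorm_ge0// ltW.
have ek0 : 0 < e / K by rewrite divr_gt0.
apply: le_lt_trans (enormD _ _) _; apply: le_lt_trans (lerD H1 H2) _.
have : K * (e / K) = e by rewrite mulrC divfK// gt_eqF.
by move: (e / K) ek0 {y1 w2 H1 H2} => q q0; rewrite /K; lra.
Qed.

(** One step of the chain in terms of the scaled noise, the variable whose normalized law
    converges. *)
Definition nstep eta y z := y + clip b (eta *: a y + sigma y *m z).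

Lemma nstep_continuous eta (y : 'cV[R]_m) (w : 'cV[R]_d) (e : R) : 0 < e ->
  exists2 de, 0 < de & forall y' w',
    enorm (y' - y) < de -> enorm (w' - w) < de -> enorm (nstep eta y' w' - nstep eta y w) < e.
Proof.
move=> e0; have e20 : 0 < e / 2 by lra.
have [de de0 H] := sigma_mul_continuous y w e20.
pose K := 1 + `|eta| * D; have K0 : 0 < K by rewrite ltr_wpDr// mulr_ge0.
exists (Num.min de (e / 2 / K)); first by rewrite lt_min de0 divr_gt0.
move=> y' w'; rewrite !lt_min => /andP[y1 y2] /andP[w1 w2].
have H1 := H _ _ y1 w1.
rewrite /nstep opprD addrACA; apply: le_lt_trans (enormD _ _) _.
have H2 := clip_lip (eta *: a y' + sigma y' *m w') (eta *: a y + sigma y *m w) b0.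
have H3 : enorm (eta *: a y' + sigma y' *m w' - (eta *: a y + sigma y *m w)) <=
    `|eta| * (D * enorm (y' - y)) + enorm (sigma y' *m w' - sigma y *m w).
  rewrite opprD addrACA -scalerBr; apply: (le_trans (enormD _ _)).
  by rewrite enormZ lerD2r ler_wpM2l.
have H4 : K * enorm (y' - y) < e / 2 by rewrite mulrC -ltr_pdivlMr.
by move: H4; rewrite /K mulrDl mul1r -mulrA; lra.
Qed.

Lemma X_iterS eta x z n : X_iter a sigma eta b x z n.+1 =
  nstep eta (X_iter a sigma eta b x z n) (eta *: z n.+1).
Proof. by rewrite /nstep /= -scalemxAl scalemxAr. Qed.

Lemma measurable_nstep {disp} {T : measurableType disp} eta (Y : T -> 'cV[R]_m)
    (W : T -> 'cV[R]_d) : measurable_fun setT Y -> measurable_fun setT W ->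
  measurable_fun setT (fun t => nstep eta (Y t) (W t)).
Proof. by apply: measurable_jointly_continuous; exact: nstep_continuous. Qed.

Lemma measurable_scalev {disp} {T : measurableType disp} n (c : R) (f : T -> 'cV[R]_n) :
  measurable_fun setT f -> measurable_fun setT (fun t => c *: f t).
Proof.
move=> mf; apply: measurable_fun_cV => i.
rewrite (_ : (fun _ => _) = fun t => c * f t i ord0); last first.
  by apply/funext => t; rewrite mxE.
apply: measurable_funM; first exact: measurable_cst.
by apply: (measurableT_comp (measurable_coord i)).
Qed.

Lemma measurable_X_iter {disp} {T : measurableType disp} eta x (z : nat -> T -> 'cV[R]_d) n :
  (forall j, measurable_fun setT (z j)) ->
  measurable_fun setT (fun t => X_iter a sigma eta b x (fun j => z j t) n).
Proof.
move=> mz; elim: n => [|n IH]; first exact: measurable_cst.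
rewrite (_ : (fun _ => _) = fun t => nstep eta (X_iter a sigma eta b x (fun j => z j t) n)
   (eta *: z n.+1 t)); last by apply/funext => t; rewrite X_iterS.
by apply: measurable_nstep => //; exact: measurable_scalev.
Qed.

(** The path depends on the finitely many states up to step [n], and J1 balls contain sup-norm
    balls, so preimages of open sets are open in the coordinates of these states. *)
Lemma measurable_X_path {disp} {T : measurableType disp} eta x (z : nat -> T -> 'cV[R]_d) :
  0 < eta -> (forall j, measurable_fun setT (z j)) ->
  measurable_fun setT (fun t => X_path a sigma eta b x (fun j => z j t)).
Proof.
move=> eta0 mz.
pose n := Num.truncn eta^-1.
apply: (@measurability _ _ _ _ _ _ (@open (skorokhod R m))) => //.
move=> _ [U oU <-]; rewrite setTI.
pose X t j := X_iter a sigma eta b x (fun j => z j t) j.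
pose c (i : 'I_n.+1 * 'I_m) t := X t i.1 i.2 ord0.
apply: (@measurable_rel_open _ _ _ _ c setT) => //.
  by move=> i; apply: (measurableT_comp (measurable_coord i.2)); exact: measurable_X_iter.
move=> t Ut; have : nbhs (X_path a sigma eta b x (fun j => z j t)) U.
  exact: open_nbhs_nbhs.
move=> /nbhs_ballP[e /= e0 eU].
pose e' := e / 2 / m.+1%:R; have e'0 : 0 < e' by rewrite !divr_gt0.
exists e' => // t' _ ct; apply: eU; rewrite /ball/=.
suff : J1_dist (X_path a sigma eta b x (fun j => z j t))
    (X_path a sigma eta b x (fun j => z j t')) <= e / 2.
  by move=> H; apply: le_lt_trans H _; rewrite ltr_pdivrMr// ltr_pMr// ltr1n.
apply: J1_dist_sup => u u01; rewrite /= /step_path u01.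
have ltn : (Num.truncn (u / eta) < n.+1)%N.
  rewrite ltnS; apply: le_truncn; rewrite ler_pdivrMr// mulVf ?gt_eqF//.
  by move: u01; rewrite in_itv/= => /andP[].
apply: (le_trans (enorm_le_sum _)).
apply: (@le_trans _ _ (\sum_(i < m) e')).
  apply: ler_sum => i _; rewrite !mxE distrC.
  by have := ct (Ordinal ltn, i); rewrite /c /X /= => /ltW.
rewrite sumr_const card_ord -[_ *+ _]mulr_natl /e' mulrA ler_pdivrMr// mulrC.
by rewrite ler_pM2l ?divr_gt0// ler_nat.
Qed.

End measurable_dynamics.

(** * Accumulated effect of the small noises *)

Section exponential_bound.
Context {R : realType}.

(** A crude second-order bound, but with the exact linear term: the latter has mean zero when
    applied to the noise. *)
Lemma expR_le_quadratic (t : R) : expR t <= 1 + t + t ^+ 2 * expR `|t|.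
Proof.
have [t0|t0] := leP 0 t.
  rewrite ger0_norm//.
  have h1 : 1 - t <= expR (- t) by have := expR_ge1Dx (- t).
  have h2 : expR t * expR (- t) = 1 by rewrite -expRD subrr expR0.
  have h3 := expR_gt0 t.
  have h4 : expR t * (1 - t) <= 1 by rewrite -[leRHS]h2 ler_wpM2l// ltW.
  have : t * (expR t * (1 - t)) <= t * 1 by rewrite ler_wpM2l.
  by lra.
rewrite ltr0_norm//; set u := - t; have -> : t = - u by rewrite opprK.
have u0 : 0 < u by rewrite oppr_gt0.
have h1 := expR_ge1Dx u; have h2 : expR u * expR (- u) = 1 by rewrite -expRD subrr expR0.
have h3 := expR_gt0 (- u).
have h4 : (1 + u) * expR (- u) <= 1 by rewrite -[leRHS]h2 ler_wpM2r// ltW.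
have h5 : (1 + u) * expR (- u) <= (1 + u) * (1 - u + u ^+ 2).
  apply: (le_trans h4); rewrite (_ : (1 + u) * _ = 1 + u ^+ 3); last by ring.
  by rewrite lerDl exprn_ge0// ltW.
rewrite ler_pM2l in h5; last by lra.
have h6 : u ^+ 2 <= u ^+ 2 * expR u.
  by apply: ler_peMr; [exact: sqr_ge0|lra].
by rewrite sqrrN; lra.
Qed.

Lemma near0r_lt (c : R) : 0 < c -> \forall eta \near (0 : R)^'+, 0 < eta < c.
Proof.
move=> c0; near=> eta; apply/andP; split; near: eta; first exact: nbhs_right_gt.
exact: nbhs_right_lt.
Unshelve. all: by end_near. Qed.

Context {d : nat} {disp} {Omega : measurableType disp}.
Variable P : probability Omega R.
Local Notation V := 'cV[R]_d.+1.
Variable Z0 : Omega -> V.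
Hypothesis mZ0 : measurable_fun setT Z0.
Hypothesis Z0_mean : mean_zero P Z0.

Lemma linear_mean_zero (u : 'I_d.+1 -> R) :
  P.-integrable setT (fun w => (\sum_j u j * Z0 w j ord0)%:E) /\
  (\int[P]_w (\sum_j u j * Z0 w j ord0)%:E = 0)%E.
Proof.
elim: (index_enum _) => [|j s [IH1 IH2]].
  under eq_fun do rewrite big_nil.
  split; first exact: integrable0.
  by rewrite integral0.
have [h1 h2] := Z0_mean j; rewrite expectation.unlock in h2.
have E w : (\sum_(i <- j :: s) u i * Z0 w i ord0)%:E =
  ((u j)%:E * (Z0 w j ord0)%:E + (\sum_(i <- s) u i * Z0 w i ord0)%:E)%E.
  by rewrite big_cons EFinD EFinM.
have i1 : P.-integrable setT (fun w => (u j)%:E * (Z0 w j ord0)%:E)%E.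
  by apply: integrableZl.
split.
  rewrite (_ : (fun w => _) = (fun w => (u j)%:E * (Z0 w j ord0)%:E +
    (\sum_(i <- s) u i * Z0 w i ord0)%:E)%E); last by apply/funext => w; exact: E.
  by apply: integrableD.
under eq_integral do rewrite E.
by rewrite integralD// IH2 adde0 integralZl// h2 mule0.
Qed.

Definition trunc (delta : R) n (z : 'cV[R]_n) : 'cV[R]_n := if enorm z <= delta then z else 0.

Variables (C delta p K : R).
Hypothesis C0 : 0 <= C.
Hypothesis delta0 : 0 < delta.
Hypothesis p12 : 1 < p < 2.
Hypothesis K0 : 0 <= K.
Hypothesis ZK : (\int[P]_w (enorm (Z0 w) `^ p)%:E <= K%:E)%E.

(** Bounds the excess of an exponential moment over 1. Only moments of order [p < 2] are used, since
    [alpha] may be below 2. The first summand pays for the linear term removed by truncation, the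
    second for the quadratic remainder on the ball of radius [delta]. *)
Definition chernoff_excess (eta s : R) : R :=
  eta `^ p * K * (s * C * delta `^ (1 - p) + s ^+ 2 * C ^+ 2 * delta `^ (2 - p) * expR (s * C * delta)).

(** The linear term on the right is that of [z] itself, not of its truncation, because only that one
    has mean zero. Below [delta] a square is dominated by the power [p]; above [delta] the missing
    linear term is. *)
Lemma chernoff_pointwise (u : 'I_d.+1 -> R) (s : R) (z : V) : 0 <= s ->
  (forall z : V, `|\sum_j u j * z j ord0| <= C * enorm z) ->
  expR (s * (\sum_j u j * trunc delta z j ord0)) <=
  1 + s * (\sum_j u j * z j ord0) +
  (s * C * delta `^ (1 - p) + s ^+ 2 * C ^+ 2 * delta `^ (2 - p) * expR (s * C * delta))
    * enorm z `^ p.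
Proof.
move=> s0 uC; have uz := uC z; set l := \sum_j u j * z j ord0 in uz *.
have [p1 p2] := andP p12; have e0 := enorm_ge0 z.
rewrite mulrDl /trunc; case: ifPn => [zd|].
  have q1 : enorm z ^+ 2 <= delta `^ (2 - p) * enorm z `^ p.
    have -> : enorm z ^+ 2 = enorm z `^ (2 - p) * enorm z `^ p.
      by rewrite -powRD; [rewrite subrK powR_mulrn|rewrite subrK pnatr_eq0].
    rewrite ler_wpM2r ?powR_ge0//; apply: ge0_ler_powR; rewrite ?nnegrE//; first lra.
    exact: ltW.
  have q2 : (s * l) ^+ 2 * expR `|s * l| <=
      s ^+ 2 * C ^+ 2 * delta `^ (2 - p) * expR (s * C * delta) * enorm z `^ p.
    rewrite normrM (ger0_norm s0).
    have h1 : expR (s * `|l|) <= expR (s * C * delta).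
      rewrite ler_expR -mulrA ler_wpM2l//; apply: (le_trans uz); exact: ler_wpM2l.
    have h2 : (s * l) ^+ 2 <= s ^+ 2 * C ^+ 2 * (delta `^ (2 - p) * enorm z `^ p).
      rewrite exprMn -mulrA ler_wpM2l ?sqr_ge0//.
      apply: (@le_trans _ _ (C ^+ 2 * enorm z ^+ 2)); last by rewrite ler_wpM2l ?sqr_ge0.
      rewrite -exprMn -real_normK ?num_real//.
      by apply: lerXn2r; rewrite ?nnegrE// mulr_ge0.
    apply: (le_trans (ler_pM (sqr_ge0 _) (expR_ge0 _) h2 h1)).
    by rewrite le_eqVlt; apply/orP; left; apply/eqP; ring.
  have q3 : 0 <= s * C * delta `^ (1 - p) * enorm z `^ p by rewrite !mulr_ge0 ?powR_ge0.
  by have := expR_le_quadratic (s * l); lra.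
rewrite -ltNge => dz; rewrite big1; last by move=> j _; rewrite mxE mulr0.
rewrite mulr0 expR0.
have q1 : enorm z <= delta `^ (1 - p) * enorm z `^ p.
  have z0 : 0 < enorm z by exact: lt_trans dz.
  have -> : delta `^ (1 - p) = (delta `^ (p - 1))^-1 by rewrite -powRN opprB.
  rewrite mulrC ler_pdivlMr ?powR_gt0//.
  have -> : enorm z `^ p = enorm z * enorm z `^ (p - 1).
    by rewrite -{2}(powRr1 e0) -powRD ?subrKC//; apply/implyP => _; rewrite gt_eqF.
  rewrite ler_wpM2l//; apply: ge0_ler_powR; rewrite ?nnegrE ?subr_ge0 ?(ltW p1)//; exact: ltW.
have q2 : s * C * enorm z <= s * C * delta `^ (1 - p) * enorm z `^ p.
  by rewrite -[leRHS]mulrA ler_wpM2l// mulr_ge0.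
have q3 : - (s * l) <= s * C * enorm z.
  rewrite -mulrN -mulrA ler_wpM2l//; apply: le_trans uz; rewrite -normrN; exact: ler_norm.
have q4 : 0 <= s ^+ 2 * C ^+ 2 * delta `^ (2 - p) * expR (s * C * delta) * enorm z `^ p.
  by rewrite !mulr_ge0 ?powR_ge0 ?expR_ge0 ?sqr_ge0.
by lra.
Qed.

Lemma measurable_trunc n : measurable_fun setT (@trunc delta n).
Proof.
apply: measurable_fun_ifT => //=.
rewrite (_ : (fun _ => _) = (fun u : R => u <= delta) \o @enorm R n) //.
apply: measurable_fun_ler; [exact: measurable_enorm|exact: measurable_cst].
Qed.

Lemma chernoff_step (u : 'I_d.+1 -> R) (eta s : R) : 0 <= s -> 0 <= eta ->
  (forall z : V, `|\sum_j u j * z j ord0| <= C * enorm z) ->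
  (\int[P]_w (expR (s * (\sum_j u j * trunc delta (eta *: Z0 w) j ord0)))%:E <=
   (1 + chernoff_excess eta s)%:E)%E.
Proof.
move=> s0 eta0 uC.
pose A := s * C * delta `^ (1 - p) + s ^+ 2 * C ^+ 2 * delta `^ (2 - p) * expR (s * C * delta).
have A0 : 0 <= A by rewrite addr_ge0// !mulr_ge0 ?powR_ge0 ?expR_ge0 ?sqr_ge0.
have mE : measurable_fun setT (fun w => enorm (Z0 w) `^ p).
  apply: (@measurableT_comp _ _ _ _ _ _ (fun u : R => u `^ p)); first exact: measurable_powR.
  by apply: measurableT_comp => //; exact: measurable_enorm.
have mS : measurable_fun setT (fun w => eta *: Z0 w).
  apply: measurable_fun_cV => i.
  rewrite (_ : (fun _ => _) = fun w => eta * (Z0 w i ord0)); last first.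
    by apply/funext => w; rewrite mxE.
  apply: measurable_funM; first exact: measurable_cst.
  by apply: (measurableT_comp (measurable_coord i)).
have mL : measurable_fun setT (fun w => \sum_j u j * trunc delta (eta *: Z0 w) j ord0).
  apply: measurable_sum => j; apply: measurable_funM; first exact: measurable_cst.
  apply: (measurableT_comp (measurable_coord j)).
  by apply: measurableT_comp mS; exact: measurable_trunc.
have [i1 i2] := linear_mean_zero u.
pose G w := (1 + (s * eta) * (\sum_j u j * Z0 w j ord0) + A * eta `^ p * enorm (Z0 w) `^ p).
have ub w : expR (s * (\sum_j u j * trunc delta (eta *: Z0 w) j ord0)) <= G w.
  have := chernoff_pointwise (eta *: Z0 w) s0 uC.
  rewrite enormZ (ger0_norm eta0) (powRM _ eta0 (enorm_ge0 _)) -/A mulrA.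
  have -> // : \sum_j u j * (eta *: Z0 w) j ord0 = eta * \sum_j u j * Z0 w j ord0.
    by rewrite mulr_sumr; apply: eq_bigr => j _; rewrite mxE mulrCA.
  by rewrite mulrA.
have i3 : P.-integrable setT (fun w => (enorm (Z0 w) `^ p)%:E).
  apply/integrableP; split; first exact/measurable_EFinP.
  apply: le_lt_trans (ltry K); apply: le_trans ZK.
  rewrite le_eqVlt; apply/orP; left; apply/eqP; apply: eq_integral => w _.
  by rewrite gee0_abs// lee_fin powR_ge0.
have mG : measurable_fun setT G.
  apply: measurable_funD; last by apply: measurable_funM => //; exact: measurable_cst.
  apply: measurable_funD; first exact: measurable_cst.
  apply: measurable_funM; first exact: measurable_cst.
  by have /measurable_int/measurable_EFinP := i1.
apply: (@le_trans _ _ (\int[P]_w (G w)%:E)%E).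
  apply: ge0_le_integral => //.
  - apply/measurable_EFinP; apply: (measurableT_comp (@measurable_expR R)).
    by apply: measurable_funM => //; exact: measurable_cst.
  - exact/measurable_EFinP.
  - by move=> w _; rewrite lee_fin.
have GE w : (G w)%:E = (1%:E + ((s * eta)%:E * (\sum_j u j * Z0 w j ord0)%:E +
   (A * eta `^ p)%:E * (enorm (Z0 w) `^ p)%:E))%E by rewrite -!EFinM -!EFinD /G addrA.
under eq_integral do rewrite GE.
have c1 : P.-integrable setT (fun=> 1%:E) := finite_measure_integrable_cst P 1 measurableT.
have c2 : P.-integrable setT (fun w => (s * eta)%:E * (\sum_j u j * Z0 w j ord0)%:E)%E by exact: integrableZl.
have c3 : P.-integrable setT (fun w => (A * eta `^ p)%:E * (enorm (Z0 w) `^ p)%:E)%E by exact: integrableZl.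
have c4 := integrableD measurableT c2 c3.
rewrite integralD//= integralD//= !integralZl// i2 mule0 add0e.
rewrite (integral_cst P measurableT) [X in (_ * X)%E]probability_setT mule1.
rewrite EFinD leeD//.
apply: (@le_trans _ _ ((A * eta `^ p)%:E * K%:E)%E).
  by rewrite lee_wpmul2l// lee_fin mulr_ge0 ?powR_ge0.
by rewrite -EFinM lee_fin /chernoff_excess -/A le_eqVlt; apply/orP; left; apply/eqP; ring.
Qed.

(** With [s] a multiple of the logarithm, the exponential factor costs at most half of the exponent
    [p - 1], and the squared logarithm a further quarter. Since [eta] to the power [p] is [eta]
    times [eta] to the power [p - 1], a positive power remains to beat the constants. *)
Lemma chernoff_excess_small (Q : R) : 0 < Q -> Q * C * delta <= (p - 1) / 2 ->
  \forall eta \near (0 : R)^'+, chernoff_excess eta (Q * ln eta^-1) <= eta.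
Proof.
move=> Q0 Qd; have [p1 p2] := andP p12.
pose q := p - 1; have q0 : 0 < q by rewrite subr_gt0.
pose B := Q * (8 / q); have B0 : 0 < B by rewrite mulr_gt0// divr_gt0.
pose M := K * (B * C * delta `^ (1 - p) + B ^+ 2 * C ^+ 2 * delta `^ (2 - p)).
have M0 : 0 <= M.
  have B0' := ltW B0.
  rewrite /M; move: (B) B0' => B' B0'; apply: mulr_ge0 => //.
  by apply: addr_ge0; rewrite !mulr_ge0 ?powR_ge0 ?sqr_ge0.
have q40 : 0 < q / 4 by rewrite divr_gt0.
have M1 : 0 < (M + 1)^-1 by rewrite invr_gt0 ltr_wpDl.
near=> eta.
have eta0 : 0 < eta by near: eta; exact: nbhs_right_gt.
have eta1 : eta < 1 by near: eta; apply: nbhs_right_lt.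
have H : eta `^ (q / 4) <= (M + 1)^-1.
  near: eta; have := @powR_cvg0 R _ q40; move/cvgr_le; apply; exact: M1.
pose L := ln eta^-1.
have L0 : 0 < L by rewrite /L ln_gt0// invf_gt1.
have pw c : eta `^ c = expR (- (c * L)).
  by rewrite /powR gt_eqF// /L lnV ?posrE// mulrN opprK.
have LB : Q * L <= B * expR (q * L / 8).
  have := expR_ge1Dx (q * L / 8).
  have -> : Q * L = B * (q * L / 8) by rewrite /B; field; rewrite gt_eqF.
  by rewrite ler_pM2l//; lra.
pose E := expR (- (q / 4 * L)).
have E0 : 0 <= E by exact: expR_ge0.
have T1 : eta `^ q * (Q * L) <= B * E.
  apply: (le_trans (ler_wpM2l (powR_ge0 _ _) LB)).
  rewrite pw mulrCA -expRD ler_pM2l// ler_expR.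
  have : 0 < q * L by rewrite mulr_gt0.
  by lra.
have T2 : eta `^ q * ((Q * L) ^+ 2 * expR (Q * L * C * delta)) <= B ^+ 2 * E.
  have h1 : (Q * L) ^+ 2 <= B ^+ 2 * expR (q * L / 4).
    have -> : B ^+ 2 * expR (q * L / 4) = (B * expR (q * L / 8)) ^+ 2.
have -> : expR (q * L / 4) = expR (q * L / 8) * expR (q * L / 8).
        by rewrite -expRD; congr expR; field.
      by ring.
    have g1 : 0 <= Q * L by rewrite ltW// mulr_gt0.
    have g2 : 0 <= B * expR (q * L / 8) by exact: le_trans LB.
    by apply: lerXn2r.
  have h2 : expR (Q * L * C * delta) <= expR (q / 2 * L).
    rewrite ler_expR (_ : Q * L * C * delta = Q * C * delta * L); last by ring.
    by rewrite ler_wpM2r// ltW.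
  apply: (le_trans (ler_wpM2l (powR_ge0 _ _) (ler_pM (sqr_ge0 _) (expR_ge0 _) h1 h2))).
  rewrite le_eqVlt; apply/orP; left; apply/eqP; rewrite pw.
  have -> : E = expR (- (q * L)) * (expR (q * L / 4) * expR (q / 2 * L)).
    by rewrite -!expRD; congr expR; field.
  by ring.
have -> : chernoff_excess eta (Q * L) = eta * (K * (C * delta `^ (1 - p) * (eta `^ q * (Q * L)) +
   C ^+ 2 * delta `^ (2 - p) * (eta `^ q * ((Q * L) ^+ 2 * expR (Q * L * C * delta))))).
  rewrite /chernoff_excess (_ : eta `^ p = eta * eta `^ q); last first.
    by rewrite /q -{2}(powRr1 (ltW eta0)) -powRD ?subrKC//; apply/implyP => _; rewrite gt_eqF.
  by ring.
rewrite ler_piMr ?(ltW eta0)//.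
have U1 : C * delta `^ (1 - p) * (eta `^ q * (Q * L)) <= C * delta `^ (1 - p) * (B * E).
  by rewrite ler_wpM2l// mulr_ge0 ?powR_ge0.
have U2 : C ^+ 2 * delta `^ (2 - p) * (eta `^ q * ((Q * L) ^+ 2 * expR (Q * L * C * delta))) <=
  C ^+ 2 * delta `^ (2 - p) * (B ^+ 2 * E).
  by rewrite ler_wpM2l// mulr_ge0 ?powR_ge0 ?sqr_ge0.
apply: (le_trans (ler_wpM2l K0 (lerD U1 U2))).
rewrite (_ : K * _ = M * E); last by rewrite /M; ring.
have HE : E <= (M + 1)^-1 by rewrite /E -pw.
apply: (le_trans (ler_wpM2l M0 HE)).
by rewrite ler_pdivrMr ?mul1r ?lerDl// ltr_wpDl.
Unshelve. all: by end_near. Qed.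

End exponential_bound.

Lemma finite_union_bound {R : realType} {disp} {T : measurableType disp}
    (mu : {measure set T -> \bar R}) (I : finType) (E : I -> set T) (A : set T) :
  measurable A -> (forall i, measurable (E i)) -> (forall w, A w -> exists i, E i w) ->
  (mu A <= \sum_i mu (E i))%E.
Proof.
move=> mA mE AE.
apply: (@le_trans _ _ (mu (\big[setU/set0]_i E i))).
  apply: le_measure; rewrite ?inE//; first exact: bigsetU_measurable.
  move=> w /AE[i Ei]; rewrite -bigcup_seq; exists i => //=.
  by rewrite mem_index_enum.
elim: (index_enum I) => [|i s IH]; first by rewrite !big_nil measure0.
rewrite !big_cons; apply: (le_trans (measureU2 _ (mE i) _)).
  exact: bigsetU_measurable.
by rewrite leeD2l.
Qed.

Section noise_accumulation.
Context {R : realType} {m d : nat}.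
Variables (a : 'cV[R]_m -> 'cV[R]_m) (sigma : 'cV[R]_m -> 'M[R]_(m, d.+1)).
Variables (b : \bar R) (C D : R).
Hypothesis b0 : (0 < b)%E.
Hypothesis C0 : 0 <= C.
Hypothesis D0 : 0 <= D.
Hypothesis aD : forall x y, enorm (a x - a y) <= D * enorm (x - y).
Hypothesis sC : forall x, opnorm (sigma x) <= C.
Hypothesis sD : forall x y, opnorm (sigma x - sigma y) <= D * enorm (x - y).
Local Notation V := 'cV[R]_d.+1.
Local Notation nstep := (nstep a sigma b).

(** The state [y] moves with the full noise and only the summands are truncated. Recursion on the
    remaining noises amounts to conditioning on the present state, in the shape required by
    [tmeas_int_cons]. *)
Fixpoint noise_acc (delta eta : R) (y : 'cV[R]_m) (zs : seq V) : 'cV[R]_m :=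
  if zs is z :: zs' then sigma y *m trunc delta z + noise_acc delta eta (nstep eta y z) zs'
  else 0.

Lemma measurable_noise_acc {disp} {T : measurableType disp} delta eta k
    (Y : T -> 'cV[R]_m) (zs : T -> k.-tuple V) :
  measurable_fun setT Y -> measurable_fun setT zs ->
  measurable_fun setT (fun t => noise_acc delta eta (Y t) (zs t)).
Proof.
elim: k Y zs => [|k IH] Y zs mY mzs.
  rewrite (_ : (fun _ => _) = cst 0); first exact: measurable_cst.
  by apply/funext => t; rewrite (tuple0 (zs t)).
have m0 : measurable_fun setT (fun t => tnth (zs t) ord0).
  by move/measurable_fun_tnthP : mzs; exact.
rewrite (_ : (fun _ => _) = fun t => sigma (Y t) *m trunc delta (tnth (zs t) ord0) +
  noise_acc delta eta (nstep eta (Y t) (tnth (zs t) ord0)) [tuple of behead (zs t)]); last first.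
  by apply/funext => t; rewrite {1}(tuple_eta (zs t)).
apply: measurable_addv.
  apply: (measurable_jointly_continuous (f := fun y w => sigma y *m w)) => //.
    by move=> y w e; exact: (sigma_mul_continuous D0 sD).
  by apply: measurableT_comp m0; exact: measurable_trunc.
apply: IH; first by apply: (measurable_nstep b0 D0 aD sD).
apply: (@measurableT_comp _ _ _ _ _ _ (fun z : k.+1.-tuple V => [tuple of behead z]) _ zs) => //.
exact: measurable_behead.
Qed.

(** The one-step bound is uniform in the state. Given the first noise, the induction hypothesis
    bounds the integral over the others by a constant, and the first factor is integrated last; no
    conditional expectation is involved. *)
Lemma noise_mgf (rho : probability V R) delta eta (l : 'I_m) (c kappa : R) :
  0 <= kappa ->
  (forall y, (\int[rho]_z (expR (c * (sigma y *m trunc delta z) l ord0))%:E <= (1 + kappa)%:E)%E) ->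
  forall n y, (\int[tmeas rho n]_zs (expR (c * (noise_acc delta eta y zs) l ord0))%:E <=
    ((1 + kappa) ^+ n)%:E)%E.
Proof.
move=> k0 H; have mexp disp (T : measurableType disp) (f : T -> 'cV[R]_m) :
    measurable_fun setT f -> measurable_fun setT (fun t => (expR (c * f t l ord0))%:E).
  move=> mf; apply/measurable_EFinP; apply: (measurableT_comp (@measurable_expR R)).
  apply: measurable_funM; first exact: measurable_cst.
  by apply: (measurableT_comp (measurable_coord l)).
have e0 (T : Type) (f : T -> 'cV[R]_m) t : (0 <= (expR (c * f t l ord0))%:E)%E.
  by rewrite lee_fin expR_ge0.
elim=> [|n IH] y.
  rewrite tmeas_int0//; first by rewrite /= mxE mulr0 expR0.
  by apply: mexp; apply: measurable_noise_acc => //; exact: measurable_cst.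
have macc : measurable_fun setT (fun zs : n.+1.-tuple V => (expR (c * (noise_acc delta eta y zs) l ord0))%:E).
  by apply: mexp; apply: measurable_noise_acc => //; exact: measurable_cst.
have mstep : measurable_fun setT (fun z => sigma y *m trunc delta z).
  apply: (measurable_jointly_continuous (f := fun y w => sigma y *m w)
    (Y := fun=> y) (W := @trunc R delta d.+1)).
  - by move=> y' w e; exact: (sigma_mul_continuous D0 sD).
  - exact: measurable_cst.
  - exact: measurable_trunc.
rewrite (tmeas_int_cons _ (fun zs => e0 _ (fun z : n.+1.-tuple V => noise_acc delta eta y z) zs) macc).
apply: (@le_trans _ _ (\int[rho]_z (((1 + kappa) ^+ n)%:E *
    (expR (c * (sigma y *m trunc delta z) l ord0))%:E))%E).
  apply: ge0_le_integral => //.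
  - by move=> z _; apply: integral_ge0 => zs _; exact: e0.
  - by apply: (measurable_tmeas_int_cons _ (fun zs => e0 _ (fun z : n.+1.-tuple V => noise_acc delta eta y z) zs) macc).
  - apply: emeasurable_funM; first exact: measurable_cst.
    exact: mexp.
  - move=> z _ /=.
    under eq_integral do rewrite mxE mulrDr expRD EFinM.
    rewrite ge0_integralZl//; last first.
      by apply: mexp; apply: measurable_noise_acc => //; exact: measurable_cst.
    by rewrite muleC lee_wpmul2r ?lee_fin ?expR_ge0.
rewrite ge0_integralZl//; last 2 first.
- exact: mexp.
- by rewrite lee_fin exprn_ge0// addr_ge0.
rewrite exprSr EFinM lee_wpmul2l// lee_fin exprn_ge0// addr_ge0//.
Qed.

Definition bigs (delta eta : R) (z : nat -> V) : seq nat :=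
  [seq i <- iota 1 (Num.truncn eta^-1) | delta < enorm (eta *: z i)].

(** Leaving out the steps in [bigs] amounts to replacing their noises by 0, which is what [trunc]
    does above [delta]. *)
Lemma noise_acc_off delta eta x (z : nat -> V) i : (i <= Num.truncn eta^-1)%N ->
  off_noise a sigma b eta x z (bigs delta eta z) i =
  noise_acc delta eta x [seq eta *: z j | j <- iota 1 i].
Proof.
move=> iN; rewrite /off_noise.
have gen r p : (p + r <= Num.truncn eta^-1)%N ->
    \sum_(p <= j < p + r | j.+1 \notin bigs delta eta z) step_noise a sigma b eta x z j =
    noise_acc delta eta (X_iter a sigma eta b x z p) [seq eta *: z j | j <- iota p.+1 r].
  elim: r p => [|r IH] p pr; first by rewrite addn0 big_geq.
  rewrite big_mkcond/= big_ltn ?addnS ?ltnS ?leq_addr//= -big_mkcond/= -addSn.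
  rewrite IH; last by rewrite addSnnS.
  rewrite -X_iterS; congr (_ + _).
  have -> : (p.+1 \in bigs delta eta z) = (delta < enorm (eta *: z p.+1)).
    have pN : (p.+1 <= Num.truncn eta^-1)%N by rewrite (leq_trans _ pr)// addnS ltnS leq_addr.
    by rewrite mem_filter mem_iota (_ : (1 <= p.+1 < 1 + _)%N) ?andbT// add1n ltnS pN.
  rewrite -leNgt /trunc; case: ifP => _; last by rewrite mulmx0.
  by rewrite /step_noise -scalemxAl scalemxAr.
by have := gen i 0%N; rewrite add0n => ->.
Qed.

Context {disp : measure_display} {Omega : measurableType disp}.
Variable P : probability Omega R.
Variable Z : nat -> Omega -> V.
Hypothesis mZ : forall n, measurable_fun setT (Z n).
Hypothesis iidZ : iid P Z.
Hypothesis meanZ : mean_zero P (Z 0%N).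
Variable alpha : R.
Hypothesis alpha1 : 1 < alpha.
Hypothesis RV : forall t : R, 0 < t ->
  (tail P (Z 0%N) (t * x) / tail P (Z 0%N) x)%E @[x --> +oo] --> (t `^ (- alpha))%:E.

Definition noise_bad (delta eps eta : R) x : set Omega :=
  [set w | exists2 i, (i <= Num.truncn eta^-1)%N &
    eps < enorm (off_noise a sigma b eta x (Z ^~ w) (bigs delta eta (Z ^~ w)) i)].

Lemma measurable_off_noise delta eta x i : (i <= Num.truncn eta^-1)%N ->
  measurable_fun setT (fun w => off_noise a sigma b eta x (Z ^~ w) (bigs delta eta (Z ^~ w)) i).
Proof.
move=> iN; rewrite (_ : (fun _ => _) =
  fun w => noise_acc delta eta x (ntuple Z eta (iota_tuple i 1) w)); last first.
  by apply/funext => w; rewrite noise_acc_off.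
by apply: measurable_noise_acc; [exact: measurable_cst|exact: measurable_ntuple].
Qed.

Lemma measurable_noise_bad delta eps eta x : measurable (noise_bad delta eps eta x).
Proof.
rewrite (_ : noise_bad _ _ _ _ = \big[setU/set0]_(i < (Num.truncn eta^-1).+1)
  [set w | eps < enorm (off_noise a sigma b eta x (Z ^~ w) (bigs delta eta (Z ^~ w)) i)]).
  apply: bigsetU_measurable => -[i /= iN] _.
  rewrite (_ : [set w | _] = (fun w => enorm (off_noise a sigma b eta x (Z ^~ w)
    (bigs delta eta (Z ^~ w)) i)) @^-1` `]eps, +oo[); last first.
    by apply/seteqP; split => w /=; rewrite in_itv/= andbT.
  rewrite -[X in measurable X]setTI.
  apply: (_ : measurable_fun setT _) => //.
  by apply: (measurableT_comp (@measurable_enorm _ _)); exact: measurable_off_noise.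
rewrite -(bigcup_mkord _ (fun i => [set w | eps < enorm (off_noise a sigma b eta x
  (Z ^~ w) (bigs delta eta (Z ^~ w)) i)])).
by apply/seteqP; split => w [i iN wi]; exists i.
Qed.

(* The small noises are truncated and centred; their exponential moments of order
   [ln eta^-1] stay bounded, which yields any power of [eta]. *)
Lemma noise_small eps N : 0 < eps -> exists2 delta0, 0 < delta0 &
  forall delta, 0 < delta <= delta0 -> forall x,
    \forall eta \near (0 : R)^'+, (P (noise_bad delta eps eta x) <= (eta ^+ N)%:E)%E.
Proof.
move=> eps0; have al := alpha1.
have u1 : 1 < (1 + alpha) / 2 < alpha by apply/andP; split; lra.
have u2 : 1 < 3 / 2 :> R by lra.
have u3 : 3 / 2 < 2 :> R by lra.
have [u4 u5] := andP u1.
pose p := Num.min ((1 + alpha) / 2) (3 / 2).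
have p12 : 1 < p < 2.
  by rewrite /p lt_min gt_min u4 u2 u3 orbT.
have pa : 0 < p < alpha.
  by rewrite /p lt_min gt_min u5 (lt_trans ltr01 u4) (lt_trans ltr01 u2).
have [K K0 ZK] := tail_moment (mZ 0) RV pa.
(* Chosen so that an excess of [eps / m.+1] in one coordinate has probability at most a constant
   times [eta ^+ (N + 2)]. One of the two extra powers pays for the number of partial sums, the
   other for the constants. *)
pose Q := m.+1%:R * (N + 2)%:R / eps.
have Q0 : 0 < Q by rewrite divr_gt0// mulr_gt0// ltr0n ?addn2.
have [p1 p2] := andP p12.
(* This is the smallness that [chernoff_excess_small] asks of [delta]; [C + 1] covers [C = 0]. *)
pose delta0 := (p - 1) / 2 / (Q * (C + 1)).
have QC0 : 0 < Q * (C + 1) by rewrite mulr_gt0// ltr_wpDl.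
exists delta0; first by rewrite !divr_gt0// subr_gt0.
move=> delta /andP[d0 dd0] x.
have Qd : Q * C * delta <= (p - 1) / 2.
  have h1 : delta * (Q * (C + 1)) <= (p - 1) / 2 by rewrite -ler_pdivlMr.
  have h2 : 0 <= delta * Q by rewrite mulr_ge0 ?ltW.
  by lra.
have c0 : 0 < ((4 * m.+1%:R * expR 1)^-1 : R) by rewrite invr_gt0 !mulr_gt0 ?expR_gt0.
near=> eta.
have /andP[eta0 eta1] : 0 < eta < 1 by near: eta; exact: near0r_lt.
have /andP[_ etac] : 0 < eta < (4 * m.+1%:R * expR 1)^-1 by near: eta; exact: near0r_lt.
have exc : chernoff_excess C delta p K eta (Q * ln eta^-1) <= eta.
  by near: eta; exact: chernoff_excess_small.
set s := Q * ln eta^-1 in exc.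
have L0 : 0 < ln eta^-1 by rewrite ln_gt0// invf_gt1.
have s0 : 0 < s by rewrite mulr_gt0.
set n := Num.truncn eta^-1.
have n1 : eta * n%:R <= 1.
  by rewrite mulrC -ler_pdivlMr// mul1r truncn_le// invr_ge0 ltW.
pose S w i := noise_acc delta eta x (ntuple Z eta (iota_tuple i 1) w).
(* A large partial sum has a coordinate of modulus above [eps / m.+1]; the sign is part of the index
   so that each event is one-sided and fits an exponential moment. *)
pose E (q : 'I_n.+1 * ('I_m * bool)) := [set w |
  eps / m.+1%:R < (-1) ^+ q.2.2 * S w q.1 q.2.1 ord0].
have mS i : measurable_fun setT (S ^~ i).
  by apply: measurable_noise_acc; [exact: measurable_cst|exact: measurable_ntuple].
have mSc (q : 'I_n.+1 * ('I_m * bool)) :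
    measurable_fun setT (fun w => (-1) ^+ q.2.2 * S w q.1 q.2.1 ord0).
  apply: measurable_funM; first exact: measurable_cst.
  by apply: (measurableT_comp (measurable_coord q.2.1)).
have mE q : measurable (E q).
  rewrite (_ : E q = (fun w => (-1) ^+ q.2.2 * S w q.1 q.2.1 ord0) @^-1` `]eps / m.+1%:R, +oo[).
    by rewrite -[X in measurable X]setTI; exact: mSc.
  by apply/seteqP; split => w /=; rewrite in_itv/= andbT.
have PE q : (P (E q) <= (expR 1 * eta ^+ (N + 2))%:E)%E.
  case: q mE => -[i iN] [l sg] mE.
  pose c := s * (-1) ^+ sg.
  have mgf : (\int[P]_w (expR (c * S w i l ord0))%:E <= (expR 1)%:E)%E.
    rewrite (ntuple_int mZ iidZ eta (J := iota_tuple i 1)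
      (f := fun zs => (expR (c * (noise_acc delta eta x zs) l ord0))%:E)); last 3 first.
    - exact: iota_uniq.
    - apply/measurable_EFinP; apply: (measurableT_comp (@measurable_expR R)).
      apply: measurable_funM; first exact: measurable_cst.
      apply: (measurableT_comp (measurable_coord l)).
      by apply: measurable_noise_acc => //; exact: measurable_cst.
    - by move=> W; rewrite lee_fin expR_ge0.
    apply: (le_trans (@noise_mgf _ delta eta l c eta (ltW eta0) _ i x)).
      move=> y; rewrite /nlaw law_int; last 2 first.
      - apply/measurable_EFinP; apply: (measurableT_comp (@measurable_expR R)).
        apply: measurable_funM; first exact: measurable_cst.
        apply: (measurableT_comp (measurable_coord l)).
        apply: (measurable_jointly_continuous (f := fun y w => sigma y *m w)
          (Y := fun=> y) (W := @trunc R delta d.+1)).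
        + by move=> y' w e; exact: (sigma_mul_continuous D0 sD).
        + exact: measurable_cst.
        + exact: measurable_trunc.
      - by move=> z; rewrite lee_fin expR_ge0.
      have uE (z : V) : \sum_j ((-1) ^+ sg * sigma y l j) * z j ord0 =
          (-1) ^+ sg * (sigma y *m z) l ord0.
        by rewrite mxE mulr_sumr; apply: eq_bigr => j _; rewrite mulrA.
      have := @chernoff_step R d disp Omega P (Z 0%N) (mZ 0) meanZ C delta p K C0 d0 p12 ZK
        (fun j => (-1) ^+ sg * sigma y l j) eta s (ltW s0) (ltW eta0).
      have uC (z : V) : `|\sum_j (-1) ^+ sg * sigma y l j * z j ord0| <= C * enorm z.
        rewrite uE normrMsign (le_trans (coord_le_enorm _ _))//.
        by rewrite (le_trans (enorm_mulmx _ _))// ler_wpM2r ?enorm_ge0.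
      move=> /(_ uC) h; apply: (@le_trans _ _ (1 + chernoff_excess C delta p K eta s)%:E).
        apply: le_trans h; rewrite le_eqVlt; apply/orP; left; apply/eqP.
        by apply: eq_integral => w _; rewrite uE mulrA.
      by rewrite lee_fin lerD2l.
    rewrite lee_fin; apply: (@le_trans _ _ (expR eta ^+ i)).
      apply: lerXn2r; rewrite ?nnegrE ?expR_ge0 ?expR_ge1Dx// addr_ge0// ltW.
    rewrite -expRM_natr ler_expR; apply: le_trans n1.
    by rewrite ler_pM2l// ler_nat -ltnS.
  have -> : expR 1 * eta ^+ (N + 2) = eta ^+ (N + 2) * expR 1 by rewrite mulrC.
  rewrite EFinM; apply: (le_trans _ (lee_wpmul2l _ mgf)); last by rewrite lee_fin exprn_ge0// ltW.
  have mS' : measurable_fun setT (fun w => (expR (c * S w i l ord0))%:E).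
    apply/measurable_EFinP; apply: (measurableT_comp (@measurable_expR R)).
    apply: measurable_funM; first exact: measurable_cst.
    by apply: (measurableT_comp (measurable_coord l)).
  rewrite -ge0_integralZl//; last by rewrite lee_fin exprn_ge0// ltW.
  rewrite -(setIT (E _)) -integral_indic//.
  apply: ge0_le_integral => //.
  - by apply/measurable_EFinP; apply: measurable_indic; exact: mE.
  - apply: emeasurable_funM; first exact: measurable_cst.
    apply/measurable_EFinP; apply: (measurableT_comp (@measurable_expR R)).
    apply: measurable_funM; first exact: measurable_cst.
    by apply: (measurableT_comp (measurable_coord l)).
  move=> w _; rewrite -EFinM lee_fin indicE; case: (boolP (w \in _)) => [|_]; last first.
    by rewrite mulr_ge0 ?expR_ge0// exprn_ge0// ltW.
  rewrite inE /E /= => wE.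
  have -> : eta ^+ (N + 2) = expR (- (s * (eps / m.+1%:R))).
    have -> : - (s * (eps / m.+1%:R)) = (N + 2)%:R * ln eta.
      have : m.+1%:R != 0 :> R by rewrite pnatr_eq0.
      have : eps != 0 by rewrite gt_eqF.
      by rewrite /s /Q lnV ?posrE//; move: (m.+1%:R : R) => M h1 h2; field; rewrite h1 h2.
    by rewrite expRM_natl lnK ?posrE.
  rewrite -expRD -[leLHS]expR0 ler_expR /c -mulrA addrC subr_ge0 ler_pM2l// ltW//.
have card : (\sum_(q : 'I_n.+1 * ('I_m * bool)) (expR 1 * eta ^+ (N + 2))%:E <= (eta ^+ N)%:E)%E.
  rewrite sumEFin lee_fin sumr_const !card_prod !card_ord card_bool -[_ *+ _]mulr_natl.
  have -> : (n.+1 * (m * 2))%:R * (expR 1 * eta ^+ (N + 2)) =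
    (n.+1%:R * eta) * ((m * 2)%:R * expR 1 * eta) * eta ^+ N.
    by rewrite natrM exprD; ring.
  rewrite ler_piMl ?exprn_ge0// ?(ltW eta0)//.
  have h1 : n.+1%:R * eta <= 2 by rewrite -natr1 mulrDl mul1r mulrC; lra.
  have h2 : (m * 2)%:R * expR 1 * eta <= 2^-1.
    apply: (@le_trans _ _ ((m.+1 * 2)%:R * expR 1 * eta)).
      by rewrite ler_pM2r// ler_pM2r ?expR_gt0// ler_nat leq_mul2r leqnSn orbT.
    have h : eta * (4 * m.+1%:R * expR 1) <= 1.
      by rewrite -ler_pdivlMr ?mul1r ?(ltW etac)// !mulr_gt0 ?expR_gt0.
    by rewrite natrM; move: h; rewrite [m.+1%:R]lock; lra.
  have h3 : 0 <= n.+1%:R * eta by rewrite mulr_ge0// ltW.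
  apply: (@le_trans _ _ (2 * 2^-1)); last by rewrite divff.
  by apply: ler_pM => //; rewrite !mulr_ge0 ?expR_ge0// ltW.
apply: le_trans card; apply: le_trans (finite_union_bound P _ mE _) _.
- exact: measurable_noise_bad.
- move=> w [i iN]; rewrite noise_acc_off// => wi; apply: contrapT => /forallNP H.
  move: wi; rewrite ltNge => /negP; apply.
  apply: (le_trans (enorm_le_sum _)); apply: (@le_trans _ _ (\sum_(l < m) eps / m.+1%:R)).
    apply: ler_sum => l _; rewrite leNgt; apply/negP => Hl.
    have iN' : (i < n.+1)%N by [].
    have [sl|sl] := leP 0 (S w i l ord0).
      apply: (H (Ordinal iN', (l, false))); rewrite /E /= mul1r.
      by rewrite -[ltRHS]ger0_norm.
    apply: (H (Ordinal iN', (l, true))); rewrite /E /= mulN1r.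
    by rewrite -[ltRHS]ltr0_norm.
  rewrite sumr_const card_ord -[_ *+ _]mulr_natl mulrA ler_pdivrMr// mulrC.
  by rewrite ler_pM2l// ler_nat.
- by apply: lee_sum => q _; exact: PE.
Unshelve. all: by end_near. Qed.

End noise_accumulation.

(** * Approximation of the discrete path by jump paths *)

(** With fewer large noises than expected, further steps are declared to be jumps, so that the
    shadowing path has exactly the number of jumps prescribed by [perturbed_paths]. *)
Lemma pad_sorted n j (J : seq nat) : uniq J -> {subset J <= iota 1 n} ->
  (size J <= j <= n)%N -> exists J', [/\ sorted ltn J', {subset J <= J'},
    {subset J' <= iota 1 n} & size J' = j].
Proof.
move=> uJ Jn /andP[Jj jn].
pose F := [seq i <- iota 1 n | i \notin J].
pose L := J ++ take (j - size J) F.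
have uF : uniq F by rewrite filter_uniq// iota_uniq.
have sF : size F = (n - size J)%N.
  have : perm_eq [seq i <- iota 1 n | i \in J] J.
    apply: uniq_perm => //; first by rewrite filter_uniq// iota_uniq.
    by move=> i; rewrite mem_filter andb_idr//; exact: Jn.
  move=> /perm_size sJ; have := count_predC (mem J) (iota 1 n).
  by rewrite -!size_filter sJ size_iota => <-; rewrite addKn.
have uL : uniq L.
  rewrite cat_uniq uJ take_uniq// andbT; apply/hasPn => i /mem_take.
  by rewrite mem_filter => /andP[].
have Ln : {subset L <= iota 1 n}.
  move=> i; rewrite mem_cat => /orP[/Jn//|/mem_take].
  by rewrite mem_filter => /andP[].
exists [seq i <- iota 1 n | i \in L]; split.
- by apply: sorted_filter; [exact: ltn_trans|exact: iota_ltn_sorted].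
- by move=> i iJ; rewrite mem_filter Jn// andbT mem_cat iJ.
- by move=> i; rewrite mem_filter => /andP[].
have : perm_eq [seq i <- iota 1 n | i \in L] L.
  apply: uniq_perm => //; first by rewrite filter_uniq// iota_uniq.
  by move=> i; rewrite mem_filter andb_idr//; exact: Ln.
move=> /perm_size ->; rewrite size_cat size_takel ?subnKC// sF.
by rewrite leq_sub2r.
Qed.

Section good_event.
Context {R : realType} {m d : nat}.
Variables (a : 'cV[R]_m -> 'cV[R]_m) (sigma : 'cV[R]_m -> 'M[R]_(m, d.+1)).
Variables (b : \bar R) (C D : R).
Hypothesis b0 : (0 < b)%E.
Hypothesis C0 : 0 <= C.
Hypothesis D0 : 0 <= D.
Hypothesis aC : forall x, enorm (a x) <= C.
Hypothesis aD : forall x y, enorm (a x - a y) <= D * enorm (x - y).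
Hypothesis sC : forall x, opnorm (sigma x) <= C.
Hypothesis sD : forall x y, opnorm (sigma x - sigma y) <= D * enorm (x - y).
Local Notation V := 'cV[R]_d.+1.
Local Notation times l := [seq p.1 | p <- l : seq (R * (V * 'cV[R]_m))].
Variables (k : nat) (x : 'cV[R]_m).
Local Notation h := (h a sigma b x).

Lemma clip_level : exists2 beta : R, 0 < beta & (beta%:E <= b)%E.
Proof.
move: b0; case: b => [r| |]//; first by rewrite lte_fin => r0; exists r.
by move=> _; exists 1; rewrite ?leey.
Qed.

Definition err_const : R := expR D * (C + 2 * D + D * C) + 2 + C.

Lemma err_const_ge0 : 0 <= err_const.
Proof. by rewrite /err_const !addr_ge0// mulr_ge0 ?expR_ge0// !addr_ge0// mulr_ge0. Qed.

Lemma shadow_err_le eta eps : 0 <= eta -> 0 <= eps ->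
  shadow_err C D eta eps <= err_const * (eta + eps).
Proof.
move=> e0 p0; rewrite /shadow_err /err_const.
have E0 := expR_ge0 D; have D2 := mulr_ge0 D0 e0; have CD := mulr_ge0 D0 C0.
have h1 : expR D * (C * eta + D * (2 * eps) + D * C * eta) <=
    expR D * ((C + 2 * D + D * C) * (eta + eps)).
  rewrite ler_wpM2l//; have := mulr_ge0 C0 p0; have := mulr_ge0 CD p0; lra.
have := mulr_ge0 C0 p0; lra.
Qed.

Variables (eta : R) (z : nat -> V).
Hypothesis eta0 : 0 < eta.
Local Notation n := (Num.truncn eta^-1).
Local Notation X := (X_iter a sigma eta b x z).

Lemma noclip_step (J : seq nat) delta i : (i < n)%N -> i.+1 \notin J ->
  (forall i, (0 < i <= n)%N -> i \notin J -> enorm (eta *: z i) <= delta) ->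
  ((C * eta + C * delta)%:E <= b)%E ->
  clip b (eta *: a (X i) + step_noise a sigma b eta x z i) =
  eta *: a (X i) + step_noise a sigma b eta x z i.
Proof.
move=> iN iJ small cb; apply: clip_small; apply: le_trans cb; rewrite lee_fin.
apply: (le_trans (enormD _ _)); apply: lerD.
  by rewrite enormZ gtr0_norm// mulrC ler_wpM2r// ltW.
rewrite /step_noise -scalemxAl scalemxAr.
apply: (le_trans (enorm_sigma sC _ _)); rewrite ler_wpM2l//; exact: small.
Qed.

(** Moving a step with noise at most [delta] in or out of the set of jumps changes a partial sum by
    at most [C * delta], and at most [size J + size J'] steps can move. *)
Lemma off_noise_diff (J J' : seq nat) delta i : 0 <= delta -> (i <= n)%N ->
  (forall j, (0 < j <= n)%N -> (j \in J) != (j \in J') -> enorm (eta *: z j) <= delta) ->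
  enorm (off_noise a sigma b eta x z J' i) <=
  enorm (off_noise a sigma b eta x z J i) + (size J + size J')%:R * (C * delta).
Proof.
move=> d0 iN small; rewrite -lerBlDl; apply: (le_trans (enorm_sub _ _)).
rewrite /off_noise big_mkcond [X in _ - X]big_mkcond -sumrB.
apply: (le_trans (enorm_sum _ _ _)).
apply: (@le_trans _ _ (\sum_(0 <= j < i) (j.+1 \in J ++ J')%:R * (C * delta))).
  rewrite !big_seq; apply: ler_sum => j; rewrite mem_index_iota => /andP[_ ji].
  have Cd : 0 <= C * delta by rewrite mulr_ge0.
  have st : (j.+1 \in J) != (j.+1 \in J') -> enorm (step_noise a sigma b eta x z j) <= C * delta.
    move=> H; rewrite /step_noise -scalemxAl scalemxAr (le_trans (enorm_sigma sC _ _))//.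
    by rewrite ler_wpM2l//; apply: small => //=; rewrite (leq_trans ji).
  rewrite mem_cat; case: (j.+1 \in J) st; case: (j.+1 \in J') => /= st;
    rewrite ?subrr ?enorm0 ?mul1r ?mul0r ?subr0 ?sub0r ?enormN//; exact: st.
rewrite -mulr_suml ler_wpM2r ?mulr_ge0// -natr_sum ler_nat -size_cat.
have -> : (\sum_(0 <= j < i) (j.+1 \in J ++ J') = size [seq j <- iota 1 i | j \in J ++ J'])%N.
  rewrite size_filter -sum1_count [RHS]big_mkcond/= (iotaDl 1 0 i) big_map /index_iota subn0.
  by apply: eq_bigr => j _; rewrite add1n; case: (_ \in _).
apply: uniq_leq_size; first by rewrite filter_uniq// iota_uniq.
by move=> j; rewrite mem_filter => /andP[].
Qed.

Lemma bigs_sorted delta : sorted ltn (bigs delta eta z).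
Proof. by apply: sorted_filter; [exact: ltn_trans|exact: iota_ltn_sorted]. Qed.

Lemma mem_bigs delta i : (i \in bigs delta eta z) =
  (0 < i <= n)%N && (delta < enorm (eta *: z i)).
Proof. by rewrite mem_filter mem_iota add1n ltnS andbC. Qed.

Lemma sorted_path0 (J : seq nat) : sorted ltn J -> (forall i, i \in J -> (0 < i)%N) ->
  path ltn 0 J.
Proof.
by case: J => //= i J -> H; rewrite andbT; apply: H; rewrite mem_head.
Qed.

Lemma times_step_data (J : seq nat) (Vs : seq 'cV[R]_m) : size Vs = size J ->
  times (step_data eta z J Vs) = [seq eta * i%:R | i <- J].
Proof.
move=> sV; rewrite /step_data -/unzip1 unzip1_zip// size_zip !size_map sV minnn//.
Qed.

Lemma scaled_times_sorted (J : seq nat) : sorted ltn J ->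
  sorted <%R [seq eta * i%:R | i <- J].
Proof.
move=> sJ; rewrite sorted_map; apply: sub_sorted sJ => i j /= ij.
by rewrite ltr_pM2l// ltr_nat.
Qed.

Lemma scaled_times_in (J : seq nat) u : {subset J <= iota 1 n} ->
  u \in [seq eta * i%:R | i <- J] -> 0 < u <= 1.
Proof.
move=> JN /mapP[i /JN]; rewrite mem_iota add1n ltnS => /andP[i0 iN] ->.
by rewrite mulr_gt0 ?ltr0n//= eta_steps.
Qed.

Definition support_away (g : skorokhod R m -> R) (eps0 r0 : R) :=
  forall xi, perturbed_paths_pred a sigma b [set x] k eps0 xi ->
  forall y, J1_dist y xi <= r0 -> g y = 0.

(** Two levels are used: [delta] controls the accumulated noise, the larger [delta'] decides what
    counts as a jump. The few noises between them, and the steps added to reach [k - 1] jumps, cost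
    at most [C * delta'] each. The path then shadows a perturbed path with [k - 1] jumps, near which
    [g] vanishes. *)
Lemma few_jumps (g : skorokhod R m -> R) eps0 r0 delta delta' eps :
  support_away g eps0 r0 -> 0 <= delta <= delta' -> 0 <= eps -> (k <= n)%N ->
  (size (bigs delta eta z) <= k)%N -> (size (bigs delta' eta z) < k)%N ->
  (forall i, (i <= n)%N -> enorm (off_noise a sigma b eta x z (bigs delta eta z) i) <= eps) ->
  ((C * eta + C * delta')%:E <= b)%E ->
  shadow_err C D eta (eps + (2 * k)%:R * (C * delta')) <= Num.min eps0 r0 ->
  g (X_path a sigma eta b x z) = 0.
Proof.
rewrite /support_away => supp /andP[d0 dd'] e0 kn sk sk' noise cb.
rewrite le_min => /andP[err1 err2].
case: k supp kn sk sk' err1 err2 => // k' supp kn sk sk' err1 err2.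
have d'0 : 0 <= delta' by exact: le_trans dd'.
have ub : uniq (bigs delta' eta z) by rewrite filter_uniq// iota_uniq.
have subb : {subset bigs delta' eta z <= iota 1 n} by move=> i; rewrite mem_filter => /andP[].
have [J [sJ bJ JN szJ]] := @pad_sorted n k' (bigs delta' eta z) ub subb
  (introT andP (conj (sk' : (_ <= k')%N) (ltnW kn))).
have J0 i : i \in J -> (0 < i <= n)%N by move=> /JN; rewrite mem_iota add1n ltnS.
have small i : (0 < i <= n)%N -> i \notin J -> enorm (eta *: z i) <= delta'.
  move=> iN; apply: contraNT; rewrite -ltNge => di; apply: bJ.
  by rewrite mem_bigs iN.
have noiseJ i : (i <= n)%N -> enorm (off_noise a sigma b eta x z J i) <=
    eps + (2 * k'.+1)%:R * (C * delta').
  move=> iN; apply: (le_trans (@off_noise_diff (bigs delta eta z) J delta' i d'0 iN _)).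
    move=> j jn; case: (boolP (j \in J)) => [jJ|jJ _]; last exact: small.
    by rewrite eqb_id mem_bigs jn/= -leNgt => /le_trans; apply.
  apply: lerD; first exact: noise.
  rewrite ler_wpM2r ?mulr_ge0// ler_nat szJ mul2n -addnn leq_add// leqW//.
have noc i : (i < n)%N -> i.+1 \notin J -> clip b (eta *: a (X i) + step_noise a sigma b eta x z i) =
    eta *: a (X i) + step_noise a sigma b eta x z i.
  by move=> iN iJ; apply: (noclip_step iN iJ small).
have alJ : all (fun i => i <= n)%N J by apply/allP => i /J0 /andP[].
have X0 : enorm (X 0%N - x) <= C * eta by rewrite subrr enorm0 mulr_ge0// ltW.
have pJ := sorted_path0 sJ (fun i iJ => proj1 (andP (J0 i iJ))).
have [W [W1 W2 W3]] := shadow b0 C0 D0 aC aD eta0 noiseJ noc pJ alJ (leq0n _)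
  (fun j _ => erefl) X0.
have sD' : size (step_data eta z J W) = k'.
  by rewrite /step_data !size_zip !size_map W1 szJ !minnn.
have [|||xi xiP xiE] := perturbed_paths_jpath sigma b C0 D0 aC aD x
  (eps := eps0) sD'.
- by rewrite times_step_data//; exact: scaled_times_sorted.
- by move=> u; rewrite times_step_data//; exact: scaled_times_in.
- move=> p pl; apply: le_trans err1; apply: W2.
  have sz : size [seq eta *: z i | i <- J] = size W by rewrite size_map.
  have : p.2 \in unzip2 (step_data eta z J W) by apply: map_f.
  rewrite unzip2_zip ?size_zip ?size_map ?W1 ?minnn// => p2.
  have : p.2.2 \in unzip2 (zip [seq eta *: z i | i <- J] W) by apply: map_f.
  by rewrite unzip2_zip// size_map W1.
apply: (supp xi xiP); apply: J1_dist_sup => u u01; apply: le_trans err2.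
have [u0 u1] : 0 <= u /\ u <= 1 by move: u01; rewrite in_itv => /andP.
rewrite xiE// /= /step_path u01; have := W3 u; rewrite mulr0; apply.
by rewrite u0.
Qed.

(** Total amplification of the shadowing error: 1 for the distance to the perturbed path, and the
    product for removing its perturbations. *)
Definition jump_weight (W : seq V) : R :=
  1 + amp_const C D * \prod_(w <- W) (amp_const C D * (1 + D * enorm w)).

Lemma amp_jump_weight (l : seq (R * (V * 'cV[R]_m))) :
  amp_const C D * amp C D l = jump_weight [seq p.2.1 | p <- l] - 1.
Proof. by rewrite /jump_weight big_map addrC addKr. Qed.

Lemma jump_weight_ge1 W : 1 <= jump_weight W.
Proof.
rewrite lerDl; have A1 := amp_const_ge1 C0 D0.
have A0 : 0 <= amp_const C D by exact: le_trans A1.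
by rewrite mulr_ge0// prodr_ge0// => w _; rewrite mulr_ge0// addr_ge0// mulr_ge0 ?enorm_ge0.
Qed.

(** The shadowing path has the right times and noises, with perturbations at most [shadow_err]; the
    stability of jump paths allows these to be set to 0. *)
Lemma exact_jumps (W : k.-tuple V) (t : k.-tuple R) (J : k.-tuple nat) delta eps :
  0 <= delta -> bigs delta eta z = J :> seq nat ->
  W = [seq eta *: z i | i <- J] :> seq V -> t = [seq eta * i%:R | i <- J] :> seq R ->
  (forall i, (i <= n)%N -> enorm (off_noise a sigma b eta x z (bigs delta eta z) i) <= eps) ->
  ((C * eta + C * delta)%:E <= b)%E ->
  J1_dist (X_path a sigma eta b x z) (h W t) <= shadow_err C D eta eps * jump_weight W.
Proof.
move=> d0 bJ WE tE; rewrite bJ => noise cb.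
have sJ : sorted ltn J by rewrite -bJ bigs_sorted.
have J0 i : i \in (J : seq nat) -> (0 < i <= n)%N by rewrite -bJ mem_bigs => /andP[].
have JN : {subset (J : seq nat) <= iota 1 n}.
  by move=> i /J0; rewrite mem_iota add1n ltnS.
have small i : (0 < i <= n)%N -> i \notin (J : seq nat) -> enorm (eta *: z i) <= delta.
  by move=> iN; rewrite -bJ mem_bigs iN/= -leNgt.
have noc i : (i < n)%N -> i.+1 \notin (J : seq nat) ->
    clip b (eta *: a (X i) + step_noise a sigma b eta x z i) =
    eta *: a (X i) + step_noise a sigma b eta x z i.
  by move=> iN iJ; apply: (noclip_step iN iJ small).
have alJ : all (fun i => i <= n)%N (J : seq nat) by apply/allP => i /J0 /andP[].
have X0 : enorm (X 0%N - x) <= C * eta by rewrite subrr enorm0 mulr_ge0// ltW.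
have pJ := sorted_path0 sJ (fun i iJ => proj1 (andP (J0 i iJ))).
have [Vs [V1 V2 V3]] := shadow b0 C0 D0 aC aD eta0 noise noc pJ alJ (leq0n _)
  (fun j _ => erefl) X0.
have ti : increasing_tuples `]0, 1]%classic k t.
  split=> [|s]; rewrite tE; first exact: scaled_times_sorted.
  by move=> /(scaled_times_in JN); rewrite /= in_itv.
have sV : size Vs == k by rewrite V1 size_tuple.
pose Vt := Tuple sV.
have lE : step_data eta z J Vs = jdata W Vt t by rewrite /step_data /jdata -WE -tE.
have err0 := shadow_err_ge0 C0 D0 eta0 noise.
have [p1 p2] := increasing_path ti.
apply: J1_dist_sup => u u01.
have /andP[u0 u1] : 0 <= u <= 1 by move: u01; rewrite in_itv.
rewrite /h (hbarE sigma b D0 aD C0 aC x W _ ti u01) /= /step_path u01.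
have H1 := V3 u; rewrite mulr0 u0 u1 lE in H1; have {}H1 := H1 isT.
have H2 : enorm (jpath a sigma b 0 x (jdata W Vt t) u -
    jpath a sigma b 0 x (jdata W [tuple of nseq k 0] t) u) <=
    (jump_weight W - 1) * shadow_err C D eta eps.
  have WE' (U : k.-tuple 'cV[R]_m) : [seq p.2.1 | p <- jdata W U t] = W.
    rewrite /jdata (map_comp fst snd) -/unzip2 unzip2_zip ?size_zip ?size_tuple ?minnn//.
    by rewrite -/unzip1 unzip1_zip// !size_tuple.
  rewrite -(WE' Vt) -amp_jump_weight.
  have := @jpath_close R m d.+1 a sigma b C D b0 C0 D0 aC aD sC sD (shadow_err C D eta eps)
    u u 0 0 x x (jdata W Vt t) (jdata W [tuple of nseq k 0] t).
  rewrite !times_jdata !subrr enorm0 add0r normr0; apply => //.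
  - by rewrite lexx.
  - by rewrite lexx.
  - apply: jclose_jdata => j; rewrite !subrr normr0 enorm0 err0; split => //.
    rewrite [X in _ - X](_ : _ = 0) ?subr0; last by rewrite (tnth_nth 0) /= nth_nseq if_same.
    by apply: V2; exact: mem_tnth.
rewrite mulrBl mul1r [_ * jump_weight W]mulrC in H2 *.
by have := enormBD (jpath a sigma b 0 x (jdata W Vt t) u) (X (Num.truncn (u / eta)))
  (jpath a sigma b 0 x (jdata W [tuple of nseq k 0] t) u); lra.
Qed.

(** By [jpath_drop] the small jump can be removed at the price of a small perturbation, which leads
    to a path with one jump fewer, where [g] is known to vanish. *)
Lemma small_jump_vanish (g : skorokhod R m -> R) eps0 r0 delta (W : k.-tuple V) (t : k.-tuple R) :
  support_away g eps0 r0 -> increasing_tuples `]0, 1]%classic k t ->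
  expR D * (C * delta) <= Num.min eps0 r0 ->
  (exists j, enorm (tnth W j) <= delta) -> g (h W t) = 0.
Proof.
move=> supp ti; rewrite le_min => /andP[err1 err2] [j Wj].
have [p1 p2] := increasing_path ti.
set l := jdata W [tuple of nseq k (0 : 'cV[R]_m)] t.
have lj : (tnth t j, (tnth W j, 0)) \in l.
  have := jdata_mem W [tuple of nseq k (0 : 'cV[R]_m)] t j.
  by rewrite [tnth [tuple of nseq k 0] j](_ : _ = 0)// (tnth_nth 0) /= nth_nseq if_same.
have l0 p : p \in l -> p.2.2 = 0.
  by move=> /mem_jdata[i ->] /=; rewrite (tnth_nth 0) /= nth_nseq if_same.
have lt : times l = t := times_jdata _ _ _.
have lsz : size l = k by rewrite -(size_map fst) lt size_tuple.
have [l1 [l2 lE]] : exists l1 l2, l = l1 ++ (tnth t j, (tnth W j, 0)) :: l2.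
  by case/splitPr: lj => l1 l2; exists l1, l2.
have l12 p : p \in l1 ++ l2 -> p.2.2 = 0.
  move=> pl; apply: l0; rewrite lE mem_cat inE; move: pl; rewrite mem_cat.
  by case/orP => ->; rewrite ?orbT.
rewrite -lt lE in p1 p2.
have [l' [s1 s2 s3 s4 s5]] := jpath_drop b0 C0 D0 aC aD sC x Wj p1 p2 l12.
have sl : size l' = k.-1.
  by rewrite s1 -lsz lE !size_cat /= addnS.
have srt : sorted <%R (times l') by exact: path_sorted s2.
have [|xi xiP xiE] := perturbed_paths_jpath sigma b C0 D0 aC aD x
  (eps := eps0) sl srt s3.
  by move=> p pl; apply: le_trans err1; exact: s4.
have kE : k = k.-1.+1 by rewrite prednK// (leq_ltn_trans _ (ltn_ord j)).
have {}xiP : perturbed_paths_pred a sigma b [set x] k eps0 xi by rewrite kE; exact: xiP.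
apply: (supp xi xiP).
apply: J1_dist_sup => u u01; apply: le_trans err2.
rewrite xiE// /h (hbarE sigma b D0 aD C0 aC x W _ ti u01) -/l lE; apply: s5.
by move: u01; rewrite in_itv.
Qed.

End good_event.

Lemma bernoulli_sub {R : realDomainType} (c : R) k : 0 <= c <= 1 ->
  1 - k%:R * c <= (1 - c) ^+ k.
Proof.
move=> /andP[c0 c1]; elim: k => [|j IH]; first by rewrite mul0r subr0 expr0.
rewrite exprS -natr1; apply: (@le_trans _ _ ((1 - c) * (1 - j%:R * c))); last first.
  by rewrite ler_wpM2l// subr_ge0.
rewrite (_ : (1 - c) * _ = 1 - (j%:R + 1) * c + j%:R * (c * c)); last by ring.
by rewrite lerDl !mulr_ge0.
Qed.

(** * Continuity and measurability in the noises *)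

Section tuple_continuity.
Context {R : realType} {d k : nat}.
Local Notation V := 'cV[R]_d.

Definition tuple_near (de : R) (W W' : k.-tuple V) := forall j, enorm (tnth W' j - tnth W j) < de.

Lemma measurable_tuple_open (A : set (k.-tuple V)) :
  (forall W, A W -> exists2 de : R, 0 < de & forall W', tuple_near de W W' -> A W') ->
  measurable A.
Proof.
move=> oA; pose c (i : 'I_k * 'I_d) (W : k.-tuple V) := tnth W i.1 i.2 ord0.
apply: (@measurable_rel_open _ _ _ _ c setT) => //.
  move=> i; apply: (measurableT_comp (measurable_coord i.2)); exact: measurable_tnth.
move=> W /oA[de de0 H]; exists (de / d.+1%:R); first by rewrite divr_gt0.
move=> W' _ WW'; apply: H => j; apply: le_lt_trans (enorm_le_sum _) _.
apply: (@le_lt_trans _ _ (\sum_(i < d) (de / d.+1%:R))).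
  by apply: ler_sum => i _; rewrite !mxE; have := WW' (j, i); rewrite /c/= => /ltW.
rewrite sumr_const card_ord -[_ *+ _]mulr_natl mulrA ltr_pdivrMr// mulrC.
by rewrite ltr_pM2l// ltr_nat.
Qed.

Lemma measurable_tuple_continuous (f : k.-tuple V -> R) :
  (forall W e, 0 < e -> exists2 de, 0 < de & forall W', tuple_near de W W' -> `|f W' - f W| < e) ->
  measurable_fun setT f.
Proof.
move=> cf; apply: (@measurability _ _ _ _ _ _ (@RGenOInfty.G R)).
  exact: RGenOInfty.measurableE.
move=> _ [_ [q ->] <-]; rewrite setTI; apply: measurable_tuple_open => W /=.
rewrite in_itv/= andbT => qW; have qW' : 0 < f W - q by rewrite subr_gt0.
have [de de0 H] := cf W _ qW'; exists de => // W' /H.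
by rewrite in_itv/= andbT ltr_norml; lra.
Qed.

End tuple_continuity.

Section jump_functionals.
Context {R : realType} {m d : nat}.
Variables (a : 'cV[R]_m -> 'cV[R]_m) (sigma : 'cV[R]_m -> 'M[R]_(m, d.+1)).
Variables (b : \bar R) (C D : R).
Hypothesis b0 : (0 < b)%E.
Hypothesis C0 : 0 <= C.
Hypothesis D0 : 0 <= D.
Hypothesis aC : forall x, enorm (a x) <= C.
Hypothesis aD : forall x y, enorm (a x - a y) <= D * enorm (x - y).
Hypothesis sC : forall x, opnorm (sigma x) <= C.
Hypothesis sD : forall x y, opnorm (sigma x - sigma y) <= D * enorm (x - y).
Local Notation V := 'cV[R]_d.+1.
Variables (k : nat) (x : 'cV[R]_m).
Local Notation h := (h a sigma b x).
Local Notation rho := (jump_weight C D).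

Lemma noises_jdata (U : k.-tuple 'cV[R]_m) (W : k.-tuple V) (t : k.-tuple R) :
  [seq p.2.1 | p <- jdata W U t] = W.
Proof.
rewrite /jdata (map_comp fst snd) -/unzip2 unzip2_zip ?size_zip ?size_tuple ?minnn//.
by rewrite -/unzip1 unzip1_zip// !size_tuple.
Qed.

Lemma h_noise_continuous (W : k.-tuple V) (t : k.-tuple R) e :
  increasing_tuples `]0, 1]%classic k t -> 0 < e ->
  exists2 de, 0 < de & forall W', tuple_near de W W' -> J1_dist (h W t) (h W' t) < e.
Proof.
move=> ti e0; have w1 := jump_weight_ge1 C0 D0 W.
have w0 : 0 < rho W by exact: lt_le_trans w1.
exists (e / 2 / rho W); first by rewrite !divr_gt0.
move=> W' WW'; apply: (@le_lt_trans _ _ (e / 2)); last by lra.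
have [p1 p2] := increasing_path ti.
apply: J1_dist_sup => u u01; rewrite /h !(hbarE sigma b D0 aD C0 aC x _ _ ti u01).
have := @jpath_close R m d.+1 a sigma b C D b0 C0 D0 aC aD sC sD (e / 2 / rho W)
    u u 0 0 x x (jdata W [tuple of nseq k 0] t) (jdata W' [tuple of nseq k 0] t).
rewrite !times_jdata !subrr enorm0 add0r normr0 amp_jump_weight noises_jdata => H.
apply: le_trans (H _ _ _ _ _ _ _ _ _ _) _ => //.
- by move: u01; rewrite in_itv/= lexx/= => /andP[].
- by move: u01; rewrite in_itv/= => /andP[].
- by move: u01; rewrite in_itv/= lexx/= => /andP[].
- by rewrite !divr_ge0// ltW.
- by rewrite !divr_ge0// ltW.
- by rewrite !divr_ge0// ltW.
- apply: jclose_jdata => j; have de0 : 0 <= e / 2 / rho W by rewrite !divr_ge0// ltW.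
  by rewrite !subrr normr0 enorm0 de0 enormB; split => //; exact/ltW/WW'.
by rewrite mulrBl mul1r [rho W * _]mulrC divfK ?gt_eqF// lerBlDr lerDl !divr_ge0// ltW.
Qed.

(** The lower bound, which tends to the weight itself, is needed to show that [osc_set] is open; the
    cruder upper bound serves in its asymptotics. *)
Lemma jump_weight_near (W W' : k.-tuple V) de : 0 <= de -> D * de <= 1 ->
  tuple_near de W W' -> (1 - D * de) ^+ k * rho W <= rho W' /\ rho W' <= 2 ^+ k * rho W.
Proof.
move=> de0 De WW'; have A1 := amp_const_ge1 C0 D0.
have A0 : 0 <= amp_const C D by exact: le_trans A1.
have De0 : 0 <= D * de by rewrite mulr_ge0.
have s01 : 0 <= 1 - D * de <= 1 by lra.
have [s0 s1] := andP s01.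
have f0 (w : V) : 0 <= amp_const C D * (1 + D * enorm w).
  by rewrite mulr_ge0// addr_ge0// mulr_ge0 ?enorm_ge0.
have near j : `|enorm (tnth W' j) - enorm (tnth W j)| <= de.
  by rewrite (le_trans (enorm_dist _ _))// ltW.
rewrite /rho; split.
  rewrite mulrDr mulr1 lerD ?exprn_ile1//.
  rewrite mulrCA ler_wpM2l// !big_tuple -[X in X ^+ k]/(1 - D * de).
  rewrite -[X in _ ^+ X](card_ord k) -prodr_const -big_split/=.
  apply: ler_prod => j _; rewrite mulr_ge0//= mulrCA ler_wpM2l//.
  have := near j; rewrite ler_norml => /andP[n1 _].
  have h1 : D * (enorm (tnth W j) - de) <= D * enorm (tnth W' j) by rewrite ler_wpM2l//; lra.
  have h2 : 0 <= D * de * (D * enorm (tnth W j)) by rewrite !mulr_ge0 ?enorm_ge0.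
  by lra.
rewrite [leRHS]mulrDr mulr1 lerD ?exprn_ege1 ?ler1n//.
rewrite [leRHS]mulrCA ler_wpM2l// !big_tuple.
rewrite -[X in _ ^+ X](card_ord k) -prodr_const -big_split/=.
apply: ler_prod => j _; rewrite f0//= mulrCA ler_wpM2l//.
have := near j; rewrite ler_norml => /andP[_ n1].
have h1 : D * enorm (tnth W' j) <= D * (enorm (tnth W j) + de) by rewrite ler_wpM2l//; lra.
have h2 : 0 <= D * enorm (tnth W j) by rewrite mulr_ge0 ?enorm_ge0.
by lra.
Qed.

Variable g : skorokhod R m -> R.
Hypothesis cg : continuous g.

Lemma J1_continuousP xi e : 0 < e -> exists2 de, 0 < de &
  forall y, J1_dist xi y < de -> `|g y - g xi| < e.
Proof.
move=> e0; have /cvgrPdist_lt/(_ _ e0)/nbhs_ballP[de /= de0 H] := @cg xi.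
by exists de => // y xy; rewrite distrC; apply: H.
Qed.

Lemma measurable_g : measurable_fun setT g.
Proof.
apply: (@measurability _ _ _ _ _ _ (@RGenOInfty.G R)).
  exact: RGenOInfty.measurableE.
move=> _ [_ [q ->] <-]; rewrite setTI; apply: sub_sigma_algebra.
by move/continuousP : cg; apply; exact: rray_open.
Qed.

Lemma measurable_gh (t : k.-tuple R) : increasing_tuples `]0, 1]%classic k t ->
  measurable_fun setT (fun W : k.-tuple V => g (h W t)).
Proof.
move=> ti; apply: measurable_tuple_continuous => W e e0.
have [de' de'0 H'] := J1_continuousP (h W t) e0.
have [de de0 H] := h_noise_continuous W ti de'0.
by exists de => // W' /H/H'.
Qed.

(** Noises at which the available continuity of [g] is insufficient: some path within the tolerance
    [e], scaled by the weight, changes [g] by more than [tau]. The witness [y] ranges over all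
    paths, so the set does not depend on the discrete dynamics. *)
Definition osc_set (tau e : R) (t : k.-tuple R) : set (k.-tuple V) :=
  [set W | exists y, J1_dist y (h W t) < e * rho W /\ tau < `|g y - g (h W t)|].

(** The set is open. The same witness [y] serves for nearby noises, the slack in each of the two
    strict inequalities being split into halves [q] and [r]. *)
Lemma measurable_osc_set tau e (t : k.-tuple R) : 0 < e ->
  increasing_tuples `]0, 1]%classic k t -> measurable (osc_set tau e t).
Proof.
move=> e0 ti; apply: measurable_tuple_open => W [y [y1 y2]].
have aux2 (u : R) : tau < u -> (u - tau) / 2 < u - tau by lra.
have aux (u v q' r' : R) : r' < q' -> u - q' <= v -> u - 2 * q' + r' < v by lra.
have w1 := jump_weight_ge1 C0 D0 W.
have w0 : 0 < rho W by exact: lt_le_trans w1.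
pose q := (e * rho W - J1_dist y (h W t)) / 2.
have q0 : 0 < q by rewrite /q; lra.
pose r := (`|g y - g (h W t)| - tau) / 2.
have r0 : 0 < r by rewrite /r; lra.
have [de1 de10 H1] := J1_continuousP (h W t) r0.
have m0 : 0 < Num.min q de1 by rewrite lt_min q0.
have [de2 de20 H2] := h_noise_continuous W ti m0.
pose s := q / (e * rho W) / k.+1%:R.
have er0 : 0 < e * rho W by rewrite mulr_gt0.
have s0 : 0 < s by apply: divr_gt0 => //; apply: divr_gt0.
pose de3 := Num.min 1 s / (D + 1).
have D1 : 0 < D + 1 by rewrite ltr_wpDl.
have de30 : 0 < de3 by rewrite divr_gt0// lt_min ltr01.
have Dde3 : D * de3 <= Num.min 1 s.
  rewrite /de3 mulrA ler_pdivrMr// mulrC ler_wpM2l ?lerDl//.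
  by rewrite le_min ler01 ltW.
exists (Num.min de2 de3); first by rewrite lt_min de20.
move=> W' WW'.
have WW2 : tuple_near de2 W W' by move=> j; have := WW' j; rewrite lt_min => /andP[].
have WW3 : tuple_near de3 W W' by move=> j; have := WW' j; rewrite lt_min => /andP[].
have := H2 _ WW2; rewrite lt_min => /andP[h1 h2].
have De1 : D * de3 <= 1 by rewrite (le_trans Dde3)// ge_min lexx.
have Des : D * de3 <= s by rewrite (le_trans Dde3)// ge_min lexx orbT.
have [h3 _] := jump_weight_near (ltW de30) De1 WW3.
have bern : 1 - k%:R * (D * de3) <= (1 - D * de3) ^+ k.
  by apply: bernoulli_sub; rewrite De1 mulr_ge0// ltW.
exists y; split.
  have tri := J1_dist_triangle (h W t) y (h W' t); apply: le_lt_trans tri _.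
  have k1 : k%:R * (D * de3) <= q / (e * rho W).
    apply: (@le_trans _ _ (k.+1%:R * s)); last by rewrite /s mulrCA divff ?mulr1// pnatr_eq0.
    apply: ler_pM => //; first by rewrite mulr_ge0// ltW.
    by rewrite ler_nat.
  have k2 : (1 - q / (e * rho W)) * rho W <= rho W'.
    by apply: le_trans h3; rewrite ler_pM2r//; apply: le_trans bern; rewrite lerD2l lerN2.
  have H : e * ((1 - q / (e * rho W)) * rho W) <= e * rho W' by rewrite ler_pM2l.
  rewrite (_ : e * _ = e * rho W - q) in H; last by field; rewrite !gt_eqF.
  have -> : J1_dist y (h W t) = e * rho W - 2 * q by rewrite /q; field.
  exact: aux.
have l1 := H1 _ h2; have l2 := ler_distD (g (h W' t)) (g y) (g (h W t)).
have l3 : `|g y - g (h W t)| - r < `|g y - g (h W' t)| by rewrite ltrBlDr (le_lt_trans l2)// ltrD2l.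
apply: lt_trans l3; rewrite ltrBrDr -ltrBrDl /r.
exact: aux2.
Qed.

End jump_functionals.

(** * Pathwise comparison with a sum over tuples of steps *)

Section step_tuples.
Variable n : nat.

(* Steps are numbered from 1: [inc] and [distinct] exclude the index 0. *)
Definition distinct k (I : k.-tuple 'I_n.+1) : bool := uniq I && (ord0 \notin I).
Definition steps k (I : k.-tuple 'I_n.+1) : k.-tuple nat := map_tuple (@nat_of_ord _) I.
Definition inc k (I : k.-tuple 'I_n.+1) : bool := path ltn 0%N (steps I).

Lemma steps_inj k : injective (@steps k).
Proof.
move=> I I' /(congr1 val) /= H; apply: val_inj; apply: (inj_map _ H).
exact: ord_inj.
Qed.

Lemma ord_tuple_exists k (J : seq nat) : size J = k -> {in J, forall i, (i <= n)%N} ->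
  exists I : k.-tuple 'I_n.+1, steps I = J :> seq nat.
Proof.
move=> sJ Jn; have sz : size [seq inord i : 'I_n.+1 | i <- J] == k by rewrite size_map sJ.
exists (Tuple sz); rewrite /= -map_comp -[RHS]map_id; apply/eq_in_map => i /Jn iN /=.
by rewrite inordK.
Qed.

Lemma inc_sorted k (I : k.-tuple 'I_n.+1) : inc I -> sorted ltn (steps I).
Proof. by move=> /path_sorted. Qed.

Lemma inc_gt0 k (I : k.-tuple 'I_n.+1) i : inc I -> i \in (steps I : seq nat) -> (0 < i <= n)%N.
Proof.
move=> iI iJ; have := order_path_min ltn_trans iI => /allP/(_ _ iJ) /= ->.
by move: iJ => /mapP[j _ ->]; rewrite -ltnS ltn_ord.
Qed.

Lemma inc_uniq k (I : k.-tuple 'I_n.+1) : inc I -> uniq (steps I).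
Proof. by move=> /inc_sorted; apply: sorted_uniq; [exact: ltn_trans|exact: ltnn]. Qed.

Lemma inc_distinct k (I : k.-tuple 'I_n.+1) : inc I -> distinct I.
Proof.
move=> iI; rewrite /distinct -(map_inj_uniq (@ord_inj _)) inc_uniq//=.
apply/negP => /(map_f (@nat_of_ord _)) /(inc_gt0 iI).
by rewrite ltnn.
Qed.

Lemma sorted_inc k (I : k.-tuple 'I_n.+1) : sorted ltn (steps I) ->
  (forall i, i \in (steps I : seq nat) -> (0 < i)%N) -> inc I.
Proof.
rewrite /inc; case: (tval (steps I)) => //= i J -> H.
by rewrite andbT; apply: H; rewrite mem_head.
Qed.

End step_tuples.

Definition stimes {R : realType} n (eta : R) k (I : k.-tuple 'I_n.+1) : k.-tuple R :=
  map_tuple (fun i : 'I_n.+1 => eta * (i : nat)%:R) I.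

Section path_approximation.
Context {R : realType} {m d : nat}.
Variables (a : 'cV[R]_m -> 'cV[R]_m) (sigma : 'cV[R]_m -> 'M[R]_(m, d.+1)).
Variables (b : \bar R) (C D : R).
Hypothesis b0 : (0 < b)%E.
Hypothesis C0 : 0 <= C.
Hypothesis D0 : 0 <= D.
Hypothesis aC : forall x, enorm (a x) <= C.
Hypothesis aD : forall x y, enorm (a x - a y) <= D * enorm (x - y).
Hypothesis sC : forall x, opnorm (sigma x) <= C.
Hypothesis sD : forall x y, opnorm (sigma x - sigma y) <= D * enorm (x - y).
Local Notation V := 'cV[R]_d.+1.
Variables (k : nat) (x : 'cV[R]_m).
Local Notation h := (h a sigma b x).
Variables (g : skorokhod R m -> R) (M eps0 r0 : R).
Hypothesis gM : forall xi, 0 <= g xi <= M.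
Hypothesis supp : support_away a sigma b k x g eps0 r0.

Definition all_big (delta : R) j (W : j.-tuple V) : bool := [forall i, delta < enorm (tnth W i)].

Section fixed_noise.
Variables (eta : R) (z : nat -> V).
Hypothesis eta0 : 0 < eta.
Local Notation n := (Num.truncn eta^-1).
Local Notation X := (X_path a sigma eta b x z).

Definition noises j (I : j.-tuple 'I_n.+1) : j.-tuple V := map_tuple (fun i => eta *: z i) (steps I).

Lemma all_big_bigs delta j (I : j.-tuple 'I_n.+1) : distinct I ->
  all_big delta (noises I) -> {subset (steps I : seq nat) <= bigs delta eta z}.
Proof.
move=> /andP[_ I0] /forallP bI i /tnthP[l ->]; rewrite mem_bigs.
have := bI l; rewrite tnth_map => ->; rewrite andbT tnth_map.
apply/andP; split; last by rewrite -ltnS ltn_ord.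
rewrite lt0n; apply: contra I0 => /eqP E; apply/tnthP; exists l; apply: val_inj => /=.
by rewrite E.
Qed.

Lemma bigs_all_big delta j (I : j.-tuple 'I_n.+1) :
  {subset (steps I : seq nat) <= bigs delta eta z} -> all_big delta (noises I).
Proof.
move=> H; apply/forallP => l; have := H _ (mem_tnth l (steps I)).
by rewrite mem_bigs !tnth_map => /andP[].
Qed.

(** When more than [k] noises exceed [delta], every [k]-tuple of such steps extends by one more. So
    both the value of [g] and the sum over [k]-tuples are controlled by the number of [k.+1]-tuples;
    using distinct rather than increasing tuples lets the new step be put in front. *)
Lemma many_jumps_count delta delta' : delta <= delta' -> (k < size (bigs delta eta z))%N ->
  let U := (\sum_(K : k.+1.-tuple 'I_n.+1 | distinct K) (all_big delta (noises K) : nat))%N in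
  (1 <= U)%N /\ (\sum_(I : k.-tuple 'I_n.+1 | inc I) (all_big delta' (noises I) : nat) <= U)%N.
Proof.
move=> dd' kN U.
pose Cn := (\sum_(I : k.-tuple 'I_n.+1 | distinct I) (all_big delta (noises I) : nat))%N.
have CU : (Cn <= U)%N.
  have UE : U = (\sum_(I : k.-tuple 'I_n.+1) \sum_(i : 'I_n.+1 | distinct [tuple of i :: I])
      (all_big delta (noises [tuple of i :: I]) : nat))%N.
    rewrite /U pair_big_dep /=.
    rewrite (reindex (fun p : k.-tuple 'I_n.+1 * 'I_n.+1 => [tuple of p.2 :: p.1])) //=.
    exists (fun K : k.+1.-tuple 'I_n.+1 => ([tuple of behead K], thead K)) => [[I i] _|K _].
      by rewrite theadE; congr (_, _); apply: val_inj.
    by rewrite /= -tuple_eta.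
  rewrite UE /Cn big_mkcond; apply: leq_sum => I _; case: ifPn => // dI.
  case: (boolP (all_big delta (noises I))) => // bI.
  have sI := all_big_bigs dI bI.
  have : ~~ all (fun i => i \in (steps I : seq nat)) (bigs delta eta z).
    apply/negP => /allP H.
    have : (size (bigs delta eta z) <= size (steps I))%N.
      by apply: uniq_leq_size => //; rewrite filter_uniq// iota_uniq.
    by rewrite size_tuple leqNgt kN.
  move=> /allPn[i ib iI].
  have /andP[/andP[i0 iN] _] : (0 < i <= n)%N && (delta < enorm (eta *: z i)) by rewrite -mem_bigs.
  have iK : (inord i : 'I_n.+1) = i :> nat by rewrite inordK.
  have diI : distinct [tuple of (inord i : 'I_n.+1) :: I].
    move: dI => /andP[uI I0]; rewrite /distinct /= uI andbT inE negb_or I0 andbT.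
    apply/andP; split.
      by apply: contra iI => /(map_f (@nat_of_ord _)); rewrite iK.
    by apply/eqP => /(congr1 (@nat_of_ord _)) /= E; rewrite iK in E; rewrite -E in i0.
  rewrite (bigD1 (inord i : 'I_n.+1))//= (_ : all_big _ _ = true) ?leq_addr//.
  apply: bigs_all_big => j; rewrite inE => /predU1P[->|]; last exact: sI.
  by rewrite iK.
have C1 : (1 <= Cn)%N.
  have [||I IE] := @ord_tuple_exists n k (take k (bigs delta eta z)).
  - by rewrite size_takel// ltnW.
  - by move=> i /mem_take; rewrite mem_bigs => /andP[/andP[]].
  have dI : distinct I.
    apply/inc_distinct/sorted_inc.
      by rewrite IE; apply: (subseq_sorted ltn_trans (take_subseq _ _)); exact: bigs_sorted.
    by move=> i; rewrite IE => /mem_take; rewrite mem_bigs => /andP[/andP[]].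
  rewrite /Cn (bigD1 I)//= (_ : all_big _ _ = true) ?leq_addr//.
  by apply: bigs_all_big => j; rewrite IE => /mem_take.
split; first exact: leq_trans CU.
apply: leq_trans CU; rewrite /Cn big_mkcond [X in (_ <= X)%N]big_mkcond; apply: leq_sum => I _.
case: ifPn => // iI; rewrite (inc_distinct iI).
case: (boolP (all_big delta' (noises I))) => // bI.
rewrite (_ : all_big _ _ = true)//; apply/forallP => l.
by move/forallP : bI => /(_ l); exact: le_lt_trans.
Qed.

Lemma big_steps_unique delta delta' (I : k.-tuple 'I_n.+1) : delta <= delta' ->
  (size (bigs delta eta z) <= k)%N -> inc I -> all_big delta' (noises I) ->
  bigs delta eta z = steps I.
Proof.
move=> dd' Nk iI bI.
have bI' : all_big delta (noises I).
  by apply/forallP => l; move/forallP : bI => /(_ l); exact: le_lt_trans.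
have sub := all_big_bigs (inc_distinct iI) bI'.
have [//|_ eqi] := uniq_min_size (inc_uniq iI) sub; first by rewrite size_tuple.
apply/esym; apply: (irr_sorted_eq ltn_trans ltnn) => //.
  exact: inc_sorted.
exact: bigs_sorted.
Qed.

(** With more than [k] noises above [delta] the last term suffices. Otherwise at most one increasing
    tuple has all its noises above [delta'], and by support considerations no other contributes. If
    it exists, [exact_jumps] compares the two values up to oscillation; if not, [few_jumps] makes
    both vanish. The middle term covers the failure of the noise control. *)
Lemma path_approx delta delta' eps tau e :
  0 <= delta <= delta' -> 0 <= tau -> (k <= n)%N -> 0 <= eps ->
  ((C * eta + C * delta')%:E <= b)%E ->
  shadow_err C D eta (eps + (2 * k)%:R * (C * delta')) <= Num.min eps0 r0 ->
  shadow_err C D eta eps < e ->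
  expR D * (C * delta') <= Num.min eps0 r0 ->
  `|g X - \sum_(I : k.-tuple 'I_n.+1 | inc I) g (h (noises I) (stimes eta I))| <=
  \sum_(I : k.-tuple 'I_n.+1 | inc I) (all_big delta' (noises I))%:R *
     (tau + M * \1_(osc_set a sigma b C D x g tau e (stimes eta I)) (noises I)) +
  M * `[< exists2 i, (i <= n)%N & eps < enorm (off_noise a sigma b eta x z (bigs delta eta z) i) >]%:R +
  M * (\sum_(K : k.+1.-tuple 'I_n.+1 | distinct K) (all_big delta (noises K) : nat))%:R.
Proof.
move=> /andP[d0 dd'] tau0 kn ep0 cb err1 err2 err3.
have M0 : 0 <= M by have /andP[/le_trans] := gM X; apply.
have gX := gM X; have [gX0 gXM] := andP gX.
have ti (I : k.-tuple 'I_n.+1) : inc I -> increasing_tuples `]0, 1]%classic k (stimes eta I).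
  move=> iI; have tE : stimes eta I = [seq eta * i%:R | i <- steps I] :> seq R.
    by rewrite /= -map_comp.
  split=> [|s]; rewrite tE; first exact/scaled_times_sorted/inc_sorted.
  move=> /(scaled_times_in eta0) H; rewrite /= in_itv/=; apply: H.
  by move=> i /(inc_gt0 iI); rewrite mem_iota add1n ltnS.
have van (I : k.-tuple 'I_n.+1) : inc I -> ~~ all_big delta' (noises I) ->
    g (h (noises I) (stimes eta I)) = 0.
  move=> iI /forallPn[l]; rewrite -leNgt => nl.
  by apply: (small_jump_vanish b0 C0 D0 aC aD sC supp (ti _ iI) err3); exists l.
set T := \sum_(I | inc I) _ * _; set bad := `[< _ >]; set U := (\sum_(K | distinct K) _)%N.
have T0 : 0 <= T.
  apply: sumr_ge0 => I _; rewrite mulr_ge0// addr_ge0// mulr_ge0//.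
have S0 : 0 <= \sum_(I : k.-tuple 'I_n.+1 | inc I) g (h (noises I) (stimes eta I)).
  by apply: sumr_ge0 => I _; have /andP[] := gM (h (noises I) (stimes eta I)).
have [Nk|kN] := leqP (size (bigs delta eta z)) k; last first.
  have [U1 CU] := many_jumps_count dd' kN; rewrite -/U in U1 CU.
  have S1 : \sum_(I : k.-tuple 'I_n.+1 | inc I) g (h (noises I) (stimes eta I)) <= M * U%:R.
    apply: (@le_trans _ _ (M * (\sum_(I : k.-tuple 'I_n.+1 | inc I)
        (all_big delta' (noises I) : nat))%:R)); last by rewrite ler_wpM2l// ler_nat.
    rewrite natr_sum mulr_sumr; apply: ler_sum => I iI.
    case: (boolP (all_big _ _)) => bI; first by rewrite mulr1; have /andP[] := gM (h (noises I) (stimes eta I)).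
    by rewrite van// mulr0.
  have S2 : g X <= M * U%:R.
    by apply: (le_trans gXM); rewrite ler_peMr// ler1n.
  have : 0 <= M * bad%:R by rewrite mulr_ge0.
  by rewrite ler_norml; lra.
have MU : 0 <= M * U%:R by rewrite mulr_ge0.
have [[I0 [i0 B0]]|none] := pselect (exists I : k.-tuple 'I_n.+1, inc I /\ all_big delta' (noises I)).
  have bE := big_steps_unique dd' Nk i0 B0.
  have oth (I : k.-tuple 'I_n.+1) : inc I -> I != I0 -> ~~ all_big delta' (noises I).
    move=> iI; apply: contra => bI; apply/eqP/steps_inj/val_inj.
    by rewrite /= -bE (big_steps_unique dd' Nk iI bI).
  have -> : \sum_(I : k.-tuple 'I_n.+1 | inc I) g (h (noises I) (stimes eta I)) =
      g (h (noises I0) (stimes eta I0)).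
    rewrite (bigD1 I0)//= big1 ?addr0// => I /andP[iI II0].
    by rewrite van//; exact: oth.
  have -> : T = tau + M * \1_(osc_set a sigma b C D x g tau e (stimes eta I0)) (noises I0).
    rewrite /T (bigD1 I0)//= B0 mul1r big1 ?addr0// => I /andP[iI II0].
    by rewrite (negbTE (oth _ iI II0)) mul0r.
  have /andP[h0 hM] := gM (h (noises I0) (stimes eta I0)).
  have dif : `|g X - g (h (noises I0) (stimes eta I0))| <= M by rewrite ler_norml; lra.
  set O := osc_set _ _ _ _ _ _ _ _ _ _.
  have MO : 0 <= M * \1_O (noises I0) by rewrite mulr_ge0.
  have [bd|nbd] := boolP bad; first by rewrite mulr1; lra.
  rewrite mulr0 addr0.
  have noise i : (i <= n)%N -> enorm (off_noise a sigma b eta x z (bigs delta eta z) i) <= eps.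
    move=> iN; rewrite leNgt; apply: contra nbd => H; apply/asboolP; exists i => //.
  have cb' : ((C * eta + C * delta)%:E <= b)%E.
    by apply: le_trans cb; rewrite lee_fin lerD2l ler_wpM2l.
  have J1 := exact_jumps b0 C0 D0 aC aD sC sD (x := x) eta0 d0 bE (W := noises I0)
    (t := stimes eta I0) erefl _ noise cb'.
  have {}J1 : J1_dist X (h (noises I0) (stimes eta I0)) <= shadow_err C D eta eps * jump_weight C D (noises I0).
    by apply: J1; rewrite /= -map_comp.
  have [le|gt] := leP `|g X - g (h (noises I0) (stimes eta I0))| tau; first by lra.
  rewrite indicE mem_set ?mulr1; first by lra.
  exists X; split => //; apply: (le_lt_trans J1); rewrite ltr_pM2r//.
  exact: lt_le_trans ltr01 (jump_weight_ge1 C0 D0 _).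
have nb (I : k.-tuple 'I_n.+1) : inc I -> ~~ all_big delta' (noises I).
  by move=> iI; apply/negP => bI; apply: none; exists I.
rewrite big1; last by move=> I iI; rewrite van//; exact: nb.
rewrite subr0 ger0_norm//.
have [bd|nbd] := boolP bad; first by rewrite mulr1; lra.
have noise i : (i <= n)%N -> enorm (off_noise a sigma b eta x z (bigs delta eta z) i) <= eps.
  move=> iN; rewrite leNgt; apply: contra nbd => H; apply/asboolP; exists i => //.
have sub : subseq (bigs delta' eta z) (bigs delta eta z).
  rewrite subseq_filter filter_subseq andbT; apply/allP => i; rewrite mem_filter => /andP[+ _].
  exact: le_lt_trans.
have Nk' : (size (bigs delta' eta z) < k)%N.
  rewrite ltn_neqAle (leq_trans (size_subseq sub) Nk) andbT; apply/negP => /eqP sk.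
  have [|I IE] := @ord_tuple_exists n k _ sk.
    by move=> i; rewrite mem_bigs => /andP[/andP[]].
  have iI : inc I.
    apply: sorted_inc; rewrite IE; first exact: bigs_sorted.
    by move=> i; rewrite mem_bigs => /andP[/andP[]].
  by have := nb _ iI; rewrite bigs_all_big// IE.
rewrite (few_jumps b0 C0 D0 aC aD sC eta0 supp _ ep0 kn Nk Nk' noise cb err1) ?d0//.
by rewrite !addr_ge0// mulr_ge0.
Qed.

End fixed_noise.
End path_approximation.

Section bounded_measurable.
Context {disp} {T : measurableType disp} {R : realType} (P : {measure set T -> \bar R}).
Hypothesis PT : (P setT < +oo)%E.

Definition bounded_meas (f : T -> R) := measurable_fun setT f /\ exists B, forall x, 0 <= f x <= B.

Lemma bounded_meas_fin f : bounded_meas f -> (\int[P]_x (f x)%:E < +oo)%E.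
Proof. by move=> [mf [B fB]]; exact: (prob_int_fin PT mf fB). Qed.

Lemma bounded_meas_ge0 f : bounded_meas f -> forall x, 0 <= f x.
Proof. by move=> [_ [B fB]] x; have /andP[] := fB x. Qed.

Lemma bounded_measD f g : bounded_meas f -> bounded_meas g ->
  bounded_meas (fun x => f x + g x) /\ rint P (fun x => f x + g x) = rint P f + rint P g.
Proof.
move=> bf bg; have [[mf [B fB]] [mg [B' gB]]] := (bf, bg); split.
  split; first exact: measurable_funD.
  exists (B + B') => x; have /andP[f0 f1] := fB x; have /andP[g0 g1] := gB x.
  by rewrite addr_ge0// lerD.
have f0 := bounded_meas_ge0 bf; have g0 := bounded_meas_ge0 bg.
by have [_ ->] := rintD f0 g0 mf mg (bounded_meas_fin bf) (bounded_meas_fin bg).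
Qed.

Lemma bounded_measZ c f : 0 <= c -> bounded_meas f ->
  bounded_meas (fun x => c * f x) /\ rint P (fun x => c * f x) = c * rint P f.
Proof.
move=> c0 bf; have [mf [B fB]] := bf; split.
  split; first by apply: measurable_funM => //; exact: measurable_cst.
  by exists (c * B) => x; have /andP[f0 f1] := fB x; rewrite mulr_ge0// ler_wpM2l.
by have [_ ->] := rintZ c0 (bounded_meas_ge0 bf) mf (bounded_meas_fin bf).
Qed.

Lemma bounded_meas_sum (I : Type) (s : seq I) (p : pred I) (F : I -> T -> R) :
  (forall i, p i -> bounded_meas (F i)) ->
  bounded_meas (fun x => \sum_(i <- s | p i) F i x) /\
  rint P (fun x => \sum_(i <- s | p i) F i x) = \sum_(i <- s | p i) rint P (F i).
Proof.
move=> bF; elim: s => [|i s [IH1 IH2]].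
  rewrite big_nil (_ : (fun x => _) = cst 0); last by apply/funext => x; rewrite big_nil.
  split; last by rewrite /rint integral0.
  by split; [exact: measurable_cst|exists 0 => x; rewrite lexx].
rewrite big_cons; have [pi|pi] := boolP (p i).
  rewrite (_ : (fun x => _) = fun x => F i x + \sum_(i <- s | p i) F i x); last first.
    by apply/funext => x; rewrite big_cons pi.
  have [h1 h2] := bounded_measD (bF _ pi) IH1.
  by split => //; rewrite h2 IH2.
rewrite (_ : (fun x => _) = fun x => \sum_(i <- s | p i) F i x) //.
by apply/funext => x; rewrite big_cons (negbTE pi).
Qed.

Lemma bounded_meas_le f g : bounded_meas f -> bounded_meas g -> (forall x, f x <= g x) ->
  rint P f <= rint P g.
Proof.
move=> bf bg fg; apply: rint_le; [|exact: bf.1|exact: bg.1|exact: bounded_meas_fin].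
by move=> x; rewrite (bounded_meas_ge0 bf)/=.
Qed.

Lemma bounded_meas_indic A : measurable A ->
  bounded_meas \1_A /\ rint P \1_A = fine (P A).
Proof.
move=> mA; split; last by rewrite /rint integral_indic// setIT.
split; first exact: measurable_indic.
by exists 1 => x; rewrite indicE; case: (_ \in _); rewrite ?lexx ?ler01.
Qed.

Lemma rint_dist_le f g c : bounded_meas f -> bounded_meas g -> bounded_meas c ->
  (forall x, `|f x - g x| <= c x) -> `|rint P f - rint P g| <= rint P c.
Proof.
move=> bf bg bc fgc.
have [b1 e1] := bounded_measD bg bc; have [b2 e2] := bounded_measD bf bc.
have : rint P f <= rint P g + rint P c.
  by rewrite -e1; apply: bounded_meas_le => // x; have := fgc x; rewrite ler_norml; lra.
have : rint P g <= rint P f + rint P c.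
  by rewrite -e2; apply: bounded_meas_le => // x; have := fgc x; rewrite ler_norml; lra.
by rewrite ler_norml; lra.
Qed.

End bounded_measurable.

Section expectation_approximation.
Context {R : realType} {m d : nat}.
Variables (a : 'cV[R]_m -> 'cV[R]_m) (sigma : 'cV[R]_m -> 'M[R]_(m, d.+1)).
Variables (b : \bar R) (C D : R).
Hypothesis b0 : (0 < b)%E.
Hypothesis C0 : 0 <= C.
Hypothesis D0 : 0 <= D.
Hypothesis aC : forall x, enorm (a x) <= C.
Hypothesis aD : forall x y, enorm (a x - a y) <= D * enorm (x - y).
Hypothesis sC : forall x, opnorm (sigma x) <= C.
Hypothesis sD : forall x y, opnorm (sigma x - sigma y) <= D * enorm (x - y).
Local Notation V := 'cV[R]_d.+1.
Variables (k : nat) (x : 'cV[R]_m).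
Local Notation h := (h a sigma b x).
Variables (g : skorokhod R m -> R) (M eps0 r0 : R).
Hypothesis cg : continuous g.
Hypothesis gM : forall xi, 0 <= g xi <= M.
Hypothesis supp : support_away a sigma b k x g eps0 r0.
Context {disp : measure_display} {Omega : measurableType disp}.
Variable P : probability Omega R.
Variable Z : nat -> Omega -> V.
Hypothesis mZ : forall n, measurable_fun setT (Z n).
Hypothesis iidZ : iid P Z.
Local Notation H := (rtail P (Z 0%N)).

Lemma measurable_all_big delta j : measurable [set W : j.-tuple V | all_big delta W].
Proof.
rewrite (_ : [set W | _] = box (fun=> [set z : V | (delta < enorm z)%R])).
  by apply: measurable_box => i; exact: measurable_enorm_gt.
by apply/seteqP; split => W; [move=> /forallP H' i; exact: H'|move=> H'; apply/forallP => i; exact: H'].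
Qed.

Lemma all_big_indic delta j (W : j.-tuple V) :
  (all_big delta W)%:R = \1_[set W : j.-tuple V | all_big delta W] W :> R.
Proof. by rewrite indicE; congr (_%:R); rewrite mem_setE. Qed.

Lemma stimes_inc n (eta : R) (I : k.-tuple 'I_n.+1) : 0 < eta -> n = Num.truncn eta^-1 -> inc I ->
  increasing_tuples `]0, 1]%classic k (stimes eta I).
Proof.
move=> eta0 nE iI; have tE : stimes eta I = [seq eta * i%:R | i <- steps I] :> seq R.
  by rewrite /= -map_comp.
split=> [|s]; rewrite tE; first exact/(scaled_times_sorted eta0)/inc_sorted.
move=> /(scaled_times_in eta0) H'; rewrite /= in_itv/=; apply: H'.
by move=> i /(inc_gt0 iI); rewrite mem_iota add1n ltnS nE.
Qed.

Definition jump_sum (eta : R) (F : k.-tuple V -> k.-tuple R -> R) : R :=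
  \sum_(I : k.-tuple 'I_(Num.truncn eta^-1).+1 | inc I)
    rint (tmeas (nlaw P mZ eta) k) (fun W => F W (stimes eta I)).

(** Noises of distinct steps are independent, so all of them being large has probability a power of
    [H]; the tuples are counted crudely by powers of the number of indices. *)
Lemma expect_approx eta delta delta' eps tau e q :
  0 < eta -> 0 <= delta <= delta' -> 0 <= tau -> (k <= Num.truncn eta^-1)%N -> 0 <= eps ->
  0 < e -> 0 <= q ->
  ((C * eta + C * delta')%:E <= b)%E ->
  shadow_err C D eta (eps + (2 * k)%:R * (C * delta')) <= Num.min eps0 r0 ->
  shadow_err C D eta eps < e ->
  expR D * (C * delta') <= Num.min eps0 r0 ->
  (P (noise_bad a sigma b Z delta eps eta x) <= q%:E)%E ->
  `|rint P (fun w => g (X_path a sigma eta b x (Z ^~ w))) - jump_sum eta (fun W t => g (h W t))| <=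
  tau * ((Num.truncn eta^-1).+1%:R * H (delta' / eta)) ^+ k +
  M * jump_sum eta (fun W t => (all_big delta' W)%:R * \1_(osc_set a sigma b C D x g tau e t) W) +
  M * q + M * ((Num.truncn eta^-1).+1%:R * H (delta / eta)) ^+ k.+1.
Proof.
move=> eta0 dd' tau0 kn ep0 e0 q0 cb err1 err2 err3 bad.
have [d0 d'] := andP dd'; set n := Num.truncn eta^-1 in kn *.
have M0 : 0 <= M by have /andP[/le_trans] := gM (X_path a sigma eta b x (fun=> 0)); apply.
have PT : (P setT < +oo)%E by rewrite probability_setT ltry.
pose ti (I : k.-tuple 'I_n.+1) (iI : inc I) := @stimes_inc n eta I eta0 erefl iI.
pose osc (I : k.-tuple 'I_n.+1) := osc_set a sigma b C D x g tau e (stimes eta I).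
have mosc I : inc I -> measurable (osc I).
  by move=> iI; apply: measurable_osc_set => //; exact: ti.
pose nt j (I : j.-tuple 'I_n.+1) w := ntuple Z eta (steps I) w.
have mnt j (I : j.-tuple 'I_n.+1) : measurable_fun setT (nt j I) by exact: measurable_ntuple.
have mpre j (I : j.-tuple 'I_n.+1) A : measurable A -> measurable (nt j I @^-1` A).
  by move=> mA; rewrite -[X in measurable X]setTI; exact: mnt.
have bX : bounded_meas (fun w => g (X_path a sigma eta b x (Z ^~ w))).
  split; last by exists M => w.
  apply: measurableT_comp; first exact: measurable_g.
  exact: (measurable_X_path b0 D0 aD sD).
have bG I : inc I -> bounded_meas (fun w => g (h (nt k I w) (stimes eta I))).
  move=> iI; split; last by exists M => w.
  apply: (@measurableT_comp _ _ _ _ _ _ (fun W => g (h W (stimes eta I)))); last exact: mnt.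
  by apply: (measurable_gh b0 C0 D0 aC aD sC sD) => //; exact: ti.
have bB delta1 j (I : j.-tuple 'I_n.+1) : bounded_meas (fun w => (all_big delta1 (nt j I w))%:R : R).
  rewrite (_ : (fun _ => _) = \1_(nt j I @^-1` [set W : j.-tuple V | all_big delta1 W])).
    have [] // := bounded_meas_indic P (mpre j I _ (@measurable_all_big delta1 j)).
  by apply/funext => w; rewrite all_big_indic !indicE; congr (_%:R).
have eB delta1 j (I : j.-tuple 'I_n.+1) : distinct I ->
    rint P (fun w => (all_big delta1 (nt j I w))%:R : R) = H (delta1 / eta) ^+ j.
  move=> dI; have uI : uniq (steps I).
    by rewrite map_inj_uniq; [case/andP: dI|exact: ord_inj].
  rewrite (_ : (fun _ => _) = \1_(nt j I @^-1` [set W : j.-tuple V | all_big delta1 W])); last first.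
    by apply/funext => w; rewrite all_big_indic !indicE; congr (_%:R).
  have [_ ->] := bounded_meas_indic P (mpre j I _ (@measurable_all_big delta1 j)).
  rewrite -[RHS]/(fine (H (delta1 / eta) ^+ j)%:E) -(big_noise_prob mZ iidZ delta1 eta0 uI).
  congr (fine (P _)); apply/seteqP; split => w /=.
    by move=> /forallP bI l; have := bI l; rewrite /nt tnth_map.
  by move=> bI; apply/forallP => l; rewrite [tnth (nt _ _ _) _]tnth_map.
pose F2 (W : k.-tuple V) (t : k.-tuple R) : R :=
  (all_big delta' W)%:R * \1_(osc_set a sigma b C D x g tau e t) W.
have F2E W t : F2 W t = \1_([set W : k.-tuple V | all_big delta' W] `&`
    osc_set a sigma b C D x g tau e t) W.
  by rewrite /F2 all_big_indic indicI.
have mF2 I : inc I -> measurable ([set W : k.-tuple V | all_big delta' W] `&` osc I).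
  by move=> iI; apply: measurableI; [exact: measurable_all_big|exact: mosc].
have bF2 I : inc I -> bounded_meas (fun w => F2 (nt k I w) (stimes eta I)).
  move=> iI; rewrite (_ : (fun _ => _) = \1_(nt k I @^-1` ([set W : k.-tuple V | all_big delta' W] `&` osc I))).
    by have [] // := bounded_meas_indic P (mpre k I _ (mF2 I iI)).
  by apply/funext => w; rewrite F2E !indicE; congr (_%:R).
have [bS eS] := bounded_meas_sum PT (index_enum _) bG.
pose T1 w := \sum_(I : k.-tuple 'I_n.+1 | inc I) (all_big delta' (nt k I w))%:R : R.
have [bT1 eT1] := bounded_meas_sum PT (index_enum _) (fun I (_ : inc I) => bB delta' k I).
have [bT2 eT2] := bounded_meas_sum PT (index_enum _) bF2.
have [bU eU] := bounded_meas_sum PT (index_enum _) (fun K (_ : distinct K) => bB delta k.+1 K).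
have mbad := measurable_noise_bad b0 D0 aD sD mZ delta eps eta x.
have [bb eb] := bounded_meas_indic P mbad.
have [z1 ez1] := bounded_measZ PT tau0 bT1.
have [z2 ez2] := bounded_measZ PT M0 bT2.
have [z3 ez3] := bounded_measZ PT M0 bb.
have [z4 ez4] := bounded_measZ PT M0 bU.
have [s1 es1] := bounded_measD PT z1 z2.
have [s2 es2] := bounded_measD PT s1 z3.
have [s3 es3] := bounded_measD PT s2 z4.
have jsE (F : k.-tuple V -> k.-tuple R -> R) : (forall I : k.-tuple 'I_n.+1, inc I ->
      measurable_fun setT (fun W => F W (stimes eta I)) /\ forall W, 0 <= F W (stimes eta I)) ->
    jump_sum eta F = \sum_(I : k.-tuple 'I_n.+1 | inc I) rint P (fun w => F (nt k I w) (stimes eta I)).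
  move=> mF; apply: eq_bigr => I iI; have [mFI F0] := mF I iI.
  by rewrite -(ntuple_rint mZ iidZ eta (inc_uniq iI) mFI F0).
rewrite jsE; last first.
  move=> I iI; split; first by apply: (measurable_gh b0 C0 D0 aC aD sC sD) => //; exact: ti.
  by move=> W; have /andP[] := gM (h W (stimes eta I)).
rewrite -eS; apply: (le_trans (rint_dist_le PT bX bS s3 _)).
  move=> w; have := @path_approx R m d a sigma b C D b0 C0 D0 aC aD sC sD k x g M eps0 r0 gM supp
    eta (Z ^~ w) eta0 delta delta' eps tau e dd' tau0 kn ep0 cb err1 err2 err3.
  move/le_trans; apply; rewrite le_eqVlt; apply/orP; left; apply/eqP.
  congr (_ + _ + _).
  - rewrite !mulr_sumr -big_split/=; apply: eq_bigr => I _.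
    by rewrite mulrDr mulrC; congr (_ + _); rewrite mulrCA.
  - by rewrite natr_sum.
rewrite es3 es2 es1 ez1 ez2 ez3 ez4 eT1 eT2 eU eb.
rewrite (jsE F2); last first.
  move=> I iI; split; last by move=> W; rewrite F2E.
  rewrite (_ : (fun W => _) = \1_([set W : k.-tuple V | all_big delta' W] `&` osc I)).
    by apply: measurable_indic; exact: mF2.
  by apply/funext => W; exact: F2E.
have cnt j (p : pred (j.-tuple 'I_n.+1)) (c : R) : 0 <= c ->
    \sum_(I : j.-tuple 'I_n.+1 | p I) c ^+ j <= (n.+1%:R * c) ^+ j.
  move=> c0; rewrite big_mkcond/=; apply: (@le_trans _ _ (\sum_(I : j.-tuple 'I_n.+1) c ^+ j)).
    by apply: ler_sum => I _; case: ifP => // _; rewrite exprn_ge0.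
  by rewrite sumr_const card_tuple card_ord exprMn -natrX mulr_natl.
have H0 y : 0 <= H y := rtail_ge0 P (Z 0%N) y.
have l1 : tau * (\sum_(I : k.-tuple 'I_n.+1 | inc I) rint P (fun w => (all_big delta' (nt k I w))%:R)) <=
    tau * (n.+1%:R * H (delta' / eta)) ^+ k.
  rewrite ler_wpM2l// (eq_bigr (fun=> H (delta' / eta) ^+ k)); first exact: cnt.
  by move=> I /inc_distinct; exact: eB.
have l2 : M * (\sum_(K : k.+1.-tuple 'I_n.+1 | distinct K) rint P (fun w => (all_big delta (nt k.+1 K w))%:R)) <=
    M * (n.+1%:R * H (delta / eta)) ^+ k.+1.
  rewrite ler_wpM2l// (eq_bigr (fun=> H (delta / eta) ^+ k.+1)); first exact: cnt.
  by move=> K; exact: eB.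
have l3 : M * fine (P (noise_bad a sigma b Z delta eps eta x)) <= M * q.
  rewrite ler_wpM2l// -lee_fin fineK// ge0_fin_numE//.
  by rewrite (le_lt_trans (probability_le1 _ mbad)) ?ltry.
by rewrite lerD// lerD// lerD.
Qed.

End expectation_approximation.

(** * Sums over grids of jump times *)

Section lebesgue_on_R.
Context {R : realType}.

(* [lebesgue_measure] is declared on the copy [measurableTypeR R] of [R] *)
Definition leb (A : set R) : \bar R := @lebesgue_measure R A.

Let leb0 : leb set0 = 0%E. Proof. exact: (@measure0 _ _ _ (@lebesgue_measure R)). Qed.
Let leb_ge0 A : (0 <= leb A)%E. Proof. exact: (@measure_ge0 _ _ _ (@lebesgue_measure R)). Qed.
Let leb_sigma_additive : semi_sigma_additive leb.
Proof. exact: (@measure_semi_sigma_additive _ _ _ (@lebesgue_measure R)). Qed.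

HB.instance Definition _ := isMeasure.Build _ R R leb leb0 leb_ge0 leb_sigma_additive.

Let leb_sigma_finite : sigma_finite setT leb.
Proof. exact: (@sigma_finiteT _ _ _ (@lebesgue_measure R)). Qed.

HB.instance Definition _ := @Measure_isSigmaFinite.Build _ R R leb leb_sigma_finite.

End lebesgue_on_R.

Section grid.
Context {R : realType}.
Variables (k n : nat) (eta : R).
Hypothesis eta0 : 0 < eta.
Hypothesis n1 : eta * n%:R <= 1.
Hypothesis n2 : 1 < eta * n.+1%:R.

(** Indexed by the right end, the time of step [i]; index 0 yields an empty interval. *)
Definition cell (i : nat) : set R := `]eta * i.-1%:R, eta * i%:R]%classic.

Definition cells (I : k.-tuple 'I_n.+1) : set (k.-tuple R) :=
  box (fun j => cell (tnth I j)).

Lemma cell_inj i i' u : (0 < i)%N -> (0 < i')%N -> cell i u -> cell i' u -> i = i'.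
Proof.
rewrite /cell /= !in_itv/= => i0 i0' /andP[a1 a2] /andP[b1 b2].
have := lt_le_trans a1 b2; rewrite ltr_pM2l// ltr_nat => h1.
have := lt_le_trans b1 a2; rewrite ltr_pM2l// ltr_nat => h2.
by apply/eqP; rewrite eqn_leq -{1}(prednK i0) -{2}(prednK i0') h1 h2.
Qed.

Lemma cell_exists u : 0 < u -> exists2 i, (0 < i)%N & cell i u.
Proof.
move=> u0; have ex : exists i, u <= eta * i%:R.
  exists (Num.truncn (u / eta)).+1; rewrite mulrC -ler_pdivrMr//.
  have /andP[_ /ltW//] : (Num.truncn (u / eta))%:R <= u / eta < (Num.truncn (u / eta)).+1%:R.
  by apply: truncn_itv; rewrite divr_ge0// ltW.
case: (ex_minnP ex) => -[|i]; first by rewrite mulr0 leNgt u0.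
move=> ui mi; exists i.+1 => //; rewrite /cell /= in_itv/= ui andbT ltNge.
by apply/negP => /mi; rewrite ltnn.
Qed.

Lemma inc_pos (I : k.-tuple 'I_n.+1) j : inc I -> (0 < tnth I j)%N.
Proof.
move=> iI; have := inc_gt0 iI (mem_tnth j (steps I)).
by rewrite tnth_map => /andP[].
Qed.

Lemma cells_inj (I I' : k.-tuple 'I_n.+1) t : inc I -> inc I' -> cells I t -> cells I' t -> I = I'.
Proof.
move=> iI iI' tI tI'; apply: eq_from_tnth => j; apply: val_inj => /=.
by apply: (cell_inj (inc_pos j iI) (inc_pos j iI') (tI j) (tI' j)).
Qed.

Lemma sorted_tnth (t : k.-tuple R) : (forall i j : 'I_k, (i.+1 = j)%N -> tnth t i < tnth t j) ->
  sorted <%R t.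
Proof.
move=> H; apply/(sortedP 0) => i; rewrite size_tuple => ik.
by have := H (Ordinal (ltnW ik)) (Ordinal ik) erefl; rewrite !(tnth_nth 0).
Qed.

Lemma sorted_tnth_lt (T : Type) (x0 : T) (e : rel T) (s : k.-tuple T) (i j : 'I_k) : (i.+1 = j)%N ->
  sorted e s -> e (tnth s i) (tnth s j).
Proof.
move=> ij /(sortedP x0)/(_ i); rewrite size_tuple !(tnth_nth x0) -ij; apply.
by rewrite ij ltn_ord.
Qed.

Lemma cells_increasing (I : k.-tuple 'I_n.+1) t : inc I -> cells I t ->
  increasing_tuples `]0, 1]%classic k t.
Proof.
move=> iI tI; split.
  apply: sorted_tnth => i j ij; have := tI i; have := tI j.
  rewrite /cell /= !in_itv/= => /andP[h1 _] /andP[_ h2].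
  apply: (le_lt_trans h2); apply: le_lt_trans h1; rewrite ler_pM2l// ler_nat.
  have := sorted_tnth_lt 0%N ij (inc_sorted iI); rewrite !tnth_map /=.
  have := inc_pos j iI; case: (nat_of_ord (tnth I j)) => //.
move=> s /tnthP[j ->]; rewrite /= in_itv/=; have := tI j; rewrite /cell /= in_itv/=.
move=> /andP[h1 h2]; rewrite (le_lt_trans _ h1) ?mulr_ge0 ?(ltW eta0)//=.
by rewrite (le_trans h2)// (le_trans _ n1)// ler_pM2l// ler_nat -ltnS.
Qed.

Lemma cells_stimes (I : k.-tuple 'I_n.+1) t j : cells I t ->
  inc I -> `|tnth (stimes eta I) j - tnth t j| < eta.
Proof.
move=> /(_ j); rewrite /cell /= in_itv/= => /andP[h1 h2] iI; rewrite tnth_map.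
have := inc_pos j iI; move: h1 h2; case: (nat_of_ord _) => //= i.
by rewrite -natr1 mulrDr mulr1 ltr_norml => h1 h2 _; lra.
Qed.

(** Times whose mutual distance is at least the mesh fall into different half-open cells, so their
    indices increase strictly. *)
Lemma cells_exists t kappa : 0 < kappa -> eta <= kappa ->
  (forall i, kappa <= tnth t i <= 1 - kappa /\
    forall j, i != j -> kappa <= `|tnth t i - tnth t j|) -> sorted <%R t ->
  exists2 I : k.-tuple 'I_n.+1, inc I & cells I t.
Proof.
move=> kap0 etak gap st.
have /choice[f Hf] (j : 'I_k) : exists i : 'I_n.+1, (0 < i)%N /\ cell i (tnth t j).
  have [/andP[t1 t2] _] := gap j.
  have [i i0 it] := cell_exists (lt_le_trans kap0 t1).
  have iN : (i < n.+1)%N.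
    rewrite -(ltr_nat R) -(ltr_pM2l eta0); apply: le_lt_trans n2.
    move: it; rewrite /cell /= in_itv/= => /andP[h _].
    rewrite -(prednK i0) -natr1 mulrDr mulr1; lra.
  by exists (Ordinal iN).
exists [tuple f j | j < k]; last by move=> j; rewrite tnth_mktuple; have [] := Hf j.
apply: sorted_inc.
  apply/(sortedP 0%N) => i; rewrite size_tuple => ik.
  pose i1 := Ordinal (ltnW ik); pose i2 := Ordinal ik.
  have := sorted_tnth_lt (i := i1) (j := i2) 0 erefl st => tt.
  have [_ /(_ i2)] := gap i1.
  rewrite -val_eqE /= neq_ltn ltnSn => /(_ isT); rewrite distrC gtr0_norm ?subr_gt0// => g.
  have -> : nth 0%N (steps [tuple f j | j < k]) i = f i1.
    by rewrite -(tnth_nth 0%N (steps [tuple f j | j < k]) i1) tnth_map tnth_mktuple.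
  have -> : nth 0%N (steps [tuple f j | j < k]) i.+1 = f i2.
    by rewrite -(tnth_nth 0%N (steps [tuple f j | j < k]) i2) tnth_map tnth_mktuple.
  have [f1 c1] := Hf i1; have [f2 c2] := Hf i2.
  move: c1 c2; rewrite /cell /= !in_itv/= => /andP[h1 h2] /andP[h3 h4].
  rewrite -(ltr_nat R) -(ltr_pM2l eta0); apply: lt_le_trans h4.
  rewrite -(prednK f1) -natr1 mulrDr mulr1; lra.
move=> i /tnthP[j ->]; rewrite tnth_map tnth_mktuple.
by have [] := Hf j.
Qed.

Lemma measurable_cells (I : k.-tuple 'I_n.+1) : measurable (cells I).
Proof. by apply: measurable_box => j; exact: measurable_itv. Qed.

Lemma cells_measure (I : k.-tuple 'I_n.+1) : inc I -> tmeas (@leb R) k (cells I) = (eta ^+ k)%:E.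
Proof.
move=> iI; rewrite tmeas_box; last by move=> j; exact: measurable_itv.
rewrite (eq_bigr (fun=> eta%:E)); last first.
  move=> j _; transitivity (lebesgue_measure
    (`]eta * (tnth I j).-1%:R, eta * (tnth I j)%:R]%classic : set R)) => //.
  rewrite lebesgue_measure_itv/= lte_fin; have := inc_pos j iI; case: (nat_of_ord _) => //= i _.
  rewrite -natr1 mulrDr mulr1 ltrDl eta0 -EFinD; congr (_%:E); ring.
by rewrite big_const_ord iter_mule mule1 EFin_expe.
Qed.

End grid.

Section grid_sums.
Context {R : realType} {d : nat}.
Local Notation V := 'cV[R]_d.
Variables (rho_ : nat -> probability V R) (c_ eta_ : nat -> R).
Variable mu : {sigma_finite_measure set V -> \bar R}.
Hypothesis vag : vague_cvg \oo c_ rho_ mu.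
Hypothesis eta_gt0 : forall l, 0 < eta_ l.
Hypothesis eta_cvg : eta_ l @[l --> \oo] --> 0.
Variables (k : nat) (F_ : nat -> k.-tuple V -> k.-tuple R -> R).
Variables (F : k.-tuple V -> k.-tuple R -> R) (M r : R).
Hypothesis r0 : 0 < r.
Local Notation Inc := (increasing_tuples `]0, 1[%classic k).
Local Notation Inc1 := (increasing_tuples `]0, 1]%classic k).
Hypothesis mF_ : forall l t, Inc1 t -> measurable_fun setT (F_ l ^~ t).
Hypothesis F_M : forall l W t, 0 <= F_ l W t <= M.
Hypothesis F_0 : forall l W t, Inc1 t -> (exists j, enorm (tnth W j) <= r) -> F_ l W t = 0.
Hypothesis mF : forall t, Inc t -> measurable_fun setT (F ^~ t).
Hypothesis FM : forall W t, 0 <= F W t <= M.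
Hypothesis F0 : forall W t, Inc t -> (exists j, enorm (tnth W j) <= r) -> F W t = 0.
Hypothesis F_F : forall W t, Inc t -> forall e, 0 < e -> exists2 de : R, 0 < de &
  \forall l \near \oo, forall W' t', Inc1 t' -> tuple_near de W W' ->
    (forall j, `|tnth t' j - tnth t j| < de) -> `|F_ l W' t' - F W t| < e.
Hypothesis mFt : measurable_fun setT (fun t => \1_Inc t * rint (tmeas mu k) (F ^~ t)).

Let U01 : set (k.-tuple R) := box (fun=> `]0, 1]%classic : set R).

Let n_ l := Num.truncn (eta_ l)^-1.

Let n1 l : eta_ l * (n_ l)%:R <= 1.
Proof.
rewrite mulrC -ler_pdivlMr// mul1r truncn_le// invr_ge0 ltW//.
Qed.

Let n2 l : 1 < eta_ l * (n_ l).+1%:R.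
Proof.
rewrite mulrC -ltr_pdivrMr// mul1r.
have /andP[] : (n_ l)%:R <= (eta_ l)^-1 < (n_ l).+1%:R => //.
by apply: truncn_itv; rewrite invr_ge0 ltW.
Qed.

Let A l (I : k.-tuple 'I_(n_ l).+1) : R :=
  c_ l ^+ k * rint (tmeas (rho_ l) k) (F_ l ^~ (stimes (eta_ l) I)).

(** The cells have volume [eta_ l ^+ k], so the Lebesgue integral of this step function is the
    normalized grid sum. *)
Let G l (t : k.-tuple R) : R :=
  \sum_(I : k.-tuple 'I_(n_ l).+1 | inc I) A I * \1_(cells (eta_ l) I) t.

Let c0 l : 0 <= c_ l. Proof. by have [] := vag. Qed.

Let A0 l (I : k.-tuple 'I_(n_ l).+1) : 0 <= A I.
Proof.
rewrite mulr_ge0 ?exprn_ge0// rint_ge0// => W.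
by have /andP[] := F_M l W (stimes (eta_ l) I).
Qed.

Let stimes_Inc1 l (I : k.-tuple 'I_(n_ l).+1) : inc I -> Inc1 (stimes (eta_ l) I).
Proof. exact: (@stimes_inc R k (n_ l) (eta_ l) I (eta_gt0 l)). Qed.

Let G_integral l : (\int[tmeas (@leb R) k]_t (G l t)%:E =
  (\sum_(I : k.-tuple 'I_(n_ l).+1 | inc I) A I * eta_ l ^+ k)%:E)%E.
Proof.
have E t : (G l t)%:E = (\sum_(I : k.-tuple 'I_(n_ l).+1)
    (if inc I then A I * \1_(cells (eta_ l) I) t else 0)%:E)%E.
  by rewrite /G sumEFin big_mkcond.
under eq_integral do rewrite E.
rewrite ge0_integral_sum//; last 2 first.
- move=> J; case: (inc J); last exact: measurable_cst.
  apply/measurable_EFinP; apply: measurable_funM; first exact: measurable_cst.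
  by apply: measurable_indic; exact: measurable_cells.
- by move=> J t _; case: (inc J); rewrite lee_fin//; apply: mulr_ge0.
rewrite -sumEFin [RHS]big_mkcond; apply: eq_bigr => I _; case: ifP => iI; last by rewrite integral0.
under eq_integral do rewrite EFinM.
rewrite ge0_integralZl//; last 2 first.
- by apply/measurable_EFinP; apply: measurable_indic; exact: measurable_cells.
- by rewrite lee_fin A0.
rewrite integral_indic ?setIT//; last exact: measurable_cells.
by rewrite [X in (_ * X)%E](cells_measure (eta_gt0 l) iI).
Qed.

(** For fixed [t], the integrand is frozen at the grid times of the cell that contains [t]. This
    cell is unique if it exists, and the default 0 covers the other case; the value of the step
    function thus becomes a single integral over the noises, as [multi_factor] expects. *)
Let Psi_ (t : k.-tuple R) l (W : k.-tuple V) : R :=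
  if [pick J : k.-tuple 'I_(n_ l).+1 | inc J && (t \in cells (eta_ l) J)] is Some J
  then F_ l W (stimes (eta_ l) J) else 0.

Let G_Psi t l : G l t = c_ l ^+ k * rint (tmeas (rho_ l) k) (Psi_ t l).
Proof.
rewrite /Psi_; case: pickP => [I /andP[iI tI]|none].
  rewrite /G (bigD1 I)//= indicE tI mulr1 big1 ?addr0// => I' /andP[iI' II'].
  rewrite indicE; case: (boolP (t \in _)) => [tI'|_]; last by rewrite mulr0.
  rewrite !inE in tI tI'.
  by move/eqP: II'; rewrite (cells_inj (eta_gt0 l) iI' iI tI' tI).
rewrite /rint integral0 mulr0 /G big1// => I iI.
by have := none I; rewrite iI/= indicE => ->; rewrite mulr0.
Qed.

(** The normalized masses beyond [r] are dominated by a convergent sequence, which bounds all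
    coefficients uniformly; since the cells are disjoint, the same bound holds for the step
    function. *)
Let bnd : exists2 B : R, 0 <= B & forall l t, G l t <= B * \1_U01 t.
Proof.
have [_ _ _ conv] := vag.
have M0 : 0 <= M by have /andP[/le_trans] := FM [tuple of nseq k 0] [tuple of nseq k 0]; apply.
have H : cvgn (fun l => c_ l * rint (rho_ l) (ramp r)).
  apply/cvg_ex; exists (rint mu (ramp r)); apply: (conv _ 1 (r / 2)) => //; first by rewrite divr_gt0.
  - exact: ramp_continuous.
  - exact: ramp01.
  - by move=> w; exact: ramp0.
have [B0 [_ HB]] := cvg_seq_bounded H.
pose B := `|B0| + 1; have B1 : B0 < B by rewrite /B; have := ler_norm B0; lra.
have cB l : c_ l * fine (rho_ l [set w | (r < enorm w)%R]) <= B.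
  apply: le_trans (le_trans (ler_norm _) (HB B B1 l I)); rewrite ler_wpM2l//.
  have foo : (rho_ l [set w | (r < enorm w)%R] < +oo)%E.
    by rewrite (le_lt_trans (probability_le1 _ _)) ?ltry//; exact: measurable_enorm_gt.
  rewrite -lee_fin fineK ?ge0_fin_numE// rintE.
  - rewrite -(setIT [set w | (r < enorm w)%R]) -integral_indic//; last exact: measurable_enorm_gt.
    apply: ge0_le_integral => //.
    + by apply/measurable_EFinP/measurable_indic; exact: measurable_enorm_gt.
    + by apply/measurable_EFinP; exact: measurable_ramp.
    + move=> v _; rewrite lee_fin indicE; case: (boolP (v \in _)) => [|_].
        by rewrite inE /= => /ltW rv; rewrite ramp1.
      by have /andP[] := ramp01 r v.
  - by move=> v; have /andP[] := ramp01 r v.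
  - apply: (@prob_int_fin _ _ _ (rho_ l) (ramp r) 1); last exact: ramp01.
      by rewrite (le_lt_trans (probability_le1 (rho_ l) measurableT))// ltry.
    exact: measurable_ramp.
have AB l (J : k.-tuple 'I_(n_ l).+1) : inc J -> A J <= M * B ^+ k.
  move=> iJ; have J1 := stimes_Inc1 iJ.
  have foo : (rho_ l [set w | (r < enorm w)%R] < +oo)%E.
    by rewrite (le_lt_trans (probability_le1 _ _)) ?ltry//; exact: measurable_enorm_gt.
  have h1 : (\int[tmeas (rho_ l) k]_W (F_ l W (stimes (eta_ l) J))%:E <=
      (M * fine (rho_ l [set w | (r < enorm w)%R]) ^+ k)%:E)%E.
    rewrite EFinM EFin_expe fineK ?ge0_fin_numE//.
    apply: (@le_trans _ _ (M%:E * tmeas (rho_ l) k (box (fun=> [set w | (r < enorm w)%R])))%E).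
      apply: (@rint_bound _ _ _ _ (F_ l ^~ (stimes (eta_ l) J))).
      - by apply: measurable_box => i; exact: measurable_enorm_gt.
      - exact: mF_.
      - by move=> W; exact: F_M.
      - move=> W /= /existsNP[i /negP]; rewrite -leNgt => Wi.
        by apply: F_0 => //; exists i.
    rewrite tmeas_box; last by move=> i; exact: measurable_enorm_gt.
    by rewrite big_const_ord iter_mule mule1.
  rewrite /A; apply: (@le_trans _ _ (c_ l ^+ k * (M * fine (rho_ l [set w | (r < enorm w)%R]) ^+ k))).
    rewrite ler_wpM2l ?exprn_ge0// -lee_fin rintE//; last by apply: le_lt_trans h1 (ltry _).
    by move=> W; have /andP[] := F_M l W (stimes (eta_ l) J).
  rewrite mulrCA -exprMn ler_wpM2l// lerXn2r ?nnegrE//.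
    by rewrite mulr_ge0// fine_ge0.
  by rewrite /B addr_ge0.
have MB : 0 <= M * B ^+ k by rewrite mulr_ge0// exprn_ge0// /B addr_ge0.
exists (M * B ^+ k) => // l t.
rewrite /G; have [[J [iJ tJ]]|none] := pselect (exists J : k.-tuple 'I_(n_ l).+1, inc J /\ cells (eta_ l) J t).
  rewrite (bigD1 J)//= indicE mem_set// mulr1 big1 ?addr0; last first.
    move=> J' /andP[iJ' JJ']; rewrite indicE; case: (boolP (t \in _)) => [|_]; last by rewrite mulr0.
    rewrite inE => tJ'; move/eqP: JJ'.
    by rewrite (cells_inj (eta_gt0 l) iJ' iJ tJ' tJ).
  rewrite indicE mem_set ?mulr1; first exact: AB.
  have [_ H'] := cells_increasing (eta_gt0 l) (n1 l) iJ tJ.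
  by move=> i; apply: H'; exact: mem_tnth.
have ge : 0 <= M * B ^+ k * \1_U01 t by apply: mulr_ge0.
rewrite big1// => J iJ; rewrite indicE memNset ?mulr0// => tJ.
by apply: none; exists J.
Qed.

(** Tuples with an entry equal to 1 are excepted: they may lie in a cell although they are not in
    [Inc]. They form a Lebesgue null set. *)
Let pointwise t : ~ (exists j, tnth t j = 1) ->
  G l t @[l --> \oo] --> \1_Inc t * rint (tmeas mu k) (F ^~ t).
Proof.
move=> t1; rewrite indicE; case: (boolP (t \in _)) => [|]; rewrite ?inE => tI; last first.
  rewrite mul0r (_ : G ^~ t = cst 0); first exact: cvg_cst.
  apply/funext => l; rewrite /G big1// => J iJ; rewrite indicE memNset ?mulr0// => tJ.
  move/negP : tI; apply; rewrite inE; have [st Ht] := cells_increasing (eta_gt0 l) (n1 l) iJ tJ.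
  split=> // s sI; have /tnthP[j sj] := sI; have := Ht _ sI; rewrite /= !in_itv/= => /andP[-> s1].
  by rewrite lt_neqAle s1 andbT; apply/eqP => sE; apply: t1; exists j; rewrite -sj.
rewrite mul1r (_ : G ^~ t = fun l => c_ l ^+ k * rint (tmeas (rho_ l) k) (Psi_ t l)); last first.
  by apply/funext => l; exact: G_Psi.
have [kappa kap0 gap] := tent_gap tI.
have eta_small e : 0 < e -> \forall l \near \oo, eta_ l < e.
  by move=> e0; apply: (cvgr_lt _ eta_cvg).
apply: (@multi_factor R d k nat \oo _ c_ rho_ mu (Psi_ t) (F ^~ t) M r) => //.
- move=> l; rewrite /Psi_; case: pickP => [J /andP[iJ _]|_]; last exact: measurable_cst.
  by apply: mF_; exact: stimes_Inc1.
- exact: mF.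
- move=> l W; rewrite /Psi_; case: pickP => [J _|_]; first exact: F_M.
  by rewrite lexx; have /andP[/le_trans] := FM W t; apply.
- move=> l W Wr; rewrite /Psi_; case: pickP => [J /andP[iJ _]|//].
  by apply: F_0 => //; exact: stimes_Inc1.
- by move=> W; exact: F0.
apply: ccv_near => W e e0; have [de de0 near] := F_F W tI e0; exists de => //.
near=> l => W' WW'; rewrite /Psi_.
have el1 : eta_ l < kappa by near: l; exact: eta_small.
have el2 : eta_ l < de by near: l; exact: eta_small.
case: pickP => [J /andP[iJ]|none].
  rewrite inE => tJ; have : forall W' t', Inc1 t' -> tuple_near de W W' ->
    (forall j, `|tnth t' j - tnth t j| < de) -> `|F_ l W' t' - F W t| < e by near: l.
  apply => //; first exact: stimes_Inc1.
  by move=> j; apply: lt_trans el2; apply: (cells_stimes j tJ iJ).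
have [st _] := tI.
have [J iJ tJ] := cells_exists (eta_gt0 l) (n2 l) kap0 (ltW el1) gap st.
by have := none J; rewrite iJ mem_set.
Unshelve. all: by end_near. Qed.

(* The sum is the integral of a step function of [t], to which dominated convergence
   applies. *)
Lemma grid_sum_cvg :
  (c_ l * eta_ l) ^+ k * (\sum_(I : k.-tuple 'I_(Num.truncn (eta_ l)^-1).+1 | inc I)
     rint (tmeas (rho_ l) k) (F_ l ^~ (stimes (eta_ l) I))) @[l --> \oo] -->
  rint (tmeas (@leb R) k) (fun t => \1_Inc t * rint (tmeas mu k) (F ^~ t)).
Proof.
have [B B0 HB] := bnd.
have mG l : measurable_fun setT (G l).
  rewrite /G; under eq_fun do rewrite big_mkcond.
  apply: measurable_sum => J; case: (inc J); last exact: measurable_cst.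
  apply: measurable_funM; first exact: measurable_cst.
  by apply: measurable_indic; exact: measurable_cells.
have G0 l t : 0 <= G l t by apply: sumr_ge0 => J _; rewrite mulr_ge0 ?A0.
pose U := U01.
have mU : measurable U by apply: measurable_box => j; exact: measurable_itv.
have Uoo : tmeas (@leb R) k U = 1%E.
  rewrite tmeas_box; last by move=> j; exact: measurable_itv.
  rewrite big1// => j _; transitivity (lebesgue_measure (`]0, 1]%classic : set R)) => //.
  by rewrite lebesgue_measure_itv/= lte_fin ltr01 oppr0 adde0.
have mf : measurable_fun setT (fun t => (\1_Inc t * rint (tmeas mu k) (F ^~ t))%:E).
  exact/measurable_EFinP.
have mBU : measurable_fun setT (fun t : k.-tuple R => (B * \1_U t)%:E).
  by apply/measurable_EFinP; apply: measurable_funM; [exact: measurable_cst|exact: measurable_indic].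
have iBU : (tmeas (@leb R) k).-integrable setT (fun t => (B * \1_U t)%:E).
  apply/integrableP; split => //.
  under eq_integral do rewrite gee0_abs ?lee_fin ?mulr_ge0// EFinM.
  rewrite ge0_integralZl//; last exact/measurable_EFinP/measurable_indic.
  by rewrite integral_indic// setIT [X in (_ * X)%E]Uoo mule1 ltry.
have tie : {ae tmeas (@leb R) k, forall t : k.-tuple R, ~ (exists j, tnth t j = 1)}.
  pose N1 (j : 'I_k) := box (fun i : 'I_k => if i == j then [set 1 : R] else setT).
  have mN1 j : measurable (N1 j).
    by apply: measurable_box => i; case: ifP => _ //; exact: measurable_set1.
  have N1E : [set t : k.-tuple R | exists j, tnth t j = 1] = \big[setU/set0]_j N1 j.
    rewrite -bigcup_seq; apply/seteqP; split => [t [j tj]|t [j _ tj]].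
      by exists j; [rewrite /= mem_index_enum|move=> i; case: eqP => // ->].
    by exists j; have := tj j; rewrite eqxx.
  exists [set t : k.-tuple R | exists j, tnth t j = 1]; split.
  - by rewrite N1E; exact: bigsetU_measurable.
  - apply/eqP; rewrite eq_le measure_ge0 andbT.
    have mU1 : measurable [set t : k.-tuple R | exists j, tnth t j = 1].
      by rewrite N1E; exact: bigsetU_measurable.
    apply: (le_trans (finite_union_bound (tmeas (@leb R) k) mU1 mN1 _)).
      by move=> t [j tj]; exists j => i; case: eqP => // ->.
    rewrite big1// => j _; apply: (eq_trans (tmeas_box (@leb R) _)).
      by move=> i; case: ifP => _ //; exact: measurable_set1.
    rewrite (bigD1 j)//= eqxx [X in (X * _)%E](_ : _ = 0%E) ?mul0e//.
    exact: lebesgue_measure_set1.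
  - by move=> t /= /contrapT.
have mGE l : measurable_fun setT (fun t => (G l t)%:E) by exact/measurable_EFinP.
have ae1 : {ae tmeas (@leb R) k, forall t, setT t ->
    (G l t)%:E @[l --> \oo] --> (\1_Inc t * rint (tmeas mu k) (F ^~ t))%:E}.
  by apply: filterS tie => t t1 _; apply: cvg_EFin; [exact: nearW|exact: pointwise].
have ae2 : {ae tmeas (@leb R) k, forall t l, setT t -> (`|(G l t)%:E| <= (B * \1_U t)%:E)%E}.
  by apply: aeW => t l _; rewrite gee0_abs ?lee_fin.
have [if_ _ Hc] := dominated_convergence measurableT mGE mf ae1 iBU ae2.
have ffin := integrable_fin_num measurableT if_.
rewrite -(fineK ffin) in Hc; have {}Hc := fine_cvg Hc.
rewrite (_ : (fun l => _) = fun l => fine (\int[tmeas (@leb R) k]_t (G l t)%:E)%E); first exact: Hc.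
apply/funext => l; rewrite G_integral /= mulr_sumr; apply: eq_bigr => J _.
by rewrite /A exprMn; ring.
Qed.

End grid_sums.

(** * Regular variation in polar coordinates *)

Section polar_measure.
Context {R : realType} {d : nat}.
Local Notation V := 'cV[R]_d.+1.
Variables (alpha : R) (nu : {measure set R -> \bar R}) (S : probability V R).
Hypothesis nuE : power_law alpha nu.
Hypothesis S1 : S (@sphere R d) = 1%E.

Let D : set (R * V) := `]0, +oo[%classic `*` @sphere R d.
Let q (p : R * V) : V := p.1 *: p.2.

Lemma measurable_sphere : measurable (@sphere R d).
Proof.
rewrite (_ : sphere = @enorm R d.+1 @^-1` [set 1]); last by apply/seteqP; split.
by rewrite -[X in measurable X]setTI; exact: measurable_enorm.
Qed.

Let mD : measurable D.
Proof. by apply: measurableX; [exact: measurable_itv|exact: measurable_sphere]. Qed.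

Lemma measurable_unpolar : measurable_fun setT (fun p : R * V => p.1 *: p.2).
Proof.
apply: measurable_fun_cV => i.
rewrite (_ : (fun _ => _) = fun p : R * V => p.1 * p.2 i ord0); last first.
  by apply/funext => p; rewrite mxE.
apply: measurable_funM; first exact: measurable_fst.
by apply: (measurableT_comp (measurable_coord i)); exact: measurable_snd.
Qed.

Lemma polar_scaleK (p : R * V) : 0 < p.1 -> enorm p.2 = 1 -> polar (p.1 *: p.2) = p.
Proof.
case: p => r w /= r0 w1; rewrite /polar.
have e1 : enorm (r *: w) = r by rewrite enormZ w1 mulr1 gtr0_norm.
case: eqP => [rw|_]; first by exfalso; move: r0; rewrite -e1 rw enorm0 ltxx.
by rewrite e1 scalerA mulVf ?scale1r// gt_eqF.
Qed.

Lemma scale_polar (w : V) : (polar w).1 *: (polar w).2 = w.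
Proof.
rewrite /polar; case: eqP => [->|/eqP w0]; first by rewrite scale0r.
rewrite /= scalerA divff ?scale1r//; apply: contra_neq w0; exact: enorm_eq0.
Qed.

Lemma polar_sphere (w : V) : enorm (polar w).2 = 1.
Proof.
rewrite /polar; case: eqP => [_|/eqP w0] /=.
  rewrite /enorm (bigD1 ord0)//= mxE !eqxx expr1n big1 ?addr0 ?sqrtr1// => i i0.
  by rewrite mxE (negbTE i0) expr0n.
rewrite enormZ gtr0_norm ?invr_gt0 ?mulVf//.
- by apply: contra_neq w0; exact: enorm_eq0.
- by rewrite lt_neqAle enorm_ge0 andbT eq_sym; apply: contra_neq w0; exact: enorm_eq0.
Qed.

Lemma polar_fst (w : V) : (polar w).1 = enorm w.
Proof. by rewrite /polar; case: eqP => // ->; rewrite enorm0. Qed.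

(** The image under [polar] is rewritten as a preimage under scalar multiplication, so that
    additivity and measurability are inherited from the product measure. *)
Lemma polar_measureE (E : set V) :
  polar_measure nu S E = (nu \x S)%E (D `&` q @^-1` E).
Proof.
rewrite /polar_measure; congr ((nu \x S)%E _); apply/seteqP; split.
  move=> _ [w [Ew /= w0] <-]; split; last by rewrite /q /= scale_polar.
  split; rewrite /sphere /= ?polar_sphere//= polar_fst in_itv/= andbT.
  by rewrite lt_neqAle enorm_ge0 andbT eq_sym; apply/eqP => /enorm_eq0.
move=> p [[]]; rewrite /= in_itv/= andbT => p0 p1 Eq.
exists (q p); last exact: polar_scaleK.
split=> //= q0; have : enorm (q p) = p.1 by rewrite enormZ p1 mulr1 gtr0_norm.
by rewrite q0 enorm0; lra.
Qed.

Lemma polar_measure_tail (r : R) : 0 < r ->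
  (polar_measure nu S [set w | (r < enorm w)%R] <= (r `^ (- alpha))%:E)%E.
Proof.
move=> r0; rewrite polar_measureE.
apply: (@le_trans _ _ ((nu \x S)%E (`[r, +oo[%classic `*` @sphere R d))).
  apply: le_measure; rewrite ?inE.
  - apply: measurableI => //; rewrite -[X in measurable X]setTI.
    by apply: measurable_unpolar => //; exact: measurable_enorm_gt.
  - by apply: measurableX; [exact: measurable_itv|exact: measurable_sphere].
  - move=> p [[]]; rewrite /= !in_itv/= !andbT => p0 p1; split=> //.
    by move: b; rewrite /q enormZ p1 mulr1 gtr0_norm// => /ltW.
rewrite product_measure1E//; last exact: measurable_sphere.
by rewrite [X in (_ * X)%E]S1 mule1; have [_ ->] := nuE.
Qed.

Lemma polar_measure_sigma_finite :
  exists mu : {sigma_finite_measure set V -> \bar R},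
    (mu : set V -> \bar R) = polar_measure nu S.
Proof.
pose N0 := @polar_measure R d nu S.
have N00 : N0 set0 = 0%E by rewrite /N0 polar_measureE preimage_set0 setI0 measure0.
have N0_ge0 A : (0 <= N0 A)%E by rewrite /N0 polar_measureE; exact: measure_ge0.
have mpre (A : set V) : measurable A -> measurable (q @^-1` A).
  by move=> mA; rewrite -[X in measurable X]setTI; exact: measurable_unpolar.
have N0_sigma : semi_sigma_additive N0.
  move=> F mF tF mUF; rewrite /N0 polar_measureE preimage_bigcup setI_bigcupr.
  rewrite (_ : (fun n => _) = fun n => \sum_(0 <= i < n) (nu \x S)%E (D `&` q @^-1` F i))%E; last first.
    by apply/funext => n; apply: eq_bigr => i _; exact: polar_measureE.
  apply: measure_semi_sigma_additive; first by move=> n; apply: measurableI => //; exact: mpre.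
    apply/trivIsetP => i j _ _ ij; rewrite setIACA setIid -preimage_setI.
    by move/trivIsetP : tF => /(_ _ _ _ _ ij) ->//; rewrite preimage_set0 setI0.
  by rewrite -setI_bigcupr -preimage_bigcup; apply: measurableI => //; exact: mpre.
have N0_sf : sigma_finite setT N0.
  (* The origin is added to the complements of balls to cover the whole space; it carries no mass
     because radii are positive on the domain of polar coordinates. *)
  exists (fun n => [set w : V | w = 0 \/ n.+1%:R^-1 < enorm w]).
    apply/esym/seteqP; split=> // w _; have [->|/eqP w0] := eqVneq w 0; first by exists 0%N => //; left.
    have e0 : 0 < enorm w by rewrite lt_neqAle enorm_ge0 andbT eq_sym; apply/eqP => /enorm_eq0.
    exists (Num.truncn (enorm w)^-1) => //; right.
    by rewrite invf_plt ?posrE ?truncnS_gt.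
  move=> n; have mA : measurable [set w : V | w = 0 \/ n.+1%:R^-1 < enorm w].
    rewrite (_ : mkset _ = (@enorm R d.+1 @^-1` [set 0]) `|` [set w | (n.+1%:R^-1 < enorm w)%R]); last first.
      apply/seteqP; split => w /= -[]; [|by right| |by right].
        by move=> ->; left; rewrite enorm0.
      by move/enorm_eq0 => ->; left.
    apply: measurableU; last exact: measurable_enorm_gt.
    by rewrite -[X in measurable X]setTI; exact: measurable_enorm.
  split=> //; rewrite (_ : N0 _ = N0 [set w | (n.+1%:R^-1 < enorm w)%R]).
    apply: le_lt_trans (polar_measure_tail _) (ltry _).
    by rewrite invr_gt0.
  rewrite /N0 !polar_measureE; congr ((nu \x S)%E _); apply/seteqP; split => p [Dp] /=; last first.
    by move=> h; split=> //=; right.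
  move=> [q0|h]; last by split.
  case: Dp; rewrite /= in_itv/= andbT => p0 p1.
  have : enorm (q p) = p.1 by rewrite enormZ p1 mulr1 gtr0_norm.
  by rewrite q0 enorm0; lra.
pose N1 : {measure set V -> \bar R} :=
  HB.pack N0 (isMeasure.Build _ _ R N0 N00 N0_ge0 N0_sigma).
pose N2 : {sigma_finite_measure set V -> \bar R} :=
  HB.pack N0 N1 (@Measure_isSigmaFinite.Build _ _ R N1 N0_sf).
by exists N2.
Qed.

Lemma polar_measure_int (f : V -> \bar R) : measurable_fun setT f ->
  (forall w, (0 <= f w)%E) -> f 0 = 0%E ->
  (\int[polar_measure nu S]_w f w =
   \int[(nu \x S)%E]_(p in `]0%R, +oo[%classic `*` @sphere R d) f (p.1 *: p.2)%R)%E.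
Proof.
move=> mf f0 f00; have [mu muE] := polar_measure_sigma_finite; rewrite -muE.
(* Extending by 0 outside the domain keeps the preimages of sets without the origin inside it, and
   the origin does not matter since [f] vanishes there. *)
pose q' (p : R * V) : V := if p \in D then q p else 0.
have mq' : measurable_fun setT q'.
  apply: measurable_fun_ifT => //; last exact: measurable_unpolar.
  apply: (measurable_fun_bool true); rewrite setTI (_ : _ @^-1` _ = D)//.
  by apply/seteqP; split => p /=; rewrite ?inE; [exact: set_mem|exact: mem_set].
have q'N0 : q' @^-1` (~` [set 0]) = D.
  apply/seteqP; split => p /=; rewrite /q'; first by case: ifPn => [/set_mem//|].
  move=> Dp; rewrite mem_set// => qp.
  case: Dp; rewrite /= in_itv/= andbT => p0 p1.
  have : enorm (q p) = p.1 by rewrite enormZ p1 mulr1 gtr0_norm.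
  by rewrite qp enorm0; lra.
have m0 : measurable (~` [set 0 : V]).
  apply: measurableC; rewrite (_ : [set 0] = @enorm R d.+1 @^-1` [set 0]).
    by rewrite -[X in measurable X]setTI; exact: measurable_enorm.
  by apply/seteqP; split => w /= ; [move=> ->; rewrite enorm0|exact: enorm_eq0].
transitivity (\int[mu]_(w in ~` [set 0%R]) f w)%E.
  rewrite [RHS]integral_mkcond; apply: eq_integral => w _.
  rewrite patchE; case: ifPn => // /negP; rewrite inE /= => w0.
  by rewrite (_ : w = 0) ?f00//; apply: contrapT.
rewrite (@eq_measure_integral _ _ _ _ (pushforward (nu \x S)%E q')).
  rewrite (ge0_integral_pushforward mq')//; last first.
  - exact: measurable_funTS.
  rewrite q'N0; apply: eq_integral => p pD /=.
  by rewrite /q' pD.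
move=> A mA A0; transitivity (polar_measure nu S A); first by rewrite -muE.
rewrite polar_measureE /pushforward; congr ((nu \x S)%E _).
apply/seteqP; split => p /=; rewrite /q'.
  by move=> [Dp Ap]; rewrite mem_set.
by case: ifPn => [/set_mem//|_ A00]; case: (A0 _ A00).
Qed.

End polar_measure.

Section regular_variation.
Context {R : realType} {d : nat} {disp} {Omega : measurableType disp}.
Variable P : probability Omega R.
Local Notation V := 'cV[R]_d.+1.
Variables (alpha : R) (nu : {measure set R -> \bar R}) (S : probability V R).
Hypothesis nuE : power_law alpha nu.
Hypothesis S1 : S (@sphere R d) = 1%E.
Hypothesis alpha1 : 1 < alpha.
Variable Z : nat -> Omega -> V.
Hypothesis mZ : forall n, measurable_fun setT (Z n).
Hypothesis mrv : MRV P (Z 0%N) alpha nu S.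
Variable mu : {sigma_finite_measure set V -> \bar R}.
Hypothesis muE : (mu : set V -> \bar R) = polar_measure nu S.

Lemma measurable_polar : measurable_fun setT (@polar R d).
Proof.
have m0 : measurable_fun setT (fun w : V => w == 0).
  apply: (measurable_fun_bool true); rewrite setTI (_ : _ @^-1` _ = @enorm R d.+1 @^-1` [set 0]).
    by rewrite -[X in measurable X]setTI; exact: measurable_enorm.
  by apply/seteqP; split => w /=; [move=> /eqP ->; rewrite enorm0|move=> /enorm_eq0 ->; rewrite eqxx].
rewrite (_ : polar = fun w : V => if w == 0 then (0, delta_mx ord0 ord0) else (enorm w, (enorm w)^-1 *: w))//.
apply: measurable_fun_ifT => //.
apply: measurable_fun_pair; first exact: measurable_enorm.
apply: measurable_fun_cV => i.
rewrite (_ : (fun _ => _) = fun w : V => enorm w `^ (-1) * w i ord0); last first.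
  by apply/funext => w; rewrite mxE powR_inv1 ?enorm_ge0.
apply: measurable_funM; last exact: measurable_coord.
by apply: (measurableT_comp (measurable_powR (-1))); exact: measurable_enorm.
Qed.

(** Translates the polar form of regular variation into the law of the noise scaled by [x^-1]; the
    noise at the origin is lost in polar coordinates but invisible to [phi]. *)
Lemma nlaw_polar (x : R) (phi : V -> R) : 0 < x -> measurable_fun setT phi ->
  (forall w, 0 <= phi w) -> phi 0 = 0 ->
  (\int[fun A => polar_law P (Z 0%N) x A / tail P (Z 0%N) x]_(p in
     `](0 : R)%R, +oo[%classic `*` @sphere R d) (phi (p.1 *: p.2)%R)%:E =
   ((rtail P (Z 0%N) x)^-1)%:E * \int[nlaw P mZ x^-1]_w (phi w)%:E)%E.
Proof.
move=> x0 mphi phi0 phi00; have RV := mrv.1.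
pose psi w := (x^-1 * (polar (Z 0%N w)).1, (polar (Z 0%N w)).2) : R * V.
have mpsi : measurable_fun setT psi.
  have mp : measurable_fun setT (@polar R d \o Z 0%N).
    by apply: measurableT_comp; [exact: measurable_polar|exact: mZ].
  apply: measurable_fun_pair.
    apply: measurable_funM; first exact: measurable_cst.
    by apply: (measurableT_comp measurable_fst); exact: mp.
  by apply: (measurableT_comp measurable_snd); exact: mp.
have H0 := rtail_gt0 (mZ 0%N) alpha1 RV x.
have k0 : 0 <= (rtail P (Z 0%N) x)^-1 by rewrite invr_ge0 ltW.
have mD : measurable (`](0 : R)%R, +oo[%classic `*` @sphere R d).
  by apply: measurableX; [exact: measurable_itv|exact: measurable_sphere].
have mf : measurable_fun setT (fun p : R * V => (phi (p.1 *: p.2))%:E).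
  apply/measurable_EFinP; apply: (measurableT_comp mphi).
  exact: measurable_unpolar.
rewrite (eq_integral_set_fun (m2 := mscale (NngNum k0) (pushforward P psi))); last first.
  move=> A mA; rewrite /mscale /= /pushforward (tailE P (mZ 0%N)) inver gt_eqF// muleC.
  by [].
rewrite ge0_integral_mscale//; last 2 first.
  exact: measurable_funTS.
  by move=> p _; rewrite lee_fin.
congr (_ * _)%E; rewrite (ge0_integral_pushforward mpsi)//; last 2 first.
  exact: measurable_funTS.
  by move=> p _; rewrite lee_fin.
rewrite law_int//; last exact/measurable_EFinP.
rewrite integral_mkcond; apply: eq_integral => w _; rewrite patchE.
have psiE : (psi w).1 *: (psi w).2 = x^-1 *: Z 0%N w.
  by rewrite /psi /= -scalerA scale_polar.
case: ifPn => [_|]; first by rewrite /= psiE.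
move=> /negP wD; rewrite (_ : Z 0%N w = 0) ?scaler0 ?phi00//; apply: enorm_eq0.
apply/eqP; rewrite eq_le enorm_ge0 andbT leNgt; apply/negP => Z0; apply: wD; apply: mem_set.
split; rewrite /psi /= ?polar_fst ?in_itv/= ?andbT ?mulr_gt0 ?invr_gt0//.
exact: polar_sphere.
Qed.

Lemma MRV_vague_cvg (eta : nat -> R) : (forall l, 0 < eta l) -> eta l @[l --> \oo] --> 0 ->
  vague_cvg \oo (fun l => (rtail P (Z 0%N) (eta l)^-1)^-1) (fun l => nlaw P mZ (eta l)) mu.
Proof.
move=> eta0 etac; have RV := mrv.1.
have mutail r : 0 < r -> (mu [set w | (r < enorm w)%R] <= (r `^ (- alpha))%:E)%E.
  by move=> r0; rewrite muE; exact: polar_measure_tail.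
have mufin r : 0 < r -> (mu [set w | (r < enorm w)%R] < +oo)%E.
  by move=> r0; exact: le_lt_trans (mutail _ r0) (ltry _).
split=> //.
- by move=> l; rewrite invr_ge0 rtail_ge0.
(* [ramp L] vanishes up to [L / 2], and [L] is chosen so that the power of [L / 2] with exponent
   [- alpha] equals [tau]. *)
- move=> tau tau0; pose L := 2 * tau `^ (- alpha^-1).
  have L0 : 0 < L by rewrite mulr_gt0 ?powR_gt0.
  exists L => //; rewrite -lee_fin rintE; last 2 first.
    by move=> w; have /andP[] := ramp01 L w.
    apply: (@mu_int_fin _ _ mu _ 1 (L / 2)); first by apply: mufin; lra.
    - exact: measurable_ramp.
    - by move=> w; exact: ramp01.
    - by move=> w; exact: ramp0.
  apply: (@le_trans _ _ (1 * mu [set w | (L / 2 < enorm w)%R])%E).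
    apply: rint_bound; first exact: measurable_enorm_gt.
    - exact: measurable_ramp.
    - by move=> w; exact: ramp01.
    - by move=> w /= /negP; rewrite -leNgt; exact: ramp0.
  rewrite mul1e (le_trans (mutail _ _))//; first by lra.
  rewrite lee_fin /L mulrC mulKf// -powRrM mulrNN mulVf ?powRr1 ?(ltW tau0)//.
  by rewrite gt_eqF// (lt_trans _ alpha1).
move=> phi M r r0 cphi phiM phi0.
have mphi := continuous_measurable_cV cphi.
have phi00 : phi 0 = 0 by apply: phi0; rewrite enorm0 ltW.
have phige w : 0 <= phi w by have /andP[] := phiM w.
have DE : `[(0 : R)%R, +oo[%classic `*` @sphere R d `\` [set (0 : R)%R] `*` @sphere R d =
    `](0 : R)%R, +oo[%classic `*` @sphere R d.
  apply/seteqP; split => p [].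
    move=> [/=]; rewrite !in_itv/= !andbT => p0 p1 n; split=> //=.
    by rewrite lt_neqAle p0 andbT eq_sym; apply/eqP => p00; apply: n.
  rewrite /= !in_itv/= !andbT => p0 p1; split; first by split=> //=; rewrite ltW.
  by move=> [/= p00]; rewrite p00 ltxx in p0.
pose f (p : R * V) := phi (p.1 *: p.2).
have := mrv.2 f; rewrite DE => H.
have {}H : (\int[fun A => polar_law P (Z 0%N) x A / tail P (Z 0%N) x]_(p in
     `](0 : R)%R, +oo[%classic `*` @sphere R d) (f p)%:E)%E @[x --> +oo] -->
     (rint mu phi)%:E.
  rewrite rintE//; last first.
    by apply: (@mu_int_fin _ _ mu _ M r) => //; exact: mufin.
  rewrite (eq_integral_set_fun (m2 := polar_measure nu S)); last by move=> A _; rewrite -muE.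
  rewrite (polar_measure_int nuE S1)//; [|exact/measurable_EFinP|by rewrite phi00].
  apply: H.
  - apply: continuous_subspaceT => p.
    apply: (@continuous_comp _ _ _ (fun p : R * V => p.1 *: p.2) phi); last exact: cphi.
    exact: scale_continuous.
  - by exists M => p _; exact: phiM.
  (* The distance from [p] to the points of radius 0 is at least its radius, so [f] vanishes near
     them as [phi] does near 0. *)
  - exists r => // p [/=]; rewrite in_itv/= andbT => p0 p1 inf_le.
    apply: phi0; rewrite enormZ p1 mulr1 gtr0_norm// -lee_fin.
    apply: le_trans inf_le; apply: le_ereal_inf_tmp => _ [c [/= c0 _] <-].
    by rewrite lee_fin le_max c0 sub0r normrN gtr0_norm// lexx.
have ei : (eta l)^-1 @[l --> \oo] --> +oo.
  apply/gtr0_cvgV0; first by near=> l; rewrite invr_gt0.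
  apply: cvg_trans etac; apply: near_eq_cvg; near=> l.
  by rewrite /= invrK.
have /fine_cvg {}H := cvg_comp _ _ ei H.
apply: cvg_trans H; apply: near_eq_cvg; near=> l => /=.
rewrite nlaw_polar ?invr_gt0// invrK /rint fineM//.
rewrite ge0_fin_numE; first by apply: (@prob_int_fin _ _ _ _ phi M) => //; rewrite [X in (X < _)%E]probability_setT ltry.
by apply: integral_ge0 => w _; rewrite lee_fin.
Unshelve. all: by end_near. Qed.

End regular_variation.

(** * Limit of expectations for bounded coefficients *)

Section increasing_open.
Context {R : realType} {k : nat}.
Implicit Types t : k.-tuple R.

Lemma increasing_near t : increasing_tuples `]0, 1[%classic k t ->
  exists2 de : R, 0 < de & forall t' : k.-tuple R,
    (forall j, `|tnth t' j - tnth t j| < de) -> increasing_tuples `]0, 1[%classic k t'.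
Proof.
move=> ti; have [kap kap0 gap] := tent_gap ti; have [st _] := ti.
exists (kap / 2); first by rewrite divr_gt0.
have aux (u v u' v' : R) : kap <= `|u - v| -> u < v -> `|u' - u| < kap / 2 ->
    `|v' - v| < kap / 2 -> u' < v'.
  by rewrite ler_normr !ltr_norml => /orP[] h1 h2 /andP[h3 h4] /andP[h5 h6]; lra.
move=> t' tt'; split.
  apply/(sortedP 0) => i; rewrite size_tuple => ik.
  have := tt' (Ordinal ik); have := tt' (Ordinal (ltnW ik)).
  rewrite !(tnth_nth 0)/=; apply: aux.
    have [_ /(_ (Ordinal ik))] := gap (Ordinal (ltnW ik)); rewrite !(tnth_nth 0)/=; apply.
    by rewrite -val_eqE/= neq_ltn ltnSn.
  by move/(sortedP 0) : st; apply; rewrite size_tuple.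
move=> s /tnthP[j ->]; have [/andP[g1 g2] _] := gap j; have := tt' j.
by rewrite ltr_norml /= in_itv/= => /andP[h1 h2]; apply/andP; split; lra.
Qed.

Lemma measurable_increasing : measurable (increasing_tuples (R := R) `]0, 1[%classic k).
Proof.
apply: (@measurable_rel_open _ _ _ _ (fun (j : 'I_k) (t : k.-tuple R) => tnth t j) setT) => //.
  by move=> j; exact: measurable_tnth.
by move=> t /increasing_near[de de0 H]; exists de => // t' _; exact: H.
Qed.

End increasing_open.

Section jump_functionals_measurability.
Context {R : realType} {m d k : nat}.
Local Notation V := 'cV[R]_d.
Local Notation Inc := (increasing_tuples (R := R) `]0, 1[%classic k).
Variable hh : k.-tuple V -> k.-tuple R -> skorokhod R m.
Hypothesis mh : measurable_fun ([set: k.-tuple V] `*` Inc) (fun p => hh p.1 p.2).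

(** Measurability of [hh] is available for times in [Inc] only, since [hbar] may take arbitrary
    values elsewhere; the indicator removes the rest. *)
Lemma measurable_jump_functional (f : skorokhod R m -> R) : measurable_fun setT f ->
  measurable_fun setT (fun p : k.-tuple V * k.-tuple R => \1_Inc p.2 * f (hh p.1 p.2)).
Proof.
move=> mf; rewrite (_ : (fun _ => _) = (fun p : k.-tuple V * k.-tuple R => f (hh p.1 p.2)) \_ ([set: k.-tuple V] `*` Inc)).
  have mDI : measurable ([set: k.-tuple V] `*` Inc).
    by apply: measurableX => //; exact: measurable_increasing.
  apply/(measurable_restrictT _ mDI).
  exact: (measurable_comp measurableT _ mf).
apply/funext => p; rewrite patchE indicE.
have [pI|pI] := boolP (p.2 \in Inc).
  by rewrite mem_set ?mul1r//; split=> //; exact: set_mem.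
by rewrite memNset ?mul0r// => -[_ /mem_set]; exact/negP.
Qed.

Lemma measurable_jump_rint (mu : {sigma_finite_measure set V -> \bar R})
    (f : skorokhod R m -> R) : measurable_fun setT f -> (forall xi, 0 <= f xi) ->
  measurable_fun setT (fun t => \1_Inc t * rint (tmeas mu k) (fun W => f (hh W t))).
Proof.
move=> mf f0.
have mF : measurable_fun setT (fun p : k.-tuple V * k.-tuple R => (\1_Inc p.2 * f (hh p.1 p.2))%:E).
  by apply/measurable_EFinP; exact: measurable_jump_functional.
have H := @measurable_fun_fubini_tonelli_G _ _ _ _ R (tmeas mu k) _ mF.
rewrite (_ : (fun _ => _) = fun t => fine (\int[tmeas mu k]_W (\1_Inc t * f (hh W t))%:E)%E).
  apply: (measurableT_comp (f := fine)) => //.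
  by apply: H => p; rewrite lee_fin mulr_ge0.
apply/funext => t; rewrite indicE; have [_|_] := boolP (t \in Inc).
  by rewrite mul1r /rint; under [in RHS]eq_integral do rewrite mul1r.
by rewrite mul0r; under eq_integral do rewrite mul0r; rewrite integral0.
Qed.

End jump_functionals_measurability.

Section jump_path_measurability.
Context {R : realType} {m d : nat}.
Variables (a : 'cV[R]_m -> 'cV[R]_m) (sigma : 'cV[R]_m -> 'M[R]_(m, d.+1)).
Variables (b : \bar R) (C D : R).
Hypothesis b0 : (0 < b)%E.
Hypothesis C0 : 0 <= C.
Hypothesis D0 : 0 <= D.
Hypothesis aC : forall x, enorm (a x) <= C.
Hypothesis aD : forall x y, enorm (a x - a y) <= D * enorm (x - y).
Hypothesis sC : forall x, opnorm (sigma x) <= C.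
Hypothesis sD : forall x y, opnorm (sigma x - sigma y) <= D * enorm (x - y).
Local Notation V := 'cV[R]_d.+1.
Variables (k : nat) (x : 'cV[R]_m).
Local Notation h := (h a sigma b x).
Local Notation Inc := (increasing_tuples (R := R) `]0, 1[%classic k).

Lemma h_continuous_near (W : k.-tuple V) (t : k.-tuple R) e : Inc t -> 0 < e ->
  exists2 de, 0 < de & forall W' t', tuple_near de W W' ->
    (forall j, `|tnth t' j - tnth t j| < de) ->
    Inc t' /\ J1_dist (h W t) (h W' t') < e.
Proof.
move=> ti e0; have [de1 de10 H1] := increasing_near ti.
have [de2 de20 H2] := h_continuous b0 C0 D0 aC aD sC sD x W ti e0.
exists (Num.min de1 de2); first by rewrite lt_min de10.
move=> W' t' WW' tt'; have t'i : Inc t'.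
  by apply: H1 => j; have := tt' j; rewrite lt_min => /andP[].
split=> //; apply: H2 => // j.
  by have := tt' j; rewrite lt_min => /andP[].
by have := WW' j; rewrite lt_min => /andP[].
Qed.

Let coord (i : ('I_k * 'I_d.+1) + 'I_k) (p : k.-tuple V * k.-tuple R) : R :=
  match i with inl ij => tnth p.1 ij.1 ij.2 ord0 | inr j => tnth p.2 j end.

Lemma measurable_h : measurable_fun ([set: k.-tuple V] `*` Inc) (fun p => h p.1 p.2).
Proof.
apply: (@measurability _ _ _ _ _ _ (@open (skorokhod R m))) => //.
move=> _ [U oU <-].
apply: (@measurable_rel_open _ _ _ _ coord ([set: k.-tuple V] `*` Inc)).
- case=> [[i j]|j] /=.
    apply: (measurableT_comp (measurable_coord j)).
    by apply: (measurableT_comp (measurable_tnth i)); exact: measurable_fst.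
  by apply: (measurableT_comp (measurable_tnth j)); exact: measurable_snd.
- by apply: measurableX => //; exact: measurable_increasing.
- by move=> p [].
move=> [W t] [[_ /= ti] Up].
have : nbhs (h W t) U by exact: open_nbhs_nbhs.
move=> /nbhs_ballP[e /= e0 eU].
have [de de0 H] := h_continuous_near W ti e0.
exists (de / d.+2%:R); first by rewrite divr_gt0.
move=> [W' t'] [_ /= t'i] near; split => //; apply: eU.
have [||//] := H W' t'.
  move=> j; apply: le_lt_trans (enorm_le_sum _) _.
  apply: (@le_lt_trans _ _ (\sum_(i < d.+1) (de / d.+2%:R))).
    by apply: ler_sum => i _; rewrite !mxE; have := near (inl (j, i)) => /ltW.
  rewrite sumr_const card_ord -[_ *+ _]mulr_natl mulrA ltr_pdivrMr// mulrC.
  by rewrite ltr_pM2l// ltr_nat.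
move=> j; apply: lt_le_trans (near (inr j)) _.
by rewrite ler_pdivrMr// ler_peMr ?(ltW de0)// ler1n.
Qed.

End jump_path_measurability.

Lemma near0r_inv {R : realType} (Q : R -> Prop) : (\forall x \near +oo, Q x) ->
  \forall eta \near (0 : R)^'+, Q eta^-1.
Proof.
move=> /pinfty_nearP[x0 x00 H].
have i0 : 0 < x0^-1 by rewrite invr_gt0.
apply: filterS (near0r_lt i0) => eta /andP[e0 ex]; apply: H.
by rewrite -[x0]invrK lef_pV2 ?posrE// ltW.
Qed.

(** * Counts of large noises against the normalization *)

Section rates.
Context {R : realType} {d : nat} {disp : measure_display} {Omega : measurableType disp}.
Variable P : probability Omega R.
Local Notation V := 'cV[R]_d.+1.
Variable Z0 : Omega -> V.
Hypothesis mZ0 : measurable_fun setT Z0.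
Variable alpha : R.
Hypothesis alpha1 : 1 < alpha.
Hypothesis RV : forall t : R, 0 < t ->
  (tail P Z0 (t * x) / tail P Z0 x)%E @[x --> +oo] --> (t `^ (- alpha))%:E.
Local Notation H := (rtail P Z0).

(* Inverse of the order of the mean number of noises [eta *: Z] larger than 1 over
   a unit of time. *)
Definition rate (eta : R) : R := (H eta^-1)^-1 * eta.

Lemma rate_gt0 eta : 0 < eta -> 0 < rate eta.
Proof. by move=> e0; rewrite mulr_gt0// invr_gt0 (rtail_gt0 mZ0 alpha1 RV). Qed.

Let steps_le (eta : R) : 0 < eta < 1 -> (Num.truncn eta^-1).+1%:R <= 2 / eta.
Proof.
move=> /andP[e0 e1]; have i1 : 1 < eta^-1 by rewrite invf_gt1.
have : (Num.truncn eta^-1)%:R <= eta^-1 by rewrite truncn_le// invr_ge0 ltW.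
by rewrite -natr1; lra.
Qed.

(** The number of indices is at most [2 / eta], and the ratio of the tails at [r / eta] and [eta^-1]
    is eventually below its limit plus 1. *)
Lemma rate_count_bounded r : 0 < r -> \forall eta \near (0 : R)^'+,
  rate eta * ((Num.truncn eta^-1).+1%:R * H (r / eta)) <= 2 * (r `^ (- alpha) + 1).
Proof.
move=> r0; have c1 : r `^ (- alpha) - 1 < r `^ (- alpha) < r `^ (- alpha) + 1 by lra.
have near1 := near0r_inv (rtail_ratio_near mZ0 RV r0 c1).
near=> eta; have eta01 : 0 < eta < 1 by near: eta; exact: near0r_lt.
have [e0 e1] := andP eta01.
have [h0 /andP[_ h1]] : 0 < H eta^-1 /\ (r `^ (- alpha) - 1) * H eta^-1 < H (r / eta)
    < (r `^ (- alpha) + 1) * H eta^-1 by near: eta.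
apply: (@le_trans _ _ (rate eta * (2 / eta * ((r `^ (- alpha) + 1) * H eta^-1)))).
  rewrite ler_wpM2l ?(ltW (rate_gt0 _))//; apply: ler_pM => //; first exact: rtail_ge0.
    exact: steps_le.
  exact: ltW.
rewrite le_eqVlt; apply/orP; left; apply/eqP.
by rewrite /rate; field; rewrite !gt_eqF.
Unshelve. all: by end_near. Qed.

(** This rests on [alpha > 1]: a moment of some order [p] between 1 and [alpha] makes the tail at
    [x], multiplied by [x], tend to 0. *)
Lemma count_small r e : 0 < r -> 0 < e -> \forall eta \near (0 : R)^'+,
  (Num.truncn eta^-1).+1%:R * H (r / eta) < e.
Proof.
move=> r0 e0; pose p := (1 + alpha) / 2.
have al := alpha1.
have pa : 0 < p < alpha by rewrite /p; apply/andP; split; lra.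
have p1 : 0 < p - 1 by rewrite /p; lra.
have [K K0 HK] := rtail_markov mZ0 RV pa.
(* The outer exponent inverts the power [p - 1]: for arguments beyond [y], that power exceeds
   [2 * K / (r * e)], as the Markov bound requires. *)
pose y := (2 * K / (r * e) + 1) `^ (p - 1)^-1.
have y0 : 0 < y by apply: powR_gt0; rewrite ltr_wpDl// divr_ge0 ?mulr_ge0// ltW.
near=> eta; have eta01 : 0 < eta < 1 by near: eta; exact: near0r_lt.
have [t0 t1] := andP eta01.
have ety : 0 < eta < r / y by near: eta; apply: near0r_lt; rewrite divr_gt0.
have yx : y < r / eta by move: ety => /andP[_]; rewrite !ltr_pdivlMr// mulrC.
have x0 : 0 < r / eta by exact: lt_trans yx.
apply: (@le_lt_trans _ _ (2 / r * (r / eta * H (r / eta)))).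
  rewrite [leRHS]mulrA (_ : 2 / r * (r / eta) = 2 / eta); last by field; rewrite !gt_eqF.
  by rewrite ler_wpM2r ?rtail_ge0// steps_le.
have big : 2 * K / (r * e) < (r / eta) `^ (p - 1).
  apply: (@lt_trans _ _ (2 * K / (r * e) + 1)); first by rewrite ltrDl.
  have -> : 2 * K / (r * e) + 1 = y `^ (p - 1).
    by rewrite -powRrM mulVf ?gt_eqF// powRr1// addr_ge0// divr_ge0 ?mulr_ge0// ltW.
  by apply: gt0_ltr_powR; rewrite ?nnegrE ?(ltW y0) ?(ltW x0).
have := HK _ x0; rewrite (_ : (r / eta) `^ p = r / eta * (r / eta) `^ (p - 1)); last first.
  by rewrite -{2}(powRr1 (ltW x0)) -powRD ?subrKC// (gt_eqF x0) implybT.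
set q := (r / eta) `^ (p - 1) in big * => h1.
have q0 : 0 < q by apply: powR_gt0.
have h2 : r / eta * H (r / eta) <= K / q.
  by rewrite ler_pdivlMr// mulrAC.
apply: (@le_lt_trans _ _ (2 / r * (K / q))); first by rewrite ler_wpM2l// divr_ge0// ltW.
rewrite ltr_pdivrMr ?mulr_gt0// in big.
rewrite (_ : 2 / r * (K / q) = 2 * K / (r * q)); last by field; rewrite !gt_eqF.
by rewrite ltr_pdivrMr ?mulr_gt0//; lra.
Unshelve. all: by end_near. Qed.

(** By [rtail_pow_lower] the rate times [eta ^+ s] is bounded, so [eta ^+ (s * k)] compensates
    [rate eta ^+ k], and one more factor [eta] tends to 0. *)
Lemma rate_noise_small k : exists N : nat, forall e, 0 < e ->
  \forall eta \near (0 : R)^'+, rate eta ^+ k * eta ^+ N < e.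
Proof.
have [s [x0 [c [x00 c0 Hc]]]] := rtail_pow_lower mZ0 alpha1 RV.
exists (s * k).+1 => e e0.
pose y := e * c ^+ k.
have y0 : 0 < y by rewrite mulr_gt0// exprn_gt0.
near=> eta; have eta01 : 0 < eta < 1 by near: eta; exact: near0r_lt.
have [t0 t1] := andP eta01.
have etx : 0 < eta < x0^-1 by near: eta; apply: near0r_lt; rewrite invr_gt0.
have ety : 0 < eta < y by near: eta; exact: near0r_lt.
have xe : x0 <= eta^-1.
  by case/andP: etx => _ h; rewrite -[x0]invrK lef_pV2 ?posrE ?invr_gt0// ltW.
have h0 : 0 < H eta^-1 := rtail_gt0 mZ0 alpha1 RV eta^-1.
have h1 : rate eta * eta ^+ s <= c^-1.
  have -> : rate eta * eta ^+ s = (eta^-1 ^+ s * H eta^-1)^-1 * eta.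
    by rewrite /rate invfM exprVn invrK; ring.
  have hc : (eta^-1 ^+ s * H eta^-1)^-1 <= c^-1.
    by rewrite lef_pV2 ?posrE ?mulr_gt0 ?exprn_gt0 ?invr_gt0//; exact: Hc.
  have c0' : 0 <= c^-1 by rewrite invr_ge0 ltW.
  by apply: (le_trans (ler_wpM2r (ltW t0) hc)); rewrite ler_piMr// ltW.
have -> : rate eta ^+ k * eta ^+ (s * k).+1 = (rate eta * eta ^+ s) ^+ k * eta.
  by move: (rate eta) => u; rewrite exprMn -exprM exprSr mulrA.
apply: (@le_lt_trans _ _ (c^-1 ^+ k * eta)).
  rewrite ler_wpM2r ?(ltW t0)// lerXn2r ?nnegrE ?invr_ge0 ?(ltW c0)//.
  by rewrite mulr_ge0 ?exprn_ge0 ?(ltW t0) ?(ltW (rate_gt0 t0)).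
by rewrite exprVn mulrC ltr_pdivrMr ?exprn_gt0//; case/andP: ety.
Unshelve. all: by end_near. Qed.

End rates.

(** Small parameters are chosen below as quotients by [u + 1], the 1 covering constants [u] that
    vanish. *)
Lemma mul_divS_le {R : realFieldType} (u v : R) : 0 <= u -> 0 <= v -> u * (v / (u + 1)) <= v.
Proof.
move=> u0 v0; have u1 : 0 < u + 1 by rewrite ltr_wpDl.
by rewrite mulrCA ler_piMr// ler_pdivrMr// mul1r lerDl.
Qed.

Section bounded_coefficients.
Context {R : realType} {m d : nat}.
Variables (a : 'cV[R]_m -> 'cV[R]_m) (sigma : 'cV[R]_m -> 'M[R]_(m, d.+1)).
Variables (b : \bar R) (C D : R).
Hypothesis b0 : (0 < b)%E.
Hypothesis C0 : 0 <= C.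
Hypothesis D0 : 0 <= D.
Hypothesis aC : forall x, enorm (a x) <= C.
Hypothesis aD : forall x y, enorm (a x - a y) <= D * enorm (x - y).
Hypothesis sC : forall x, opnorm (sigma x) <= C.
Hypothesis sD : forall x y, opnorm (sigma x - sigma y) <= D * enorm (x - y).
Local Notation V := 'cV[R]_d.+1.
Context {disp : measure_display} {Omega : measurableType disp}.
Variable P : probability Omega R.
Variable Z : nat -> Omega -> V.
Hypothesis mZ : forall n, measurable_fun setT (Z n).
Hypothesis iidZ : iid P Z.
Hypothesis meanZ : mean_zero P (Z 0%N).
Variable alpha : R.
Hypothesis alpha1 : 1 < alpha.
Hypothesis RV : forall t : R, 0 < t ->
  (tail P (Z 0%N) (t * x) / tail P (Z 0%N) x)%E @[x --> +oo] --> (t `^ (- alpha))%:E.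
Local Notation H := (rtail P (Z 0%N)).
Local Notation rate := (rate P (Z 0%N)).
Variable mu : {sigma_finite_measure set V -> \bar R}.
Hypothesis vag : forall eta_ : nat -> R, (forall l, 0 < eta_ l) -> eta_ l @[l --> \oo] --> 0 ->
  vague_cvg \oo (fun l => (H (eta_ l)^-1)^-1) (fun l => nlaw P mZ (eta_ l)) mu.
Variables (k : nat) (x : 'cV[R]_m).
Local Notation h := (h a sigma b x).
Local Notation Inc := (increasing_tuples (R := R) `]0, 1[%classic k).
Local Notation osc := (osc_set a sigma b C D x).
Variables (g : skorokhod R m -> R) (M eps0 r0 : R).
Hypothesis eps0_gt0 : 0 < eps0.
Hypothesis r0_gt0 : 0 < r0.
Hypothesis cg : continuous g.
Hypothesis gM : forall xi, 0 <= g xi <= M.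
Hypothesis supp : support_away a sigma b k x g eps0 r0.

Lemma subset_Inc1 (t : k.-tuple R) : Inc t -> increasing_tuples `]0, 1]%classic k t.
Proof.
by move=> [st Ht]; split=> // s /Ht; rewrite /= !in_itv/= => /andP[-> /ltW].
Qed.

Lemma small_noise_vanish : exists2 delta : R, 0 < delta &
  forall (W : k.-tuple V) t, Inc t -> (exists j, enorm (tnth W j) <= delta) -> g (h W t) = 0.
Proof.
have m10 : 0 < Num.min eps0 r0 by rewrite lt_min eps0_gt0.
have EC : 0 <= expR D * C by rewrite mulr_ge0 ?expR_ge0.
pose delta := Num.min eps0 r0 / (expR D * C + 1).
have Ed : expR D * (C * delta) <= Num.min eps0 r0.
  by rewrite mulrA; apply: mul_divS_le => //; exact: ltW.
exists delta; first by rewrite divr_gt0// ltr_wpDl.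
by move=> W t /subset_Inc1 ti; exact: (small_jump_vanish b0 C0 D0 aC aD sC supp ti Ed).
Qed.

Lemma jump_sum_cvg (delta : R) : 0 < delta -> expR D * (C * delta) <= Num.min eps0 r0 ->
  rate eta ^+ k * jump_sum P mZ eta (fun (W : k.-tuple V) t => g (h W t)) @[eta --> (0 : R)^'+] -->
  rint (tmeas (@leb R) k) (fun t => \1_Inc t * rint (tmeas mu k) (fun W : k.-tuple V => g (h W t))).
Proof.
(* The limit is reduced to sequences because dominated convergence, behind [grid_sum_cvg], is
   sequential. *)
move=> delta0 err; apply/cvg_at_rightP => u [u0 uc].
have M0 : 0 <= M by have /andP[/le_trans] := gM (X_path a sigma 1 b x (fun=> 0)); apply.
apply: (@grid_sum_cvg R d.+1 (fun l => nlaw P mZ (u l)) _ u mu (vag u0 uc) u0 uc k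
  (fun _ W t => g (h W t)) (fun (W : k.-tuple V) t => g (h W t)) M delta) => //.
- by move=> _ t ti; exact: (measurable_gh b0 C0 D0 aC aD sC sD).
- by move=> _ W t ti; exact: (small_jump_vanish b0 C0 D0 aC aD sC supp ti err).
- by move=> t /subset_Inc1 ti; exact: (measurable_gh b0 C0 D0 aC aD sC sD).
- by move=> W t /subset_Inc1 ti; exact: (small_jump_vanish b0 C0 D0 aC aD sC supp ti err).
- move=> W t ti e e0; have [de1 de10 H1] := J1_continuousP cg (h W t) e0.
  have [de de0 H2] := h_continuous_near b0 C0 D0 aC aD sC sD x W ti de10.
  exists de => //; near=> l => W' t' _ WW' tt'; apply: H1.
  by have [] := H2 _ _ WW' tt'.
- apply: (measurable_jump_rint (measurable_h b0 C0 D0 aC aD sC sD x)); first exact: measurable_g.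
  by move=> xi; have /andP[] := gM xi.
Unshelve. all: by end_near. Qed.

(* By contradiction, along a sequence of pairs ([e], [eta]) tending to 0. *)
Lemma osc_sum_small (tau delta eps : R) : 0 < tau -> 0 < delta -> 0 < eps -> exists2 e, 0 < e &
  \forall eta \near (0 : R)^'+, rate eta ^+ k *
    jump_sum P mZ eta (fun (W : k.-tuple V) t => (all_big delta W)%:R * \1_(osc g tau e t) W) <= eps.
Proof.
move=> tau0 delta0 eps0'; apply: contrapT => none.
have /choice[u uP] (l : nat) : exists eta : R, 0 < eta < l.+1%:R^-1 /\
    eps < rate eta ^+ k * jump_sum P mZ eta
      (fun (W : k.-tuple V) t => (all_big delta W)%:R * \1_(osc g tau l.+1%:R^-1 t) W).
  apply: contrapT => nu; apply: none; exists l.+1%:R^-1; first by rewrite invr_gt0.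
  have l0 : (0 : R) < l.+1%:R^-1 by rewrite invr_gt0.
  apply: filterS (near0r_lt l0) => eta etal; rewrite leNgt; apply/negP => ?.
  by apply: nu; exists eta.
have u0 l : 0 < u l by have [/andP[]] := uP l.
have inv0 : (l.+1%:R^-1 : R) @[l --> \oo] --> 0.
  by apply/gtr0_cvgV0; [near=> l|rewrite cvg_shiftS; exact: cvgr_idn].
have uc : u l @[l --> \oo] --> 0.
  apply: (@squeeze_cvgr _ _ _ _ (fun=> 0) (fun l => l.+1%:R^-1)) => //; last exact: cvg_cst.
  by near=> l; have [/andP[/ltW -> /ltW]] := uP l.
pose F_ (l : nat) (W : k.-tuple V) (t : k.-tuple R) : R :=
  (all_big delta W)%:R * \1_(osc g tau l.+1%:R^-1 t) W.
have FE l W t : F_ l W t = \1_([set W : k.-tuple V | all_big delta W] `&` osc g tau l.+1%:R^-1 t) W.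
  by rewrite /F_ all_big_indic indicI.
have key : rate (u l) ^+ k * jump_sum P mZ (u l) (F_ l) @[l --> \oo] --> 0.
  have lim0 : rint (tmeas (@leb R) k) (fun t => \1_Inc t * rint (tmeas mu k) (fun _ => 0)) = 0.
    have r00 : rint (tmeas mu k) (fun _ => 0) = 0 by rewrite /rint integral0.
    by rewrite r00 /rint; under eq_integral do rewrite mulr0; rewrite integral0.
  rewrite -[X in _ --> X]lim0.
  apply: (@grid_sum_cvg R d.+1 (fun l => nlaw P mZ (u l)) _ u mu (vag u0 uc) u0 uc k
    F_ (fun _ _ => 0) 1 delta) => //.
  - move=> l t ti; rewrite (_ : F_ l ^~ t = \1_([set W : k.-tuple V | all_big delta W] `&` osc g tau l.+1%:R^-1 t)); last first.
      by apply/funext => W; exact: FE.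
    apply: measurable_indic; apply: measurableI; first exact: measurable_all_big.
    have l0 : (0 : R) < l.+1%:R^-1 by rewrite invr_gt0.
    exact: (@measurable_osc_set R m d a sigma b C D b0 C0 D0 aC aD sC sD k x g cg tau l.+1%:R^-1 t l0 ti).
  - by move=> l W t; rewrite FE indicE; case: (_ \in _); rewrite ?lexx ?ler01.
  - move=> l W t ti [j Wj]; rewrite /F_ (_ : all_big delta W = false) ?mul0r//.
    by apply/negbTE/forallPn; exists j; rewrite -leNgt.
  - by move=> W t; rewrite lexx ler01.
  (* Around [(W, t)] the indicator is eventually 0: paths within the shrinking tolerance of
     [h W' t'] stay where [g] differs from [g (h W t)] by less than [tau / 2]. *)
  - move=> W t ti e e0; have tau2 : 0 < tau / 2 by rewrite divr_gt0.
    have [de1 de10 H1] := J1_continuousP cg (h W t) tau2.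
    have de12 : 0 < de1 / 2 by rewrite divr_gt0.
    have [de2 de20 H2] := h_continuous_near b0 C0 D0 aC aD sC sD x W ti de12.
    have D1 : 0 < (D + 1)^-1 by rewrite invr_gt0 ltr_wpDl.
    (* [D] times the second radius is at most 1, so nearby noises have weight at most [2 ^+ k] times
       that of [W]. *)
    exists (Num.min de2 (D + 1)^-1); first by rewrite lt_min de20.
    have w0 : 0 < 2 ^+ k * jump_weight C D W.
      by rewrite mulr_gt0 ?exprn_gt0// (lt_le_trans ltr01 (jump_weight_ge1 C0 D0 W)).
    have q0 : 0 < de1 / 2 / (2 ^+ k * jump_weight C D W) by rewrite divr_gt0.
    near=> l => W' t' _ WW' tt'.
    have [||_ hh'] := H2 W' t'.
      by move=> j; have := WW' j; rewrite lt_min => /andP[].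
      by move=> j; have := tt' j; rewrite lt_min => /andP[].
    have small : l.+1%:R^-1 < de1 / 2 / (2 ^+ k * jump_weight C D W).
      by near: l; exact: (cvgr_lt _ inv0).
    have [||_ rho] := @jump_weight_near R d C D C0 D0 k W W' (D + 1)^-1 (ltW D1).
      by rewrite ler_pdivrMr ?mul1r ?lerDl// ltr_wpDl.
      by move=> j; have := WW' j; rewrite lt_min => /andP[].
    have F00 : F_ l W' t' = 0.
      rewrite /F_ indicE memNset ?mulr0// => -[y [y1 y2]].
      have yd : J1_dist y (h W' t') < de1 / 2.
        apply: lt_le_trans y1 _; apply: (le_trans (ler_wpM2l _ rho)) => //.
        by move: small; rewrite ltr_pdivlMr// => /ltW.
      have g1 : `|g (h W' t') - g (h W t)| < tau / 2.
        by apply: H1; apply: lt_trans hh' _; rewrite ltr_pdivrMr// ltr_pMr// ltr1n.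
      have g2 : `|g y - g (h W t)| < tau / 2.
        apply: H1; have := J1_dist_triangle (h W' t') (h W t) y.
        by rewrite [J1_dist (h W' t') y]J1_dist_sym; lra.
      have := ler_distD (g (h W t)) (g y) (g (h W' t')).
      by rewrite [`|g (h W t) - _|]distrC; lra.
    by rewrite F00 subrr normr0.
  - by rewrite (_ : (fun _ => _) = cst 0); [exact: measurable_cst|
      apply/funext => t; rewrite /rint integral0 mulr0].
have /filter_ex[l] : \forall l \near \oo, rate (u l) ^+ k * jump_sum P mZ (u l) (F_ l) < eps.
  exact: (cvgr_lt _ key).
by have [_ h1] := uP l; rewrite ltNge (ltW h1).
Unshelve. all: by end_near. Qed.

(** The order of the choices matters: [delta'] comes from the support of [g] and the clipping level,
    [tau] from the count of noises above [delta'], the tolerance [e1] from [osc_sum_small], [eps]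
    from [e1] and the support, and [delta] from the noise bound for [eps]. Only then is [eta] small.
    The four error terms receive [e / 4] each. *)
Lemma expectation_near_jump_sum e : 0 < e -> \forall eta \near (0 : R)^'+,
  rate eta ^+ k * `|rint P (fun w => g (X_path a sigma eta b x (Z ^~ w))) -
    jump_sum P mZ eta (fun (W : k.-tuple V) t => g (h W t))| <= e.
Proof.
move=> e0; have M0 : 0 <= M by have /andP[/le_trans] := gM (X_path a sigma 1 b x (fun=> 0)); apply.
pose m1 := Num.min eps0 r0; have m10 : 0 < m1 by rewrite lt_min eps0_gt0.
have [beta beta0 bb] := clip_level b0.
have Kc0 := err_const_ge0 C0 D0; set Kc := err_const C D in Kc0.
have E0 := expR_ge0 D; have C0' := C0.
(* [A] adds up the coefficients of [delta'] in three smallness conditions: dropping a small jump,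
   not reaching the clipping level, and shadowing. *)
pose A := expR D * C + C + Kc * ((2 * k)%:R * C).
have A1 : 0 <= expR D * C by rewrite mulr_ge0.
have A2 : 0 <= Kc * ((2 * k)%:R * C) by rewrite mulr_ge0// mulr_ge0.
have A0 : 0 <= A by rewrite /A; lra.
(* In the shadowing error a third of [m1] is reserved for each of [delta'], [eps] and [eta]; below
   the clipping level half of [beta] for each of [delta'] and [eta]. *)
pose B := Num.min (m1 / 3) (beta / 2).
have B0 : 0 < B by rewrite lt_min !divr_gt0.
pose delta' := B / (A + 1).
have d'0 : 0 < delta' by rewrite divr_gt0// ltr_wpDl.
have Ad' : A * delta' <= B by apply: mul_divS_le => //; exact: ltW.
have Bm : B <= m1 / 3 by rewrite /B ge_min lexx.
have Bb : B <= beta / 2 by rewrite /B ge_min lexx orbT.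
have d1 : 0 <= expR D * C * delta' by rewrite mulr_ge0// ltW.
have d2 : 0 <= C * delta' by rewrite mulr_ge0// ltW.
have d3 : 0 <= Kc * ((2 * k)%:R * C) * delta' by rewrite mulr_ge0// ltW.
have Ad'E : A * delta' = expR D * C * delta' + C * delta' + Kc * ((2 * k)%:R * C) * delta'.
  by rewrite /A !mulrDl.
have err3 : expR D * (C * delta') <= m1 by rewrite mulrA; lra.
pose K1 := 2 * (delta' `^ (- alpha) + 1).
have K10 : 0 <= K1 by rewrite mulr_ge0// addr_ge0// powR_ge0.
have e4 : 0 < e / 4 by rewrite divr_gt0.
have K1k : 0 <= K1 ^+ k by rewrite exprn_ge0.
pose tau := e / 4 / (K1 ^+ k + 1).
have tau0 : 0 < tau by rewrite divr_gt0// ltr_wpDl.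
pose eM := e / 4 / (M + 1).
have eM0 : 0 < eM by rewrite divr_gt0// ltr_wpDl.
have MeM : M * eM <= e / 4 by apply: mul_divS_le => //; exact: ltW.
have [e1 e10 near_osc] := osc_sum_small tau0 d'0 eM0.
pose B2 := Num.min (m1 / 3) (e1 / 3).
have B20 : 0 < B2 by rewrite lt_min !divr_gt0.
have B2m : B2 <= m1 / 3 by rewrite /B2 ge_min lexx.
have B2e : B2 <= e1 / 3 by rewrite /B2 ge_min lexx orbT.
pose eps := B2 / (Kc + 1).
have eps_gt0 : 0 < eps by rewrite divr_gt0// ltr_wpDl.
have Keps : Kc * eps <= B2 by apply: mul_divS_le => //; exact: ltW.
have [N near_noise] := rate_noise_small (mZ 0%N) alpha1 RV k.
have [delta0 delta00 noise] := noise_small b0 C0 D0 aD sC sD mZ iidZ meanZ alpha1 RV N eps_gt0.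
pose delta := Num.min delta0 delta'.
have dl0 : 0 < delta by rewrite lt_min delta00.
have dl1 : 0 < delta <= delta0 by rewrite dl0 ge_min lexx.
have dl2 : 0 <= delta <= delta' by rewrite (ltW dl0) ge_min lexx orbT.
pose K2 := 2 * (delta `^ (- alpha) + 1).
have K20 : 0 <= K2 by rewrite mulr_ge0// addr_ge0// powR_ge0.
have K2k : 0 <= K2 ^+ k by rewrite exprn_ge0.
pose eK := eM / (K2 ^+ k + 1).
have eK0 : 0 < eK by rewrite divr_gt0// ltr_wpDl.
have KeK : K2 ^+ k * eK <= eM by apply: mul_divS_le => //; exact: ltW.
have near_bad := noise delta dl1 x.
have near_cd' := rate_count_bounded (mZ 0%N) alpha1 RV d'0.
have near_cd := rate_count_bounded (mZ 0%N) alpha1 RV dl0.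
have near_small := count_small (mZ 0%N) alpha1 RV dl0 eK0.
have near_q := near_noise _ eM0.
near=> eta.
have /andP[t0 t1] : 0 < eta < 1 by near: eta; exact: near0r_lt.
have /andP[_ t2] : 0 < eta < eps by near: eta; exact: near0r_lt.
have /andP[_ t3] : 0 < eta < beta / 2 / (C + 1).
  by near: eta; apply: near0r_lt; rewrite !divr_gt0// ltr_wpDl.
have /andP[_ t4] : 0 < eta < k.+1%:R^-1 by near: eta; apply: near0r_lt; rewrite invr_gt0.
have bad : (P (noise_bad a sigma b Z delta eps eta x) <= (eta ^+ N)%:E)%E by near: eta.
have cd' : rate eta * ((Num.truncn eta^-1).+1%:R * H (delta' / eta)) <= K1 by near: eta.
have cd : rate eta * ((Num.truncn eta^-1).+1%:R * H (delta / eta)) <= K2 by near: eta.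
have sm : (Num.truncn eta^-1).+1%:R * H (delta / eta) < eK by near: eta.
have qs : rate eta ^+ k * eta ^+ N < eM by near: eta.
have os : rate eta ^+ k * jump_sum P mZ eta (fun (W : k.-tuple V) t =>
  (all_big delta' W)%:R * \1_(osc g tau e1 t) W) <= eM by near: eta.
have ra0 := rate_gt0 (mZ 0%N) alpha1 RV t0.
have kn : (k <= Num.truncn eta^-1)%N.
  rewrite truncn_ge_nat ?invr_ge0 ?(ltW t0)//.
  rewrite ltW//; apply: (@lt_trans _ _ k.+1%:R); first by rewrite ltr_nat.
  by rewrite -[ltLHS]invrK ltf_pV2 ?posrE ?invr_gt0.
have Ceta : C * eta <= beta / 2.
  have C1 : 0 < C + 1 by rewrite ltr_wpDl.
  move: t3; rewrite ltr_pdivlMr//; lra.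
have cb : ((C * eta + C * delta')%:E <= b)%E.
  by apply: le_trans bb; rewrite lee_fin; lra.
have Keta : Kc * eta <= B2 by apply: le_trans Keps; rewrite ler_wpM2l// ltW.
have err1 : shadow_err C D eta (eps + (2 * k)%:R * (C * delta')) <= m1.
  apply: le_trans (shadow_err_le C0 D0 (ltW t0) _) _.
    by rewrite addr_ge0 ?(ltW eps_gt0)// mulr_ge0.
  rewrite -/Kc !mulrDr (_ : Kc * ((2 * k)%:R * (C * delta')) = Kc * ((2 * k)%:R * C) * delta').
    by lra.
  by rewrite !mulrA.
have err2 : shadow_err C D eta eps < e1.
  apply: le_lt_trans (shadow_err_le C0 D0 (ltW t0) (ltW eps_gt0)) _.
  by rewrite -/Kc mulrDr; lra.
have := @expect_approx R m d a sigma b C D b0 C0 D0 aC aD sC sD k x g M eps0 r0 cg gM supp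
  disp Omega P Z mZ iidZ eta delta delta' eps tau e1 (eta ^+ N) t0 dl2 (ltW tau0) kn
  (ltW eps_gt0) e10 (exprn_ge0 N (ltW t0)) cb err1 err2 err3 bad.
move=> main; apply: (le_trans (ler_wpM2l (exprn_ge0 k (ltW ra0)) main)).
have J0 : 0 <= jump_sum P mZ eta (fun (W : k.-tuple V) t =>
  (all_big delta' W)%:R * \1_(osc g tau e1 t) W).
  by apply: sumr_ge0 => I _; apply: rint_ge0 => W; rewrite mulr_ge0.
move: main cd' cd sm qs os J0 ra0.
move: (jump_sum _ _ _ _) (jump_sum _ _ _ _) => J1 J2.
have X0 : 0 <= (Num.truncn eta^-1).+1%:R * H (delta' / eta) by rewrite mulr_ge0// rtail_ge0.
have Y0 : 0 <= (Num.truncn eta^-1).+1%:R * H (delta / eta) by rewrite mulr_ge0// rtail_ge0.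
move: X0 Y0; move: (_ * H (delta' / eta)) (_ * H (delta / eta)) => X Y.
move: (rate eta) => ra X0 Y0 _ cd' cd sm qs os J0 ra0.
have T1 : ra ^+ k * (tau * X ^+ k) <= e / 4.
  rewrite mulrCA -exprMn; apply: (@le_trans _ _ (tau * K1 ^+ k)).
    by rewrite ler_wpM2l ?(ltW tau0)// lerXn2r ?nnegrE// mulr_ge0// ltW.
  by rewrite mulrC; apply: mul_divS_le => //; exact: ltW.
have T2 : ra ^+ k * (M * J1) <= e / 4.
  by rewrite mulrCA; apply: le_trans MeM; rewrite ler_wpM2l.
have T3 : ra ^+ k * (M * eta ^+ N) <= e / 4.
  by rewrite mulrCA; apply: le_trans MeM; rewrite ler_wpM2l// ltW.
(* There is one factor [Y] more than the rate compensates: [ra * Y] stays bounded, and the extra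
   factor is small by [count_small]. *)
have T4 : ra ^+ k * (M * Y ^+ k.+1) <= e / 4.
  rewrite (_ : _ * _ = M * ((ra * Y) ^+ k * Y)); last by rewrite exprMn exprSr; ring.
  apply: le_trans MeM; rewrite ler_wpM2l//.
  apply: le_trans KeK; apply: ler_pM => //; last exact: ltW.
    by rewrite exprn_ge0// mulr_ge0// ltW.
  by rewrite lerXn2r ?nnegrE// mulr_ge0// ltW.
by rewrite !mulrDr; lra.
Unshelve. all: by end_near. Qed.

Lemma expectation_cvg :
  rate eta ^+ k * rint P (fun w => g (X_path a sigma eta b x (Z ^~ w))) @[eta --> (0 : R)^'+] -->
  rint (tmeas (@leb R) k) (fun t => \1_Inc t * rint (tmeas mu k) (fun W : k.-tuple V => g (h W t))).
Proof.
have m10 : 0 < Num.min eps0 r0 by rewrite lt_min eps0_gt0.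
have EC : 0 <= expR D * C by rewrite mulr_ge0 ?expR_ge0.
pose delta := Num.min eps0 r0 / (expR D * C + 1).
have delta0 : 0 < delta by rewrite divr_gt0// ltr_wpDl.
have Ed : expR D * (C * delta) <= Num.min eps0 r0.
  by rewrite mulrA; apply: mul_divS_le => //; exact: ltW.
apply/cvgrPdist_le => e e0; have e2 : 0 < e / 2 by rewrite divr_gt0.
have /cvgrPdist_le/(_ _ e2) near1 := jump_sum_cvg delta0 Ed.
have near2 := expectation_near_jump_sum e2.
near=> eta; have t0 : 0 < eta by near: eta; exact: nbhs_right_gt.
have h1 : `|rint (tmeas (@leb R) k) (fun t => \1_Inc t * rint (tmeas mu k) (fun W : k.-tuple V => g (h W t))) -
  rate eta ^+ k * jump_sum P mZ eta (fun (W : k.-tuple V) t => g (h W t))| <= e / 2 by near: eta.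
have h2 : rate eta ^+ k * `|rint P (fun w => g (X_path a sigma eta b x (Z ^~ w))) -
    jump_sum P mZ eta (fun (W : k.-tuple V) t => g (h W t))| <= e / 2 by near: eta.
have ra0 : 0 <= rate eta ^+ k by rewrite exprn_ge0// ltW// (rate_gt0 (mZ 0%N) alpha1 RV).
apply: (le_trans (ler_distD (rate eta ^+ k * jump_sum P mZ eta (fun (W : k.-tuple V) t => g (h W t))) _ _)).
rewrite [e]splitr lerD// -mulrBr normrM ger0_norm// distrC.
exact: h2.
Unshelve. all: by end_near. Qed.

End bounded_coefficients.

(** * Clipped jumps with Lipschitz coefficients *)

Section path_growth.
Context {R : realType} {m d : nat}.
Variables (a : 'cV[R]_m -> 'cV[R]_m) (sigma : 'cV[R]_m -> 'M[R]_(m, d)).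
Variables (beta C D A eps : R).
Hypothesis beta0 : 0 <= beta.
Hypothesis C0 : 0 <= C.
Hypothesis D0 : 0 <= D.
Hypothesis aC : forall x, enorm (a x) <= C.
Hypothesis aD : forall x y, enorm (a x - a y) <= D * enorm (x - y).
Hypothesis a0 : enorm (a 0) <= A.
Hypothesis eps0 : 0 <= eps.

Let A0 : 0 <= A. Proof. exact: le_trans (enorm_ge0 _) a0. Qed.

(** The bound involves only [D] and the size of [a] at 0, not [C]. For frozen coefficients [C]
    depends on the radius of the ball, and that radius is chosen from this bound. *)
Lemma iter_euler_growth h n x : 0 <= h ->
  enorm (iter n (euler a h) x) <= expR (h * n%:R * D) * (enorm x + h * n%:R * A).
Proof.
move=> h0; elim: n => [|n IH]; first by rewrite mulr0 !mul0r expR0 mul1r addr0.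
rewrite iterS; set y := iter n _ x in IH *.
have ay : enorm (a y) <= A + D * enorm y.
  by have := enormD (a y - a 0) (a 0); have := aD y 0; rewrite subrK subr0; have := a0; lra.
have h1 : enorm (euler a h y) <= (1 + h * D) * enorm y + h * A.
  apply: (le_trans (enormD _ _)); rewrite enormZ ger0_norm//.
  by have := ler_wpM2l h0 ay; lra.
have hn : 0 <= h * n%:R by rewrite mulr_ge0.
have h2 : (1 + h * D) * enorm y <= expR (h * D) * (expR (h * n%:R * D) * (enorm x + h * n%:R * A)).
  by apply: ler_pM; rewrite ?enorm_ge0 ?addr_ge0 ?mulr_ge0 ?expR_ge1Dx.
have h3 : h * A <= expR (h * n.+1%:R * D) * (h * A).
  by rewrite ler_peMl ?mulr_ge0// -expR0 ler_expR !mulr_ge0.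
rewrite mulrA -expRD (_ : h * D + h * n%:R * D = h * n.+1%:R * D) in h2; last first.
  by rewrite -natr1; ring.
rewrite (_ : enorm x + h * n.+1%:R * A = enorm x + h * n%:R * A + h * A); last first.
  by rewrite -natr1; ring.
by rewrite mulrDr; lra.
Qed.

Lemma flow_growth t x : 0 <= t <= 1 -> enorm (flow a t x) <= expR D * (enorm x + A).
Proof.
move=> /andP[t0 t1]; rewrite -[flow a t x]subr0.
apply: (enorm_limn_le (flow_cvg C0 D0 aC aD t0)); apply: nearW => n; rewrite subr0.
apply: (le_trans (iter_euler_growth _ _ (ltW (mesh_gt0 n)))).
have /andP[s1 _] := polygon_steps n t0.
have s0 : 0 <= mesh n * (Num.truncn (t / mesh n))%:R :> R by rewrite mulr_ge0// ltW// mesh_gt0.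
apply: ler_pM; rewrite ?expR_ge0 ?addr_ge0 ?enorm_ge0 ?mulr_ge0 ?(ltW (mesh_gt0 n))//.
  by rewrite ler_expR ler_piMl// (le_trans s1).
by rewrite lerD2l ler_piMl// (le_trans s1).
Qed.

(** Largest norm after one flow segment, one perturbation and one jump started below [r]. The
    clipping level [beta] bounds the jump whatever its noise, which makes the estimate uniform in
    the noises. *)
Definition jump_growth (r : R) : R := expR D * (r + A) + eps + beta.

Lemma jump_growth_ge r : 0 <= r -> r <= jump_growth r.
Proof.
move=> r0; rewrite /jump_growth -addrA ler_wpDr ?addr_ge0//.
apply: (@le_trans _ _ (r + A)); first by rewrite lerDl.
by rewrite ler_peMl ?addr_ge0// -expR0 ler_expR.
Qed.

Lemma jump_growth_le r s : r <= s -> jump_growth r <= jump_growth s.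
Proof. by move=> rs; rewrite /jump_growth !lerD2r ler_wpM2l ?expR_ge0// lerD2r. Qed.

Lemma iter_jump_growth_ge0 n r : 0 <= r -> 0 <= iter n jump_growth r.
Proof. by move=> r0; elim: n => //= n IH; exact: le_trans (jump_growth_ge IH). Qed.

Lemma iter_jump_growth_le n r s : r <= s -> iter n jump_growth r <= iter n jump_growth s.
Proof. by move=> rs; elim: n => //= n IH; exact: jump_growth_le. Qed.

Lemma iter_jump_growth_mono n p r : (n <= p)%N -> 0 <= r ->
  iter n jump_growth r <= iter p jump_growth r.
Proof.
move=> /subnKC <- r0; elim: (p - n)%N => [|q IH]; first by rewrite addn0.
by rewrite addnS iterS; apply: le_trans IH (jump_growth_ge _); exact: iter_jump_growth_ge0.
Qed.

Lemma jpath_growth s y l t : 0 <= s <= t -> t <= 1 -> path <%R s [seq p.1 | p <- l] ->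
  (forall p, p \in l -> enorm p.2.2 <= eps) ->
  enorm (jpath a sigma beta%:E s y l t) <= iter (size l).+1 jump_growth (enorm y).
Proof.
elim: l s y => [|[t1 [w v]] l IH] s y /= /andP[s0 st] t1' pl vl.
  have ts : 0 <= t - s <= 1 by lra.
  apply: (le_trans (flow_growth _ ts)).
  by rewrite /jump_growth -addrA lerDl addr_ge0.
have [s1 pl'] := andP pl.
case: ifPn => [tt1|]; last rewrite -leNgt => tt1.
  have ts : 0 <= t - s <= 1 by lra.
  apply: (le_trans (flow_growth _ ts)).
  apply: (@le_trans _ _ (jump_growth (enorm y))).
    by rewrite /jump_growth -addrA lerDl addr_ge0.
  by apply: (@iter_jump_growth_mono 1 (size l).+2); rewrite ?enorm_ge0.
have t1s : 0 <= t1 - s <= 1 by lra.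
have ht1 : 0 <= t1 <= t by lra.
apply: (le_trans (IH t1 _ ht1 t1' pl' _)).
  by move=> p pl0; apply: vl; rewrite inE pl0 orbT.
rewrite -[X in _ <= X]/(iter (size l).+2 jump_growth (enorm y)) [X in _ <= X]iterSr.
apply: iter_jump_growth_le; rewrite /jump.
apply: (le_trans (enormD _ _)); rewrite lerD ?enorm_clip_bound//.
apply: (le_trans (enormD _ _)); rewrite lerD ?flow_growth//.
by apply: (vl (t1, (w, v))); rewrite mem_head.
Qed.

Lemma hbar_growth k x (W : k.-tuple 'cV[R]_d) (U : k.-tuple 'cV[R]_m) (t : k.-tuple R) u :
  increasing_tuples `]0, 1]%classic k t -> (forall j, enorm (tnth U j) <= eps) ->
  u \in `[0, 1] ->
  enorm (hbar a sigma beta%:E x W U t u) <= iter k.+1 jump_growth (enorm x).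
Proof.
move=> ti Ue u01; rewrite (hbarE sigma _ D0 aD C0 aC x W U ti u01).
have [p1 _] := increasing_path ti.
have sz : size (jdata W U t) = k by rewrite -(size_map fst) times_jdata size_tuple.
have /andP[u0 u1] : 0 <= u <= 1 by move: u01; rewrite in_itv.
have := @jpath_growth 0 x (jdata W U t) u; rewrite sz times_jdata lexx u0 => /(_ isT u1 p1).
by move=> H; apply: H => p /mem_jdata[j ->]; exact: Ue.
Qed.

End path_growth.

Section clamping.
Context {R : realDomainType}.

Definition clamp01 (u : R) : R := Num.min 1 (Num.max 0 u).

Lemma clamp01_itv u : 0 <= clamp01 u <= 1.
Proof. by rewrite /clamp01 ge_min lexx andbT le_min ler01 le_max lexx. Qed.

Lemma clamp01_le0 u : u <= 0 -> clamp01 u = 0.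
Proof. by move=> h; rewrite /clamp01 max_l// min_r. Qed.

Lemma clamp01_ge1 u : 1 <= u -> clamp01 u = 1.
Proof. by move=> h; rewrite /clamp01 min_l// le_max h orbT. Qed.

Lemma clamp01_id u : 0 <= u <= 1 -> clamp01 u = u.
Proof. by move=> /andP[h1 h2]; rewrite /clamp01 max_r// min_r. Qed.

Lemma clamp01_lip u v : `|clamp01 u - clamp01 v| <= `|u - v|.
Proof.
wlog uv : u v / u <= v.
  by move=> H; have [/H//|/ltW/H] := leP u v; rewrite distrC [`|v - u|]distrC.
have -> : `|u - v| = v - u by rewrite distrC ger0_norm ?subr_ge0.
rewrite distrC.
have [u0|u0] := leP u 0.
  rewrite (clamp01_le0 u0) subr0 ger0_norm; last by have /andP[] := clamp01_itv v.
  rewrite /clamp01 ge_min ge_max; apply/orP; right; apply/andP; split; lra.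
have [v1|v1] := leP 1 v; last by rewrite !clamp01_id ?ger0_norm ?subr_ge0//; lra.
rewrite (clamp01_ge1 v1); have [u1|u1] := leP 1 u.
  by rewrite (clamp01_ge1 u1) subrr normr0 subr_ge0.
by rewrite clamp01_id ?ger0_norm ?subr_ge0//; lra.
Qed.

End clamping.

Section sup_norm.
Context {R : realType} {m : nat}.
Implicit Types xi y : skorokhod R m.

Definition zero_path : skorokhod R m := Skorokhod (@cadlag01_cst0 R m).

(** Time changes do not affect the zero path, so the distance to it is the supremum norm, which
    thereby becomes a Lipschitz function on path space. *)
Lemma enorm_le_J1_dist xi u : u \in `[0, 1] -> enorm (xi u) <= J1_dist xi zero_path.
Proof.
move=> u01; apply/ler_addgt0Pl => e e0.
have /J1_distP[e' [l _ /(_ u u01)[_]]] : J1_dist xi zero_path < J1_dist xi zero_path + e by rewrite ltrDl.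
by rewrite /= subr0 => h1 h2; rewrite addrC (le_trans h1)// ltW.
Qed.

Lemma J1_dist_zero_le xi r : (forall u, u \in `[0, 1] -> enorm (xi u) <= r) ->
  J1_dist xi zero_path <= r.
Proof. by move=> H; apply: J1_dist_sup => u u01; rewrite /= subr0; exact: H. Qed.

Lemma J1_lipschitz_continuous (f : skorokhod R m -> R) (K : R) : 0 < K ->
  (forall xi y, `|f xi - f y| <= K * J1_dist xi y) -> continuous f.
Proof.
move=> K0 fK xi; apply/(@cvgrPdist_lt _ _ _ (nbhs xi)) => e e0; apply/nbhs_ballP.
exists (e / K); first exact: divr_gt0.
move=> y; rewrite /ball /= => xy; apply: le_lt_trans (fK _ _) _.
by rewrite mulrC -ltr_pdivlMr.
Qed.

Lemma J1_dist_lip xi y z : `|J1_dist xi z - J1_dist y z| <= J1_dist xi y.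
Proof.
have := J1_dist_triangle y xi z; have := J1_dist_triangle xi y z.
by rewrite [J1_dist y xi]J1_dist_sym ler_norml; lra.
Qed.

Definition exit_cutoff (r : R) xi : R := clamp01 (J1_dist xi zero_path - (r - 1)).

Lemma exit_cutoff01 r xi : 0 <= exit_cutoff r xi <= 1.
Proof. exact: clamp01_itv. Qed.

Lemma exit_cutoff_continuous r : continuous (exit_cutoff r).
Proof.
apply: (@J1_lipschitz_continuous _ 1) => // xi y; rewrite mul1r.
apply: le_trans (J1_dist_lip xi y zero_path).
apply: le_trans (clamp01_lip _ _) _.
rewrite (_ : _ - _ - _ = J1_dist xi zero_path - J1_dist y zero_path)//; ring.
Qed.

Lemma exit_cutoff0 r xi : J1_dist xi zero_path <= r - 1 -> exit_cutoff r xi = 0.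
Proof. by move=> h; rewrite /exit_cutoff clamp01_le0// subr_le0. Qed.

Lemma exit_cutoff1 r xi : r <= J1_dist xi zero_path -> exit_cutoff r xi = 1.
Proof. by move=> h; rewrite /exit_cutoff clamp01_ge1//; lra. Qed.

End sup_norm.

Section truncated_coefficients.
Context {R : realType} {m d : nat}.
Variables (a : 'cV[R]_m -> 'cV[R]_m) (sigma : 'cV[R]_m -> 'M[R]_(m, d.+1)).
Variables (beta D : R).
Hypothesis beta0 : 0 < beta.
Hypothesis D0 : 0 <= D.
Hypothesis aD : forall x y, enorm (a x - a y) <= D * enorm (x - y).
Hypothesis sD : forall x y, opnorm (sigma x - sigma y) <= D * enorm (x - y).
Local Notation V := 'cV[R]_d.+1.
Variable r : R.
Hypothesis r0 : 0 < r.

(** Composition with the projection on a ball, rather than multiplication by a cutoff, keeps the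
    Lipschitz constant [D], because [clip] is nonexpansive. *)
Definition ta (y : 'cV[R]_m) : 'cV[R]_m := a (clip r%:E y).
Definition tsigma (y : 'cV[R]_m) : 'M[R]_(m, d.+1) := sigma (clip r%:E y).
Definition tbound : R := enorm (a 0) + opnorm (sigma 0) + D * r.

Lemma tbound_ge0 : 0 <= tbound.
Proof. by rewrite /tbound !addr_ge0 ?enorm_ge0 ?opnorm_ge0// mulr_ge0// ltW. Qed.

Lemma ta_in y : enorm y <= r -> ta y = a y.
Proof. by move=> yr; rewrite /ta clip_small// lee_fin. Qed.

Lemma tsigma_in y : enorm y <= r -> tsigma y = sigma y.
Proof. by move=> yr; rewrite /tsigma clip_small// lee_fin. Qed.

Let clipD (y y' : 'cV[R]_m) : D * enorm (clip r%:E y - clip r%:E y') <= D * enorm (y - y').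
Proof. by rewrite ler_wpM2l// clip_lip// lte_fin. Qed.

Lemma taD y y' : enorm (ta y - ta y') <= D * enorm (y - y').
Proof. exact: le_trans (aD _ _) (clipD y y'). Qed.

Lemma tsigmaD y y' : opnorm (tsigma y - tsigma y') <= D * enorm (y - y').
Proof. exact: le_trans (sD _ _) (clipD y y'). Qed.

Let clip_in (y : 'cV[R]_m) : D * enorm (clip r%:E y) <= D * r.
Proof. by rewrite ler_wpM2l// enorm_clip_bound// ltW. Qed.

Lemma taC y : enorm (ta y) <= tbound.
Proof.
have := enormD (ta y - a 0) (a 0); rewrite subrK.
have := aD (clip r%:E y) 0; rewrite -/(ta y) subr0.
by have := clip_in y; have := opnorm_ge0 (sigma 0); rewrite /tbound; lra.
Qed.

Lemma tsigmaC y : opnorm (tsigma y) <= tbound.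
Proof.
apply: opnorm_le => w w1.
have h1 : enorm (tsigma y *m w) <= enorm ((tsigma y - sigma 0) *m w) + enorm (sigma 0 *m w).
  by have := enormD ((tsigma y - sigma 0) *m w) (sigma 0 *m w); rewrite -mulmxDl subrK.
apply: (le_trans h1).
have h2 : enorm ((tsigma y - sigma 0) *m w) <= D * r.
  apply: (le_trans (enorm_mulmx _ _)); apply: (le_trans _ (clip_in y)).
  have := sD (clip r%:E y) 0; rewrite -/(tsigma y) subr0; apply: le_trans.
  by rewrite ler_piMr ?opnorm_ge0.
have h3 : enorm (sigma 0 *m w) <= opnorm (sigma 0).
  by apply: (le_trans (enorm_mulmx _ _)); rewrite ler_piMr ?opnorm_ge0.
by have := enorm_ge0 (a 0); rewrite /tbound; lra.
Qed.

Lemma ta0 : ta 0 = a 0.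
Proof. by rewrite ta_in// enorm0 ltW. Qed.

Section paths.
Variables (k : nat) (x : 'cV[R]_m).
Local Notation G := (jump_growth beta D (enorm (a 0)) 1).
Hypothesis rk : iter k.+1 G (enorm x) + 2 <= r.

Let hbar_bound j (W : j.-tuple V) (U : j.-tuple 'cV[R]_m) (t : j.-tuple R) u : (j <= k)%N ->
  increasing_tuples `]0, 1]%classic j t -> (forall i, enorm (tnth U i) <= 1) ->
  u \in `[0, 1] -> enorm (hbar ta tsigma beta%:E x W U t u) <= r - 2.
Proof.
move=> jk ti U1 u01.
have A1 : enorm (ta 0) <= enorm (a 0) by rewrite ta0.
apply: (le_trans (hbar_growth tsigma (ltW beta0) tbound_ge0 D0 taC taD A1 ler01 _ W ti U1 u01)).
apply: (@le_trans _ _ (iter k.+1 G (enorm x))); last by rewrite lerBrDr.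
by apply: iter_jump_growth_mono; rewrite ?enorm_ge0// ltW.
Qed.

Lemma hbar_truncated j (W : j.-tuple V) (U : j.-tuple 'cV[R]_m) (t : j.-tuple R) : (j <= k)%N ->
  increasing_tuples `]0, 1]%classic j t -> (forall i, enorm (tnth U i) <= 1) ->
  hbar a sigma beta%:E x W U t = hbar ta tsigma beta%:E x W U t.
Proof.
move=> jk ti U1; apply: (hbar_agree D0 tbound_ge0 aD taD taC ti).
  move=> u u01; rewrite ta_in//.
  by have := hbar_bound W jk ti U1 u01; lra.
(* Before the jump the path is below [r - 2]; the margin 2 is spent on the passage to the left limit
   and on the perturbation, 1 for each. *)
move=> i /=; rewrite tsigma_in//; apply: (le_trans (enormD _ _)).
set xi := hbar _ _ _ _ _ _ _.
have tj : tnth t i \in `]0, 1] by have [_ H] := ti; exact: H (mem_tnth i t).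
have ll : llim xi (tnth t i) (left_limit xi (tnth t i)).
  by apply/llimP; have [_ xl _] := skorokhod_cadlag xi; exact: xl.
have [e e0 He] := ll _ ltr01.
move: tj; rewrite in_itv/= => /andP[tj0 tj1].
pose q := Num.min e (tnth t i) / 2.
have m0 : 0 < Num.min e (tnth t i) by rewrite lt_min e0.
have q1 : Num.min e (tnth t i) <= e by rewrite ge_min lexx.
have q2 : Num.min e (tnth t i) <= tnth t i by rewrite ge_min lexx orbT.
have h1 : enorm (xi (tnth t i - q) - left_limit xi (tnth t i)) < 1.
  by apply: He; rewrite /q; lra.
have h2 : enorm (xi (tnth t i - q)) <= r - 2.
  by apply: hbar_bound => //; rewrite in_itv/= /q; lra.
have := enormBD (xi (tnth t i - q)) (left_limit xi (tnth t i)) 0.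
by rewrite !subr0 enormB; have := U1 i; lra.
Qed.

Let U0 j : forall i, enorm (tnth [tuple of nseq j (0 : 'cV[R]_m)] i) <= 1.
Proof. by move=> i; rewrite (tnth_nth 0) /= nth_nseq if_same enorm0 ler01. Qed.

Lemma h_truncated (W : k.-tuple V) (t : k.-tuple R) : increasing_tuples `]0, 1]%classic k t ->
  h a sigma beta%:E x W t = h ta tsigma beta%:E x W t.
Proof. by move=> ti; apply: hbar_truncated. Qed.

Lemma h_truncated_bound (W : k.-tuple V) (t : k.-tuple R) : increasing_tuples `]0, 1]%classic k t ->
  J1_dist (h ta tsigma beta%:E x W t) zero_path <= r - 2.
Proof. by move=> ti; apply: J1_dist_zero_le => u u01; apply: hbar_bound. Qed.

Lemma truncated_perturbed_paths eps xi : eps <= 1 ->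
  perturbed_paths_pred ta tsigma beta%:E [set x] k eps xi ->
  perturbed_paths_pred a sigma beta%:E [set x] k eps xi /\ J1_dist xi zero_path <= r - 2.
Proof.
move=> e1; rewrite /perturbed_paths_pred; case: k rk hbar_bound hbar_truncated => // j _ hb ht.
move=> [_ [W [U [t [/= -> Ue ti ->]]]]].
have U1 i : enorm (tnth U i) <= 1 by exact: le_trans (Ue i) e1.
split; last by apply: J1_dist_zero_le => u u01; apply: hb.
by exists x, W, U, t; rewrite ht.
Qed.

Lemma X_iter_truncated eta z n :
  (forall i, (i < n)%N -> enorm (X_iter ta tsigma eta beta%:E x z i) <= r) ->
  X_iter a sigma eta beta%:E x z n = X_iter ta tsigma eta beta%:E x z n.
Proof.
elim: n => //= n IH H; rewrite IH; last by move=> i /ltnW; exact: H.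
by rewrite ta_in ?tsigma_in// H.
Qed.

(** The two chains agree until the truncated one leaves the ball, and leaving it sets the cutoff to
    1. *)
Lemma X_path_truncated eta z : 0 < eta ->
  X_path a sigma eta beta%:E x z = X_path ta tsigma eta beta%:E x z \/
  exit_cutoff r (X_path ta tsigma eta beta%:E x z) = 1.
Proof.
move=> e0; have [far|near] := leP r (J1_dist (X_path ta tsigma eta beta%:E x z) zero_path).
  by right; exact: exit_cutoff1.
left; apply: skorokhod_ext => u u01; rewrite /= /step_path u01.
move: u01; rewrite in_itv/= => /andP[u0 u1].
apply: X_iter_truncated => i iu.
have ie : eta * i%:R \in `[0, 1].
  rewrite in_itv/= mulr_ge0 ?(ltW e0)//=; apply: le_trans u1.
  rewrite mulrC -ler_pdivlMr// -truncn_ge_nat ?divr_ge0 ?(ltW e0)//.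
  exact: ltnW.
apply: le_trans (ltW near); have := enorm_le_J1_dist (X_path ta tsigma eta beta%:E x z) ie.
have -> // : X_path ta tsigma eta beta%:E x z (eta * i%:R) = X_iter ta tsigma eta beta%:E x z i.
by rewrite /= /step_path ie [eta * _]mulrC mulfK ?gt_eqF// natrK.
Qed.

End paths.
End truncated_coefficients.

Section clipped_jumps.
Context {R : realType} {m d : nat}.
Variables (a : 'cV[R]_m -> 'cV[R]_m) (sigma : 'cV[R]_m -> 'M[R]_(m, d.+1)).
Variables (beta D : R).
Hypothesis beta0 : 0 < beta.
Hypothesis D0 : 0 <= D.
Hypothesis aD : forall x y, enorm (a x - a y) <= D * enorm (x - y).
Hypothesis sD : forall x y, opnorm (sigma x - sigma y) <= D * enorm (x - y).
Local Notation V := 'cV[R]_d.+1.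
Context {disp : measure_display} {Omega : measurableType disp}.
Variable P : probability Omega R.
Variable Z : nat -> Omega -> V.
Hypothesis mZ : forall n, measurable_fun setT (Z n).
Hypothesis iidZ : iid P Z.
Hypothesis meanZ : mean_zero P (Z 0%N).
Variable alpha : R.
Hypothesis alpha1 : 1 < alpha.
Hypothesis RV : forall t : R, 0 < t ->
  (tail P (Z 0%N) (t * x) / tail P (Z 0%N) x)%E @[x --> +oo] --> (t `^ (- alpha))%:E.
Local Notation H := (rtail P (Z 0%N)).
Local Notation rate := (rate P (Z 0%N)).
Variable mu : {sigma_finite_measure set V -> \bar R}.
Hypothesis vag : forall eta_ : nat -> R, (forall l, 0 < eta_ l) -> eta_ l @[l --> \oo] --> 0 ->
  vague_cvg \oo (fun l => (H (eta_ l)^-1)^-1) (fun l => nlaw P mZ (eta_ l)) mu.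
Variables (k : nat) (x : 'cV[R]_m).
Local Notation Inc := (increasing_tuples (R := R) `]0, 1[%classic k).

(** The iterate bounds all paths with at most [k] jumps and unit perturbations; the margin 2 leaves
    room for left limits, perturbations and the cutoff of the norm. *)
Let r : R := iter k.+1 (jump_growth beta D (enorm (a 0)) 1) (enorm x) + 2.

Let r0 : 0 < r.
Proof.
rewrite ltr_wpDl//.
exact: (iter_jump_growth_ge0 (ltW beta0) D0 (lexx (enorm (a 0))) ler01 _ (enorm_ge0 _)).
Qed.

Let rk : iter k.+1 (jump_growth beta D (enorm (a 0)) 1) (enorm x) + 2 <= r.
Proof. exact: lexx. Qed.

Local Notation ta := (ta a r).
Local Notation tsigma := (tsigma sigma r).
Local Notation C := (tbound a sigma D r).
Let b0 : (0 < beta%:E)%E. Proof. by rewrite lte_fin. Qed.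
Let C0 : 0 <= C := tbound_ge0 a sigma D0 r0.
Let aC' := taC sigma D0 aD r0.
Let aD' := taD D0 aD r0.
Let sC' := tsigmaC a D0 sD r0.
Let sD' := tsigmaD D0 sD r0.

Lemma truncated_expectation_cvg (g : skorokhod R m -> R) (M eps0 r1 : R) :
  0 < eps0 -> 0 < r1 -> continuous g -> (forall xi, 0 <= g xi <= M) ->
  support_away ta tsigma beta%:E k x g eps0 r1 ->
  rate eta ^+ k * rint P (fun w => g (X_path ta tsigma eta beta%:E x (Z ^~ w))) @[eta --> (0 : R)^'+] -->
  rint (tmeas (@leb R) k) (fun t => \1_Inc t *
    rint (tmeas mu k) (fun W : k.-tuple V => g (h a sigma beta%:E x W t))).
Proof.
move=> e0 r10 cg gM supp.
rewrite (_ : (fun t => _) = fun t => \1_Inc t *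
    rint (tmeas mu k) (fun W : k.-tuple V => g (h ta tsigma beta%:E x W t))).
  exact: (expectation_cvg b0 C0 D0 aC' aD' sC' sD' iidZ meanZ alpha1 RV vag e0 r10 cg gM supp).
apply/funext => t; rewrite indicE; have [|_] := boolP (t \in Inc); last exact: etrans (mul0r _) (esym (mul0r _)).
rewrite inE => /subset_Inc1 ti; congr (_ * rint _ _); apply/funext => W.
by rewrite (h_truncated sigma beta0 D0 aD r0 rk).
Qed.

(* The growth bound of jump paths does not depend on [r], so the limit paths stay
   away from the sphere of radius [r] and the limit vanishes. *)
Lemma exit_expectation_cvg0 :
  rate eta ^+ k * rint P (fun w => exit_cutoff r (X_path ta tsigma eta beta%:E x (Z ^~ w)))
    @[eta --> (0 : R)^'+] --> 0.
Proof.
have := @truncated_expectation_cvg (exit_cutoff r) 1 1 1 ltr01 ltr01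
  (@exit_cutoff_continuous R m r) (exit_cutoff01 r) _.
rewrite (_ : rint (tmeas leb k) _ = 0).
  apply=> xi xip y yxi; apply: exit_cutoff0.
  have [_ xi0] := truncated_perturbed_paths beta0 D0 aD r0 rk (lexx 1) xip.
  by have := J1_dist_triangle xi y zero_path; lra.
rewrite /rint (eq_integral (fun=> 0%E)) ?integral0// => t _.
rewrite indicE; have [|_] := boolP (t \in Inc); last by rewrite mul0r.
rewrite inE => /subset_Inc1 ti; rewrite mul1r (eq_integral (fun=> 0%E)) ?integral0// => W _.
rewrite (h_truncated sigma beta0 D0 aD r0 rk)// exit_cutoff0//.
by have := h_truncated_bound sigma beta0 D0 aD r0 rk W ti; lra.
Qed.

Lemma truncated_support (g : skorokhod R m -> R) (eps0 r1 : R) :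
  support_away a sigma beta%:E k x g eps0 r1 ->
  support_away ta tsigma beta%:E k x g (Num.min eps0 1) r1.
Proof.
move=> supp xi xip; apply: supp; have m1 : Num.min eps0 1 <= 1 by rewrite ge_min lexx orbT.
have [xip' _] := truncated_perturbed_paths beta0 D0 aD r0 rk m1 xip.
move: xip'; rewrite /perturbed_paths_pred; case: (k) => // j [y [W [U [t [yx Ue ti ->]]]]].
exists y, W, U, t; split=> // i; apply: (le_trans (Ue i)).
by rewrite ge_min lexx.
Qed.

Lemma clipped_small_noise_vanish (g : skorokhod R m -> R) (eps0 r1 : R) :
  0 < eps0 -> 0 < r1 -> support_away a sigma beta%:E k x g eps0 r1 ->
  exists2 delta : R, 0 < delta & forall (W : k.-tuple V) t, Inc t ->
    (exists j, enorm (tnth W j) <= delta) -> g (h a sigma beta%:E x W t) = 0.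
Proof.
move=> e0 r10 supp; have e1 : 0 < Num.min eps0 1 by rewrite lt_min e0 ltr01.
have [delta delta0 H] := small_noise_vanish b0 C0 D0 aC' aD' sC' e1 r10 (truncated_support supp).
exists delta => // W t ti Wj; rewrite (h_truncated sigma beta0 D0 aD r0 rk); last exact: subset_Inc1.
exact: H.
Qed.

Lemma measurable_clipped_h :
  measurable_fun ([set: k.-tuple V] `*` Inc) (fun p => h a sigma beta%:E x p.1 p.2).
Proof.
apply: (eq_measurable_fun (fun p => h ta tsigma beta%:E x p.1 p.2)).
  move=> p; rewrite inE => -[_ /subset_Inc1 ti].
  by rewrite (h_truncated sigma beta0 D0 aD r0 rk).
exact: (measurable_h b0 C0 D0 aC' aD' sC' sD').
Qed.

(** The original and the truncated path differ only where the exit cutoff equals 1, so the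
    expectations differ by at most [M] times that of the cutoff, which is negligible after
    normalization. *)
Lemma clipped_expectation_cvg (g : skorokhod R m -> R) (M eps0 r1 : R) :
  0 < eps0 -> 0 < r1 -> continuous g -> (forall xi, 0 <= g xi <= M) ->
  support_away a sigma beta%:E k x g eps0 r1 ->
  rate eta ^+ k * rint P (fun w => g (X_path a sigma eta beta%:E x (Z ^~ w))) @[eta --> (0 : R)^'+] -->
  rint (tmeas (@leb R) k) (fun t => \1_Inc t *
    rint (tmeas mu k) (fun W : k.-tuple V => g (h a sigma beta%:E x W t))).
Proof.
move=> e0 r10 cg gM supp.
have M0 : 0 <= M by have /andP[/le_trans] := gM zero_path; apply.
have e1 : 0 < Num.min eps0 1 by rewrite lt_min e0 ltr01.
have supp' := truncated_support supp.
have cv1 := truncated_expectation_cvg e1 r10 cg gM supp'.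
apply/cvgrPdist_le => e ee0; have e20 : 0 < e / 2 by rewrite divr_gt0.
have eM0 : 0 < e / 2 / (M + 1) by rewrite divr_gt0// ltr_wpDl.
have /cvgrPdist_le/(_ _ e20) near1 := cv1.
have /cvgrPdist_le/(_ _ eM0) near2 := exit_expectation_cvg0.
near=> eta; have t0 : 0 < eta by near: eta; exact: nbhs_right_gt.
have PT : (P setT < +oo)%E by rewrite probability_setT ltry.
have ra0 : 0 <= rate eta ^+ k by rewrite exprn_ge0// ltW// (rate_gt0 (mZ 0%N) alpha1 RV).
have bX : bounded_meas (fun w => g (X_path a sigma eta beta%:E x (Z ^~ w))).
  split; last by exists M => w.
  by apply: measurableT_comp; [exact: measurable_g|exact: (measurable_X_path b0 D0 aD sD)].
have bX' : bounded_meas (fun w => g (X_path ta tsigma eta beta%:E x (Z ^~ w))).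
  split; last by exists M => w.
  by apply: measurableT_comp; [exact: measurable_g|exact: (measurable_X_path b0 D0 aD' sD')].
have bE : bounded_meas (fun w => exit_cutoff r (X_path ta tsigma eta beta%:E x (Z ^~ w))).
  split; last by exists 1 => w; exact: exit_cutoff01.
  apply: measurableT_comp; last exact: (measurable_X_path b0 D0 aD' sD').
  by apply: measurable_g; exact: exit_cutoff_continuous.
have [bM eM] := bounded_measZ PT M0 bE.
have h0 : `|rint P (fun w => g (X_path a sigma eta beta%:E x (Z ^~ w))) -
    rint P (fun w => g (X_path ta tsigma eta beta%:E x (Z ^~ w)))| <=
    M * rint P (fun w => exit_cutoff r (X_path ta tsigma eta beta%:E x (Z ^~ w))).
  rewrite -eM; apply: rint_dist_le => // w.
  have [->|->] := X_path_truncated a sigma beta r x (Z ^~ w) t0.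
    by rewrite subrr normr0 mulr_ge0//; have /andP[] := exit_cutoff01 r (X_path ta tsigma eta beta%:E x (Z ^~ w)).
  rewrite mulr1 ler_norml; have /andP[p1 p2] := gM (X_path a sigma eta beta%:E x (Z ^~ w)).
  by have /andP[p3 p4] := gM (X_path ta tsigma eta beta%:E x (Z ^~ w)); lra.
have h2 : `|0 - rate eta ^+ k * rint P (fun w => exit_cutoff r (X_path ta tsigma eta beta%:E x (Z ^~ w)))|
   <= e / 2 / (M + 1) by near: eta.
have h1 : `|rint (tmeas (@leb R) k) (fun t => \1_Inc t *
    rint (tmeas mu k) (fun W : k.-tuple V => g (h a sigma beta%:E x W t))) -
   rate eta ^+ k * rint P (fun w => g (X_path ta tsigma eta beta%:E x (Z ^~ w)))| <= e / 2 by near: eta.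
rewrite sub0r normrN ger0_norm in h2; last first.
  by rewrite mulr_ge0// (rint_ge0 P)// => w; have /andP[] := exit_cutoff01 r (X_path ta tsigma eta beta%:E x (Z ^~ w)).
move: h0 h1 h2 ra0; set I1 := rint P _; set I2 := rint P _; set I3 := rint P _.
move: I1 I2 I3 (rint _ _) (rate eta ^+ k) => I1 I2 I3 L u h0 h1 h2 u0.
apply: (le_trans (ler_distD (u * I2) _ _)); rewrite [e]splitr; apply: lerD => //.
rewrite -mulrBr normrM ger0_norm// distrC.
apply: (le_trans (ler_wpM2l u0 h0)); rewrite mulrCA.
by apply: le_trans (mul_divS_le M0 (ltW e20)); rewrite ler_wpM2l.
Unshelve. all: by end_near. Qed.

End clipped_jumps.

(** * Conditional laws *)

Section concentrated_measures.
Context {disp} {T : measurableType disp} {R : realType}.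
Implicit Types (m : {measure set T -> \bar R}) (D : set T) (f : T -> \bar R).
Import HBNNSimple.

(* [f] need not be measurable outside [D] *)
Lemma integral_concentrated m D f : measurable D -> m (~` D) = 0%E ->
  (forall x, (0 <= f x)%E) -> (\int[m]_x f x = \int[m]_(x in D) f x)%E.
Proof.
move=> mD mD0 f0; rewrite ge0_integralTE// ge0_integralE//.
apply/eqP; rewrite eq_le; apply/andP; split; apply: ge_ereal_sup => _ [g gf <-].
  rewrite (_ : sintegral m g = sintegral m (proj_nnsfun g mD)).
    apply: ereal_sup_ubound; exists (proj_nnsfun g mD) => // x.
    rewrite -mrestrict !patchE; case: ifPn => // _; exact: gf.
  rewrite -!integralT_nnsfun.
  rewrite (@ge0_negligible_integral _ _ _ m setT (~` D))//; [|exact: measurableC|exact/measurable_EFinP|by move=> x _; rewrite lee_fin].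
  rewrite setTD setCK integral_mkcond; apply: eq_integral => x _.
  by rewrite -mrestrict !patchE; case: ifPn.
apply: ereal_sup_ubound; exists g => // x.
apply: (le_trans (gf x)); rewrite patchE; case: ifPn => // _; exact: f0.
Qed.

Lemma integral_mrestr m D (mD : measurable D) f : (forall x, (0 <= f x)%E) ->
  (\int[mrestr m mD]_x f x = \int[m]_(x in D) f x)%E.
Proof.
move=> f0; rewrite (integral_concentrated mD)//; last first.
  by transitivity (m (~` D `&` D)) => //; rewrite setICl measure0.
apply: eq_measure_integral => A mA AD.
by transitivity (m (A `&` D)) => //; rewrite setIidl.
Qed.

Lemma restricted_image_exists {disp'} {T' : measurableType disp'} m D (q : T -> T') :
  measurable D -> measurable_fun D q -> exists N : {measure set T' -> \bar R},
  (forall A, measurable A -> N A = m (D `&` q @^-1` A)) /\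
  (forall f : T' -> \bar R, measurable_fun setT f -> (forall y, (0 <= f y)%E) ->
    (\int[N]_y f y = \int[m]_(p in D) f (q p))%E).
Proof.
move=> mD mq; pose h0 := q \_ D.
have mh0 : measurable_fun setT h0 by apply/(measurable_restrictT _ mD).
have h0E p : D p -> h0 p = q p by move=> Dp; rewrite /h0 patchE mem_set.
exists (measure_function_pushforward__canonical__measure_function_Measure (mrestr m mD) mh0).
split=> [A mA|f mf f0].
  transitivity (m (h0 @^-1` A `&` D)) => //; congr (m _).
  by apply/seteqP; split => p [] /=; [move=> + Dp; rewrite h0E|move=> Dp; rewrite -h0E].
transitivity (\int[pushforward (mrestr m mD) h0]_y f y)%E => //.
rewrite (ge0_integral_pushforward mh0)//.
rewrite preimage_setT integral_mrestr; last by move=> p /=.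
by apply: eq_integral => p; rewrite inE => Dp /=; rewrite h0E.
Qed.

(** [f] may change sign: adding its bound [M] allows integrals of nonnegative functions, and the
    shift is subtracted exactly because the normalized measure has mass 1. *)
Lemma normalized_integral (Q : {measure set T -> \bar R}) (q : set T -> \bar R) (B : set T)
    (f : T -> R) (M : R) : measurable B -> (0 < Q B)%E -> (Q B < +oo)%E ->
  (forall A, measurable A -> q A = Q (A `&` B) / Q B)%E ->
  measurable_fun setT f -> (forall x, `|f x| <= M) ->
  (\int[q]_x (f x)%:E = (fine (\int[Q]_(x in B) (f x + M)%:E) / fine (Q B) - M)%:E)%E.
Proof.
move=> mB Q0 Qoo qE mf fM.
have Qfin : Q B \is a fin_num by rewrite ge0_fin_numE.
have c0 : 0 < fine (Q B) by apply: fine_gt0; rewrite Q0.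
have k0 : 0 <= (fine (Q B))^-1 by rewrite invr_ge0 ltW.
pose q' := mscale (NngNum k0) (mrestr Q mB).
have q'T : q' setT = 1%E.
  rewrite /q' /mscale /= /mrestr setTI -(fineK Qfin) -EFinM mulVf// gt_eqF//.
rewrite (eq_integral_set_fun (m2 := q')); last first.
  move=> A mA; rewrite qE// /q' /mscale /= /mrestr muleC.
  by rewrite -(fineK Qfin) inver gt_eqF.
have q'oo : (q' setT < +oo)%E by rewrite q'T ltry.
have M0 x : 0 <= f x + M by have := fM x; rewrite ler_norml; lra.
have fMM x : f x + M <= M + M by have := fM x; rewrite ler_norml; lra.
have mfM : measurable_fun setT (fun x => (f x + M)%:E).
  by apply/measurable_EFinP; apply: measurable_funD => //; exact: measurable_cst.
have i1 : q'.-integrable setT (fun x => (f x + M)%:E).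
  apply/integrableP; split=> //.
  under eq_integral do rewrite gee0_abs ?lee_fin//.
  apply: le_lt_trans (_ : (M + M)%:E * q' setT < +oo)%E; last by rewrite q'T mule1 ltry.
  rewrite -integral_cst//; apply: ge0_le_integral => //.
  by move=> x _; rewrite lee_fin.
  by move=> x _; rewrite /= lee_fin.
have i2 : q'.-integrable setT (cst M%:E).
  apply/integrableP; split; first exact: measurable_cst.
  rewrite (_ : (fun x => _) = cst `|M%:E|%E)// integral_cst// [X in (_ * X < _)%E]q'T mule1.
  exact: ltry.
have -> : (\int[q']_x (f x)%:E = \int[q']_x ((fun x => (f x + M)%:E) \- cst M%:E)%E x)%E.
  by apply: eq_integral => x _; rewrite /= -EFinB addrK.
rewrite integralB// integral_cst// [X in (_ - _ * X)%E]q'T mule1 EFinB; congr (_ - _)%E.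
rewrite ge0_integral_mscale//; last by move=> x _; rewrite lee_fin.
rewrite integral_mrestr; last by move=> x; rewrite lee_fin.
rewrite mulrC EFinM /= fineK//.
rewrite ge0_fin_numE; last by apply: integral_ge0 => x _; rewrite lee_fin.
apply: (@le_lt_trans _ _ (\int[Q]_(x in B) (M + M)%:E)%E).
  apply: ge0_le_integral => //.
  - by move=> x _; rewrite lee_fin.
  - exact: measurable_funTS.
  - by move=> x _; rewrite lee_fin.
have [->|/set0P[x _]] := eqVneq B set0; first by rewrite integral_set0 ltry.
rewrite integral_cst// lte_mul_pinfty//.
by rewrite lee_fin (le_trans (M0 x)).
Qed.

End concentrated_measures.

(** * Distance cutoffs and restricted expectations *)

Section set_distance.
Context {R : realType} {m : nat}.
Implicit Types (xi y : skorokhod R m) (A : set (skorokhod R m)).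

(* The 1 keeps the infimum over a nonempty set when [A] is empty. *)
Definition setdist A xi : R := inf ([set J1_dist xi y | y in A] `|` [set 1]).

Let has_inf_setdist A xi : has_inf ([set J1_dist xi y | y in A] `|` [set 1]).
Proof.
split; first by exists 1; right.
by exists 0 => _ [[y _ <-]|->]; [exact: J1_dist_ge0|exact: ler01].
Qed.

Lemma setdist_ge0 A xi : 0 <= setdist A xi.
Proof.
apply: lb_le_inf; first by have [] := has_inf_setdist A xi.
by move=> _ [[y _ <-]|->]; [exact: J1_dist_ge0|exact: ler01].
Qed.

Lemma setdist_le A xi y : A y -> setdist A xi <= J1_dist xi y.
Proof.
move=> Ay; apply: ge_inf; first by have [] := has_inf_setdist A xi.
by left; exists y.
Qed.

Lemma setdist_gt A xi e : e <= 1 -> (forall y, A y -> e <= J1_dist xi y) -> e <= setdist A xi.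
Proof.
move=> e1 H; apply: lb_le_inf; first by have [] := has_inf_setdist A xi.
by move=> _ [[y Ay <-]|->] //; exact: H.
Qed.

Lemma setdist_lip A xi y : `|setdist A xi - setdist A y| <= J1_dist xi y.
Proof.
have H z z' : setdist A z - J1_dist z z' <= setdist A z'.
  apply: lb_le_inf; first by have [] := has_inf_setdist A z'.
  move=> _ [[w Aw <-]|->].
    by rewrite lerBlDl (le_trans (setdist_le z Aw))// J1_dist_triangle.
  rewrite lerBlDr (@le_trans _ _ 1)//; last by rewrite lerDl J1_dist_ge0.
  by apply: ge_inf; [have [] := has_inf_setdist A z|right].
have := H xi y; have := H y xi; rewrite [J1_dist y xi]J1_dist_sym ler_norml; lra.
Qed.

Lemma setdist_in A xi : closure A xi -> setdist A xi = 0.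
Proof.
move=> cA; apply/eqP; rewrite eq_le setdist_ge0 andbT.
apply/ler_addgt0Pl => e e0; rewrite addr0.
have : nbhs xi [set y | J1_dist xi y < e] by apply/nbhs_ballP; exists e.
by move=> /cA[y [Ay /ltW]]; apply: le_trans; exact: setdist_le.
Qed.

Lemma setdist_out A xi : ~ closure A xi -> 0 < setdist A xi.
Proof.
move=> cA; have : nbhs xi (~` A).
  have := @open_nbhs_nbhs _ xi (~` closure A); have oc : open (~` closure A).
    exact/closed_openC/closed_closure.
  by move=> /(_ (conj oc cA)); apply: filterS => y; apply: subsetC; exact: subset_closure.
move=> /nbhs_ballP[e /= e0 He].
apply: (@lt_le_trans _ _ (Num.min e 1)); first by rewrite lt_min e0 ltr01.
apply: setdist_gt; first by rewrite ge_min lexx orbT.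
move=> y Ay; rewrite ge_min leNgt; apply/orP; left; apply/negP => xy.
exact: (He y xy).
Qed.

Definition outer_cutoff A (n : nat) xi : R := 1 - clamp01 (n%:R * setdist A xi).

Lemma scaled_setdist_lip A n xi y :
  `|clamp01 (n%:R * setdist A xi) - clamp01 (n%:R * setdist A y)| <= (n%:R + 1) * J1_dist xi y.
Proof.
apply: (le_trans (clamp01_lip _ _)); rewrite -mulrBr normrM ger0_norm//.
apply: (le_trans (ler_wpM2l (ler0n _ _) (setdist_lip A xi y))).
by rewrite ler_wpM2r ?J1_dist_ge0// lerDl.
Qed.

Lemma scaled_setdist_continuous A n : continuous (fun xi => clamp01 (n%:R * setdist A xi)).
Proof.
apply: (@J1_lipschitz_continuous _ _ _ (n%:R + 1)); first by rewrite ltr_wpDl.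
exact: scaled_setdist_lip.
Qed.

Lemma outer_cutoff_continuous A n : continuous (outer_cutoff A n).
Proof.
apply: (@J1_lipschitz_continuous _ _ _ (n%:R + 1)); first by rewrite ltr_wpDl.
move=> xi y; rewrite /outer_cutoff opprB addrC subrKA.
by rewrite distrC; exact: scaled_setdist_lip.
Qed.

Lemma outer_cutoff01 A n xi : 0 <= outer_cutoff A n xi <= 1.
Proof. by have := clamp01_itv (n%:R * setdist A xi); rewrite /outer_cutoff; lra. Qed.

Lemma outer_cutoff_closure A n xi : closure A xi -> outer_cutoff A n xi = 1.
Proof. by move=> cA; rewrite /outer_cutoff setdist_in// mulr0 clamp01_le0// subr0. Qed.

Lemma outer_cutoff_far A n xi : 1 <= n%:R * setdist A xi -> outer_cutoff A n xi = 0.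
Proof. by move=> h1; rewrite /outer_cutoff clamp01_ge1// subrr. Qed.

Lemma scaled_setdist_near A xi : ~ closure A xi ->
  \forall n \near \oo, clamp01 (n%:R * setdist A xi) = 1.
Proof.
move=> /setdist_out s0; exists (Num.truncn (setdist A xi)^-1).+1 => // n /= nN.
apply: clamp01_ge1; rewrite mulrC -ler_pdivrMl// mulr1.
apply: le_trans (ltW (truncnS_gt _)) _; by rewrite ler_nat.
Qed.

Lemma outer_cutoff_cvg A xi : outer_cutoff A n xi @[n --> \oo] --> (\1_(closure A) xi : R).
Proof.
rewrite indicE; have [|] := boolP (xi \in closure A); rewrite ?inE => cA.
  rewrite (_ : (fun n => _) = cst 1); first exact: cvg_cst.
  by apply/funext => n; rewrite outer_cutoff_closure.
apply: cvg_near_cst; move/negP : cA; rewrite inE => /scaled_setdist_near.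
by apply: filterS => n h; rewrite /outer_cutoff h subrr.
Qed.

Lemma inner_cutoff_cvg A xi : clamp01 (n%:R * setdist (~` A) xi) @[n --> \oo] --> (\1_(A° : set (skorokhod R m)) xi : R).
Proof.
have cE : closure (~` A) = ~` A° by rewrite closure_setC.
rewrite indicE; have [|] := boolP (xi \in (A° : set (skorokhod R m))); rewrite ?inE => iA.
  by apply: cvg_near_cst; apply: scaled_setdist_near; rewrite cE => /(_ iA).
rewrite (_ : (fun n => _) = cst 0); first exact: cvg_cst.
apply/funext => n; rewrite setdist_in ?mulr0 ?clamp01_le0//.
by rewrite cE => ?; move/negP : iA; apply; rewrite inE.
Qed.

End set_distance.

Section conditional_limits.
Context {R : realType} {m : nat} {disp : measure_display} {Omega : measurableType disp}.
Local Notation S := (skorokhod R m).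
Variable P : probability Omega R.
Variables (X : R -> Omega -> S) (s : R -> R).
Hypothesis mX : forall eta, 0 < eta -> measurable_fun setT (X eta).
Hypothesis s_gt0 : forall eta, 0 < eta -> 0 < s eta.
Variables (N : {measure set S -> \bar R}) (E : set S).
Hypothesis conv : forall (g : S -> R) (M r : R), 0 < r -> continuous g ->
  (forall xi, 0 <= g xi <= M) ->
  (forall xi, E xi -> forall y, J1_dist y xi <= r -> g y = 0) ->
  (\int[N]_y (g y)%:E < +oo)%E /\
  s eta * rint P (fun w => g (X eta w)) @[eta --> (0 : R)^'+] --> rint N g.
Variable B : set S.
Hypothesis mB : measurable B.
Hypothesis BE : bounded_away B E.
Hypothesis NB : N (B° : set S) = N (closure B).
Hypothesis NB0 : (0 < N (closure B))%E.

Lemma integral_mul_indic (Q : {measure set S -> \bar R}) (A : set S) (f : S -> R) :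
  (\int[Q]_y (f y * \1_A y)%:E = \int[Q]_(y in A) (f y)%:E)%E.
Proof.
rewrite [RHS]integral_mkcond; apply: eq_integral => y _.
by rewrite patchE indicE; case: (y \in A); rewrite ?mulr1 ?mulr0.
Qed.

Let gap : exists2 r : R, 0 < r <= 1 & forall y xi, B y -> E xi -> r <= J1_dist y xi.
Proof.
move: BE; rewrite /bounded_away; set I := ereal_inf _ => I0.
have lb y xi : B y -> E xi -> (I <= (J1_dist y xi)%:E)%E.
  by move=> By Exi; apply: ereal_inf_lbound; exists y => //; exists xi.
(* The infimum is infinite when [B] or [E] is empty; any gap then works, and 1 is taken. *)
case EI : I I0 => [r| |] // I0; last first.
  exists 1; first by rewrite ltr01 lexx.
  by move=> y xi By /(lb _ _ By); rewrite EI.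
rewrite lte_fin in I0; exists (Num.min r 1).
  by rewrite lt_min I0 ltr01 ge_min lexx orbT.
move=> y xi By /(lb _ _ By); rewrite EI lee_fin; apply: le_trans.
by rewrite ge_min lexx.
Qed.

(** Near [E] the distance to [B] stays above [r / 2], so a cutoff whose slope [n] is at least
    [2 / r] vanishes there. *)
Let cutoff_away : exists (n0 : nat) (r : R), 0 < r /\ forall n, (n0 <= n)%N ->
  forall xi, E xi -> forall y, J1_dist y xi <= r -> outer_cutoff B n y = 0.
Proof.
have [r /andP[r0 r1] Hr] := gap.
exists (Num.truncn (2 / r)).+1, (r / 2); split; first by rewrite divr_gt0.
move=> n nN xi Exi y yxi; apply: outer_cutoff_far.
have sd : r / 2 <= setdist B y.
  apply: setdist_gt; first by lra.
  move=> z Bz; have := Hr z xi Bz Exi; have := J1_dist_triangle y z xi.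
  by rewrite [J1_dist z y]J1_dist_sym; lra.
apply: (@le_trans _ _ (2 / r * (r / 2))).
  by rewrite le_eqVlt; apply/orP; left; apply/eqP; field; rewrite gt_eqF.
apply: ler_pM => //; rewrite ?divr_ge0 ?(ltW r0)//.
by apply: le_trans (ltW (truncnS_gt _)) _; rewrite ler_nat.
Qed.

Lemma measurable_closure_path (A : set S) : measurable (closure A).
Proof.
rewrite -[closure A]setCK; apply: measurableC; apply: sub_sigma_algebra.
exact/closed_openC/closed_closure.
Qed.

Lemma measurable_interior_path (A : set S) : measurable (A° : set S).
Proof. by apply: sub_sigma_algebra; exact: open_interior. Qed.

Let outer_fin n : (exists2 n0, (n0 <= n)%N & forall p, (n0 <= p)%N -> exists2 r, 0 < r &
    forall xi, E xi -> forall y, J1_dist y xi <= r -> outer_cutoff B p y = 0) ->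
  (\int[N]_y (outer_cutoff B n y)%:E < +oo)%E.
Proof.
move=> [n0 nn H]; have [r r0 Hr] := H n nn.
by have [] := conv r0 (@outer_cutoff_continuous _ _ B n) (outer_cutoff01 B n) Hr.
Qed.

Let mcl := measurable_closure_path B.
Let mint := measurable_interior_path B.

Let closure_fin : (N (closure B) < +oo)%E.
Proof.
have [n0 [r [r0 H]]] := cutoff_away.
have foo : (\int[N]_y (outer_cutoff B n0 y)%:E < +oo)%E.
  by apply: outer_fin; exists n0 => // p np; exists r => //; exact: H.
apply: le_lt_trans foo.
have -> : N (closure B) = (\int[N]_y (\1_(closure B) y)%:E)%E by rewrite integral_indic// setIT.
apply: ge0_le_integral => //.
- by apply/measurable_EFinP; exact: measurable_indic.
- by apply/measurable_EFinP; apply: measurable_g; exact: outer_cutoff_continuous.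
- move=> y _; rewrite lee_fin indicE; case: (boolP (_ \in _)) => [|_].
    by rewrite inE => /outer_cutoff_closure ->.
  by have /andP[] := outer_cutoff01 B n0 y.
Qed.

(** The equal masses of closure and interior may be subtracted because [closure_fin] makes them
    finite. *)
Let boundary_null : N (closure B `\` (B° : set S)) = 0%E.
Proof.
have ic : (B° : set S) `<=` closure B by apply: subset_trans (@interior_subset _ B) (@subset_closure _ B).
transitivity (N (closure B) - N (B° : set S))%E; last by rewrite NB subee// ge0_fin_numE.
transitivity (N (closure B) - N (closure B `&` (B° : set S)))%E; last by rewrite setIidr.
exact: measureD.
Qed.

Section one_function.
Variables (f : S -> R) (M : R).
Hypothesis cf : continuous f.
Hypothesis fM : forall xi, 0 <= f xi <= M.

Let mf : measurable_fun setT f := measurable_g cf.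
Let f0 xi : 0 <= f xi. Proof. by have /andP[] := fM xi. Qed.
Let M0 : 0 <= M. Proof. by have /andP[/le_trans] := fM zero_path; apply. Qed.
Let mfi (A : set S) : measurable A -> measurable_fun setT (fun y => f y * \1_A y).
Proof. by move=> mA; apply: measurable_funM => //; exact: measurable_indic. Qed.

Let closureE : rint N (fun y => f y * \1_(closure B) y) = rint N (fun y => f y * \1_B y).
Proof.
have BcB := @subset_closure _ B; have iB := @interior_subset _ B.
have mf' (A : set S) : measurable_fun A (fun y => (f y)%:E).
  by apply: measurable_funTS; exact/measurable_EFinP.
have f0' (A : set S) : forall y, A y -> (0 <= (f y)%:E)%E by move=> y _; rewrite lee_fin.
rewrite /rint !integral_mul_indic; congr fine; apply/eqP; rewrite eq_le; apply/andP; split.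
  rewrite (ge0_negligible_integral (measurableD mcl mint) mcl (mf' _) (@f0' _) boundary_null).
  rewrite setDD (setIidr (subset_trans iB BcB)).
  exact: (ge0_subset_integral N mint mB (mf' _) (@f0' _) iB).
exact: (ge0_subset_integral N mB mcl (mf' _) (@f0' _) BcB).
Qed.

Let interiorE : rint N (fun y => f y * \1_(B° : set S) y) = rint N (fun y => f y * \1_B y).
Proof.
have BcB := @subset_closure _ B; have iB := @interior_subset _ B.
have mf' (A : set S) : measurable_fun A (fun y => (f y)%:E).
  by apply: measurable_funTS; exact/measurable_EFinP.
have f0' (A : set S) : forall y, A y -> (0 <= (f y)%:E)%E by move=> y _; rewrite lee_fin.
have N0 : N (B `\` (B° : set S)) = 0%E.
  apply/eqP; rewrite eq_le measure_ge0 andbT.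
  rewrite -boundary_null; apply: le_measure; rewrite ?inE; [exact: measurableD|exact: measurableD|exact: setSD].
rewrite /rint !integral_mul_indic; congr fine.
rewrite [RHS](ge0_negligible_integral (measurableD mB mint) mB (mf' _) (@f0' _) N0).
by rewrite setDD (setIidr iB).
Qed.

Let dct (u : nat -> S -> R) (A : set S) (G : S -> R) : measurable A ->
  (forall n, measurable_fun setT (u n)) -> (forall n y, 0 <= u n y <= G y) ->
  measurable_fun setT G -> (\int[N]_y (G y)%:E < +oo)%E ->
  (forall y, u n y @[n --> \oo] --> (\1_A y : R)) ->
  rint N (fun y => f y * u n y) @[n --> \oo] --> rint N (fun y => f y * \1_A y).
Proof.
move=> mA mu uG mG Goo uA.
have mU n : measurable_fun setT (fun y => (f y * u n y)%:E).
  by apply/measurable_EFinP; exact: measurable_funM.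
have mL : measurable_fun setT (fun y => (f y * \1_A y)%:E) by apply/measurable_EFinP; exact: mfi.
have G0 y : 0 <= G y by have /andP[/le_trans] := uG 0%N y; apply.
have iG : N.-integrable setT (fun y => (M * G y)%:E).
  apply/integrableP; split; first by apply/measurable_EFinP; apply: measurable_funM => //; exact: measurable_cst.
  under eq_integral do rewrite gee0_abs ?lee_fin ?mulr_ge0//.
  by have [] := rintZ M0 G0 mG Goo.
have ae1 : {ae N, forall y, setT y -> (f y * u n y)%:E @[n --> \oo] --> (f y * \1_A y)%:E}.
  by apply: aeW => y _; apply: cvg_EFin; [exact: nearW|apply: cvgMl_tmp; exact: uA].
have ae2 : {ae N, forall y n, setT y -> (`|(f y * u n y)%:E| <= (M * G y)%:E)%E}.
  apply: aeW => y n _; have /andP[u0 u1] := uG n y; have /andP[h0 h1] := fM y.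
  by rewrite gee0_abs ?lee_fin ?mulr_ge0// ler_pM.
have [i1 _ Hc] := dominated_convergence measurableT mU mL ae1 iG ae2.
have ffin := integrable_fin_num measurableT i1.
by rewrite -(fineK ffin) in Hc; exact: fine_cvg Hc.
Qed.

Lemma restricted_cvg :
  s eta * rint P (fun w => f (X eta w) * \1_B (X eta w)) @[eta --> (0 : R)^'+] -->
  rint N (fun y => f y * \1_B y).
Proof.
have [n0 [r [r0 away]]] := cutoff_away.
(* The shift by [n0] makes every cutoff vanish near [E], as [conv] requires, and [out 0] is an
   integrable bound for all of them. *)
pose out n := outer_cutoff B (n0 + n).
pose inn n (y : S) := clamp01 ((n0 + n)%:R * setdist (~` B) y).
have cout n : continuous (out n) by exact: outer_cutoff_continuous.
have cinn n : continuous (inn n) by exact: scaled_setdist_continuous.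
have out_B n y : B y -> out n y = 1.
  by move=> By; apply: outer_cutoff_closure; exact: subset_closure.
have inn_B n y : ~ B y -> inn n y = 0.
  move=> By; rewrite /inn setdist_in ?mulr0 ?clamp01_le0//.
  exact: subset_closure.
have out_le n y : 0 <= out n y <= out 0 y.
  have /andP[-> _] := outer_cutoff01 B (n0 + n) y; rewrite /out /outer_cutoff lerD2l lerN2.
  have le : (n0 + 0)%:R * setdist B y <= (n0 + n)%:R * setdist B y.
    by rewrite ler_wpM2r ?setdist_ge0// ler_nat leq_add2l.
  by rewrite /clamp01 le_min !ge_min lexx /= le_max !ge_max; apply/orP; right; rewrite le_max lexx le_max le orbT.
have inn_le n y : 0 <= inn n y <= out 0 y.
  have /andP[-> h1] := clamp01_itv ((n0 + n)%:R * setdist (~` B) y).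
  have [By|By] := pselect (B y); first by rewrite out_B.
  by rewrite inn_B//; have /andP[] := out_le 0%N y.
have out_fin : (\int[N]_y (out 0 y)%:E < +oo)%E.
  by apply: outer_fin; exists n0; rewrite ?leq_addr// => p np; exists r => //; exact: away.
have shift (u : nat -> R) (l : R) : u n @[n --> \oo] --> l -> u (n0 + n)%N @[n --> \oo] --> l.
  move=> ul; rewrite (_ : (fun n => u (n0 + n)%N) = [sequence u (n + n0)%N]_n); last first.
    by apply/funext => n /=; rewrite addnC.
  by rewrite cvg_shiftn.
have cv1 : rint N (fun y => f y * out n y) @[n --> \oo] --> rint N (fun y => f y * \1_B y).
  rewrite -closureE; apply: (dct mcl _ out_le _ out_fin).
  - by move=> n; exact: measurable_g.
  - exact: measurable_g.
  - by move=> y; apply: (shift (fun n => outer_cutoff B n y)); exact: outer_cutoff_cvg.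
have cv2 : rint N (fun y => f y * inn n y) @[n --> \oo] --> rint N (fun y => f y * \1_B y).
  rewrite -interiorE; apply: (dct mint _ inn_le _ out_fin).
  - by move=> n; exact: measurable_g.
  - exact: measurable_g.
  - by move=> y; apply: (shift (fun n => clamp01 (n%:R * setdist (~` B) y))); exact: inner_cutoff_cvg.
have PT : (P setT < +oo)%E by rewrite probability_setT ltry.
apply/cvgrPdist_le => e e0; have e20 : 0 < e / 2 by rewrite divr_gt0.
have /cvgrPdist_le/(_ _ e20) near1 := cv1.
have /cvgrPdist_le/(_ _ e20) near2 := cv2.
have [n [h1 h2]] : exists n, `|rint N (fun y => f y * \1_B y) - rint N (fun y => f y * out n y)| <= e / 2
   /\ `|rint N (fun y => f y * \1_B y) - rint N (fun y => f y * inn n y)| <= e / 2.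
  by near \oo => n; exists n; split; near: n.
have prod_conv (u : S -> R) : continuous u -> (forall y, 0 <= u y <= out n y) ->
    s eta * rint P (fun w => f (X eta w) * u (X eta w)) @[eta --> (0 : R)^'+] -->
    rint N (fun y => f y * u y).
  move=> cu u_le; have u1 y : u y <= 1.
    by have /andP[_ /le_trans] := u_le y; apply; have /andP[] := outer_cutoff01 B (n0 + n) y.
  have u0 y : 0 <= u y by have /andP[] := u_le y.
  have [] // := @conv (fun y => f y * u y) M r r0.
  - by move=> y; have h3 : f z @[z --> y] --> f y := cf (x:=y); have h4 : u z @[z --> y] --> u y := cu y; exact: cvgM h3 h4.
  - move=> y; rewrite mulr_ge0//=; have /andP[_ h] := fM y.
    by apply: le_trans h; rewrite ler_piMr.
  - move=> xi Exi y yxi; have := u_le y.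
    rewrite /out (away _ (leq_addr _ _) xi Exi y yxi) => hh.
    by have -> : u y = 0; [apply/eqP; rewrite eq_le andbC|rewrite mulr0].
have /cvgrPdist_le/(_ _ e20) near3 := prod_conv _ (cout n) (fun y => introT andP (conj (andP (out_le n y)).1 (lexx _))).
have inn_out y : 0 <= inn n y <= out n y.
  have /andP[-> h3] := clamp01_itv ((n0 + n)%:R * setdist (~` B) y).
  have [By|By] := pselect (B y); first by rewrite out_B.
  by rewrite inn_B//; have /andP[] := out_le n y.
have /cvgrPdist_le/(_ _ e20) near4 := prod_conv _ (cinn n) inn_out.
near=> eta; have t0 : 0 < eta by near: eta; exact: nbhs_right_gt.
have h3 : `|rint N (fun y => f y * out n y) - s eta * rint P (fun w => f (X eta w) * out n (X eta w))| <= e / 2.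
  by near: eta.
have h4 : `|rint N (fun y => f y * inn n y) - s eta * rint P (fun w => f (X eta w) * inn n (X eta w))| <= e / 2.
  by near: eta.
have bm (u : S -> R) : measurable_fun setT u -> (forall y, 0 <= u y <= 1) ->
    bounded_meas (fun w => f (X eta w) * u (X eta w)).
  move=> mu u01; split; last first.
    exists M => w; have /andP[u0 u1] := u01 (X eta w); rewrite mulr_ge0//=.
    by have /andP[_ h] := fM (X eta w); apply: le_trans h; rewrite ler_piMr.
  by apply: measurable_funM; apply: measurableT_comp => //; exact: mX.
have b1 := bm _ (measurable_g (cout n)) (outer_cutoff01 B _).
have b2 := bm _ (measurable_g (cinn n)) (fun y => clamp01_itv _).
have b3 : bounded_meas (fun w => f (X eta w) * \1_B (X eta w)).
  apply: bm; first exact: measurable_indic.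
  by move=> y; rewrite indicE; case: (_ \in _); rewrite ?lexx ?ler01.
have l1 : rint P (fun w => f (X eta w) * inn n (X eta w)) <= rint P (fun w => f (X eta w) * \1_B (X eta w)).
  apply: (bounded_meas_le PT b2 b3) => w; rewrite ler_wpM2l// indicE.
  case: (boolP (_ \in _)) => [_|/negP]; first by have /andP[] := clamp01_itv ((n0 + n)%:R * setdist (~` B) (X eta w)).
  by rewrite inE => /inn_B ->.
have l2 : rint P (fun w => f (X eta w) * \1_B (X eta w)) <= rint P (fun w => f (X eta w) * out n (X eta w)).
  apply: (bounded_meas_le PT b3 b1) => w; rewrite ler_wpM2l// indicE.
  case: (boolP (_ \in _)) => [|_]; first by rewrite inE => /out_B ->.
  by have /andP[] := out_le n (X eta w).
have se := ltW (s_gt0 t0).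
have := ler_wpM2l se l1; have := ler_wpM2l se l2.
move: h1 h2 h3 h4; rewrite !ler_norml.
by move=> /andP[? ?] /andP[? ?] /andP[? ?] /andP[? ?] ? ?; apply/andP; split; lra.
Unshelve. all: by end_near. Qed.

End one_function.

(** A conditional expectation is a quotient of restricted integrals in which [s eta] cancels, so
    [restricted_cvg] for the shifted [f] and for the constant 1 is enough. *)
Lemma conditional_weak_cvg (L : set S -> \bar R) : (forall A, measurable A -> L A = N A) ->
  weak_cvg 0^'+ (fun eta => cond_law P (X eta) B) (normalized_restriction L B).
Proof.
move=> LN f cf [M fM].
have BcB := @subset_closure _ B; have iB := @interior_subset _ B.
have NBE : N B = N (closure B).
  apply/eqP; rewrite eq_le; apply/andP; split; first by apply: le_measure; rewrite ?inE.
  by rewrite -NB; apply: le_measure; rewrite ?inE.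
have NBoo : (N B < +oo)%E by rewrite NBE.
have NB_gt0 : (0 < N B)%E by rewrite NBE.
have f0 y : 0 <= f y + M <= M + M by have := fM y; rewrite ler_norml; lra.
have cfM : continuous (fun y => f y + M).
  by move=> y; have h3 : f z @[z --> y] --> f y := cf y; exact: cvgD h3 (cvg_cst _).
have c1 : continuous (fun _ : S => 1 : R).
  apply: (@J1_lipschitz_continuous _ _ _ 1) => // y z.
  by rewrite subrr normr0 mul1r J1_dist_ge0.
have one01 (y : S) : 0 <= (1 : R) <= 1 by rewrite ler01 lexx.
have cvf := restricted_cvg cfM f0; have cv1 := restricted_cvg c1 one01.
have mf : measurable_fun setT f := measurable_g cf.
have restr (Q : {measure set S -> \bar R}) (u : S -> R) :
    fine (\int[Q]_(y in B) (u y)%:E) = rint Q (fun y => u y * \1_B y).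
  by rewrite /rint integral_mul_indic.
have restr1 (Q : {measure set S -> \bar R}) : fine (Q B) = rint Q (fun y => 1 * \1_B y).
  rewrite -restr; congr fine.
  by transitivity (1 * Q B)%E; [rewrite mul1e|rewrite -integral_cst].
rewrite (normalized_integral mB NB_gt0 NBoo _ mf fM); last first.
  by move=> A mA; rewrite /normalized_restriction !LN//; exact: measurableI.
have I1 : 0 < rint N (fun y => 1 * \1_B y).
  by rewrite -restr1; apply: fine_gt0; rewrite NB_gt0.
have lawE eta (t0 : 0 < eta) (u : S -> R) (U : R) : continuous u -> (forall y, 0 <= u y <= U) ->
    rint (law P (mX t0)) (fun y => u y * \1_B y) = rint P (fun w => u (X eta w) * \1_B (X eta w)).
  move=> cu u0; rewrite law_rint//.
    by apply: measurable_funM; [exact: measurable_g|exact: measurable_indic].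
  by move=> y; rewrite mulr_ge0//; have /andP[] := u0 y.
pose ratio eta := rint P (fun w => (f (X eta w) + M) * \1_B (X eta w)) /
  rint P (fun w => 1 * \1_B (X eta w)).
have cvr : (ratio eta - M)%:E @[eta --> (0 : R)^'+] -->
    (fine (\int[N]_(y in B) (f y + M)%:E) / fine (N B) - M)%:E.
  apply: cvg_EFin; first exact: nearW.
  apply: cvgB; last exact: cvg_cst.
  rewrite restr restr1.
  have I1n : rint N (fun y => 1 * \1_B y) != 0 by rewrite gt_eqF.
  have cvV : (s eta * rint P (fun w => 1 * \1_B (X eta w)))^-1 @[eta --> (0 : R)^'+] -->
      (rint N (fun y => 1 * \1_B y))^-1 by exact: cvgV.
  have cvR : (s eta * rint P (fun w => (f (X eta w) + M) * \1_B (X eta w))) *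
      (s eta * rint P (fun w => 1 * \1_B (X eta w)))^-1 @[eta --> (0 : R)^'+] -->
      rint N (fun y => (f y + M) * \1_B y) / rint N (fun y => 1 * \1_B y) by exact: cvgM.
  apply: cvg_trans cvR; apply: near_eq_cvg; near=> eta.
  have t0 : 0 < eta by near: eta; exact: nbhs_right_gt.
  by rewrite /ratio invfM mulrACA divff ?mul1r// gt_eqF// s_gt0.
apply: cvg_trans cvr; apply: near_eq_cvg.
(* The positive limit shows that the conditioning event is not null for small [eta], so the quotient
   is a true normalization there. *)
have near1 : \forall eta \near (0 : R)^'+, 0 < s eta * rint P (fun w => 1 * \1_B (X eta w)).
  exact: (cvgr_gt _ cv1).
near=> eta; have t0 : 0 < eta by near: eta; exact: nbhs_right_gt.
have p1 : 0 < rint P (fun w => 1 * \1_B (X eta w)).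
  have : 0 < s eta * rint P (fun w => 1 * \1_B (X eta w)) by near: eta.
  by rewrite pmulr_rgt0// s_gt0.
have Qoo : (law P (mX t0) B < +oo)%E by rewrite (le_lt_trans (probability_le1 _ mB))// ltry.
have Q1 : fine (law P (mX t0) B) = rint P (fun w => 1 * \1_B (X eta w)).
  by rewrite restr1 (lawE _ t0 _ 1).
have Q0 : (0 < law P (mX t0) B)%E.
  rewrite lt_neqAle measure_ge0 andbT eq_sym; apply/eqP => q0.
  by move: p1; rewrite -Q1 [X in fine X]q0 ltxx.
rewrite (normalized_integral mB Q0 Qoo _ mf fM)//.
by rewrite restr (lawE _ t0 _ (M + M))// Q1.
Unshelve. all: by end_near. Qed.

End conditional_limits.

(** * The limit measure as an image of a product measure *)

Section jump_measure.
Context {R : realType} {m d k : nat}.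
Local Notation V := 'cV[R]_d.
Local Notation S := (skorokhod R m).
Local Notation Inc := (increasing_tuples (R := R) `]0, 1[%classic k).
Variable mu : {sigma_finite_measure set V -> \bar R}.
Variable hh : k.-tuple V -> k.-tuple R -> S.
Hypothesis mh : measurable_fun ([set: k.-tuple V] `*` Inc) (fun p => hh p.1 p.2).
Local Notation DI := ([set: k.-tuple V] `*` Inc).
Local Notation pm := (tmeas mu k \x tmeas (@leb R) k)%E.

Lemma measurable_jump_domain : measurable DI.
Proof. by apply: measurableX => //; exact: measurable_increasing. Qed.

Lemma jump_measure_exists : exists N : {measure set S -> \bar R},
  (forall A, measurable A -> N A = pm (DI `&` (fun p => hh p.1 p.2) @^-1` A)) /\
  (forall f : S -> R, measurable_fun setT f -> (forall y, 0 <= f y) ->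
    (\int[N]_y (f y)%:E = \int[pm]_(p in DI) (f (hh p.1 p.2))%:E)%E).
Proof.
have mDI := measurable_jump_domain.
have [N [N1 N2]] := restricted_image_exists pm mDI mh.
exists N; split=> // f mf f0; rewrite (N2 (fun y => (f y)%:E))//.
exact/measurable_EFinP.
Qed.

(** As [g] vanishes when some noise is small, the inner integrals are at most [M] times a power of a
    finite mass; hence [rint] loses nothing, and Tonelli gives the iterated form. *)
Lemma jump_integral (g : S -> R) (M delta : R) :
  (mu [set w | (delta < enorm w)%R] < +oo)%E ->
  measurable_fun setT g -> (forall y, 0 <= g y <= M) ->
  (forall W t, Inc t -> (exists j, enorm (tnth W j) <= delta) -> g (hh W t) = 0) ->
  (\int[pm]_(p in DI) (g (hh p.1 p.2))%:E)%E =
  (rint (tmeas (@leb R) k) (fun t => \1_Inc t * rint (tmeas mu k) (fun W => g (hh W t))))%:E.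
Proof.
move=> muoo mg gM g0; have mDI := measurable_jump_domain.
have M0 : 0 <= M by have /andP[/le_trans] := gM zero_path; apply.
have gge y : 0 <= g y by have /andP[] := gM y.
have mF : measurable_fun setT (fun p : k.-tuple V * k.-tuple R => (\1_Inc p.2 * g (hh p.1 p.2))%:E).
  apply/measurable_EFinP; exact: (measurable_jump_functional mh mg).
have F0 (p : k.-tuple V * k.-tuple R) : (0 <= (\1_Inc p.2 * g (hh p.1 p.2))%:E)%E.
  by rewrite lee_fin mulr_ge0.
have -> : (\int[pm]_(p in DI) (g (hh p.1 p.2))%:E = \int[pm]_p (\1_Inc p.2 * g (hh p.1 p.2))%:E)%E.
  rewrite integral_mkcond; apply: eq_integral => p _; rewrite patchE indicE.
  have [pI|pI] := boolP (p.2 \in Inc).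
    by rewrite mem_set ?mul1r//; split=> //; exact: set_mem.
  by rewrite memNset ?mul0r// => -[_ /mem_set]; exact/negP.
rewrite (@fubini_tonelli2 _ _ _ _ _ _ _ _ mF F0) /fubini_G.
pose K := M * fine (mu [set w | (delta < enorm w)%R]) ^+ k.
pose A : set (k.-tuple V) := box (fun=> [set w | (delta < enorm w)%R]).
have mA : measurable A by apply: measurable_box => i; exact: measurable_enorm_gt.
have mufin : mu [set w | (delta < enorm w)%R] \is a fin_num by rewrite ge0_fin_numE.
have muA : tmeas mu k A = (fine (mu [set w | (delta < enorm w)%R]) ^+ k)%:E.
  rewrite tmeas_box; last by move=> i; exact: measurable_enorm_gt.
  by rewrite big_const_ord iter_mule mule1 EFin_expe fineK.
have inner t : (\int[tmeas mu k]_W (\1_Inc t * g (hh W t))%:E <= (K * \1_Inc t)%:E)%E.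
  rewrite indicE; case: (boolP (t \in Inc)) => [|_]; last first.
    by rewrite mulr0; under eq_integral do rewrite mul0r; rewrite integral0.
  rewrite inE => ti; under eq_integral do rewrite mul1r.
  rewrite mulr1 /K EFinM -muA; apply: rint_bound => //.
    have := measurableT_comp (measurable_jump_functional mh mg) (measurable_pair2 t).
    rewrite (_ : _ \o _ = fun W => g (hh W t))//.
    by apply/funext => W /=; rewrite indicE mem_set// mul1r.
  move=> W AW; apply: g0 => //; apply: contrapT => n; apply: AW => j /=.
  by rewrite ltNge; apply/negP => h; apply: n; exists j.
have innerE t : (\int[tmeas mu k]_W (\1_Inc t * g (hh W t))%:E)%E =
    (\1_Inc t * rint (tmeas mu k) (fun W => g (hh W t)))%:E.
  have := inner t; rewrite indicE; case: (boolP (t \in Inc)) => [_|_]; last first.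
    by rewrite mul0r; under eq_integral do rewrite mul0r; rewrite integral0.
  rewrite mulr1 mul1r; under eq_integral do rewrite mul1r.
  by move=> h; rewrite rintE// (le_lt_trans h)// ltry.
under eq_integral do rewrite innerE.
rewrite rintE//; first by move=> t; rewrite mulr_ge0// rint_ge0.
pose U : set (k.-tuple R) := box (fun=> `]0, 1]%classic : set R).
have mU : measurable U by apply: measurable_box => j; exact: measurable_itv.
have Uoo : tmeas (@leb R) k U = 1%E.
  rewrite tmeas_box; last by move=> j; exact: measurable_itv.
  rewrite big1// => j _; transitivity (lebesgue_measure (`]0, 1]%classic : set R)) => //.
  by rewrite lebesgue_measure_itv/= lte_fin ltr01 oppr0 adde0.
apply: (@le_lt_trans _ _ (K%:E * tmeas (@leb R) k U)%E); last by rewrite Uoo mule1 ltry.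
have K0 : 0 <= K by rewrite mulr_ge0// exprn_ge0// fine_ge0.
apply: rint_bound => //.
- by apply: measurable_jump_rint.
- move=> t; rewrite mulr_ge0 ?rint_ge0//= -lee_fin -innerE (le_trans (inner t))// lee_fin.
  by rewrite ler_piMr// indicE; case: (_ \in _); rewrite ?lexx ?ler01.
- move=> t Ut; rewrite indicE memNset ?mul0r// => -[_ tI]; apply: Ut => j /=.
  have := tI _ (mem_tnth j t); rewrite /= !in_itv/= => /andP[-> h].
  exact: ltW.
Qed.

End jump_measure.

(** The restriction to increasing times, hidden in [lebesgue_increasing], is moved into the domain
    of integration. This removes the tuples on which [h] may be arbitrary and leaves a genuine
    product measure. *)
Lemma limit_measureE {R : realType} m d (a : 'cV[R]_m -> 'cV[R]_m)
    (sigma : 'cV[R]_m -> 'M[R]_(m, d.+1)) (nu : {measure set R -> \bar R})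
    (S : probability 'cV[R]_d.+1 R) (b : \bar R) k x (mu : {sigma_finite_measure set 'cV[R]_d.+1 -> \bar R})
    (A : set (skorokhod R m)) :
  let DI := [set: k.-tuple 'cV[R]_d.+1] `*` increasing_tuples (R := R) `]0, 1[%classic k in
  (mu : set 'cV[R]_d.+1 -> \bar R) = polar_measure nu S ->
  measurable_fun DI (fun p => h a sigma b x p.1 p.2) ->
  measurable A ->
  limit_measure a sigma nu S b k x A =
  (tmeas mu k \x tmeas (@leb R) k)%E (DI `&` (fun p => h a sigma b x p.1 p.2) @^-1` A).
Proof.
move=> DI muE mh mA; have mDI : measurable DI by exact: measurable_jump_domain.
rewrite /limit_measure.
rewrite (eq_integral_set_fun (m2 := mrestr (tmeas mu k \x tmeas (@leb R) k)%E mDI)); last first.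
  move=> F mF; rewrite /mrestr /product_measure1 /=.
  rewrite (eq_integral_set_fun (m2 := tmeas mu k)); last first.
    by move=> G mG; rewrite -muE; exact: tmeasE.
  apply: eq_integral => W _ /=.
  have mx : measurable (xsection F W) by exact: measurable_xsection.
  transitivity (tmeas (@leb R) k (xsection F W `&` increasing_tuples (R := R) `]0, 1[%classic k)).
    have mi : measurable (xsection F W `&` increasing_tuples (R := R) `]0, 1[%classic k).
      by apply: measurableI => //; exact: measurable_increasing.
    exact: (tmeasE (@leb R) mi).
  congr (_ _); apply/seteqP; split => t; rewrite /xsection /= !inE.
    by move=> [Ft ti]; split.
  by move=> [Ft [_ ti]].
rewrite integral_mrestr; last by move=> p; rewrite lee_fin.
have mE : measurable (DI `&` (fun p : k.-tuple 'cV[R]_d.+1 * k.-tuple R => h a sigma b x p.1 p.2) @^-1` A).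
  exact: mh.
rewrite (eq_integral (fun p => (\1_(DI `&` (fun p : k.-tuple 'cV[R]_d.+1 * k.-tuple R => h a sigma b x p.1 p.2) @^-1` A) p)%:E)).
  by rewrite integral_indic// setIAC setIid.
move=> p pD; rewrite !indicE; congr (_%:R%:E); congr nat_of_bool.
apply/idP/idP; rewrite !inE; last by case.
by move=> hA; split=> //; exact: set_mem.
Qed.

Section conditional_limit_of_paths.
Context {R : realType} {m d : nat} {disp : measure_display} {Omega : measurableType disp}.
Local Notation V := 'cV[R]_d.+1.
Variables (P : probability Omega R) (Z : nat -> Omega -> V).
Variables (alpha : R) (nu : {measure set R -> \bar R}) (S : probability V R).
Variables (a : 'cV[R]_m -> 'cV[R]_m) (sigma : 'cV[R]_m -> 'M[R]_(m, d.+1)) (D : R).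
Hypothesis mZ : forall n, measurable_fun setT (Z n).
Hypothesis alpha1 : 1 < alpha.
Hypothesis RV : forall t : R, 0 < t ->
  (tail P (Z 0%N) (t * x) / tail P (Z 0%N) x)%E @[x --> +oo] --> (t `^ (- alpha))%:E.
Hypothesis D0 : 0 <= D.
Hypothesis aD : forall x y, enorm (a x - a y) <= D * enorm (x - y).
Hypothesis sD : forall x y, opnorm (sigma x - sigma y) <= D * enorm (x - y).
Variable mu : {sigma_finite_measure set V -> \bar R}.
Hypothesis muE : (mu : set V -> \bar R) = polar_measure nu S.
Hypothesis mufin : forall r : R, 0 < r -> (mu [set w | (r < enorm w)%R] < +oo)%E.
Variables (b : \bar R) (k : nat) (x : 'cV[R]_m).
Hypothesis b0 : (0 < b)%E.
Local Notation h := (h a sigma b x).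
Local Notation Inc := (increasing_tuples (R := R) `]0, 1[%classic k).
Local Notation rate := (rate P (Z 0%N)).
Hypothesis mh : measurable_fun ([set: k.-tuple V] `*` Inc) (fun p => h p.1 p.2).
Hypothesis limit : forall (g : skorokhod R m -> R) (M eps0 r0 : R),
  0 < eps0 -> 0 < r0 -> continuous g -> (forall xi, 0 <= g xi <= M) ->
  support_away a sigma b k x g eps0 r0 ->
  rate eta ^+ k * rint P (fun w => g (X_path a sigma eta b x (Z ^~ w))) @[eta --> (0 : R)^'+] -->
  rint (tmeas (@leb R) k) (fun t => \1_Inc t * rint (tmeas mu k) (fun W : k.-tuple V => g (h W t))).
Hypothesis vanish : forall (g : skorokhod R m -> R) (eps0 r0 : R), 0 < eps0 -> 0 < r0 ->
  support_away a sigma b k x g eps0 r0 ->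
  exists2 delta : R, 0 < delta & forall (W : k.-tuple V) t, Inc t ->
    (exists j, enorm (tnth W j) <= delta) -> g (h W t) = 0.

(** Common end of both cases: they differ only in how measurability of [h], the limit of
    expectations and the vanishing for small noises are obtained, and these are hypotheses here. *)
Lemma path_conditional_weak_cvg (B : set (skorokhod R m)) (eps : R) : measurable B -> 0 < eps ->
  bounded_away B (perturbed_paths_pred a sigma b [set x] k eps) ->
  limit_measure a sigma nu S b k x (B° : set (skorokhod R m)) =
    limit_measure a sigma nu S b k x (closure B) ->
  (0 < limit_measure a sigma nu S b k x (closure B))%E ->
  weak_cvg 0^'+
    (fun eta : R => cond_law P (fun w => X_path a sigma eta b x (fun n => Z n w)) B)
    (normalized_restriction (limit_measure a sigma nu S b k x) B).
Proof.
move=> mB eps0 Baway.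
have [N [N1 N2]] := jump_measure_exists mu mh.
have LN A : measurable A -> limit_measure a sigma nu S b k x A = N A.
  by move=> mA; rewrite N1//; exact: (limit_measureE muE mh mA).
rewrite !LN; [|exact: measurable_closure_path|exact: measurable_interior_path] => NB NB0.
apply: (@conditional_weak_cvg R m disp Omega P
  (fun eta w => X_path a sigma eta b x (fun n => Z n w)) (fun eta => rate eta ^+ k) _ _ N
  (perturbed_paths_pred a sigma b [set x] k eps)) => //.
- by move=> eta t0; exact: (measurable_X_path b0 D0 aD sD).
- by move=> eta t0; rewrite exprn_gt0// (rate_gt0 (mZ 0%N) alpha1 RV).
- move=> g M r r0 cg gM supp; have mg := measurable_g cg.
  have g0 y : 0 <= g y by have /andP[] := gM y.
  have [delta delta0 van] := vanish eps0 r0 supp.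
  have NE := N2 g mg g0.
  rewrite (jump_integral mh (mufin delta0) mg gM van) in NE.
  split; first by rewrite NE ltry.
  by rewrite /rint NE /=; exact: limit supp.
Qed.

End conditional_limit_of_paths.

Theorem corollary2p7 (R : realType) (m d : nat)
    (disp : measure_display) (Omega : measurableType disp)
    (P : probability Omega R) (Z : nat -> Omega -> 'cV[R]_d.+1)
    (alpha : R) (nu : {measure set R -> \bar R})
    (S : probability 'cV[R]_d.+1 R)
    (a : 'cV[R]_m.+1 -> 'cV[R]_m.+1)
    (sigma : 'cV[R]_m.+1 -> 'M[R]_(m.+1, d.+1)) :
  (forall n, measurable_fun [set: Omega] (Z n)) ->
  iid P Z ->
  mean_zero P (Z 0%N) ->
  1 < alpha ->
  power_law alpha nu ->
  S (@sphere R d) = 1%E ->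
  MRV P (Z 0%N) alpha nu S ->
  (exists2 D : R, 1 <= D & forall x y : 'cV[R]_m.+1,
    Num.max (opnorm (sigma x - sigma y)) (enorm (a x - a y)) <=
    D * enorm (x - y)) ->
  (forall (b : R) (k : nat) (x : 'cV[R]_m.+1) (B : set (skorokhod R m.+1)),
    0 < b ->
    measurable B ->
    (exists2 eps : R, 0 < eps & bounded_away B
      (perturbed_paths_pred a sigma b%:E [set x] k eps)) ->
    limit_measure a sigma nu S b%:E k x B° =
      limit_measure a sigma nu S b%:E k x (closure B) ->
    (0 < limit_measure a sigma nu S b%:E k x (closure B))%E ->
    weak_cvg 0^'+
      (fun eta : R =>
        cond_law P (fun w => X_path a sigma eta b%:E x (fun n => Z n w)) B)
      (normalized_restriction (limit_measure a sigma nu S b%:E k x) B)) /\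
  ((exists2 C : R, 1 <= C & forall x : 'cV[R]_m.+1,
      Num.max (enorm (a x)) (opnorm (sigma x)) <= C) ->
   forall (k : nat) (x : 'cV[R]_m.+1) (B : set (skorokhod R m.+1)),
    measurable B ->
    (exists2 eps : R, 0 < eps & bounded_away B
      (perturbed_paths_pred a sigma +oo%E [set x] k eps)) ->
    limit_measure a sigma nu S +oo%E k x B° =
      limit_measure a sigma nu S +oo%E k x (closure B) ->
    (0 < limit_measure a sigma nu S +oo%E k x (closure B))%E ->
    weak_cvg 0^'+
      (fun eta : R =>
        cond_law P (fun w => X_path a sigma eta +oo%E x (fun n => Z n w)) B)
      (normalized_restriction (limit_measure a sigma nu S +oo%E k x) B)).
Proof.
move=> mZ iidZ meanZ alpha1 nuE S1 mrv [D D1 lip].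
have D0 : 0 <= D by exact: le_trans D1.
have aD x y : enorm (a x - a y) <= D * enorm (x - y).
  by apply: le_trans (lip x y); rewrite le_max lexx orbT.
have sD x y : opnorm (sigma x - sigma y) <= D * enorm (x - y).
  by apply: le_trans (lip x y); rewrite le_max lexx.
have RV := mrv.1.
have [mu muE] := polar_measure_sigma_finite nuE S1.
have mufin (r : R) : 0 < r -> (mu [set w | (r < enorm w)%R] < +oo)%E.
  by move=> r0; rewrite muE (le_lt_trans (polar_measure_tail nuE S1 r0))// ltry.
have vag (eta_ : nat -> R) : (forall l, 0 < eta_ l) -> eta_ l @[l --> \oo] --> 0 ->
    vague_cvg \oo (fun l => (rtail P (Z 0%N) (eta_ l)^-1)^-1) (fun l => nlaw P mZ (eta_ l)) mu.
  by move=> u0 uc; exact: (MRV_vague_cvg nuE S1 alpha1 mZ mrv muE u0 uc).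
split=> [b k x B b0 mB [eps eps0 away] NB NB0|[C C1 bnd] k x B mB [eps eps0 away] NB NB0].
  (* For finite [b] the coefficients may be unbounded; clipping confines the limit paths with a
     given number of jumps to a ball. *)
  have b0' : (0 < b%:E)%E by rewrite lte_fin.
  apply: (path_conditional_weak_cvg mZ alpha1 RV D0 aD sD muE mufin b0' _ _ _ mB eps0 away NB NB0).
  - exact: (measurable_clipped_h b0 D0 aD sD).
  - move=> g M e1 r0 e10 r00 cg gM supp.
    exact: (clipped_expectation_cvg b0 D0 aD sD iidZ meanZ alpha1 RV vag e10 r00 cg gM supp).
  - by move=> g e1 r0 e10 r00 supp; exact: (clipped_small_noise_vanish b0 D0 aD sD e10 r00 supp).
(* For [b = +oo] the assumed bound on the coefficients takes the place of the freezing outside a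
   ball. *)
have C0 : 0 <= C by exact: le_trans C1.
have aC x' : enorm (a x') <= C by apply: le_trans (bnd x'); rewrite le_max lexx.
have sC x' : opnorm (sigma x') <= C by apply: le_trans (bnd x'); rewrite le_max lexx orbT.
have b0' : (0 < +oo :> \bar R)%E by exact: ltry.
apply: (path_conditional_weak_cvg mZ alpha1 RV D0 aD sD muE mufin b0' _ _ _ mB eps0 away NB NB0).
- exact: (measurable_h b0' C0 D0 aC aD sC sD).
- move=> g M e1 r0 e10 r00 cg gM supp.
  exact: (expectation_cvg b0' C0 D0 aC aD sC sD iidZ meanZ alpha1 RV vag e10 r00 cg gM supp).
- by move=> g e1 r0 e10 r00 supp; exact: (small_noise_vanish b0' C0 D0 aC aD sC e10 r00 supp).
Qed.
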